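(* Let $p$ be an integer with $1\le p<\infty$. Every abstract-definable $\mathcal{C}^p$ manifold $M$ has an abstract-definable $\mathcal{C}^{p+1}$ atlas that is compatible, as an abstract-definable $\mathcal{C}^p$ atlas, with its given abstract-definable $\mathcal{C}^p$ atlas.
   Context: Fix an o-minimal expansion $\mathcal{R}$ of a real closed field $R$; ''definable'' means definable in $\mathcal{R}$ with parameters from $R$, and $R^k$ carries the order (product) topology. For $0\le q<\infty$, an abstract-definable $\mathcal{C}^q$ atlas of dimension $m$ on a set $M$ is a finite family of bijections $\phi_i\colon U_i\to\phi_i(U_i)\subseteq R^m$ ($U_i\subseteq M$) with $M=\bigcup_i U_i$, each $\phi_i(U_i)$ definable open, each $\phi_i(U_i\cap U_j)$ definable open, and each transition map $\phi_j\circ\phi_i^{-1}\colon\phi_i(U_i\cap U_j)\to\phi_j(U_i\cap U_j)$ a definable $\mathcal{C}^q$ diffeomorphism. Two abstract-definable $\mathcal{C}^p$ atlases are compatible if their union is an abstract-definable $\mathcal{C}^p$ atlas. An abstract-definable $\mathcal{C}^p$ manifold of dimension $m$ is a set $M$ with a compatibility class of abstract-definable $\mathcal{C}^p$ atlases whose induced topology (the unique one making each $U_i$ open and each $\phi_i$ a homeomorphism) is Hausdorff. *)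

(* Defs.v *)
From HB Require Import structures.
From mathcomp Require Import all_boot all_order all_algebra.
Set Implicit Arguments. Unset Strict Implicit. Unset Printing Implicit Defensive.
Import Order.TTheory GRing.Theory Num.Theory.
Local Open Scope ring_scope.

(* O-minimal expansions of a real closed field R (van den Dries style):
   for each n, a collection dfn n of subsets of R^n (= 'rV[R]_n), the
   definable sets (with parameters), closed under boolean operations,
   cartesian products with R, projections, containing the diagonals,
   the singletons (parameters), the order and the graphs of + and *,
   and such that every definable subset of R is a finite union of
   points and open intervals (possibly unbounded). *)

Definition in_interval (R : rcfType) (ab : option R * option R) (x : R) : bool :=
  (if ab.1 is Some a then a < x else true) && (if ab.2 is Some b then x < b else true).

Unset Implicit Arguments.
Record ominimal_expansion (R : rcfType) := OMinimalExpansion {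
  dfn : forall n : nat, ('rV[R]_n -> Prop) -> Prop;
  dfn_full : forall n, dfn n (fun _ => True);
  dfn_compl : forall n A, dfn n A -> dfn n (fun x => ~ A x);
  dfn_inter : forall n A B, dfn n A -> dfn n B -> dfn n (fun x => A x /\ B x);
  dfn_prodr : forall n A, dfn n A -> dfn (n + 1) (fun z : 'rV[R]_(n + 1) => A (lsubmx z));
  dfn_prodl : forall n A, dfn n A -> dfn (1 + n) (fun z : 'rV[R]_(1 + n) => A (rsubmx z));
  dfn_diag : forall n (i j : 'I_n), dfn n (fun x => x ord0 i = x ord0 j);
  dfn_proj : forall n (A : 'rV[R]_(n + 1) -> Prop), dfn (n + 1) A ->
     dfn n (fun x => exists y : 'rV[R]_1, A (row_mx x y));
  dfn_point : forall r : R, dfn 1 (fun x => x ord0 ord0 = r);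
  dfn_lt : dfn 2 (fun x => x ord0 ord0 < x ord0 (@Ordinal 2 1 isT));
  dfn_add : dfn 3 (fun x => x ord0 ord0 + x ord0 (@Ordinal 3 1 isT) = x ord0 (@Ordinal 3 2 isT));
  dfn_mul : dfn 3 (fun x => x ord0 ord0 * x ord0 (@Ordinal 3 1 isT) = x ord0 (@Ordinal 3 2 isT));
  dfn_ominimal : forall A, dfn 1 A ->
     exists (s : seq (option R * option R)) (t : seq R),
       forall x : 'rV[R]_1, A x <-> (x ord0 ord0 \in t \/ has (fun ab => in_interval ab (x ord0 ord0)) s)
}.
Set Implicit Arguments.
Arguments dfn {R} o {n} _.

Section Geometry.
Variable R : rcfType.

(* max norm on R^n; it induces the order (product) topology *)
Definition mnorm n (x : 'rV[R]_n) : R := \big[Num.max/0]_(i < n) `|x ord0 i|.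

Definition open_set n (A : 'rV[R]_n -> Prop) : Prop :=
  forall a, A a -> exists2 d : R, 0 < d & forall x, mnorm (x - a) < d -> A x.

Definition continuous_on m n (U : 'rV[R]_m -> Prop) (f : 'rV[R]_m -> 'rV[R]_n) : Prop :=
  forall a, U a -> forall eps : R, 0 < eps -> exists2 d : R, 0 < d &
    forall x, U x -> mnorm (x - a) < d -> mnorm (f x - f a) < eps.

Definition differentiable_at m n (U : 'rV[R]_m -> Prop) (f : 'rV[R]_m -> 'rV[R]_n)
    (a : 'rV[R]_m) (D : 'M[R]_(m, n)) : Prop :=
  forall eps : R, 0 < eps -> exists2 d : R, 0 < d &
    forall x, U x -> mnorm (x - a) < d ->
      mnorm (f x - f a - (x - a) *m D) <= eps * mnorm (x - a).

Fixpoint Cq (q : nat) m n (U : 'rV[R]_m -> Prop) (f : 'rV[R]_m -> 'rV[R]_n) : Prop :=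
  match q with
  | 0 => continuous_on U f
  | q'.+1 => exists D : 'rV[R]_m -> 'M[R]_(m, n),
      (forall a, U a -> differentiable_at U f a (D a)) /\
      Cq q' U (fun a => mxvec (D a))
  end.

End Geometry.

Section Manifolds.
Variables (R : rcfType) (S : ominimal_expansion R).

Definition definable n (A : 'rV[R]_n -> Prop) : Prop := dfn S A.

Definition definable_map_on m n (A : 'rV[R]_m -> Prop) (f : 'rV[R]_m -> 'rV[R]_n) : Prop :=
  definable (fun z : 'rV[R]_(m + n) => A (lsubmx z) /\ rsubmx z = f (lsubmx z)).

Definition definable_Cq_diffeo (q : nat) m (A B : 'rV[R]_m -> Prop) (g : 'rV[R]_m -> 'rV[R]_m) : Prop :=
  definable_map_on A g /\ Cq q A g /\ (forall x, A x -> B (g x)) /\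
  exists h : 'rV[R]_m -> 'rV[R]_m,
    definable_map_on B h /\ Cq q B h /\ (forall y, B y -> A (h y)) /\
    (forall x, A x -> h (g x) = x) /\ (forall y, B y -> g (h y) = y).

Definition chart_image (M : Type) m (I : Type) (U : I -> M -> Prop) (phi : I -> M -> 'rV[R]_m)
  (i j : I) : 'rV[R]_m -> Prop := fun v => exists x, U i x /\ U j x /\ phi i x = v.

Definition is_atlas (q : nat) (M : Type) (m : nat) (I : finType)
    (U : I -> M -> Prop) (phi : I -> M -> 'rV[R]_m) : Prop :=
  [/\ (forall x : M, exists i, U i x),
      (forall i x y, U i x -> U i y -> phi i x = phi i y -> x = y),
      (forall i, definable (fun v => exists x, U i x /\ phi i x = v) /\
                 open_set (fun v => exists x, U i x /\ phi i x = v)),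
      (forall i j, definable (chart_image U phi i j) /\ open_set (chart_image U phi i j)) &
      (forall i j, exists g : 'rV[R]_m -> 'rV[R]_m,
          (forall x, U i x -> U j x -> g (phi i x) = phi j x) /\
          definable_Cq_diffeo q (chart_image U phi i j) (chart_image U phi j i) g)].

Definition sum_fam (I J : Type) (X : Type) (f : I -> X) (g : J -> X) : I + J -> X :=
  fun k => match k with inl i => f i | inr j => g j end.

Definition compatible_atlases (q : nat) (M : Type) (m : nat) (I J : finType)
    (U : I -> M -> Prop) (phi : I -> M -> 'rV[R]_m)
    (V : J -> M -> Prop) (psi : J -> M -> 'rV[R]_m) : Prop :=
  is_atlas q (sum_fam U V) (sum_fam phi psi).

Definition atlas_open (M : Type) m (I : Type) (U : I -> M -> Prop) (phi : I -> M -> 'rV[R]_m)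
    (W : M -> Prop) : Prop :=
  forall i, open_set (fun v => exists x, W x /\ U i x /\ phi i x = v).

Definition atlas_hausdorff (M : Type) m (I : Type) (U : I -> M -> Prop) (phi : I -> M -> 'rV[R]_m) : Prop :=
  forall x y : M, x <> y -> exists W1 W2 : M -> Prop,
    [/\ atlas_open U phi W1, atlas_open U phi W2, W1 x, W2 y & forall z, ~ (W1 z /\ W2 z)].

(* an abstract-definable C^p manifold of dimension m, presented by an atlas
   representing its compatibility class *)
Definition is_manifold (p : nat) (M : Type) (m : nat) (I : finType)
    (U : I -> M -> Prop) (phi : I -> M -> 'rV[R]_m) : Prop :=
  is_atlas p U phi /\ atlas_hausdorff U phi.

End Manifolds.

(* Main.v *)
Require Import Defs.
From mathcomp Require Import all_boot all_order all_algebra boolp lra ring zify.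
Set Implicit Arguments. Unset Strict Implicit. Unset Printing Implicit Defensive.
Import Order.TTheory GRing.Theory Num.Theory.
Local Open Scope ring_scope.

(** The charts are corrected one at a time: if the transition maps between the charts of a list
    are [C^(p+1)], a further chart [phi] is replaced by [(id + e) o phi], where [e] is a definable
    [C^p] map with small derivatives, so that [id + e] is a [C^p] diffeomorphism of [R^m].  To make
    the transition map [C^(p+1)] in one chart, one shrinks the closed, nowhere dense definable set
    where it is not, by descending induction on the dimension of its coordinate projections.  Over
    a generic part of a base [R^d] this bad set is a finite union of graphs of [C^(p+1)] sections;
    near each of them the map is replaced by its fibrewise Taylor polynomial of order [p], glued to
    the original with a [C^(p+1)] cut-off.  The width of the cut-off is a slowly varying definable
    function, which keeps the [C^p] size of the modification under control and lets it extend by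
    zero.  What remains bad has a nowhere dense projection to [R^d]; at [d = 0] it is empty.
    Finally a [C^p] map inverse to a [C^(p+1)] one is itself [C^(p+1)]. *)

(** * Definability calculus *)

(** What replaces them is genericity: a property that holds on a smaller ball inside every ball. One
    dichotomy for definable sets, with definable suprema, yields compactness, selection, generic
    smoothness and finite branching.

    The obstacle is that a cut-off of width [de] around a section with derivatives of size [1 / th]
    costs [1 / (de * th)] per derivative. Subtracting the Taylor polynomial of order [p] leaves a
    function whose derivatives up to order [p] vanish on the section, so on the tube it has the size
    of [de ^ p] times its derivatives of order [p], which are as small as desired when [de] is. The
    two effects cancel, and any weight that is positive near the section can be beaten. The weight
    used decays quadratically at the boundary of the treated region.

    Smoothness of a corrected chart may be tested in any one of the earlier charts, since these are
    already mutually [C^(p+1)]. Hence the bad set is one set for all of them, it only shrinks, and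
    successive corrections do not undo each other. *)

Section DefinableBase.
Variables (R : rcfType) (S : ominimal_expansion R).

Lemma dfn_ext n (A B : 'rV[R]_n -> Prop) :
  (forall x, A x <-> B x) -> dfn S A -> dfn S B.
Proof. by move=> h; have -> : A = B by apply: funext => x; apply: propext. Qed.

Lemma dfn_all_in n (T : eqType) (s : seq T) (P : T -> 'rV[R]_n -> Prop) :
  (forall j, dfn S (P j)) -> dfn S (fun x => forall j, j \in s -> P j x).
Proof.
move=> hP; elim: s => [|j s IH].
  by apply: dfn_ext (dfn_full R S n) => x; split.
apply: dfn_ext (dfn_inter _ _ _ _ _ (hP j) IH) => x; split.
  by move=> [h1 h2] k; rewrite inE => /orP [/eqP -> //|]; apply: h2.
move=> h; split; first by apply: h; rewrite inE eqxx.
by move=> k hk; apply: h; rewrite inE hk orbT.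
Qed.

Lemma dfn_all_fin n (T : finType) (P : T -> 'rV[R]_n -> Prop) :
  (forall j, dfn S (P j)) -> dfn S (fun x => forall j, P j x).
Proof.
move=> hP; apply: dfn_ext (dfn_all_in (enum T) hP) => x; split=> h j //.
by apply: h; rewrite mem_enum.
Qed.

Lemma dfn_cyl n k (A : 'rV[R]_k -> Prop) :
  dfn S A -> dfn S (fun z : 'rV[R]_(n + k) => A (rsubmx z)).
Proof.
move=> hA; elim: n => [|n IH].
  apply: dfn_ext hA => x.
  suff -> : rsubmx (x : 'rV_(0 + k)) = x by [].
  by apply/rowP => j; rewrite !mxE; congr (x _ _); apply: val_inj.
apply: dfn_ext (dfn_prodl _ _ _ _ IH) => x.
suff -> : rsubmx (rsubmx x) = rsubmx (x : 'rV_(n.+1 + k)) by [].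
by apply/rowP => j; rewrite !mxE; congr (x _ _); apply: val_inj.
Qed.

Lemma dfn_projn k n N (A : 'rV[R]_N -> Prop) : N = (n + k)%N -> dfn S A ->
  dfn S (fun x : 'rV[R]_n => exists2 v, A v &
    forall (i : 'I_n) (j : 'I_N), val i = val j -> x 0 i = v 0 j).
Proof.
elim: k N A => [|k IH] N A e hA.
  rewrite addn0 in e; subst N; apply: dfn_ext hA => x; split.
    by move=> h; exists x => // i j /val_inj ->.
  by move=> [v hv h]; have -> : x = v by apply/rowP => i; apply: h.
have e' : N = (n + k + 1)%N by rewrite e addn1 addnS.
clear e; subst N.
apply: dfn_ext (IH _ _ erefl (dfn_proj _ _ _ _ hA)) => x; split.
  move=> [v [y hy] h]; exists (row_mx v y) => // i j hij.
  have hj : (j < n + k)%N by have := ltn_ord i; move: hij => /= ->; lia.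
  rewrite (h i (Ordinal hj)) //.
  by rewrite -(row_mxEl v y); congr (row_mx v y _ _); apply: val_inj.
move=> [v hv h]; exists (lsubmx v).
  by exists (rsubmx v); rewrite hsubmxK.
by move=> i j hij; rewrite mxE; apply: h.
Qed.

(** The preimage is the projection of a cylinder over [A], cut out by the diagonals that equate each
    of the last [k] coordinates with its source. Every substitution of variables goes back to
    this. *)
Lemma dfn_reindex k n (s : 'I_k -> 'I_n) (A : 'rV[R]_k -> Prop) :
  dfn S A -> dfn S (fun v : 'rV[R]_n => A (\row_j v 0 (s j))).
Proof.
move=> hA.
have h1 : dfn S (fun z : 'rV[R]_(n + k) => A (rsubmx z) /\
   forall j : 'I_k, z ord0 (rshift n j) = z ord0 (lshift k (s j))).
  apply: dfn_inter; first exact: dfn_cyl.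
  by apply: dfn_all_fin => j; apply: dfn_diag.
apply: dfn_ext (dfn_projn erefl h1) => v; split.
  move=> [z [hz hj] h].
  suff -> : \row_j v 0 (s j) = rsubmx z by [].
  by apply/rowP => j; rewrite !mxE hj (h (s j) (lshift k (s j))).
move=> h; exists (row_mx v (\row_j v 0 (s j))).
  split; first by rewrite row_mxKr.
  by move=> j; rewrite row_mxEr row_mxEl mxE.
move=> i j hij; have -> : j = lshift k i by apply: val_inj.
by rewrite row_mxEl.
Qed.

End DefinableBase.

(* Contexts of definable formulas: types coordinatised by some R^n. *)
Class dtype (R : rcfType) (X : Type) := DType {
  ddim : nat;
  denc : X -> 'rV[R]_ddim;
  ddec : 'rV[R]_ddim -> X;
  dencK : cancel denc ddec;
  ddecK : cancel ddec denc }.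
Arguments ddim {R} X {_}.
Arguments denc {R X _} _.
Arguments ddec {R X _} _.

Section DTypes.
Variable R : rcfType.

Lemma scal_encK : cancel (fun x : R => const_mx x : 'rV[R]_1) (fun v => v 0 0).
Proof. by move=> x; rewrite mxE. Qed.
Lemma scal_decK : cancel (fun v : 'rV[R]_1 => v 0 0) (fun x : R => const_mx x).
Proof. by move=> v; apply/rowP => i; rewrite mxE ord1. Qed.

Global Instance dtype_scal : dtype R R := DType scal_encK scal_decK.
Global Instance dtype_row n : dtype R 'rV[R]_n :=
  @DType R 'rV[R]_n n id id (fun _ => erefl) (fun _ => erefl).

Lemma pair_encK X Y (dX : dtype R X) (dY : dtype R Y) :
  cancel (fun p : X * Y => row_mx (denc p.1) (denc p.2))
         (fun v => (ddec (lsubmx v), ddec (rsubmx v))).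
Proof. by move=> [x y]; rewrite row_mxKl row_mxKr !dencK. Qed.
Lemma pair_decK X Y (dX : dtype R X) (dY : dtype R Y) :
  cancel (fun v => (ddec (lsubmx v), ddec (rsubmx v)) : X * Y)
         (fun p : X * Y => row_mx (denc p.1) (denc p.2)).
Proof. by move=> v; rewrite /= !ddecK hsubmxK. Qed.
Global Instance dtype_pair X Y (dX : dtype R X) (dY : dtype R Y) : dtype R (X * Y) :=
  DType (@pair_encK X Y dX dY) (@pair_decK X Y dX dY).

End DTypes.

Definition Def (R : rcfType) (S : ominimal_expansion R) X {dX : dtype R X}
  (A : X -> Prop) : Prop := dfn S (fun v => A (ddec v)).
(** Functions are total throughout. A map that matters only on a subset is first extended by default
    values, so that a single graph condition expresses definability. *)
Definition Dfun (R : rcfType) (S : ominimal_expansion R) X Y {dX : dtype R X}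
  {dY : dtype R Y} (f : X -> Y) : Prop := Def S (fun p : X * Y => f p.1 = p.2).
Arguments Def {R} S {X dX} A.
Arguments Dfun {R} S {X Y dX dY} f.

Section DefinableCalculus.
Variables (R : rcfType) (S : ominimal_expansion R).
Local Notation Def := (Def S).
Local Notation Dfun := (Dfun S).

(** Maps that only select coordinates. They preserve definability by [dfn_reindex] alone, and
    substitution of arbitrary definable functions in [Def_comp] is built from them and one
    existential quantifier. *)
Definition remap X Y {dX : dtype R X} {dY : dtype R Y} (f : X -> Y) : Prop :=
  exists s : 'I_(ddim Y) -> 'I_(ddim X),
    forall v, denc (f (ddec v)) = \row_j v 0 (s j).

Section Generic.
Context {X Y Z : Type} {dX : dtype R X} {dY : dtype R Y} {dZ : dtype R Z}.

Lemma Def_ext (A B : X -> Prop) : (forall x, A x <-> B x) -> Def A -> Def B.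
Proof. by move=> h; apply: dfn_ext => v; apply: h. Qed.

Lemma Def_true : Def (fun _ : X => True).
Proof. exact: dfn_full. Qed.

Lemma Def_not (A : X -> Prop) : Def A -> Def (fun x => ~ A x).
Proof. exact: dfn_compl. Qed.

Lemma Def_false : Def (fun _ : X => False).
Proof. by apply: Def_ext (Def_not Def_true) => x; tauto. Qed.

Lemma Def_and (A B : X -> Prop) : Def A -> Def B -> Def (fun x => A x /\ B x).
Proof. exact: dfn_inter. Qed.

Lemma Def_or (A B : X -> Prop) : Def A -> Def B -> Def (fun x => A x \/ B x).
Proof.
move=> hA hB; apply: Def_ext (Def_not (Def_and (Def_not hA) (Def_not hB))) => x.
by have := EM (A x); have := EM (B x); tauto.
Qed.

Lemma Def_imp (A B : X -> Prop) : Def A -> Def B -> Def (fun x => A x -> B x).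
Proof.
move=> hA hB; apply: Def_ext (Def_or (Def_not hA) hB) => x.
by have := EM (A x); tauto.
Qed.

Lemma Def_iff (A B : X -> Prop) : Def A -> Def B -> Def (fun x => A x <-> B x).
Proof. by move=> hA hB; apply: Def_and; apply: Def_imp. Qed.

Lemma Def_const (P : Prop) : Def (fun _ : X => P).
Proof.
by have [h|h] := EM P; [apply: Def_ext Def_true | apply: Def_ext Def_false].
Qed.

Lemma Def_all_fin (T : finType) (P : T -> X -> Prop) :
  (forall j, Def (P j)) -> Def (fun x => forall j, P j x).
Proof. exact: dfn_all_fin. Qed.

Lemma Def_all_in (T : eqType) (s : seq T) (P : T -> X -> Prop) :
  (forall j, Def (P j)) -> Def (fun x => forall j, j \in s -> P j x).
Proof. by move=> h; apply: dfn_all_in. Qed.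

Lemma Def_remap (f : X -> Y) (A : Y -> Prop) :
  remap f -> Def A -> Def (fun x => A (f x)).
Proof.
move=> [s hs] hA; apply: dfn_ext (dfn_reindex s hA) => v.
by rewrite -hs dencK.
Qed.

Lemma remap_id : remap (id : X -> X).
Proof. by exists id => v; apply/rowP => j; rewrite mxE ddecK. Qed.

Lemma remap_fst : remap (@fst X Y).
Proof. by exists (lshift _) => v /=; apply/rowP => j; rewrite ddecK !mxE. Qed.

Lemma remap_snd : remap (@snd X Y).
Proof. by exists (@rshift (ddim X) (ddim Y)) => v /=; apply/rowP => j; rewrite ddecK !mxE. Qed.

Lemma remap_pair (f : Z -> X) (g : Z -> Y) :
  remap f -> remap g -> remap (fun z => (f z, g z)).
Proof.
move=> [s hs] [t ht].
exists (fun j => match split j with inl i => s i | inr i => t i end) => v /=.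
apply/rowP => j; rewrite !mxE.
by case: splitP => i hi; rewrite ?hs ?ht mxE.
Qed.

Lemma remap_comp (f : X -> Y) (g : Y -> Z) :
  remap f -> remap g -> remap (fun x => g (f x)).
Proof.
move=> [s hs] [t ht]; exists (fun j => s (t j)) => v.
have -> : f (ddec v) = ddec (\row_j v 0 (s j)) by rewrite -hs dencK.
by rewrite ht; apply/rowP => j; rewrite !mxE.
Qed.

Lemma Def_ex (P : X -> Y -> Prop) :
  Def (fun p : X * Y => P p.1 p.2) -> Def (fun x => exists y, P x y).
Proof.
move=> h; apply: dfn_ext (dfn_projn erefl h) => v; split.
  move=> [w hw hvw]; exists (ddec (rsubmx w)).
  suff -> : v = lsubmx w by [].
  by apply/rowP => i; rewrite mxE; apply: hvw.
move=> [y hy]; exists (row_mx v (denc y)).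
  by rewrite /= row_mxKl row_mxKr dencK.
move=> i j hij; have -> : j = lshift _ i by apply: val_inj.
by rewrite row_mxEl.
Qed.

End Generic.

Section Generic2.
Context {X Y Z : Type} {dX : dtype R X} {dY : dtype R Y} {dZ : dtype R Z}.

Lemma Def_all (P : X -> Y -> Prop) :
  Def (fun p : X * Y => P p.1 p.2) -> Def (fun x => forall y, P x y).
Proof.
move=> h; have := Def_not (Def_ex (P := fun x y => ~ P x y) (Def_not h)).
apply: Def_ext => x; split; first by move=> h1 y; apply: contrapT => h2; apply: h1; exists y.
by move=> h1 [y hy].
Qed.

Lemma Def_ex2 (P Q : X -> Y -> Prop) :
  Def (fun p : X * Y => P p.1 p.2) -> Def (fun p : X * Y => Q p.1 p.2) ->
  Def (fun x => exists2 y, P x y & Q x y).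
Proof.
move=> h1 h2; apply: Def_ext (@Def_ex X Y _ _ (fun x y => P x y /\ Q x y) (Def_and h1 h2)) => x.
by split=> [[y []]|[y]] *; exists y.
Qed.

Lemma Def_eq_remap (f g : X -> Y) : remap f -> remap g -> Def (fun x => f x = g x).
Proof.
move=> [s hs] [t ht].
have h : dfn S (fun v : 'rV_(ddim X) => forall j, v ord0 (s j) = v ord0 (t j)).
  by apply: dfn_all_fin => j; apply: dfn_diag.
apply: dfn_ext h => v; split.
  move=> h; rewrite -[LHS]dencK -[RHS]dencK hs ht; congr ddec.
  by apply/rowP => j; rewrite !mxE h.
move=> h j; have := congr1 (fun x => denc x 0 j) h.
by rewrite hs ht !mxE.
Qed.

End Generic2.

Section Generic2'.
Context {X Y Z : Type} {dX : dtype R X} {dY : dtype R Y} {dZ : dtype R Z}.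

Lemma Dfun_remap (f : X -> Y) : remap f -> Dfun f.
Proof.
move=> h; apply: (Def_eq_remap (f := fun p : X * Y => f p.1) (g := snd)).
  by apply: (remap_comp (f := fst)) h; apply: remap_fst.
exact: remap_snd.
Qed.

Lemma Def_comp (A : Y -> Prop) (f : X -> Y) : Def A -> Dfun f -> Def (fun x => A (f x)).
Proof.
move=> hA hf.
have h : Def (fun p : X * Y => f p.1 = p.2 /\ A p.2).
  by apply: Def_and hf _; apply: Def_remap hA; apply: remap_snd.
apply: Def_ext (@Def_ex X Y _ _ (fun x y => f x = y /\ A y) h) => x.
by split=> [[y [-> //]]|hx]; exists (f x).
Qed.

Lemma Dfun_pair (f : X -> Y) (g : X -> Z) : Dfun f -> Dfun g -> Dfun (fun x => (f x, g x)).
Proof.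
move=> hf hg.
have h1 : Def (fun p : X * (Y * Z) => f p.1 = p.2.1).
  pose r := fun p : X * (Y * Z) => (p.1, p.2.1).
  apply: (@Def_remap _ _ _ _ r _ _ hf).
  apply: remap_pair; first exact: remap_fst.
  by apply: remap_comp; [apply: remap_snd | apply: remap_fst].
have h2 : Def (fun p : X * (Y * Z) => g p.1 = p.2.2).
  pose r := fun p : X * (Y * Z) => (p.1, p.2.2).
  apply: (@Def_remap _ _ _ _ r _ _ hg).
  apply: remap_pair; first exact: remap_fst.
  by apply: remap_comp; apply: remap_snd.
apply: Def_ext (Def_and h1 h2) => -[x [y z]] /=.
by split=> [[-> ->] | [-> ->]].
Qed.

End Generic2'.

Section Generic3.
Context {X Y Z W : Type} {dX : dtype R X} {dY : dtype R Y} {dZ : dtype R Z} {dW : dtype R W}.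

Lemma Dfun_id : Dfun (fun x : X => x).
Proof. exact/Dfun_remap/remap_id. Qed.

Lemma Dfun_fst (f : X -> Y * Z) : Dfun f -> Dfun (fun x => (f x).1).
Proof.
move=> hf; pose g := fun p : X * Y => ((f p.1).1 = p.2).
have h : Def (fun q : (X * Y) * Z => f q.1.1 = (q.1.2, q.2)).
  apply: (@Def_remap _ _ _ _ (fun q : (X * Y) * Z => (q.1.1, (q.1.2, q.2))) _ _ hf).
  apply: remap_pair; first by apply: remap_comp; apply: remap_fst.
  apply: remap_pair; last exact: remap_snd.
  by apply: remap_comp; [apply: remap_fst | apply: remap_snd].
apply: Def_ext (@Def_ex _ _ _ _ (fun (p : X * Y) z => f p.1 = (p.2, z)) h) => -[x y] /=.
by split=> [[z -> //]|<-]; exists (f x).2; rewrite -surjective_pairing.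
Qed.

Lemma Dfun_snd (f : X -> Y * Z) : Dfun f -> Dfun (fun x => (f x).2).
Proof.
move=> hf.
have h : Def (fun q : (X * Z) * Y => f q.1.1 = (q.2, q.1.2)).
  apply: (@Def_remap _ _ _ _ (fun q : (X * Z) * Y => (q.1.1, (q.2, q.1.2))) _ _ hf).
  apply: remap_pair; first by apply: remap_comp; apply: remap_fst.
  apply: remap_pair; first exact: remap_snd.
  by apply: remap_comp; [apply: remap_fst | apply: remap_snd].
apply: Def_ext (@Def_ex _ _ _ _ (fun (p : X * Z) z => f p.1 = (z, p.2)) h) => -[x y] /=.
by split=> [[z -> //]|<-]; exists (f x).1; rewrite -surjective_pairing.
Qed.

Lemma Dfun_comp (g : Y -> Z) (f : X -> Y) : Dfun g -> Dfun f -> Dfun (fun x => g (f x)).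
Proof.
move=> hg hf.
apply: (Def_comp (A := fun q : Y * Z => g q.1 = q.2) (f := fun p : X * Z => (f p.1, p.2)) hg).
apply: Dfun_pair; last exact/Dfun_remap/remap_snd.
pose r := fun q : (X * Z) * Y => (q.1.1, q.2).
apply: (@Def_remap _ _ _ _ r _ _ hf).
apply: remap_pair; last exact: remap_snd.
by apply: remap_comp; apply: remap_fst.
Qed.

Lemma Def_comp2 (A : Y -> Z -> Prop) (f : X -> Y) (g : X -> Z) :
  Def (fun p : Y * Z => A p.1 p.2) -> Dfun f -> Dfun g -> Def (fun x => A (f x) (g x)).
Proof. by move=> hA hf hg; apply: (Def_comp hA (Dfun_pair hf hg)). Qed.

End Generic3.

Section Generic4.
Context {X Y Z W : Type} {dX : dtype R X} {dY : dtype R Y} {dZ : dtype R Z} {dW : dtype R W}.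

Lemma Dfun_comp2 (h : Y -> Z -> W) (f : X -> Y) (g : X -> Z) :
  Dfun (fun p : Y * Z => h p.1 p.2) -> Dfun f -> Dfun g -> Dfun (fun x => h (f x) (g x)).
Proof. by move=> hA hf hg; apply: (Dfun_comp hA (Dfun_pair hf hg)). Qed.

End Generic4.

Section Scalars.
Context {X : Type} {dX : dtype R X}.

Lemma Def_lt (f g : X -> R) : Dfun f -> Dfun g -> Def (fun x => f x < g x).
Proof.
move=> hf hg; apply: (Def_comp2 (A := fun a b : R => a < b)) => //.
apply: dfn_ext (dfn_lt R S) => v /=; rewrite !mxE.
suff [-> ->] : lshift 1 (0 : 'I_1) = ord0 /\ rshift 1 (0 : 'I_1) = @Ordinal 2 1 isT by [].
by split; apply: val_inj.
Qed.

Lemma Def_eq (f g : X -> R) : Dfun f -> Dfun g -> Def (fun x => f x = g x).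
Proof.
move=> hf hg; apply: (Def_comp2 (A := fun a b : R => a = b)) => //.
by apply: Def_eq_remap; [apply: remap_fst | apply: remap_snd].
Qed.

Lemma Def_le (f g : X -> R) : Dfun f -> Dfun g -> Def (fun x => f x <= g x).
Proof.
by move=> hf hg; apply: Def_ext (Def_not (Def_lt hg hf)) => x; rewrite leNgt; split=> /negP.
Qed.

Lemma Dfun_add (f g : X -> R) : Dfun f -> Dfun g -> Dfun (fun x => f x + g x).
Proof.
move=> hf hg; apply: (Dfun_comp2 (h := fun a b : R => a + b)) => //.
apply: dfn_ext (dfn_add R S) => v /=; rewrite !mxE.
suff [-> -> ->] : [/\ lshift 1 (lshift 1 (0 : 'I_1)) = (ord0 : 'I_3),
   lshift 1 (rshift 1 (0 : 'I_1)) = @Ordinal 3 1 isT &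
   rshift 2 (0 : 'I_1) = @Ordinal 3 2 isT] by [].
by split; apply: val_inj.
Qed.

Lemma Dfun_mul (f g : X -> R) : Dfun f -> Dfun g -> Dfun (fun x => f x * g x).
Proof.
move=> hf hg; apply: (Dfun_comp2 (h := fun a b : R => a * b)) => //.
apply: dfn_ext (dfn_mul R S) => v /=; rewrite !mxE.
suff [-> -> ->] : [/\ lshift 1 (lshift 1 (0 : 'I_1)) = (ord0 : 'I_3),
   lshift 1 (rshift 1 (0 : 'I_1)) = @Ordinal 3 1 isT &
   rshift 2 (0 : 'I_1) = @Ordinal 3 2 isT] by [].
by split; apply: val_inj.
Qed.

Lemma Dfun_cst (c : R) : Dfun (fun _ : X => c).
Proof.
have h : Def (fun r : R => r = c) by exact: dfn_point.
apply: Def_ext (@Def_remap (X * R) R _ _ snd _ remap_snd h) => -[x r] /=.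
by split=> ->.
Qed.

Lemma Dfun_cstX Y (dY : dtype R Y) (c : Y) : Dfun (fun _ : X => c).
Proof.
have h : Def (fun y : Y => forall j, denc y 0 j = denc c 0 j).
  apply: Def_all_fin => j.
  have := dfn_reindex (fun _ : 'I_1 => j) (dfn_point R S (denc c 0 j)).
  by apply: dfn_ext => v /=; rewrite mxE ddecK.
apply: Def_ext (@Def_remap (X * Y) Y _ _ snd _ remap_snd h) => -[x y] /=.
split=> [h1|-> //]; rewrite -[LHS]dencK -[RHS]dencK; congr ddec.
by apply/rowP => j; rewrite h1.
Qed.

Lemma Dfun_graph (f : X -> R) (A : X -> R -> Prop) :
  Def (fun p : X * R => A p.1 p.2) -> (forall x r, A x r <-> f x = r) -> Dfun f.
Proof. by move=> hA h; apply: Def_ext hA => p; apply: h. Qed.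

(** As the value is unique, [A] is itself the graph of the chosen function; choosing the values
    classically, point by point, therefore does not harm definability. *)
Lemma Dfun_choice (A : X -> R -> Prop) :
  Def (fun p : X * R => A p.1 p.2) -> (forall x, exists r, A x r) ->
  (forall x r r', A x r -> A x r' -> r = r') ->
  exists2 f : X -> R, Dfun f & forall x, A x (f x).
Proof.
move=> hA he hu; exists (fun x => projT1 (cid (he x))); last by move=> x; case: cid.
apply: Dfun_graph hA _ => x r; case: cid => r' hr' /=.
by split=> [h|<- //]; apply: hu hr' h.
Qed.

Lemma Dfun_row n (f : X -> 'rV[R]_n) : (forall i, Dfun (fun x => f x 0 i)) -> Dfun f.
Proof.
move=> h.
have h1 : Def (fun p : X * 'rV[R]_n => forall i, f p.1 0 i = p.2 0 i).
  apply: Def_all_fin => i.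
  apply: (Def_comp2 (A := fun x r => f x 0 i = r) (f := fst) (g := fun p : X * 'rV[R]_n => p.2 0 i)).
  - exact: h.
  - exact/Dfun_remap/remap_fst.
  apply/Dfun_remap; apply: (remap_comp (f := snd) (g := fun v : 'rV[R]_n => v 0 i)); first exact: remap_snd.
  by exists (fun _ => i) => v; apply/rowP => j; rewrite !mxE.
apply: Def_ext h1 => -[x v] /=; split=> [h2|-> //].
by apply/rowP => i; apply: h2.
Qed.

Lemma Dfun_coord n (f : X -> 'rV[R]_n) i : Dfun f -> Dfun (fun x => f x 0 i).
Proof.
move=> hf; apply: (@Dfun_comp _ 'rV[R]_n R _ _ _ (fun v => v 0 i)) hf.
by apply/Dfun_remap; exists (fun _ => i) => v; apply/rowP => j; rewrite !mxE.
Qed.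

Lemma Dfun_coord' n (f : X -> 'rV[R]_n) i j : Dfun f -> Dfun (fun x => f x i j).
Proof. by rewrite (ord1 i); apply: Dfun_coord. Qed.

Lemma Dfun_opp (f : X -> R) : Dfun f -> Dfun (fun x => - f x).
Proof.
move=> hf; have -> : (fun x => - f x) = (fun x => (-1) * f x) by apply: funext => x; rewrite mulN1r.
by apply: Dfun_mul hf; apply: Dfun_cst.
Qed.

Lemma Dfun_ite (P : X -> Prop) (f g : X -> R) : Def P -> Dfun f -> Dfun g ->
  Dfun (fun x => if `[< P x >] then f x else g x).
Proof.
move=> hP hf hg; have hP' : Def (fun p : X * R => P p.1) by apply: Def_remap hP; apply: remap_fst.
apply: Def_ext (Def_or (Def_and hP' hf) (Def_and (Def_not hP') hg)) => -[x r] /=.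
by case: asboolP; tauto.
Qed.

Lemma Dfun_iteb (b : X -> bool) (f g : X -> R) : Def (fun x => b x) -> Dfun f -> Dfun g ->
  Dfun (fun x => if b x then f x else g x).
Proof.
move=> hb hf hg; have := Dfun_ite hb hf hg; congr Dfun.
by apply: funext => x; rewrite asboolb.
Qed.

Lemma Dfun_norm (f : X -> R) : Dfun f -> Dfun (fun x => `|f x|).
Proof.
move=> hf; have -> : (fun x => `|f x|) = (fun x => if 0 <= f x then f x else - f x).
  by apply: funext => x; case: leP => h; [rewrite ger0_norm | rewrite ltr0_norm].
by apply: Dfun_iteb => //; [apply: Def_le => //; apply: Dfun_cst | apply: Dfun_opp].
Qed.

Lemma Dfun_max (f g : X -> R) : Dfun f -> Dfun g -> Dfun (fun x => Num.max (f x) (g x)).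
Proof. by move=> hf hg; apply: Dfun_iteb => //; apply: Def_lt. Qed.

Lemma Dfun_min (f g : X -> R) : Dfun f -> Dfun g -> Dfun (fun x => Num.min (f x) (g x)).
Proof. by move=> hf hg; apply: Dfun_iteb => //; apply: Def_lt. Qed.

End Scalars.

Section Scalars2.
Context {X : Type} {dX : dtype R X}.

Lemma Dfun_inv (f : X -> R) : Dfun f -> Dfun (fun x => (f x)^-1).
Proof.
move=> hf.
have hf' : Dfun (fun p : X * R => f p.1) by apply: Dfun_comp hf _; exact/Dfun_remap/remap_fst.
have h2 : Dfun (fun p : X * R => p.2) by exact/Dfun_remap/remap_snd.
(* The first disjunct encodes the convention that the inverse of 0 is 0. *)
apply: (Dfun_graph (A := fun x r => (f x = 0 /\ r = 0) \/ f x * r = 1)).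
  apply: Def_or; last by apply: Def_eq; [apply: Dfun_mul | apply: Dfun_cst].
  by apply: Def_and; apply: Def_eq => //; apply: Dfun_cst.
move=> x r; have [->|h0] := eqVneq (f x) 0.
  rewrite invr0 mul0r; split=> [[[_ -> //]|/eqP]|<-]; last by left.
  by rewrite eq_sym oner_eq0.
split=> [[[h]|h]|<-]; first by rewrite h eqxx in h0.
  by rewrite -[LHS]mulr1 -h mulKf.
by right; rewrite divff.
Qed.

Lemma Dfun_exp (f : X -> R) n : Dfun f -> Dfun (fun x => f x ^+ n).
Proof.
move=> hf; elim: n => [|n IH]; first by exact: Dfun_cst.
have -> : (fun x => f x ^+ n.+1) = (fun x => f x * f x ^+ n) by apply: funext => x; rewrite exprS.
exact: Dfun_mul.
Qed.

Lemma Dfun_sum (I : Type) (s : seq I) (P : pred I) (F : I -> X -> R) :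
  (forall i, P i -> Dfun (F i)) -> Dfun (fun x => \sum_(i <- s | P i) F i x).
Proof.
move=> h; elim: s => [|i s IH].
  have -> : (fun x => \sum_(i <- [::] | P i) F i x) = (fun=> 0) by apply: funext => x; rewrite big_nil.
  exact: Dfun_cst.
have [hi|hi] := boolP (P i).
  have -> : (fun x => \sum_(i <- i :: s | P i) F i x) = (fun x => F i x + \sum_(i <- s | P i) F i x).
    by apply: funext => x; rewrite big_cons hi.
  by apply: Dfun_add => //; apply: h.
have -> // : (fun x => \sum_(i <- i :: s | P i) F i x) = (fun x => \sum_(i <- s | P i) F i x).
by apply: funext => x; rewrite big_cons (negbTE hi).
Qed.

Lemma Dfun_bigmax (I : Type) (s : seq I) (F : I -> X -> R) :
  (forall i, Dfun (F i)) -> Dfun (fun x => \big[Num.max/0]_(i <- s) F i x).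
Proof.
move=> h; elim: s => [|i s IH].
  have -> : (fun x => \big[Num.max/0]_(i <- [::]) F i x) = (fun=> 0) by apply: funext => x; rewrite big_nil.
  exact: Dfun_cst.
have -> : (fun x => \big[Num.max/0]_(i <- i :: s) F i x) = (fun x => Num.max (F i x) (\big[Num.max/0]_(i <- s) F i x)).
  by apply: funext => x; rewrite big_cons.
by apply: Dfun_max.
Qed.

Lemma Dfun_rowmk n (F : 'I_n -> X -> R) : (forall i, Dfun (F i)) -> Dfun (fun x => \row_i F i x).
Proof.
move=> h; apply: Dfun_row => i.
by have -> : (fun x => (\row_i F i x) 0 i) = F i by apply: funext => x; rewrite mxE.
Qed.

Lemma Dfun_addv n (f g : X -> 'rV[R]_n) : Dfun f -> Dfun g -> Dfun (fun x => f x + g x).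
Proof.
move=> hf hg; apply: Dfun_row => i.
have -> : (fun x => (f x + g x) 0 i) = (fun x => f x 0 i + g x 0 i) by apply: funext => x; rewrite mxE.
by apply: Dfun_add; apply: Dfun_coord.
Qed.

Lemma Dfun_oppv n (f : X -> 'rV[R]_n) : Dfun f -> Dfun (fun x => - f x).
Proof.
move=> hf; apply: Dfun_row => i.
have -> : (fun x => (- f x) 0 i) = (fun x => - f x 0 i) by apply: funext => x; rewrite mxE.
by apply: Dfun_opp; apply: Dfun_coord.
Qed.

Lemma Dfun_scalv n (f : X -> R) (g : X -> 'rV[R]_n) : Dfun f -> Dfun g -> Dfun (fun x => f x *: g x).
Proof.
move=> hf hg; apply: Dfun_row => i.
have -> : (fun x => (f x *: g x) 0 i) = (fun x => f x * g x 0 i) by apply: funext => x; rewrite mxE.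
by apply: Dfun_mul => //; apply: Dfun_coord.
Qed.

Lemma Dfun_mnorm n (f : X -> 'rV[R]_n) : Dfun f -> Dfun (fun x => mnorm (f x)).
Proof.
by move=> hf; apply: Dfun_bigmax => i; apply: Dfun_norm; apply: Dfun_coord'.
Qed.

Lemma Def_eqv n (f g : X -> 'rV[R]_n) : Dfun f -> Dfun g -> Def (fun x => f x = g x).
Proof.
move=> hf hg; have h : Def (fun x => forall i, f x 0 i = g x 0 i).
  by apply: Def_all_fin => i; apply: Def_eq; apply: Dfun_coord.
by apply: Def_ext h => x; split=> [h|-> //]; apply/rowP.
Qed.

End Scalars2.
End DefinableCalculus.

Ltac dfun_atom :=
  match goal with
  | |- Dfun _ (fun x => x) => apply: Dfun_id
  | |- Dfun _ (fun x => (_, _)) => apply: Dfun_pair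
  | |- Dfun _ (fun x => fst _) => apply: Dfun_fst
  | |- Dfun _ (fun x => snd _) => apply: Dfun_snd
  | |- Dfun _ (fun x => fun_of_matrix (matrix_of_fun _ _) _ _) => apply: Dfun_coord'
  | |- Dfun _ (fun x => fun_of_matrix _ _ _) => apply: Dfun_coord'
  | |- Dfun _ (fun x => \row_i _) => apply: Dfun_rowmk => ?
  | |- Dfun _ (fun x => mnorm _) => apply: Dfun_mnorm
  | |- Dfun _ (fun x => Num.norm _) => apply: Dfun_norm
  | |- Dfun _ (fun x => Order.max _ _) => apply: Dfun_max
  | |- Dfun _ (fun x => Order.min _ _) => apply: Dfun_min
  | |- Dfun _ (fun x => if asbool _ then _ else _) => apply: Dfun_ite
  | |- Dfun _ (fun x => GRing.exp _ _) => apply: Dfun_exp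
  | |- Dfun _ (fun x => GRing.inv _) => apply: Dfun_inv
  | |- Dfun _ (fun x => GRing.scale _ _) => apply: Dfun_scalv
  | |- Dfun _ (fun x => bigop _ _ _) => apply: Dfun_sum => ? _
  | |- Dfun _ (fun x => GRing.mul _ _) => apply: Dfun_mul
  | |- Dfun _ (fun x => GRing.add _ _) => first [apply: Dfun_add | apply: Dfun_addv]
  | |- Dfun _ (fun x => GRing.opp _) => first [apply: Dfun_opp | apply: Dfun_oppv]
  | |- Dfun _ (fun x => ?c) => apply: Dfun_cstX
  end.

Ltac dfun_hyp :=
  match goal with
  | H : Dfun _ _ |- Dfun _ _ => first [exact H | apply: (Dfun_comp H) | apply: (Dfun_comp2 H)]
  | H : Def _ _ |- Def _ _ => first [exact H | apply: (Def_comp H) | apply: (Def_comp2 H)]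
  | H : forall _, Dfun _ _ |- Dfun _ _ => first [apply: H | apply: (Dfun_comp (H _)) | apply: (Dfun_comp2 (H _))]
  | H : forall _, Def _ _ |- Def _ _ => first [apply: H | apply: (Def_comp (H _)) | apply: (Def_comp2 (H _))]
  end.

(* Unification eta-reduces function metavariables; restore the abstraction. *)
Ltac def_eta := cbn beta; try lazymatch goal with
  | |- Dfun _ (fun x => _) => idtac
  | |- Def _ (fun x => _) => idtac
  | |- Dfun ?S ?f => change (Dfun S (fun x => f x))
  | |- Def ?S ?f => change (Def S (fun x => f x))
  end.

Ltac def_step :=
  def_eta; first [ dfun_atom | match goal with
  | |- Def _ (fun x => _ /\ _) => apply: Def_and
  | |- Def _ (fun x => _ \/ _) => apply: Def_or
  | |- Def _ (fun x => _ <-> _) => apply: Def_iff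
  | |- Def _ (fun x => ~ _) => apply: Def_not
  | |- Def _ (fun x => ex2 _ _) => apply: Def_ex2
  | |- Def _ (fun x => exists _, _) => apply: Def_ex
  | |- Def _ (fun x => is_true (Order.lt _ _)) => apply: Def_lt
  | |- Def _ (fun x => is_true (Order.le _ _)) => apply: Def_le
  | |- Def _ (fun x => _ = _) => first [apply: Def_eq | apply: Def_eqv]
  | |- Def _ (fun x => ?P) => apply: (@Def_const _ _ _ _ P)
  end | dfun_hyp | match goal with
  | |- Def _ (fun x => _ -> _) => apply: Def_imp
  | |- Def _ (fun x => forall _, _) => first [apply: Def_all | apply: Def_all_in => ? | apply: Def_all_fin => ?]
  end ].
Ltac definable := repeat def_step.

(** * One-variable o-minimality *)

Section MaxNorm.
Variable R : rcfType.
Implicit Types (n : nat) (r : R).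

Lemma mnorm_ge0 n (v : 'rV[R]_n) : 0 <= mnorm v.
Proof.
by rewrite /mnorm; elim/big_ind: _ => // x y hx hy; rewrite le_max hx.
Qed.

Lemma mnorm_coord n (v : 'rV[R]_n) i : `|v 0 i| <= mnorm v.
Proof. by rewrite /mnorm; apply: (le_bigmax _ (fun i => `|v ord0 i|)). Qed.

Lemma mnorm_le n (v : 'rV[R]_n) r : 0 <= r -> (forall i, `|v 0 i| <= r) -> mnorm v <= r.
Proof. by move=> hr h; apply/bigmax_leP. Qed.

Lemma mnorm_lt n (v : 'rV[R]_n) r : 0 < r -> (forall i, `|v 0 i| < r) -> mnorm v < r.
Proof. by move=> hr h; apply/bigmax_ltP. Qed.

Lemma mnorm0 n : mnorm (0 : 'rV[R]_n) = 0.
Proof. by apply/eqP; rewrite eq_le mnorm_ge0 andbT; apply: mnorm_le => // i; rewrite mxE normr0. Qed.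

Lemma mnormN n (v : 'rV[R]_n) : mnorm (- v) = mnorm v.
Proof. by rewrite /mnorm; apply: eq_bigr => i _; rewrite mxE normrN. Qed.

Lemma mnormD n (v w : 'rV[R]_n) : mnorm (v + w) <= mnorm v + mnorm w.
Proof.
apply: mnorm_le => [|i]; first by rewrite addr_ge0 ?mnorm_ge0.
by rewrite mxE (le_trans (ler_normD _ _)) // lerD ?mnorm_coord.
Qed.

Lemma mnormBC n (v w : 'rV[R]_n) : mnorm (v - w) = mnorm (w - v).
Proof. by rewrite -mnormN opprB. Qed.

Lemma mnormB_tri n (u v w : 'rV[R]_n) : mnorm (u - w) <= mnorm (u - v) + mnorm (v - w).
Proof. by have := mnormD (u - v) (v - w); rewrite addrA subrK. Qed.

Lemma mnormZ n a (v : 'rV[R]_n) : mnorm (a *: v) = `|a| * mnorm v.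
Proof.
rewrite /mnorm (big_morph _ (id1 := 0) (op1 := Num.max) (fun x y => maxr_pMr x y (normr_ge0 a))) ?mulr0 //.
by apply: eq_bigr => i _; rewrite mxE normrM.
Qed.

Lemma mnorm_eq0 n (v : 'rV[R]_n) : mnorm v <= 0 -> v = 0.
Proof.
move=> h; apply/rowP => i; rewrite mxE; apply/eqP.
by rewrite -normr_le0 (le_trans (mnorm_coord v i)).
Qed.

End MaxNorm.

Section MinMax.
Variable R : rcfType.
Implicit Types a b : R.
Lemma maxL a b : a <= Num.max a b. Proof. by rewrite le_max lexx. Qed.
Lemma maxR a b : b <= Num.max a b. Proof. by rewrite le_max lexx orbT. Qed.
Lemma minL a b : Num.min a b <= a. Proof. by rewrite ge_min lexx. Qed.
Lemma minR a b : Num.min a b <= b. Proof. by rewrite ge_min lexx orbT. Qed.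
Lemma min_gt0 a b : 0 < a -> 0 < b -> 0 < Num.min a b.
Proof. by move=> ha hb; rewrite lt_min ha. Qed.
End MinMax.

Section OneVar.
Variables (R : rcfType) (S : ominimal_expansion R).
Local Notation Def := (Def S).
Local Notation Dfun := (Dfun S).
Implicit Types (A B : R -> Prop) (a b c : R).

Lemma omin A : Def A -> exists (s : seq (option R * option R)) (t : seq R),
  forall x, A x <-> (x \in t \/ has (fun ab => in_interval ab x) s).
Proof.
move=> /(dfn_ominimal R S) [s [t h]]; exists s, t => x.
by have := h (const_mx x); rewrite /= !mxE.
Qed.

(** O-minimality as an induction principle; it lets the arguments on germs and on suprema avoid
    handling lists of endpoints. *)
Lemma omin_ind (P : (R -> Prop) -> Prop) :
  (forall A B, (forall x, A x <-> B x) -> P A -> P B) ->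
  P (fun _ => False) ->
  (forall r, P (fun x => x = r)) ->
  (forall ab, P (fun x => in_interval ab x)) ->
  (forall A B, P A -> P B -> P (fun x => A x \/ B x)) ->
  forall A, Def A -> P A.
Proof.
move=> ext P0 P1 P2 PU A /omin [s [t h]].
have hs : P (fun x => x \in t \/ has (fun ab => in_interval ab x) s) -> P A by apply: (ext) => x; rewrite h.
apply: hs.
apply: (PU).
  elim: t {h} => [|r t IH]; first by apply: (ext _ _ _ P0) => x; split.
  apply: (ext _ _ _ (PU _ _ (P1 r) IH)) => x; rewrite inE; split=> [[->|->]|/orP [/eqP ->|->]]; rewrite ?eqxx ?orbT //; [by left|by right].
elim: s {h} => [|r s IH]; first by apply: (ext _ _ _ P0) => x; split.
apply: (ext _ _ _ (PU _ _ (P2 r) IH)) => x /=; split=> [[->|->]|/orP [->|->]]; rewrite ?orbT //; [by left|by right].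
Qed.

Definition all_oo A a b := forall x, a < x -> x < b -> A x.

(** The source of all later dichotomies. It is clear for points and intervals, and it passes to
    unions by taking the smaller of the two radii. *)
Lemma germ_right A a : Def A ->
  exists2 e : R, 0 < e & all_oo A a (a + e) \/ all_oo (fun x => ~ A x) a (a + e).
Proof.
move: A; apply: omin_ind.
- by move=> A B h [e he hA]; exists e => //; case: hA => hA; [left|right] => x h1 h2; rewrite -?h; auto.
- by exists 1 => //; right => x _ _ [].
- move=> r; have [h|h] := ltP a r.
    by exists (r - a); [lra | right => x h1 h2 h3; lra].
  by exists 1 => //; right => x h1 h2 h3; lra.
- move=> [u v]; rewrite /in_interval /=.
  have [e he hu] : exists2 e : R, 0 < e &
     all_oo (fun x => is_true (if u is Some a then a < x else true)) a (a + e) \/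
     all_oo (fun x => ~ is_true (if u is Some a then a < x else true)) a (a + e).
    case: u => [u|]; last by exists 1 => //; left.
    have [h|h] := ltP a u; last by exists 1 => //; left => x h1 h2; lra.
    by exists (u - a); [lra | right => x h1 h2; apply/negP; rewrite -leNgt; lra].
  have [f hf hv] : exists2 e : R, 0 < e &
     all_oo (fun x => is_true (if v is Some a then x < a else true)) a (a + e) \/
     all_oo (fun x => ~ is_true (if v is Some a then x < a else true)) a (a + e).
    case: v => [v|]; last by exists 1 => //; left.
    have [h|h] := ltP a v; last by exists 1 => //; right => x h1 h2; apply/negP; rewrite -leNgt; lra.
    by exists (v - a); [lra | left => x h1 h2; lra].
  exists (Num.min e f); first by rewrite lt_min he.
  have sub x : x < a + Num.min e f -> x < a + e /\ x < a + f.
    by move=> h; split; apply: lt_le_trans h _; rewrite lerD2l ge_min lexx ?orbT.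
  case: hu => hu; last by right => x h1 /sub [h2 h3] /andP [h4 _]; apply: (hu x h1 h2 h4).
  case: hv => hv; last by right => x h1 /sub [h2 h3] /andP [_ h4]; apply: (hv x h1 h3 h4).
  by left => x h1 /sub [h2 h3]; rewrite (hu x) // (hv x).
- move=> A B [e he hA] [f hf hB].
  exists (Num.min e f); first by rewrite lt_min he.
  have sub x : x < a + Num.min e f -> x < a + e /\ x < a + f.
    by move=> h; split; apply: lt_le_trans h _; rewrite lerD2l ge_min lexx ?orbT.
  case: hA => hA; first by left => x h1 /sub [h2 h3]; left; apply: hA.
  case: hB => hB; first by left => x h1 /sub [h2 h3]; right; apply: hB.
  by right => x h1 /sub [h2 h3] []; [apply: hA | apply: hB].
Qed.

Lemma interval_dichotomy A a b : Def A -> a < b -> exists a' b',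
  [/\ a <= a', a' < b', b' <= b & all_oo A a' b' \/ all_oo (fun x => ~ A x) a' b'].
Proof.
move=> hA hab; have [e he h] := germ_right a hA.
exists a, (Num.min b (a + e)); split=> //; rewrite ?lt_min ?hab ?ge_min ?lexx //=; first lra.
by case: h => h; [left|right] => x h1; rewrite lt_min => /andP [h2 h3]; apply: h.
Qed.

(** [R] need not be complete, but its definable subsets have suprema. The statement is not stable
    under unions as it stands, so the induction runs on a trichotomy that is: empty, unbounded
    above, or having a supremum. *)
Lemma def_lub A : Def A -> (exists x, A x) -> (exists M, forall x, A x -> x <= M) ->
  exists s, (forall x, A x -> x <= s) /\ (forall y, y < s -> exists2 x, A x & y < x).
Proof.
move=> hA; suff : [\/ forall x, ~ A x, forall M, exists2 x, A x & M < x |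
  exists s, (forall x, A x -> x <= s) /\ (forall y, y < s -> exists2 x, A x & y < x)].
  case=> [h [x /h] //|h _ [M hM]|//].
  by have [x /hM h1 h2] := h M; move: (lt_le_trans h2 h1); rewrite ltxx.
move: A hA; apply: omin_ind.
- move=> A B h [h1|h1|[s [h1 h2]]]; [constructor 1|constructor 2|constructor 3].
  + by move=> x /h; apply: h1.
  + by move=> M; have [x /h] := h1 M; exists x.
  + by exists s; split=> [x /h /h1 //|y /h2 [x /h]]; exists x.
- by constructor 1 => x [].
- by move=> r; constructor 3; exists r; split=> [x -> //|y h]; exists r.
- move=> [u [v|]]; rewrite /in_interval /=; last first.
    constructor 2 => M; case: u => [u|]; last by exists (M + 1) => //; lra.
    exists (Num.max u M + 1); rewrite ?andbT.
      by have := maxL u M; lra.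
    by have := maxR u M; lra.
  have [hv|hv] := EM (forall y, y < v -> exists2 x, (if u is Some a then a < x else true) && (x < v) & y < x).
    by constructor 3; exists v; split=> // x /andP [_ /ltW].
  constructor 1 => x /andP [h1 h2]; apply: hv => y hy.
  have h3 : Num.max x y < v by rewrite gt_max h2.
  have h4 : x <= Num.max x y by rewrite le_max lexx.
  have h5 : y <= Num.max x y by rewrite le_max lexx orbT.
  exists ((Num.max x y + v) / 2); last lra.
  by apply/andP; split; last lra; case: u h1 => [u|] // h1; lra.
- move=> A B [a1|a1|[s [a1 a2]]].
  + by case=> [b1|b1|[s [b1 b2]]]; [constructor 1|constructor 2|constructor 3];
     [move=> x [/a1|/b1] | move=> M; have [x] := b1 M; exists x => //; right |
      exists s; split=> [x [/a1|/b1] //|y /b2 [x]]; exists x => //; right].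
  + by move=> _; constructor 2 => M; have [x] := a1 M; exists x => //; left.
  case=> [b1|b1|[t [b1 b2]]].
  + by constructor 3; exists s; split=> [x [/a1 //|/b1 //]|y /a2 [x]]; exists x => //; left.
  + by constructor 2 => M; have [x] := b1 M; exists x => //; right.
  constructor 3; exists (Num.max s t); split=> [x [/a1|/b1] h|y].
  + by rewrite le_max h.
  + by rewrite le_max h orbT.
  by rewrite lt_max => /orP [/a2|/b2] [x ? ?]; exists x => //; [by left|by right].
Qed.

(** Being the supremum is a first-order condition with at most one solution, so it depends definably
    on the parameter. Where there is no supremum the value 0 is taken. *)
Lemma Dfun_lub X (dX : dtype R X) (Q : X -> R -> Prop) :
  Def (fun p : X * R => Q p.1 p.2) ->
  exists2 s : X -> R, Dfun s & forall x, (exists r, Q x r) -> (exists M, forall r, Q x r -> r <= M) ->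
    (forall r, Q x r -> r <= s x) /\ (forall y, y < s x -> exists2 r, Q x r & y < r).
Proof.
move=> hQ.
pose L x s := (forall r, Q x r -> r <= s) /\ (forall y, y < s -> exists2 r, Q x r & y < r).
have hL : Def (fun p : X * R => L p.1 p.2) by rewrite /L; definable.
have uL x s s' : L x s -> L x s' -> s = s'.
  wlog : s s' / s <= s' => [h h1 h2|hs [h1 _] [_ h2]].
    by have [/h|/ltW /h] := leP s s'; [apply | move=> h3; symmetry; apply: h3].
  apply/eqP; rewrite eq_le hs leNgt; apply/negP => /h2 [r /h1 h3 h4].
  by move: (lt_le_trans h4 h3); rewrite ltxx.
have [|||f hf h] := @Dfun_choice R S X dX (fun x s => L x s \/ (~ (exists s', L x s') /\ s = 0)).
- by definable.
- by move=> x; have [[s hs]|hs] := EM (exists s', L x s'); [exists s; left | exists 0; right].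
- move=> x r r' [h1|[h1 ->]] [h2|[h2 ->]] //; first exact: uL h1 h2.
    by case: h2; exists r.
  by case: h1; exists r'.
- exists f => // x h1 h2; case: (h x) => // -[h3 _]; case: h3.
  have hQx : Def (Q x) by definable.
  by have [s hs] := def_lub hQx h1 h2; exists s.
Qed.

(** The standard device for choosing radii definably: take half of the supremum of the admissible
    radii at most 1. Truncation makes the supremum exist, halving makes the value itself admissible
    by monotonicity and explains the factor 2. The value is positive exactly where some radius is
    admissible. *)
Lemma Dfun_radius X (dX : dtype R X) (Q : X -> R -> Prop) :
  Def (fun p : X * R => Q p.1 p.2) ->
  (forall x (r r' : R), Q x r -> 0 < r' -> r' <= r -> Q x r') ->
  exists2 d : X -> R, Dfun d & forall x,
    [/\ 0 <= d x, d x <= 1, 0 < d x -> Q x (d x) &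
        forall r : R, 0 < r -> r <= 1 -> Q x r -> r <= 2 * d x].
Proof.
move=> hQ mQ; pose Q' x r := r = 0 \/ (0 < r /\ r <= 1 /\ Q x r).
have hQ' : Def (fun p : X * R => Q' p.1 p.2) by rewrite /Q'; definable.
have [s hs h] := Dfun_lub hQ'; exists (fun x => s x / 2); first by definable.
move=> x; have [||h1 h2] := h x; first by exists 0; left.
  by exists 1 => r [->|[_ []]]; lra.
have h0 : 0 <= s x by apply: h1; left.
split; first lra.
- rewrite leNgt; apply/negP => h3; have [|r hr h5] := h2 1; first lra.
  by case: hr => [hr|[_ [hr _]]]; lra.
- move=> h3; have [|r hr h7] := h2 (s x / 2); first lra.
  by case: hr => [hr|[h4 [h5 h6]]]; [lra | apply: mQ h6 _ _; lra].
- by move=> r r0 r1 hr; have : r <= s x; [apply: h1; right | lra].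
Qed.

Lemma def_glb A : Def A -> (exists x, A x) -> (exists M, forall x, A x -> M <= x) ->
  exists s, (forall x, A x -> s <= x) /\ (forall y, s < y -> exists2 x, A x & x < y).
Proof.
move=> hA [x0 hx0] [M hM]; have hN : Def (fun x => A (- x)) by definable.
have [||s [h1 h2]] := def_lub hN; first by exists (- x0); rewrite opprK.
  by exists (- M) => x /hM; lra.
exists (- s); split=> [x hx|y hy]; first by have := h1 (- x); rewrite opprK => /(_ hx); lra.
by have [|x hx h] := h2 (- y); first lra; exists (- x) => //; lra.
Qed.

Lemma no_interval_finite A : Def A -> (forall a b, a < b -> ~ all_oo A a b) ->
  exists t : seq R, forall x, A x -> x \in t.
Proof.
move=> /omin [s [t h]] hA; exists t => x /h [//|/hasP [[u v] huv]].
rewrite /in_interval /= => /andP [h1 h2]; exfalso.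
pose y := if v is Some v then v else x + 1.
have hy : x < y by rewrite /y; case: (v) h2 => // _; lra.
apply: (hA x y hy) => z hz1 hz2; apply/h; right; apply/hasP; exists (u, v) => //.
rewrite /in_interval /=; apply/andP; split.
  by case: (u) h1 => // w; lra.
by move: hz2; rewrite /y; case: (v).
Qed.

(** Replaces connectedness and completeness of a closed interval. The supremum of the points up to
    which [A] holds exists because [A] is definable; the two closure conditions forbid it to be
    smaller than [b]. *)
Lemma real_induction A a b : Def A -> a <= b -> A a ->
  (forall x, a <= x -> x < b -> (forall y, a <= y -> y <= x -> A y) ->
     exists2 e : R, 0 < e & all_oo A x (x + e)) ->
  (forall x, a < x -> x <= b -> (forall y, a <= y -> y < x -> A y) -> A x) ->
  forall x, a <= x -> x <= b -> A x.
Proof.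
move=> hA hab Aa hr hl.
pose B x := a <= x /\ x <= b /\ forall y, a <= y -> y <= x -> A y.
have hB : Def B by rewrite /B; definable.
have Ba : B a by split=> //; split=> // y h1 h2; have -> : y = a by apply/eqP; rewrite eq_le h1 h2.
have [||s [h1 h2]] := def_lub hB; [by exists a|by exists b => x [_ []]|].
have as_ : a <= s by apply: h1.
have below y : a <= y -> y < s -> A y by move=> hy /h2 [x [_ [_ hx]] /ltW]; apply: hx.
have sb : s <= b by rewrite leNgt; apply/negP => /h2 [x [_ [h3 _]] h4]; lra.
have As : A s.
  by move: as_; rewrite le_eqVlt => /orP [/eqP <- //|h]; apply: hl => // y h3; apply: below.
have [hsb|hsb] := ltP s b; last first.
  move=> x hx hxb; have [|hxs] := ltP x s; first exact: below.
  by have -> : x = s by lra.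
have [|e he hse] := hr s as_ hsb.
  by move=> y hy; rewrite le_eqVlt => /orP [/eqP -> //|]; apply: below.
exfalso; pose z := Num.min b (s + e / 2).
have hz1 : z <= b by rewrite ge_min lexx.
have hz2 : z <= s + e / 2 by rewrite ge_min lexx orbT.
have hz3 : s < z by rewrite lt_min hsb /=; lra.
suff /h1 : B z by lra.
split; first lra; split=> // y hy1 hy2.
have [|hys] := ltP y s; first exact: below.
have [-> //|hne] := eqVneq y s.
by apply: hse; [rewrite lt_neqAle eq_sym hne | lra].
Qed.

Lemma seq_minimal (t : seq R) (P : R -> Prop) : (exists2 x, x \in t & P x) ->
  exists x, [/\ x \in t, P x & forall y, y \in t -> P y -> x <= y].
Proof.
elim: t => [[x] //|r t IH] hex.
have [h|h] := EM (exists2 x, x \in t & P x).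
  have [x [h1 h2 h3]] := IH h.
  have [[hr hrx]|hr] := EM (P r /\ r < x).
    exists r; rewrite inE eqxx; split=> // y; rewrite inE => /orP [/eqP -> //|hy] /(h3 _ hy); lra.
  exists x; rewrite inE h1 orbT; split=> // y; rewrite inE => /orP [/eqP -> hy|]; last exact: h3.
  by rewrite leNgt; apply/negP => ?; apply: hr.
case: hex => x; rewrite inE => /orP [/eqP -> hr|hx hPx]; last by case: h; exists x.
exists r; rewrite inE eqxx; split=> // y; rewrite inE => /orP [/eqP -> //|hy hPy].
by case: h; exists y.
Qed.

Lemma finite_avoid (t : seq R) a b : a < b -> exists2 x, a < x < b & x \notin t.
Proof.
elim: t a b => [|r t IH] a b hab; first by exists ((a + b) / 2) => //; apply/andP; split; lra.
have [h|h] := leP r a.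
  have [x /andP [h1 h2] h3] := IH _ _ hab; exists x; first exact/andP.
  by rewrite inE negb_or h3 andbT; apply/eqP; lra.
have [h'|h'] := leP b r.
  have [x /andP [h1 h2] h3] := IH _ _ hab; exists x; first exact/andP.
  by rewrite inE negb_or h3 andbT; apply/eqP; lra.
have [x /andP [h1 h2] h3] := IH _ _ h; exists x; first by apply/andP; split; lra.
by rewrite inE negb_or h3 andbT; apply/eqP; lra.
Qed.

(* A record point of [d] is one where [d] exceeds all its earlier values: near [a] either all
   points are records, or there are none; both are impossible if the sets [d >= e] are finite. *)
Lemma uniform_on_interval (Q : R -> R -> Prop) a b : a < b ->
  Def (fun p : R * R => Q p.1 p.2) ->
  (forall x (r r' : R), Q x r -> 0 < r' -> r' <= r -> Q x r') ->
  (forall x, a < x -> x < b -> exists2 r : R, 0 < r & Q x r) ->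
  exists a' b', [/\ a <= a', a' < b', b' <= b &
    exists2 e : R, 0 < e & forall x, a' < x -> x < b' -> Q x e].
Proof.
move=> hab hQ mQ exQ; have [d hd hdP] := Dfun_radius hQ mQ.
have dpos x : a < x -> x < b -> 0 < d x.
  move=> h1 h2; have [r r0 hr] := exQ x h1 h2; have [_ _ _ h] := hdP x.
  have h3 := min_gt0 r0 (ltr01 : 0 < 1 :> R).
  by have := h _ h3 (minR _ _) (mQ _ _ _ hr h3 (minL _ _)); lra.
suff [e e0 [a' [b' [h1 h2 h3 h4]]]] : exists2 e : R, 0 < e & exists a' b',
    [/\ a <= a', a' < b', b' <= b & all_oo (fun x => e <= d x) a' b'].
  exists a', b'; split=> //; exists e => // x hx1 hx2.
  have hx := h4 x hx1 hx2; have [_ _ h5 _] := hdP x.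
  by apply: mQ (h5 _) _ _ => //; lra.
apply: contrapT => hno.
have fin e : 0 < e -> exists t : seq R, forall x, (a < x /\ x < b /\ e <= d x) -> x \in t.
  move=> e0; apply: (@no_interval_finite (fun x => a < x /\ x < b /\ e <= d x)); first by definable.
  move=> a' b' hab' h; apply: hno; exists e => //; exists a', b'; split=> //.
  - rewrite leNgt; apply/negP => h1.
    have [||h2 _] := h (Num.min ((a' + a) / 2) ((a' + b') / 2)); first by rewrite lt_min; apply/andP; split; lra.
      by have := minR ((a' + a) / 2) ((a' + b') / 2); lra.
    by have := minL ((a' + a) / 2) ((a' + b') / 2); lra.
  - rewrite leNgt; apply/negP => h1.
    have [||_ [h2 _]] := h (Num.max ((b' + b) / 2) ((a' + b') / 2)).
    + by have := maxR ((b' + b) / 2) ((a' + b') / 2); lra.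
    + by rewrite gt_max; apply/andP; split; lra.
    by have := maxL ((b' + b) / 2) ((a' + b') / 2); lra.
  by move=> x h1 h2; have [_ []] := h x h1 h2.
pose Y x := forall y, a < y -> y < x -> d y < d x.
have hY : Def Y by rewrite /Y; definable.
have [e e0] := germ_right a hY.
pose c := Num.min (a + e) b.
have hc1 : c <= a + e by exact: minL.
have hc2 : c <= b by exact: minR.
have hc3 : a < c by rewrite lt_min hab andbT; lra.
case=> h.
  have [|t ht] := fin (d ((a + c) / 2)); first by apply: dpos; lra.
  have [|x /andP [h1 h2] /negP] := @finite_avoid t ((a + c) / 2) c; first lra.
  apply; apply: ht; split; first lra; split; first lra.
  by apply/ltW/h; lra.
pose x1 := (a + c) / 2.
have hx1 : a < x1 /\ x1 < c by rewrite /x1; lra.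
have [|t ht] := fin (d x1); first by apply: dpos; lra.
have [|y [h1 [h2 [h3 h4]] h5]] := @seq_minimal t (fun y => a < y /\ y <= x1 /\ d x1 <= d y).
  by exists x1; [apply: ht; split; [lra|split; lra] | split; [lra|split; lra]].
apply: (h y); try lra.
move=> z hz1 hz2; rewrite ltNge; apply/negP => hz3.
have : y <= z; last lra.
by apply: h5; [apply: ht; split; [lra|split; lra] | split; [lra|split; lra]].
Qed.

Definition ccont (f : R -> R) x := forall e : R, 0 < e ->
  exists2 d : R, 0 < d & forall y, `|y - x| < d -> `|f y - f x| < e.

Lemma right_type (f : R -> R) x : Dfun f ->
  exists2 e : R, 0 < e & [\/ all_oo (fun y => f y < f x) x (x + e),
     all_oo (fun y => f y = f x) x (x + e) | all_oo (fun y => f x < f y) x (x + e)].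
Proof.
move=> hf; have h1 : Def (fun y => f y < f x) by definable.
have h2 : Def (fun y => f x < f y) by definable.
have [e e0 he] := germ_right x h1; have [d d0 hd] := germ_right x h2.
exists (Num.min e d); first exact: min_gt0.
have sub y : y < x + Num.min e d -> y < x + e /\ y < x + d.
  by have := minL e d; have := minR e d; split; lra.
case: he => he; first by constructor 1 => y h3 /sub [h4 h5]; apply: he.
case: hd => hd; first by constructor 3 => y h3 /sub [h4 h5]; apply: hd.
constructor 2 => y h3 /sub [h4 h5]; apply/eqP; rewrite eq_le !leNgt.
by apply/andP; split; apply/negP; [apply: hd | apply: he].
Qed.

(** To the right of every point [f] is eventually smaller, equal or larger. By the germ dichotomy
    one of the three relations occurs at every point of a subinterval, and a uniform radius for it
    makes the relation hold for all pairs of points of a still smaller interval. *)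
Lemma piecewise_monotone (f : R -> R) a b : Dfun f -> a < b -> exists a' b',
  [/\ a <= a', a' < b', b' <= b &
   [\/ forall x y, a' < x -> x < y -> y < b' -> f y < f x,
       forall x y, a' < x -> x < y -> y < b' -> f y = f x |
       forall x y, a' < x -> x < y -> y < b' -> f x < f y]].
Proof.
move=> hf hab.
have key (C : R -> R -> Prop) a1 b1 : Def (fun p : R * R => C p.1 p.2) -> a <= a1 -> a1 < b1 -> b1 <= b ->
  all_oo (fun x => exists2 e : R, 0 < e & all_oo (fun y => C (f y) (f x)) x (x + e)) a1 b1 ->
  exists a' b', [/\ a <= a', a' < b', b' <= b & forall x y, a' < x -> x < y -> y < b' -> C (f y) (f x)].
  move=> hC h1 h2 h3 h4.
  have [|||a' [b' [h5 h6 h7 [e e0 he]]]] := @uniform_on_interval (fun x e => all_oo (fun y => C (f y) (f x)) x (x + e)) a1 b1 h2.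
  - by rewrite /all_oo; definable.
  - by move=> x r r' h r0 hr y hy1 hy2; apply: h; lra.
  - exact: h4.
  exists a', (Num.min b' (a' + e)).
  have := minL b' (a' + e); have := minR b' (a' + e) => m1 m2.
  split; [lra| by rewrite lt_min h6; lra | lra |].
  by move=> x y hx hxy hy; apply: (he x); lra.
have dC (C : R -> R -> Prop) : Def (fun p : R * R => C p.1 p.2) ->
    Def (fun x => exists2 e : R, 0 < e & all_oo (fun y => C (f y) (f x)) x (x + e)).
  by move=> hC; rewrite /all_oo; definable.
have hlt : Def (fun p : R * R => p.1 < p.2) by definable.
have heq : Def (fun p : R * R => p.1 = p.2) by definable.
have hgt : Def (fun p : R * R => p.2 < p.1) by definable.
have [a1 [b1 [h1 h2 h3]]] := interval_dichotomy (dC (fun x y => x < y) hlt) hab; case=> [h|hnlt].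
  by have [a' [b' [? ? ? h']]] := key (fun x y => x < y) _ _ hlt h1 h2 h3 h; exists a', b'; split=> //; constructor 1.
have [a2 [b2 [k1 k2 k3]]] := interval_dichotomy (dC (fun x y => x = y) heq) h2; case=> [h|hneq].
  have [||a' [b' [? ? ? h']]] := key (fun x y => x = y) a2 b2 heq _ k2 _ h; try lra.
  by exists a', b'; split=> //; constructor 2.
have [||||a' [b' [? ? ? h']]] := key (fun x y => y < x) a2 b2 hgt; try lra; last by exists a', b'; split=> //; constructor 3.
move=> x hx1 hx2; have [e e0 [h|h|h]] := right_type x hf; last by exists e.
- by exfalso; apply: (hnlt x); try lra; exists e.
- by exfalso; apply: (hneq x); try lra; exists e.
Qed.

(** The image of an injective function on an interval is infinite, hence contains an interval by
    o-minimality; where the image fills an interval a monotone function cannot jump. *)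
Lemma increasing_somewhere_cont (f : R -> R) a b : Dfun f -> a < b ->
  (forall x y, a < x -> x < y -> y < b -> f x < f y) ->
  exists a' b', [/\ a <= a', a' < b', b' <= b & all_oo (ccont f) a' b'].
Proof.
move=> hf hab hinc.
pose Y y := exists x, a < x /\ x < b /\ f x = y.
have hY : Def Y by rewrite /Y; definable.
have [[c [d [hcd hYcd]]]|hno] := EM (exists c d, c < d /\ all_oo Y c d); last first.
  have [|t ht] := @no_interval_finite Y hY.
    by move=> c d hcd h; apply: hno; exists c, d.
  have inj x y : a < x -> x < b -> a < y -> y < b -> f x = f y -> x = y.
    move=> h1 h2 h3 h4 h5; have [h|h|//] := ltgtP x y.
      by have := hinc x y h1 h h4; rewrite h5 ltxx.
    by have := hinc y x h3 h h2; rewrite h5 ltxx.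
  (* [g] inverts [f] on the image. If the image were contained in the finite list [t], every point
     of the interval would lie in [map g t]. *)
  pose g y := if pselect (Y y) is left h then projT1 (cid h) else 0.
  have [x /andP [h1 h2] /negP []] := @finite_avoid (map g t) a b hab.
  have hYx : Y (f x) by exists x.
  apply/mapP; exists (f x); first exact: ht.
  rewrite /g; case: pselect => // h; case: cid => z [/= h3 [h4 h5]].
  by apply: inj.
pose y1 := (2 * c + d) / 3; pose y2 := (c + 2 * d) / 3.
have hy : c < y1 /\ y1 < y2 /\ y2 < d by rewrite /y1 /y2; split; [|split]; lra.
case: hy => hy1 [hy2 hy3].
have [||x1 [h11 [h12 h13]]] := hYcd y1; try lra.
have [||x2 [h21 [h22 h23]]] := hYcd y2; try lra.
have mono x y : a < x -> x < b -> a < y -> y < b -> f x < f y -> x < y.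
  move=> k1 k2 k3 k4 k5; rewrite ltNge; apply/negP; rewrite le_eqVlt => /orP [/eqP k|k].
    by rewrite k ltxx in k5.
  by have := hinc y x k3 k k2; lra.
have h12' : x1 < x2 by apply: mono => //; lra.
exists x1, x2; split=> //; try lra.
move=> x hx1 hx2 e e0.
have f1 : f x1 < f x by apply: hinc; lra.
have f2 : f x < f x2 by apply: hinc; lra.
pose u := (Num.max (f x - e) (f x1) + f x) / 2.
pose v := (Num.min (f x + e) (f x2) + f x) / 2.
have hu : f x - e < u /\ f x1 < u /\ u < f x.
  have m1 := maxL (f x - e) (f x1); have m2 := maxR (f x - e) (f x1).
  have m3 : Num.max (f x - e) (f x1) < f x by rewrite gt_max f1 andbT; lra.
  by rewrite /u; split; [|split]; lra.
have hv : v < f x + e /\ v < f x2 /\ f x < v.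
  have m1 := minL (f x + e) (f x2); have m2 := minR (f x + e) (f x2).
  have m3 : f x < Num.min (f x + e) (f x2) by rewrite lt_min f2 andbT; lra.
  by rewrite /v; split; [|split]; lra.
have [||p [p1 [p2 p3]]] := hYcd u; try by clear -hu hv hy1 hy2 hy3 h13 h23; lra.
have [||q [q1 [q2 q3]]] := hYcd v; try by clear -hu hv hy1 hy2 hy3 h13 h23; lra.
have px : p < x by apply: mono; clear -hu p1 p2 p3 hx1 hx2 h11 h22; lra.
have xq : x < q by apply: mono; clear -hv q1 q2 q3 hx1 hx2 h11 h22; lra.
exists (Num.min (x - p) (q - x)); first by apply: min_gt0; lra.
move=> y hy; have m1 := minL (x - p) (q - x); have m2 := minR (x - p) (q - x).
move: hy; rewrite ltr_norml => /andP [n1 n2].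
have k1 : f p < f y by apply: hinc; clear -p1 q2 m1 m2 n1 n2; lra.
have k2 : f y < f q by apply: hinc; clear -p1 q2 m1 m2 n1 n2; lra.
by clear -hu hv p3 q3 k1 k2; rewrite ltr_norml; apply/andP; split; lra.
Qed.

Lemma ccont_opp f x : ccont f x -> ccont (fun y => - f y) x.
Proof. by move=> h e /h [d d0 hd]; exists d => // y /hd; rewrite -opprD normrN. Qed.

Lemma monotone_cont_somewhere (f : R -> R) a b : Dfun f -> a < b -> exists a' b',
  [/\ a <= a', a' < b', b' <= b, all_oo (ccont f) a' b' &
   (forall x y, a' < x -> x <= y -> y < b' -> f x <= f y) \/
   (forall x y, a' < x -> x <= y -> y < b' -> f y <= f x)].
Proof.
move=> hf hab; have [a1 [b1 [h1 h2 h3 h4]]] := piecewise_monotone hf hab.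
case: h4 => h4.
- have hN : Dfun (fun x => - f x) by definable.
  have [|a' [b' [k1 k2 k3 k4]]] := increasing_somewhere_cont hN h2.
    by move=> x y ? ? ?; rewrite ltrN2; apply: h4.
  exists a', b'; split=> //; try lra.
    move=> x hx1 hx2; have := ccont_opp (k4 x hx1 hx2).
    by rewrite (_ : (fun y => - - f y) = f) //; apply: funext => y; rewrite opprK.
  right=> x y hx; rewrite le_eqVlt => /orP [/eqP -> //|hxy] hy.
  by apply/ltW/h4; lra.
- exists a1, b1; split=> //.
    move=> x hx1 hx2 e e0; exists (Num.min (x - a1) (b1 - x)); first by apply: min_gt0; lra.
    move=> y; have m1 := minL (x - a1) (b1 - x); have m2 := minR (x - a1) (b1 - x).
    rewrite ltr_norml => /andP [n1 n2].
    suff -> : f y = f x by rewrite subrr normr0.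
    have [h|h|-> //] := ltgtP x y; first by apply: h4; lra.
    by symmetry; apply: h4; lra.
  left=> x y hx; rewrite le_eqVlt => /orP [/eqP -> //|hxy] hy.
  by rewrite (h4 x y) //; lra.
have [a' [b' [k1 k2 k3 k4]]] := increasing_somewhere_cont hf h2 h4.
exists a', b'; split=> //; try lra.
left=> x y hx; rewrite le_eqVlt => /orP [/eqP -> //|hxy] hy.
by apply/ltW/h4; lra.
Qed.

End OneVar.

(** * Generic behaviour of definable sets and functions *)

Section Cons.
Variable R : rcfType.

Definition consr n (t : R) (x : 'rV[R]_n) : 'rV[R]_n.+1 :=
  \row_i (if unlift ord0 i is Some j then x 0 j else t).
Definition tlr n (v : 'rV[R]_n.+1) : 'rV[R]_n := \row_i v 0 (lift ord0 i).

Lemma consr0 n t (x : 'rV[R]_n) i : consr t x i ord0 = t.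
Proof. by rewrite mxE unlift_none. Qed.
Lemma consrS n t (x : 'rV[R]_n) i j : consr t x i (lift ord0 j) = x 0 j.
Proof. by rewrite mxE liftK. Qed.
Lemma tlr_cons n t (x : 'rV[R]_n) : tlr (consr t x) = x.
Proof. by apply/rowP => i; rewrite mxE consrS. Qed.
Lemma consr_eta n (v : 'rV[R]_n.+1) : consr (v 0 ord0) (tlr v) = v.
Proof.
apply/rowP => i; case: (unliftP ord0 i) => [j ->|->]; first by rewrite consrS mxE.
by rewrite consr0.
Qed.
Lemma consrB n t s (x y : 'rV[R]_n) : consr t x - consr s y = consr (t - s) (x - y).
Proof.
apply/rowP => i; rewrite !mxE.
by case: unlift => [j|] //; rewrite !mxE.
Qed.
Lemma mnorm_consr n t (x : 'rV[R]_n) : mnorm (consr t x) = Num.max `|t| (mnorm x).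
Proof.
rewrite /mnorm big_ord_recl consr0; congr (Num.max _ _).
by apply: eq_bigr => i _; rewrite consrS.
Qed.
Lemma mnorm_consrB n t s (x y : 'rV[R]_n) (r : R) :
  (mnorm (consr t x - consr s y) < r) = (`|t - s| < r) && (mnorm (x - y) < r).
Proof. by rewrite consrB mnorm_consr gt_max. Qed.

(** The refinement relation behind all generic statements: a property is generic when every ball has
    a subball on which it holds. *)
Definition subball n (a : 'rV[R]_n) (r : R) (a' : 'rV[R]_n) (r' : R) :=
  0 < r' /\ forall x, mnorm (x - a') < r' -> mnorm (x - a) < r.

Lemma subball_refl n (a : 'rV[R]_n) r : 0 < r -> subball a r a r.
Proof. by []. Qed.
Lemma subball_trans n (a b c : 'rV[R]_n) r s t :
  subball a r b s -> subball b s c t -> subball a r c t.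
Proof. by move=> [h1 h2] [h3 h4]; split=> // x /h4 /h2. Qed.
Lemma subball_shrink n (a : 'rV[R]_n) r s : 0 < s -> s <= r -> subball a r a s.
Proof. by move=> h1 h2; split=> // x h; apply: lt_le_trans h h2. Qed.
Lemma subball_inner n (a x : 'rV[R]_n) r : mnorm (x - a) < r -> subball a r x (r - mnorm (x - a)).
Proof.
by move=> h; split=> [|y hy]; [lra | have := mnormB_tri y x a; lra].
Qed.
Lemma ball_center n (a : 'rV[R]_n) (r : R) : 0 < r -> mnorm (a - a) < r.
Proof. by rewrite subrr mnorm0. Qed.
Lemma subball_center n (a : 'rV[R]_n) r a' r' : subball a r a' r' -> mnorm (a' - a) < r.
Proof. by move=> [h1 h2]; apply/h2/ball_center. Qed.

Definition cont n (f : 'rV[R]_n -> R) (x : 'rV[R]_n) := forall e : R, 0 < e ->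
  exists2 d : R, 0 < d & forall y, mnorm (y - x) < d -> `|f y - f x| < e.

(** Finitely many generic properties hold together: the ball is refined once for each of them. *)
Lemma refine_fin n k (P : 'I_k -> 'rV[R]_n -> Prop) :
  (forall i a r, 0 < r -> exists a' r', subball a r a' r' /\ forall x, mnorm (x - a') < r' -> P i x) ->
  forall a r, 0 < r -> exists a' r', subball a r a' r' /\ forall i x, mnorm (x - a') < r' -> P i x.
Proof.
elim: k P => [|k IH] P hP a r r0; first by exists a, r; split=> // -[].
have [a1 [r1 [h1 h2]]] := hP ord0 a r r0.
have [|a2 [r2 [h3 h4]]] := IH (fun i => P (lift ord0 i)) _ a1 r1 h1.1; first by move=> i; apply: hP.
exists a2, r2; split; first exact: subball_trans h1 h3.
move=> i x hx; case: (unliftP ord0 i) => [j ->|->]; first exact: h4.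
by apply: h2; apply: h3.2.
Qed.

Lemma finite_min k (g : 'I_k -> R) : (forall i, 0 < g i) -> exists2 d : R, 0 < d & forall i, d <= g i.
Proof.
elim: k g => [|k IH] g hg; first by exists 1 => // -[].
have [d d0 hd] := IH (fun i => g (lift ord0 i)) (fun i => hg _).
exists (Num.min d (g ord0)); first exact: min_gt0.
move=> i; case: (unliftP ord0 i) => [j ->|->]; last exact: minR.
exact: le_trans (minL _ _) (hd j).
Qed.

End Cons.

Section Generic.
Variables (R : rcfType) (S : ominimal_expansion R).
Local Notation Def := (Def S).
Local Notation Dfun := (Dfun S).

Lemma Dfun_consr X (dX : dtype R X) n (f : X -> R) (g : X -> 'rV[R]_n) :
  Dfun f -> Dfun g -> Dfun (fun x => consr (f x) (g x)).
Proof.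
move=> hf hg; apply: Dfun_row => i.
case: (unliftP ord0 i) => [j ->|->].
  have -> : (fun x => consr (f x) (g x) 0 (lift ord0 j)) = (fun x => g x 0 j) by apply: funext => x; rewrite consrS.
  exact: Dfun_coord.
by have -> : (fun x => consr (f x) (g x) 0 ord0) = f by apply: funext => x; rewrite consr0.
Qed.

(** A definable Heine-Borel theorem in the form of a Lebesgue number. The set of endpoints up to
    which some uniform radius works is definable, so [real_induction] applies although bounded
    closed intervals need not be compact. *)
Lemma interval_compact (C : R -> R -> Prop) (a b : R) :
  Def (fun p : R * R => C p.1 p.2) ->
  (forall y (d d' : R), C y d -> 0 < d' -> d' <= d -> C y d') ->
  (forall y, a <= y -> y <= b -> exists2 d : R, 0 < d & forall y', `|y' - y| < d -> C y' d) ->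
  exists2 d : R, 0 < d & forall y, a <= y -> y <= b -> C y d.
Proof.
move=> hC mC loc; have [hab|hab] := leP a b; last by exists 1 => // y h1 h2; lra.
pose P t := exists2 d : R, 0 < d & forall y, a <= y -> y <= t -> C y d.
have hP : Def P by rewrite /P; definable.
have step y (d d1 : R) t : 0 < d1 -> 0 < d -> a <= y -> (forall y', `|y' - y| < d -> C y' d) ->
   y - d < t -> (forall z, a <= z -> z <= t -> C z d1) ->
   forall u, u < y + d -> P u.
  move=> d10 d0 hy h1 h2 h3 u hu; exists (Num.min d d1); first exact: min_gt0.
  move=> z hz1 hz2; have [hzt|hzt] := leP z t.
    by apply: mC (h3 z hz1 hzt) _ _; [exact: min_gt0 | exact: minR].
  apply: mC (h1 z _) _ _; [|exact: min_gt0|exact: minL].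
  by rewrite ltr_norml; apply/andP; split; lra.
suff /(_ b) [//|//|d d0 h] : forall t, a <= t -> t <= b -> P t by exists d.
have [d d0 hd] := loc a (lexx a) hab.
apply: (real_induction hP) => //.
- exists d => // y h1 h2; apply: hd; have -> : y = a by lra.
  by rewrite subrr normr0.
- move=> x hx1 hx2 /(_ x hx1 (lexx x)) [d1 d10 h1].
  have [d2 d20 h2] := loc x hx1 (ltW hx2).
  exists d2 => // t ht1 ht2; apply: (step x d2 d1 x) => //; lra.
- move=> x hx1 hx2 hx3; have [d2 d20 h2] := loc x (ltW hx1) hx2.
  pose t := Num.max a (x - d2 / 2).
  have t1 : a <= t by exact: maxL.
  have t2 : x - d2 / 2 <= t by exact: maxR.
  have t3 : t < x by rewrite gt_max hx1 /=; lra.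
  have [d1 d10 h1] := hx3 t t1 t3.
  by apply: (step x d2 d1 t) => //; lra.
Qed.

(** Induction on the dimension in the manner of the tube lemma: compactness of the slice over [t]
    gives a radius that also serves all nearby slices, and [interval_compact] makes it uniform in
    [t]. *)
Lemma cube_compact n (C : 'rV[R]_n -> R -> Prop) (M : R) :
  Def (fun p : 'rV[R]_n * R => C p.1 p.2) ->
  (forall y (d d' : R), C y d -> 0 < d' -> d' <= d -> C y d') ->
  (forall y, mnorm y <= M -> exists2 d : R, 0 < d & forall y', mnorm (y' - y) < d -> C y' d) ->
  exists2 d : R, 0 < d & forall y, mnorm y <= M -> C y d.
Proof.
elim: n C => [|n IH] C hC mC loc.
  have [hM|hM] := leP 0 M; last by exists 1 => // y; have := mnorm_ge0 y; lra.
  have [|d d0 hd] := loc 0; first by rewrite mnorm0.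
  by exists d => // y _; apply: hd; rewrite [y]thinmx0 subrr mnorm0.
have [hM|hM] := leP 0 M; last by exists 1 => // y; have := mnorm_ge0 y; lra.
have hcons := @Dfun_consr.
pose C' t d := forall x, mnorm x <= M -> C (consr t x) d.
have [|||d d0 hd] := @interval_compact C' (- M) M.
- rewrite /C'; apply: Def_all; apply: Def_imp; first by definable.
  by apply: (Def_comp2 hC); [apply: Dfun_consr|]; definable.
- by move=> y d d' h d0 hd x hx; apply: mC (h x hx) _ _.
- move=> t ht1 ht2.
  have [|||d d0 hd] := IH (fun x d => forall t', `|t' - t| < d -> C (consr t' x) d).
  + apply: Def_all; apply: Def_imp; first by definable.
    by apply: (Def_comp2 hC); [apply: Dfun_consr|]; definable.
  + by move=> x d d' h d0 hd t' ht'; apply: mC (h t' _) _ _ => //; lra.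
  + move=> x hx; have [|d d0 hd] := loc (consr t x).
      by rewrite mnorm_consr ge_max hx andbT ler_norml; lra.
    by exists d => // x' hx' t' ht'; apply: hd; rewrite mnorm_consrB ht'.
  by exists d => // t' ht' x hx; apply: hd.
exists d => // y hy; rewrite -(consr_eta y); apply: hd.
- by have := le_trans (mnorm_coord y ord0) hy; rewrite ler_norml => /andP [].
- by have := le_trans (mnorm_coord y ord0) hy; rewrite ler_norml => /andP [].
by move: hy; rewrite -{1}(consr_eta y) mnorm_consr ge_max => /andP [].
Qed.

Lemma closed_compact n (K : 'rV[R]_n -> Prop) (C : 'rV[R]_n -> R -> Prop) (M : R) :
  Def K -> Def (fun p : 'rV[R]_n * R => C p.1 p.2) ->
  (forall x, K x -> mnorm x <= M) -> open_set (fun x => ~ K x) ->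
  (forall y (d d' : R), C y d -> 0 < d' -> d' <= d -> C y d') ->
  (forall y, K y -> exists2 d : R, 0 < d & forall y', mnorm (y' - y) < d -> K y' -> C y' d) ->
  exists2 d : R, 0 < d & forall y, K y -> C y d.
Proof.
move=> hK hC bK oK mC loc.
have [|||d d0 hd] := @cube_compact n (fun x d => K x -> C x d) M.
- by definable.
- by move=> y d d' h d0 hd hy; apply: mC (h hy) _ _.
- move=> y _; have [hy|hy] := EM (K y).
    by have [d d0 hd] := loc y hy; exists d.
  by have [d d0 hd] := oK y hy; exists d => // y' /hd.
by exists d => // y hy; apply: hd => //; apply: bK.
Qed.

(** This predicate and the next two are proved by a simultaneous induction on the dimension, which
    takes the place of cell decomposition: each step only needs information on some ball, never a
    partition of the whole space. *)
Definition dichotomy_dim n := forall (A : 'rV[R]_n -> Prop) a (r : R), Def A -> 0 < r ->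
  exists a' r', subball a r a' r' /\
   ((forall x, mnorm (x - a') < r' -> A x) \/ (forall x, mnorm (x - a') < r' -> ~ A x)).
Definition continuity_dim n := forall (f : 'rV[R]_n -> R) a (r : R), Dfun f -> 0 < r ->
  exists a' r', subball a r a' r' /\ forall x, mnorm (x - a') < r' -> cont f x.
Definition branches_dim n := forall (A : 'rV[R]_n -> R -> Prop) a (r : R),
  Def (fun p : 'rV[R]_n * R => A p.1 p.2) -> 0 < r ->
  (forall x, mnorm (x - a) < r -> exists t : seq R, forall y, A x y -> y \in t) ->
  exists a' r', subball a r a' r' /\ exists k (F : 'I_k -> 'rV[R]_n -> R),
    (forall i, Dfun (F i)) /\
    forall x y, mnorm (x - a') < r' -> A x y -> exists i, F i x = y.

Lemma seq_dist (t : seq R) y : exists2 g : R, 0 < g & forall z, z \in t -> `|z - y| < g -> z = y.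
Proof.
elim: t => [|r t [g g0 hg]]; first by exists 1.
have [->|hr] := eqVneq r y.
  by exists g => // z; rewrite inE => /orP [/eqP //|]; apply: hg.
exists (Num.min g `|r - y|); first by apply: min_gt0 => //; rewrite normr_gt0 subr_eq0.
move=> z; rewrite inE lt_min => /orP [/eqP -> /andP [_]|hz /andP [h _]]; first by rewrite ltxx.
exact: hg.
Qed.

(** Definable connectedness of an interval. Real induction moves to the right; moving to the left is
    the same argument for the complement. *)
Lemma nonboundary_const (A : R -> Prop) (p q : R) : Def A ->
  (forall t, p < t -> t < q -> exists2 e : R, 0 < e &
     (forall s, `|s - t| < e -> A s) \/ (forall s, `|s - t| < e -> ~ A s)) ->
  forall s t, p < s -> s < q -> p < t -> t < q -> A s -> A t.
Proof.
move=> hA loc.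
have up (B : R -> Prop) : Def B -> (forall t, p < t -> t < q -> exists2 e : R, 0 < e &
     (forall s, `|s - t| < e -> B s) \/ (forall s, `|s - t| < e -> ~ B s)) ->
   forall s t, p < s -> s <= t -> t < q -> B s -> B t.
  move=> hB locB s t hs hst ht Bs.
  apply: (@real_induction R S B s t) => //.
  - move=> x hx1 hx2 /(_ x hx1 (lexx x)) Bx.
    have [||e e0 [h|h]] := locB x; try lra; last by case: (h x) => //; rewrite subrr normr0.
    by exists e => // y hy1 hy2; apply: h; rewrite ltr_norml; apply/andP; split; lra.
  - move=> x hx1 hx2 Bl.
    have [||e e0 [h|h]] := locB x; try lra; first by apply: h; rewrite subrr normr0.
    pose y := Num.max s (x - e / 2).
    have y1 : s <= y by exact: maxL.
    have y2 : x - e / 2 <= y by exact: maxR.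
    have y3 : y < x by rewrite gt_max hx1 /=; lra.
    by case: (h y); [rewrite ltr_norml; apply/andP; split; lra | apply: Bl].
move=> s t hs1 hs2 ht1 ht2 As; have [hst|hst] := leP s t; first exact: up As.
apply: contrapT => nAt; suff : ~ A s by [].
apply: (up (fun x => ~ A x)) nAt => //; [by definable | | lra].
move=> x hx1 hx2; have [e e0 h] := loc x hx1 hx2; exists e => //.
by case: h => h; [right => y hy nA; apply: nA; exact: h | left].
Qed.

End Generic.

(** * Simultaneous induction for dichotomy, generic continuity and finite branching *)

Section GenericInduction.
Variables (R : rcfType) (S : ominimal_expansion R).
Local Notation Def := (Def S).
Local Notation Dfun := (Dfun S).

(** The partial function with graph [A] is extended by 0, which keeps it definable since its domain
    is. *)
Lemma Dfun_partial X (dX : dtype R X) (A : X -> R -> Prop) :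
  Def (fun p : X * R => A p.1 p.2) ->
  (forall x r r', A x r -> A x r' -> r = r') ->
  exists2 f : X -> R, Dfun f & forall x r, A x r -> f x = r.
Proof.
move=> hA uA.
have [|||f hf h] := @Dfun_choice R S X dX (fun x r => A x r \/ (~ (exists r', A x r') /\ r = 0)).
- by definable.
- by move=> x; have [[r hr]|hr] := EM (exists r, A x r); [exists r; left | exists 0; right].
- move=> x r r' [h1|[h1 ->]] [h2|[h2 ->]] //; first exact: uA h1 h2.
    by case: h2; exists r.
  by case: h1; exists r'.
- exists f => // x r hr; case: (h x) => [h1|[h1 _]]; first exact: uA h1 hr.
  by case: h1; exists r.
Qed.

Lemma seq_uniform (T : eqType) (t : seq T) (P : T -> R -> Prop) :
  (forall y (r r' : R), P y r -> 0 < r' -> r' <= r -> P y r') ->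
  (forall y, y \in t -> exists2 g : R, 0 < g & P y g) ->
  exists2 g : R, 0 < g & forall y, y \in t -> P y g.
Proof.
move=> mP; elim: t => [|y t IH] h; first by exists 1.
have [|g g0 hg] := IH; first by move=> z hz; apply: h; rewrite inE hz orbT.
have [|d d0 hd] := h y; first by rewrite inE eqxx.
exists (Num.min g d); first exact: min_gt0.
move=> z; rewrite inE => /orP [/eqP ->|/hg hz]; apply: mP; [exact: hd | exact: min_gt0 | exact: minR | exact: hz | exact: min_gt0 | exact: minL].
Qed.

Lemma seq_bound (t : seq R) : exists M : R, forall y, y \in t -> `|y| <= M.
Proof.
elim: t => [|y t [M hM]]; first by exists 0.
exists (Num.max `|y| M) => z; rewrite inE => /orP [/eqP ->|/hM h]; first exact: maxL.
exact: le_trans h (maxR _ _).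
Qed.

(** The normal points known from the proof of uniform finiteness: near the point, [A] is either
    absent or contained in the graph of a function that is continuous at [x] and passes through the
    point. *)
Definition normal_pt n (A : 'rV[R]_n -> R -> Prop) x y := exists2 g : R, 0 < g &
  ((forall x' y', mnorm (x' - x) < g -> `|y' - y| < g -> ~ A x' y') \/
   (A x y /\
    (forall x' y' y'', mnorm (x' - x) < g -> `|y' - y| < g -> `|y'' - y| < g ->
       A x' y' -> A x' y'' -> y' = y'') /\
    (forall e : R, 0 < e -> exists2 d : R, 0 < d & forall x' y', mnorm (x' - x) < d ->
       `|y' - y| < g -> A x' y' -> `|y' - y| < e))).

(** A height [y'] next to but different from [y] sees no point of [A] in a small box, because the
    local branch through [y] stays closer to [y] than to [y']. *)
Lemma normal_pt_open n (A : 'rV[R]_n -> R -> Prop) x y : normal_pt A x y ->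
  exists2 e : R, 0 < e & forall y', `|y' - y| < e -> normal_pt A x y'.
Proof.
move=> [g g0 h]; exists (g / 2); first lra.
move=> y' hy'; have [->|hne] := eqVneq y' y; first by exists g.
have p0 : 0 < `|y' - y| by rewrite normr_gt0 subr_eq0.
case: h => [h|[h1 [h2 h3]]].
  exists (g / 2); first lra; left=> x1 y1 hx1 hy1; apply: h; first lra.
  by have := ler_distD y' y1 y; lra.
have [|d d0 hd] := h3 (`|y' - y| / 2); first lra.
have [m1 m2 m3] : [/\ 0 < Num.min d (`|y' - y| / 2), Num.min d (`|y' - y| / 2) <= d &
   Num.min d (`|y' - y| / 2) <= `|y' - y| / 2].
  by split; [apply: min_gt0; lra | exact: minL | exact: minR].
exists (Num.min d (`|y' - y| / 2)) => //; left=> x1 y1 hx1 hy1 hA.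
have t1 := ler_distD y' y1 y; have t2 := ler_distD y1 y' y.
move: (hy1); rewrite distrC => hy1'.
by have [] : ~ `|y1 - y| < `|y' - y| / 2; [apply/negP; rewrite -leNgt; lra | apply: (hd x1) => //; lra].
Qed.

(** If all heights over [x0] are normal, compactness of the interval from [-M] to [M] gives a
    neighbourhood of [x0] over which [A] lies close to the finitely many points of its fibre over
    [x0], and near each of these it is single-valued. *)
Lemma branches_at_normal n (A : 'rV[R]_n -> R -> Prop) x0 (r M : R) (t : seq R) :
  Def (fun p : 'rV[R]_n * R => A p.1 p.2) -> 0 < r ->
  (forall x y, mnorm (x - x0) < r -> A x y -> `|y| < M) ->
  (forall y, A x0 y -> y \in t) ->
  (forall y, `|y| <= M -> normal_pt A x0 y) ->
  exists r', subball x0 r x0 r' /\ exists k (F : 'I_k -> 'rV[R]_n -> R),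
    (forall i, Dfun (F i)) /\
    forall x y, mnorm (x - x0) < r' -> A x y -> exists i, F i x = y.
Proof.
move=> hA r0 bd ht hN.
pose P y g := A x0 y -> (forall x' y' y'', mnorm (x' - x0) < g -> `|y' - y| < g -> `|y'' - y| < g ->
       A x' y' -> A x' y'' -> y' = y'').
have [||g g0 hg] := @seq_uniform _ t P.
- by move=> y s s' h s0 hs hy x1 y1 y2 h1 h2 h3; apply: h => //; lra.
- move=> y hy; have [Ay|nAy] := EM (A x0 y); last by exists 1.
  have [|g g0 [h|[_ [h _]]]] := hN y.
  + by apply/ltW/(bd x0 y) => //; apply: ball_center.
  + by case: (h x0 y) => //; [apply: ball_center | rewrite subrr normr0].
  + by exists g => // _.
pose C y' d := (exists y0, A x0 y0 /\ `|y' - y0| < g) \/ (forall x', mnorm (x' - x0) < d -> ~ A x' y').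
have [|||d d0 hd] := @interval_compact R S C (- M) M.
- by rewrite /C; definable.
- by move=> y s s' [h|h] s0 hs; [left | right=> x' hx'; apply: h; lra].
- move=> y h1 h2; have [|s s0 h] := hN y; first by rewrite ler_norml h1.
  case: h => [h|[h _]]; first by exists s => // y' hy'; right=> x' hx'; apply: h.
  by exists g => // y' hy'; left; exists y.
pose r' := Num.min (Num.min r d) g.
have r'0 : 0 < r' by rewrite /r' !lt_min r0 d0.
have [k1 k2 k3] : [/\ r' <= r, r' <= d & r' <= g].
  have := minL (Num.min r d) g; have := minR (Num.min r d) g.
  by have := minL r d; have := minR r d; rewrite /r'; split; lra.
exists r'; split; first exact: subball_shrink.
(* The branch with index [i] consists of the points of [A] within [g] of the entry [i] of the fibre
   list. Entries of [t] that are not in the fibre give an empty branch. *)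
pose G (i : 'I_(size t)) x y := mnorm (x - x0) < g /\ A x0 (nth 0 t i) /\ A x y /\ `|y - nth 0 t i| < g.
have hG i : exists2 f : 'rV[R]_n -> R, Dfun f & forall x y, G i x y -> f x = y.
  apply: Dfun_partial; first by rewrite /G; definable.
  move=> x y y' [h1 [h2 [h3 h4]]] [_ [_ [h5 h6]]].
  by apply: (hg (nth 0 t i) _ h2 x); rewrite ?mem_nth.
have [F hF] := choice (fun i => let: ex_intro2 f h1 h2 := hG i in ex_intro (fun f => Dfun f /\ forall x y, G i x y -> f x = y) f (conj h1 h2)).
exists (size t), F; split; first by move=> i; have [] := hF i.
move=> x y hx Axy.
have ym : `|y| < M by apply: bd Axy; lra.
move: (ym); rewrite ltr_norml => /andP [y1 y2].
have [||[y0 [h1 h2]]|h] := hd y; try (by clear -y1 y2; lra); last by case: (h x) => //; lra.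
have hy0 : (index y0 t < size t)%N by rewrite index_mem ht.
exists (Ordinal hy0); have [_ h] := hF (Ordinal hy0); apply: h.
by rewrite /G /= nth_index ?ht //; split; first lra.
Qed.

(** After bounding the fibres locally, dichotomy leaves two cases. If all heights are normal over a
    ball, [branches_at_normal] applies. Otherwise the supremum [be] of the abnormal heights is
    itself abnormal, but generically it is continuous, isolated from other points of [A], and either
    always or never in [A]; this makes it normal, a contradiction. *)
Lemma branches_step n : dichotomy_dim S n -> continuity_dim S n -> branches_dim S n.
Proof.
move=> D1 D2 A a r hA r0 fin.
have [|s hs hsP] := @Dfun_lub R S _ _ (fun x M => M = 0 \/ exists y, A x y /\ M = `|y|); first by definable.
have [a1 [r1 [h1 c1]]] := D2 s a r hs r0.
have [d d0 hd] := c1 a1 (ball_center _ h1.1) 1 ltr01.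
pose M := s a1 + 1; pose r2 := Num.min r1 d.
have r20 : 0 < r2 by apply: min_gt0 => //; exact: h1.1.
have s12 : subball a1 r1 a1 r2 by apply: subball_shrink => //; exact: minL.
have bd x y : mnorm (x - a1) < r2 -> A x y -> `|y| < M.
  move=> hx Axy; have hx2 : mnorm (x - a1) < d by apply: lt_le_trans hx (minR _ _).
  have [t ht] := fin x (h1.2 _ (s12.2 _ hx)); have [B hB] := seq_bound t.
  have [||k1 _] := hsP x; first by exists 0; left.
    by exists (Num.max 0 B) => z [->|[z' [/ht /hB h ->]]]; [exact: maxL | exact: le_trans h (maxR _ _)].
  have h2 : `|y| <= s x by apply: k1; right; exists y.
  by have := hd x hx2; rewrite ltr_norml /M => /andP [_]; lra.
have hNrm : Def (fun p : 'rV[R]_n * R => normal_pt A p.1 p.2) by rewrite /normal_pt; definable.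
have hNx : Def (fun x => forall y, `|y| <= M -> normal_pt A x y) by definable.
have [a3 [r3 [h3 hdich]]] := D1 _ a1 r2 hNx r20.
have s3 : subball a r a3 r3 by apply: subball_trans h3; apply: subball_trans s12.
case: hdich => [hN|hN].
  have [t ht] := fin a3 (subball_center s3).
  have [||r' [k1 k2]] := @branches_at_normal n A a3 r3 M t hA h3.1 _ ht.
  - by move=> x y hx; apply: bd; apply: h3.2.
  - by move=> y hy; apply: hN => //; apply: ball_center; exact: h3.1.
  by exists a3, r'; split=> //; apply: subball_trans k1.
(* The supremum is attained among abnormal heights because normality is open in the height. *)
have [|be hbe hbeP] := @Dfun_lub R S _ _ (fun x y => `|y| <= M /\ ~ normal_pt A x y); first by definable.
have nbe x : mnorm (x - a3) < r3 -> ~ normal_pt A x (be x).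
  move=> hx /normal_pt_open [e e0 he].
  have [||k1 k2] := hbeP x.
  - apply: contrapT => hno; apply: (hN x hx) => y hy.
    by apply: contrapT => hny; apply: hno; exists y.
  - by exists M => y [/(le_trans (ler_norm _))].
  have [|y [hy1 hy2] hy3] := k2 (be x - e); first lra.
  have hy4 := k1 y (conj hy1 hy2); apply: hy2; apply: he.
  by rewrite ltr_norml; apply/andP; split; lra.
(* [ga x] is a radius around [be x] that contains no point of the fibre except possibly [be x]; it
   is positive as fibres are finite. *)
have [||ga hga hgaP] := @Dfun_radius R S _ _ (fun x g => forall y, A x y -> `|y - be x| < g -> y = be x).
- by definable.
- by move=> x s1 s2 h _ hs2 y Ay hy; apply: h => //; lra.
have ga0 x : mnorm (x - a3) < r3 -> 0 < ga x.
  move=> hx; have [t ht] := fin x (s3.2 x hx); have [g g0 hg] := seq_dist t (be x).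
  have [_ _ _ h] := hgaP x; have m0 := min_gt0 g0 (ltr01 : 0 < 1 :> R).
  suff : Num.min g 1 <= 2 * ga x by lra.
  apply: h => //; first exact: minR.
  by move=> y /ht hy hy2; apply: hg => //; apply: lt_le_trans hy2 (minL _ _).
have hAb : Def (fun x => A x (be x)) by definable.
have [a4 [r4 [h4 hAdec]]] := D1 _ a3 r3 hAb h3.1.
have [a5 [r5 [h5 cbe]]] := D2 be a4 r4 hbe h4.1.
have [a6 [r6 [h6 cga]]] := D2 ga a5 r5 hga h5.1.
have in6 x : mnorm (x - a6) < r6 -> mnorm (x - a4) < r4 /\ mnorm (x - a3) < r3.
  by move=> /h6.2 /h5.2 hx; split=> //; apply: h4.2.
have c6 := ball_center a6 h6.1.
have g60 : 0 < ga a6 by apply: ga0; have [] := in6 a6 c6.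
have [|d1 d10 hd1] := cga a6 c6 (ga a6 / 2); first lra.
have [|d2 d20 hd2] := cbe a6 (h6.2 _ c6) (ga a6 / 4); first lra.
pose g := Num.min (Num.min d1 d2) (Num.min r6 (ga a6 / 4)).
have gg0 : 0 < g by rewrite /g; apply: min_gt0; apply: min_gt0 => //; [exact: h6.1 | lra].
have [g1 g2 g3 g4] : [/\ g <= d1, g <= d2, g <= r6 & g <= ga a6 / 4].
  have := minL (Num.min d1 d2) (Num.min r6 (ga a6 / 4)).
  have := minR (Num.min d1 d2) (Num.min r6 (ga a6 / 4)).
  have := minL d1 d2; have := minR d1 d2; have := minL r6 (ga a6 / 4); have := minR r6 (ga a6 / 4).
  by clear; rewrite /g => *; split; lra.
have only x y : mnorm (x - a6) < g -> `|y - be a6| < g -> A x y -> y = be x.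
  move=> hx hy Axy; have [_ hx3] := in6 x (lt_le_trans hx g3).
  have [_ _ h _] := hgaP x; apply: (h (ga0 x hx3)) => //.
  have e1 := hd1 x (lt_le_trans hx g1); have e2 := hd2 x (lt_le_trans hx g2).
  move: e1; rewrite ltr_norml => /andP [e1 _].
  have e3 := ler_distD (be a6) y (be x); rewrite (distrC (be a6)) in e3.
  by clear -e1 e2 e3 hy g4 g60; lra.
case: (nbe a6); first by have [] := in6 a6 c6.
exists g => //; case: hAdec => hAdec; [right | left]; last first.
  move=> x y hx hy Axy; have [hx4 _] := in6 x (lt_le_trans hx g3).
  by apply: (hAdec x hx4); rewrite -(only x y).
split; first by apply: hAdec; have [] := in6 a6 c6.
split; first by move=> x y y' hx hy hy' Ay Ay'; rewrite (only x y) // (only x y').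
move=> e e0; have [d3 d30 hd3] := cbe a6 (h6.2 _ c6) e e0.
exists (Num.min d3 g); first exact: min_gt0.
move=> x y; rewrite lt_min => /andP [hx1 hx2] hy Axy; rewrite (only x y) //.
exact: hd3.
Qed.

(** On each vertical line the boundary of [A] is finite, so over a small ball it lies on finitely
    many continuous graphs. Around a height that avoids them [A] does not change vertically, and the
    dichotomy for one horizontal slice decides a whole box. *)
Lemma dichotomy_step n : dichotomy_dim S n -> continuity_dim S n -> branches_dim S n ->
  dichotomy_dim S n.+1.
Proof.
move=> D1 D2 D3 A a r hA r0.
pose u := a 0 ord0; pose x0 := tlr a.
have ea : a = consr u x0 by rewrite consr_eta.
have hA2 : Def (fun p : 'rV[R]_n * R => A (consr p.2 p.1)).
  by apply: (Def_comp hA); apply: Dfun_consr; definable.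
pose Bd x t := forall e : R, 0 < e -> (exists2 s, `|s - t| < e & A (consr s x)) /\ (exists2 s, `|s - t| < e & ~ A (consr s x)).
have hBd : Def (fun p : 'rV[R]_n * R => Bd p.1 p.2).
  by rewrite /Bd; pose B x t := A (consr t x); have hB : Def (fun p : 'rV[R]_n * R => B p.1 p.2) by []; rewrite -/(B _ _); definable.
have hAx x : Def (fun t => A (consr t x)).
  by pose B x t := A (consr t x); have hB : Def (fun p : 'rV[R]_n * R => B p.1 p.2) by []; rewrite -/(B _ _); definable.
have finBd x : exists t : seq R, forall y, Bd x y -> y \in t.
  apply: (@no_interval_finite R S); first by definable.
  move=> p q hpq h; have [a' [b' [k1 k2 k3 k4]]] := interval_dichotomy (hAx x) hpq.
  have [|||[s hs As] [s' hs' As']] := h ((a' + b') / 2) _ _ ((b' - a') / 2); try lra.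
  move: hs hs'; rewrite !ltr_norml => /andP [m1 m2] /andP [m3 m4].
  by case: k4 => k4; [apply: As'; apply: k4; lra | apply: (k4 s) => //; lra].
have [a1 [r1 [h1 [k [F [hF hFB]]]]]] := D3 Bd x0 r hBd r0 (fun x _ => finBd x).
have [|a2 [r2 [h2 cF]]] := @refine_fin R n k (fun i => cont (F i)) _ a1 r1 h1.1.
  by move=> i b s s0; apply: D2.
have c2 := ball_center a2 h2.1.
(* [t0] is a height inside the given ball that no boundary branch takes at the centre [a2]; by
   continuity a band of half width [g / 2] around it stays free of boundary points. *)
have [|t0 /andP [t1 t2] t3] := @finite_avoid R [seq F i a2 | i <- enum 'I_k] (u - r) (u + r); first lra.
have [|g g0 hg] := @finite_min R k (fun i => `|F i a2 - t0|).
  move=> i; rewrite normr_gt0 subr_eq0; apply/eqP => e; move/negP: t3; apply.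
  by rewrite -e; apply/mapP; exists i; rewrite ?mem_enum.
have [|dl dl0 hdl] := @finite_min R k (fun i => projT1 (cid2 (cF i a2 c2 (g / 2) (divr_gt0 g0 (ltr0n _ 2))))).
  by move=> i; case: cid2.
have cFd i x : mnorm (x - a2) < dl -> `|F i x - F i a2| < g / 2.
  move=> hx; have := hdl i; case: cid2 => d d0 hd /= hdd.
  by apply: hd; apply: lt_le_trans hx hdd.
pose r3 := Num.min r2 dl.
have r30 : 0 < r3 by apply: min_gt0 => //; exact: h2.1.
have s3 : subball x0 r a2 r3.
  apply: (subball_trans h1); apply: (subball_trans h2); apply: subball_shrink => //; exact: minL.
have hB : Def (fun x => A (consr t0 x)).
  by apply: (Def_comp hA); apply: Dfun_consr; definable.
have [a4 [r4 [h4 dec]]] := D1 _ a2 r3 hB r30.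
have noBd x t : mnorm (x - a2) < r3 -> `|t - t0| < g / 2 -> ~ Bd x t.
  rewrite lt_min => /andP [hx1 hx2] ht hb.
  have [i hi] := hFB x t (h2.2 x hx1) hb.
  have e1 := cFd i x hx2; have e2 := hg i; rewrite -hi in ht.
  have e3 := ler_distD (F i x) (F i a2) t0; rewrite (distrC _ (F i x)) in e3.
  by clear -e1 e2 e3 ht; lra.
have const x s t : mnorm (x - a2) < r3 -> `|s - t0| < g / 2 -> `|t - t0| < g / 2 ->
    A (consr s x) -> A (consr t x).
  move=> hx; rewrite !ltr_norml => /andP [s1 s2] /andP [q1 q2].
  apply: (@nonboundary_const R S (fun s => A (consr s x)) (t0 - g / 2) (t0 + g / 2)) => //; try by clear -s1 s2 q1 q2; lra.
  move=> z z1 z2; have /not_forallP : ~ Bd x z by apply: noBd => //; rewrite ltr_norml; apply/andP; split; clear -z1 z2; lra.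
  move=> hno; apply: contrapT => hno'; apply: hno => -[e he]; apply: he => e0.
  split; apply: contrapT => hn; apply: hno'; exists e => //.
    by right=> y hy Ay; apply: hn; exists y.
  by left=> y hy; apply: contrapT => Ay; apply: hn; exists y.
pose r5 := Num.min (Num.min r4 (g / 2)) (Num.min (t0 - (u - r)) (u + r - t0)).
have r50 : 0 < r5 by rewrite /r5; apply: min_gt0; apply: min_gt0; try (by clear -t1 t2 g0; lra); exact: h4.1.
have [g1 g2 g3 g4] : [/\ r5 <= r4, r5 <= g / 2, r5 <= t0 - (u - r) & r5 <= u + r - t0].
  have := minL (Num.min r4 (g / 2)) (Num.min (t0 - (u - r)) (u + r - t0)).
  have := minR (Num.min r4 (g / 2)) (Num.min (t0 - (u - r)) (u + r - t0)).
  have := minL r4 (g / 2); have := minR r4 (g / 2).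
  have := minL (t0 - (u - r)) (u + r - t0); have := minR (t0 - (u - r)) (u + r - t0).
  by clear; rewrite /r5 => *; split; lra.
exists (consr t0 a4), r5; split.
  split=> // v; rewrite -(consr_eta v) ea !mnorm_consrB => /andP [hv1 hv2]; apply/andP; split.
    by move: hv1; rewrite !ltr_norml => /andP [m1 m2]; apply/andP; split; clear -m1 m2 g3 g4; lra.
  by apply: s3.2; apply: h4.2; clear -hv2 g1; lra.
case: dec => dec; [left | right] => v; rewrite -(consr_eta v) mnorm_consrB => /andP [hv1 hv2].
  have hv3 : mnorm (tlr v - a4) < r4 by clear -hv2 g1; lra.
  apply: (const _ t0); [exact: h4.2 | by rewrite subrr normr0; clear -g0; lra | by clear -hv1 g2; lra |].
  exact: dec.
have hv3 : mnorm (tlr v - a4) < r4 by clear -hv2 g1; lra.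
move=> Av; apply: (dec (tlr v)) => //.
by apply: const Av; [exact: h4.2 | clear -hv1 g2; lra | rewrite subrr normr0; clear -g0; lra].
Qed.

Lemma locally_monotone (f : R -> R) (p q : R) : Dfun f ->
  (forall t, p < t -> t < q -> exists2 e : R, 0 < e &
     forall s s', `|s - t| < e -> `|s' - t| < e -> s <= s' -> f s <= f s') ->
  forall s s', p < s -> s <= s' -> s' < q -> f s <= f s'.
Proof.
move=> hf loc s s' hs hss hs'.
apply: (@real_induction R S (fun z => f s <= f z) s s') => //; first by definable.
- move=> x hx1 hx2 /(_ x hx1 (lexx x)) hx; have [||e e0 he] := loc x; try lra.
  exists e => // y hy1 hy2; apply: le_trans hx _; apply: he; last lra.
    by rewrite subrr normr0.
  by rewrite ltr_norml; apply/andP; split; lra.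
- move=> x hx1 hx2 hb; have [||e e0 he] := loc x; try lra.
  pose y := Num.max s (x - e / 2).
  have y1 : s <= y by exact: maxL.
  have y2 : x - e / 2 <= y by exact: maxR.
  have y3 : y < x by rewrite gt_max hx1 /=; lra.
  apply: le_trans (hb y y1 y3) _; apply: he; last lra.
    by rewrite ltr_norml; apply/andP; split; lra.
  by rewrite subrr normr0.
Qed.

(** Monotonicity in the first coordinate squeezes nearby values between those at [t0 - g] and
    [t0 + g], where continuity in the other coordinates suffices. This is how separate continuity
    becomes joint continuity. *)
Lemma cont_separately n (f : 'rV[R]_n.+1 -> R) a r : Dfun f ->
  (forall v, mnorm (v - a) < r -> cont (fun x => f (consr (v 0 ord0) x)) (tlr v)) ->
  (forall v, mnorm (v - a) < r -> ccont (fun t => f (consr t (tlr v))) (v 0 ord0) /\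
     exists2 e : R, 0 < e & forall s s', `|s - v 0 ord0| < e -> `|s' - v 0 ord0| < e -> s <= s' ->
        f (consr s (tlr v)) <= f (consr s' (tlr v))) ->
  forall v, mnorm (v - a) < r -> cont f v.
Proof.
move=> hf cx ct v hv e e0.
pose t0 := v 0 ord0; pose x0 := tlr v.
have [hct _] := ct v hv; have [|d d0 hd] := hct (e / 2); first lra.
pose g := Num.min d (r - mnorm (v - a)) / 2.
have g0 : 0 < g by rewrite /g divr_gt0 //; apply: min_gt0 => //; lra.
have [g1 g2] : g < d /\ g < r - mnorm (v - a).
  have := minL d (r - mnorm (v - a)); have := minR d (r - mnorm (v - a)).
  have : 0 < Num.min d (r - mnorm (v - a)) by apply: min_gt0 => //; lra.
  by rewrite /g; clear; split; lra.
have inb s x : `|s - t0| < r - mnorm (v - a) -> mnorm (x - x0) < r - mnorm (v - a) -> mnorm (consr s x - a) < r.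
  move=> h1 h2; have := mnormB_tri (consr s x) v a.
  have : mnorm (consr s x - v) < r - mnorm (v - a) by rewrite -{1}(consr_eta v) mnorm_consrB h1.
  by clear; lra.
have at_ s : `|s - t0| <= g -> exists2 d' : R, 0 < d' & forall x, mnorm (x - x0) < d' -> `|f (consr s x) - f (consr s x0)| < e / 2.
  move=> hs; have hin : mnorm (consr s x0 - a) < r.
    by apply: inb; [lra | rewrite subrr mnorm0; lra].
  by have [|d' d'0 hd'] := cx _ hin (e / 2); [lra | exists d'; rewrite ?consr0 ?tlr_cons // in hd' *].
have [|d1 d10 h1] := at_ (t0 - g); first by rewrite addrAC subrr add0r normrN ger0_norm // ltW.
have [|d2 d20 h2] := at_ (t0 + g); first by rewrite addrAC subrr add0r ger0_norm // ltW.
have k1 : `|f (consr (t0 - g) x0) - f v| < e / 2.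
  have := hd (t0 - g); rewrite consr_eta; apply.
  by rewrite addrAC subrr add0r normrN ger0_norm // ltW.
have k2 : `|f (consr (t0 + g) x0) - f v| < e / 2.
  have := hd (t0 + g); rewrite consr_eta; apply.
  by rewrite addrAC subrr add0r ger0_norm // ltW.
pose dd := Num.min (Num.min d1 d2) g.
have dd0 : 0 < dd by apply: min_gt0 => //; apply: min_gt0.
have [m1 m2 m3] : [/\ dd <= d1, dd <= d2 & dd <= g].
  have := minL (Num.min d1 d2) g; have := minR (Num.min d1 d2) g.
  by have := minL d1 d2; have := minR d1 d2; rewrite /dd; clear => *; split; lra.
exists dd => // y; rewrite -{1}(consr_eta y) -{1}(consr_eta v) mnorm_consrB -/t0 -/x0.
set s := y 0 ord0; set x := tlr y => /andP [hs hx].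
have mono p q : t0 - g <= p -> p <= q -> q <= t0 + g -> f (consr p x) <= f (consr q x).
  move=> hp hpq hq.
  apply: (@locally_monotone (fun s => f (consr s x)) (t0 - (r - mnorm (v - a))) (t0 + (r - mnorm (v - a)))); try by clear -hp hq g2 hpq; lra.
    by apply: (Dfun_comp hf); apply: Dfun_consr; definable.
  move=> z z1 z2; have [|_] := ct (consr z x).
    by apply: inb; [rewrite ltr_norml; apply/andP; split; clear -z1 z2; lra | clear -hx m3 g2; lra].
  by rewrite consr0 tlr_cons.
move: hs; rewrite ltr_norml => /andP [hs1 hs2].
have l1 : f (consr (t0 - g) x) <= f y by rewrite -[y]consr_eta; apply: mono; rewrite -/s; clear -hs1 hs2 m3; lra.
have l2 : f y <= f (consr (t0 + g) x) by rewrite -[y]consr_eta; apply: mono; rewrite -/s; clear -hs1 hs2 m3; lra.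
have := h1 x (lt_le_trans hx m1); have := h2 x (lt_le_trans hx m2).
move: k1 k2; rewrite !ltr_norml => /andP [u1 u2] /andP [u3 u4] /andP [u5 u6] /andP [u7 u8].
by clear -l1 l2 u1 u2 u3 u4 u5 u6 u7 u8; apply/andP; split; lra.
Qed.

Lemma cont_opp n (f : 'rV[R]_n -> R) x : cont f x -> cont (fun y => - f y) x.
Proof. by move=> h e /h [d d0 hd]; exists d => // y /hd; rewrite -opprD normrN. Qed.

(** Dichotomy is applied to continuity in the last coordinates and to being continuous and locally
    increasing, or decreasing, in the first one. The case in which these fail on a whole ball
    contradicts the corresponding result on a single line or slice. *)
Lemma continuity_step n : dichotomy_dim S n.+1 -> continuity_dim S n -> continuity_dim S n.+1.
Proof.
move=> D1 D2 f a r hf r0.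
pose F x t := f (consr t x).
have hF : Dfun (fun p : 'rV[R]_n * R => F p.1 p.2).
  by apply: (Dfun_comp hf); apply: Dfun_consr; definable.
have hT : Dfun (@tlr R n) by rewrite /tlr; definable.
pose X1 (v : 'rV[R]_n.+1) := cont (fun x => F x (v 0 ord0)) (tlr v).
have hX1 : Def X1 by rewrite /X1 /cont; definable.
have [a1 [r1 [h1 dec1]]] := D1 X1 a r hX1 r0.
case: dec1 => [ok1|no1]; last first.
  have hfx : Dfun (fun x => F x (a1 0 ord0)) by definable.
  have [a' [r' [h' c']]] := D2 _ (tlr a1) r1 hfx h1.1.
  case: (no1 (consr (a1 0 ord0) a')); last by rewrite /X1 consr0 tlr_cons; apply: c'; apply: ball_center; exact: h'.1.
  rewrite -{2}(consr_eta a1) mnorm_consrB subrr normr0 h1.1 /=; exact: subball_center h'.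
pose mon (v : 'rV[R]_n.+1) (op : R -> R) := ccont (fun t => op (F (tlr v) t)) (v 0 ord0) /\
   exists2 e : R, 0 < e & forall s s', `|s - v 0 ord0| < e -> `|s' - v 0 ord0| < e -> s <= s' ->
        op (F (tlr v) s) <= op (F (tlr v) s').
have hX2 : Def (fun v => mon v id) by rewrite /mon /ccont; definable.
have hX3 : Def (fun v => mon v (fun x => - x)) by rewrite /mon /ccont; definable.
have [a2 [r2 [h2 dec2]]] := D1 _ a1 r1 hX2 h1.1.
have s2 := subball_trans h1 h2.
case: dec2 => [ok2|no2].
  exists a2, r2; split=> // v hv.
  by apply: (cont_separately hf) hv => w hw; [apply: ok1; apply: h2.2 | apply: ok2].
have [a3 [r3 [h3 dec3]]] := D1 _ a2 r2 hX3 h2.1.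
case: dec3 => [ok3|no3].
  exists a3, r3; split; first exact: subball_trans h3.
  move=> v hv; have hN : Dfun (fun v => - f v) by definable.
  suff /cont_opp : cont (fun v => - f v) v by congr (cont _ _); apply: funext => y; rewrite opprK.
  apply: (cont_separately hN) hv => w hw; last exact: ok3.
  by apply: cont_opp; apply: ok1; apply: h2.2; apply: h3.2.
exfalso; have hfx : Dfun (fun t => F (tlr a3) t) by definable.
have [|a' [b' [k1 k2 k3 k4 k5]]] := @monotone_cont_somewhere R S _ (a3 0 ord0 - r3) (a3 0 ord0 + r3) hfx; first by have := h3.1; lra.
pose t := (a' + b') / 2; pose v := consr t (tlr a3).
have hv : mnorm (v - a3) < r3.
  rewrite /v -{2}(consr_eta a3) mnorm_consrB subrr mnorm0 h3.1 andbT ltr_norml.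
  by apply/andP; split; rewrite /t; lra.
have ct : ccont (fun t => F (tlr a3) t) t by apply: k4; rewrite /t; lra.
have near s : `|s - t| < (b' - a') / 2 -> a' < s /\ s < b'.
  by rewrite ltr_norml /t => /andP [? ?]; split; lra.
case: k5 => k5.
  apply: (no2 v); first exact: h3.2.
  rewrite /mon /v consr0 tlr_cons; split=> //; exists ((b' - a') / 2); first lra.
  by move=> s s' /near [s1 s2'] /near [s3 s4] hs; apply: k5.
apply: (no3 v) => //; rewrite /mon /v consr0 tlr_cons; split; first exact: ccont_opp.
exists ((b' - a') / 2); first lra.
by move=> s s' /near [s1 s2'] /near [s3 s4] hs; rewrite lerN2; apply: k5.
Qed.

Lemma generic_dim n : dichotomy_dim S n /\ continuity_dim S n.
Proof.
elim: n => [|n [D1 D2]]; last first.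
  have D1' : dichotomy_dim S n.+1 by apply: dichotomy_step => //; apply: branches_step.
  by split=> //; apply: continuity_step.
have e0 (x y : 'rV[R]_0) : x = y by rewrite [x]thinmx0 [y]thinmx0.
split.
  move=> A a r hA r0; exists a, r; split=> //.
  by have [h|h] := EM (A a); [left|right] => x _; rewrite (e0 x a).
move=> f a r hf r0; exists a, r; split=> // x _ e e1.
by exists 1 => // y _; rewrite (e0 y x) subrr normr0.
Qed.

Lemma dichotomy n : dichotomy_dim S n. Proof. by have [] := generic_dim n. Qed.
Lemma generic_continuity n : continuity_dim S n. Proof. by have [] := generic_dim n. Qed.
Lemma finite_branches n : branches_dim S n.
Proof. by have [] := generic_dim n; apply: branches_step. Qed.

End GenericInduction.

(** * Differentiation in one variable *)

Section Deriv1.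
Variable R : rcfType.
Implicit Types (f g : R -> R) (t l : R).

Definition is_d f t l := forall e : R, 0 < e -> exists2 d : R, 0 < d &
  forall h, `|h| < d -> `|f (t + h) - f t - h * l| <= e * `|h|.

Lemma is_d_ext f g t l : (exists2 d : R, 0 < d & forall h, `|h| < d -> f (t + h) = g (t + h)) ->
  is_d f t l -> is_d g t l.
Proof.
move=> [d d0 hd] h e /h [d' d'0 hd']; exists (Num.min d d'); first exact: min_gt0.
move=> k; rewrite lt_min => /andP [k1 k2]; rewrite -hd //.
by have := hd 0; rewrite addr0 normr0 => <- //; apply: hd'.
Qed.

Lemma is_d_uniq f t l l' : is_d f t l -> is_d f t l' -> l = l'.
Proof.
move=> h h'; apply/eqP; rewrite -subr_eq0 -normr_le0 leNgt; apply/negP => p.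
have [|d d0 hd] := h (`|l - l'| / 4); first lra.
have [|d' d'0 hd'] := h' (`|l - l'| / 4); first lra.
have m0 := min_gt0 d0 d'0; pose k := Num.min d d' / 2.
have k0 : 0 < k by rewrite /k; lra.
have [k1 k2] : k < d /\ k < d'.
  by have := minL d d'; have := minR d d'; rewrite /k; split; lra.
have nk : `|k| = k by rewrite ger0_norm // ltW.
have e1 := hd k; have e2 := hd' k; rewrite nk in e1 e2.
have {}e1 := e1 k1; have {}e2 := e2 k2.
have e3 : k * `|l - l'| <= `|f (t + k) - f t - k * l| + `|f (t + k) - f t - k * l'|.
  rewrite -{1}nk -normrM (le_trans _ (ler_normB _ _)) //.
  by rewrite le_eqVlt; apply/orP; left; apply/eqP; rewrite -normrN; congr Num.norm; ring.
have : 0 < k * `|l - l'| by exact: mulr_gt0.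
by clear -e1 e2 e3; lra.
Qed.

Lemma is_d_ccont f t l : is_d f t l -> ccont f t.
Proof.
move=> h e e0; have [d d0 hd] := h 1 ltr01.
have p0 : 0 < 1 + `|l| + 1 by have := normr_ge0 l; lra.
exists (Num.min d (e / (1 + `|l| + 1))); first by apply: min_gt0 => //; exact: divr_gt0.
move=> y; rewrite lt_min => /andP [y1 y2].
have := hd (y - t) y1; rewrite [t + _]addrC subrK mul1r => e1.
have e2 : `|f y - f t| <= `|f y - f t - (y - t) * l| + `|(y - t) * l|.
  by rewrite -{1}[f y - f t](subrK ((y - t) * l)) ler_normD.
move: y2; rewrite ltr_pdivlMr // normrM in e2 * => y2.
have := mulr_ge0 (normr_ge0 (y - t)) (normr_ge0 l).
by have := normr_ge0 (y - t); clear -e1 e2 y2; nra.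
Qed.

Lemma is_d_cst c t : is_d (fun _ => c) t 0.
Proof. by move=> e e0; exists 1 => // h _; rewrite mulr0 !subrr normr0 mulr_ge0 // ltW. Qed.

Lemma is_d_id t : is_d (fun x => x) t 1.
Proof.
move=> e e0; exists 1 => // h _.
by rewrite mulr1 [t + h]addrC addrK subrr normr0 mulr_ge0 // ltW.
Qed.

Lemma is_dD f g t l l' : is_d f t l -> is_d g t l' -> is_d (fun x => f x + g x) t (l + l').
Proof.
move=> hf hg e e0; have [|d d0 hd] := hf (e / 2); first lra.
have [|d' d'0 hd'] := hg (e / 2); first lra.
exists (Num.min d d'); first exact: min_gt0.
move=> h; rewrite lt_min => /andP [h1 h2].
have -> : f (t + h) + g (t + h) - (f t + g t) - h * (l + l') =
  (f (t + h) - f t - h * l) + (g (t + h) - g t - h * l') by ring.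
apply: le_trans (ler_normD _ _) _; have := hd h h1; have := hd' h h2; lra.
Qed.

Lemma is_dM f g t l l' : is_d f t l -> is_d g t l' ->
  is_d (fun x => f x * g x) t (l * g t + f t * l').
Proof.
move=> hf hg e e0.
pose K : R := 1 + `|f t| + `|g t| + `|l|.
have K1 : 1 <= K by rewrite /K; have := normr_ge0 (f t); have := normr_ge0 (g t); have := normr_ge0 l; lra.
have Kf : `|f t| <= K by rewrite /K; have := normr_ge0 (g t); have := normr_ge0 l; lra.
have Kg : `|g t| <= K by rewrite /K; have := normr_ge0 (f t); have := normr_ge0 l; lra.
have Kl : `|l| <= K by rewrite /K; have := normr_ge0 (f t); have := normr_ge0 (g t); lra.
pose e1 := e / (4 * K).
have e10 : 0 < e1 by rewrite divr_gt0 //; lra.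
have Ke : K * e1 = e / 4 by rewrite /e1; field; lra.
have [d d0 hd] := hf e1 e10; have [d' d'0 hd'] := hg e1 e10.
have [d2 d20 hd2] := is_d_ccont hg (min_gt0 e10 (ltr01 : 0 < 1 :> R)).
exists (Num.min (Num.min d d') d2); first by rewrite !lt_min d0 d'0.
move=> h; rewrite !lt_min => /andP [/andP [h1 h2] h3].
have -> : f (t + h) * g (t + h) - f t * g t - h * (l * g t + f t * l') =
  (f (t + h) - f t - h * l) * g (t + h) + f t * (g (t + h) - g t - h * l') + h * l * (g (t + h) - g t) by ring.
have a1 := hd h h1; have a2 := hd' h h2.
have := hd2 (t + h); rewrite addrAC subrr add0r => /(_ h3); rewrite lt_min => /andP [a3 a4].
have a5 : `|g (t + h)| <= K + 1.
  by have := ler_normD (g (t + h) - g t) (g t); rewrite subrK; lra.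
set A := f (t + h) - f t - h * l in a1 *; set B := g (t + h) - g t - h * l' in a2 *.
set C := g (t + h) - g t in a3 a4 *.
have b1 : `|A * g (t + h)| <= e1 * `|h| * (K + 1).
  by rewrite normrM ler_pM.
have b2 : `|f t * B| <= K * (e1 * `|h|) by rewrite normrM ler_pM.
have b3 : `|h * l * C| <= `|h| * K * e1.
  by rewrite !normrM ler_pM ?mulr_ge0 // ?ler_wpM2l // ltW.
have n1 := ler_normD (A * g (t + h) + f t * B) (h * l * C).
have n2 := ler_normD (A * g (t + h)) (f t * B).
have h0 := normr_ge0 h.
have c1 : e1 * `|h| * (K + 1) <= 2 * (K * e1) * `|h|.
  have -> : 2 * (K * e1) * `|h| = e1 * `|h| * (2 * K) by ring.
  apply: ler_wpM2l; first by apply: mulr_ge0 => //; exact: ltW.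
  by clear -K1; lra.
have c2 : K * (e1 * `|h|) = (K * e1) * `|h| by ring.
have c3 : `|h| * K * e1 = (K * e1) * `|h| by ring.
by rewrite Ke in c1 c2 c3; clear -n1 n2 b1 b2 b3 c1 c2 c3 h0 e0; nra.
Qed.

Lemma is_dV f t l : is_d f t l -> f t != 0 -> is_d (fun x => (f x)^-1) t (- l / f t ^+ 2).
Proof.
move=> hf ft0 e e0.
pose a := `|f t|; have a0 : 0 < a by rewrite normr_gt0.
have [|d1 d10 hd1] := is_d_ccont hf (e := a / 2); first lra.
pose K := 2 * (1 + `|l| + 1) / a ^+ 3.
have a30 : 0 < a ^+ 3 by exact: exprn_gt0.
have lp := normr_ge0 l.
have [|d2 d20 hd2] := hf (e * a ^+ 2 / 4); first by rewrite divr_gt0 // mulr_gt0 // exprn_gt0.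
have [|d3 d30 hd3] := is_d_ccont hf (e := e * a ^+ 3 / (4 * (1 + `|l|))).
  by rewrite divr_gt0 // ?mulr_gt0 //; lra.
exists (Num.min (Num.min d1 d2) d3); first by rewrite !lt_min d10 d20.
move=> h; rewrite !lt_min => /andP [/andP [h1 h2] h3].
have := hd1 (t + h); rewrite addrAC subrr add0r => /(_ h1) b1.
have := hd3 (t + h); rewrite addrAC subrr add0r => /(_ h3) b3.
have b2 := hd2 h h2.
have fn : a / 2 <= `|f (t + h)|.
  by have := ler_normD (f t - f (t + h)) (f (t + h)); rewrite subrK distrC -/a; lra.
have fh0 : f (t + h) != 0 by rewrite -normr_gt0; lra.
set A := f (t + h) - f t - h * l in b2; set C := f (t + h) - f t in b3.
have -> : (f (t + h))^-1 - (f t)^-1 - h * (- l / f t ^+ 2) =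
   (- A * f t + h * l * C) / (f (t + h) * f t ^+ 2).
  by rewrite /A /C; field; rewrite fh0 ft0.
rewrite normrM normfV [`|f (t + h) * _|]normrM normrX -/a ler_pdivrMr; last first.
  by rewrite mulr_gt0 ?exprn_gt0 //; lra.
have n1 := ler_normD (- A * f t) (h * l * C); rewrite !normrM normrN -/a in n1.
have h0 := normr_ge0 h.
have c1 : `|A| * a <= e * `|h| * a ^+ 3 / 4.
  have -> : e * `|h| * a ^+ 3 / 4 = (e * a ^+ 2 / 4 * `|h|) * a by ring.
  by rewrite ler_wpM2r // ltW.
have c2 : `|h| * `|l| * `|C| <= e * `|h| * a ^+ 3 / 4.
  have : `|l| * `|C| <= e * a ^+ 3 / 4.
    move: b3; rewrite ltr_pdivlMr; last lra.
    by have := normr_ge0 C; clear -lp; nra.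
  by move/(ler_wpM2l h0) => c; clear -c; lra.
have c3 : e * `|h| * a ^+ 3 / 2 <= e * `|h| * (`|f (t + h)| * a ^+ 2).
  rewrite -mulrA ler_wpM2l ?mulr_ge0 // ?(ltW e0) //.
  have -> : a ^+ 3 / 2 = (a / 2) * a ^+ 2 by ring.
  by rewrite ler_wpM2r // exprn_ge0 // ltW.
by clear -n1 c1 c2 c3; lra.
Qed.

Lemma is_d_shift f t l : is_d f t l <-> is_d (fun h => f (t + h)) 0 l.
Proof.
split=> h e /h [d d0 hd]; exists d => // k /hd; by rewrite add0r addr0.
Qed.

Lemma is_dN f t l : is_d f t l -> is_d (fun x => - f x) t (- l).
Proof.
move=> h e /h [d d0 hd]; exists d => // k /hd.
by rewrite -[X in X <= _ -> _]normrN; congr (_ <= _); congr Num.norm; ring.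
Qed.

Lemma is_d_affine f (c k : R) t l : is_d f (c + k * t) l -> is_d (fun x => f (c + k * x)) t (k * l).
Proof.
move=> h e e0; have k0 := normr_ge0 k.
have [|d d0 hd] := h (e / (1 + `|k|)); first by rewrite divr_gt0 //; lra.
exists (d / (1 + `|k|)); first by rewrite divr_gt0 //; lra.
move=> s; rewrite ltr_pdivlMr; last lra.
move=> hs; have s0 := normr_ge0 s.
have := hd (k * s); rewrite normrM => /(_ _) b.
have {b} : `|k| * `|s| < d by nra.
move=> ks; have := hd (k * s); rewrite normrM => /(_ ks).
have -> : c + k * t + k * s = c + k * (t + s) by ring.
have -> : f (c + k * (t + s)) - f (c + k * t) - k * s * l = f (c + k * (t + s)) - f (c + k * t) - s * (k * l) by ring.
move=> b; apply: le_trans b _.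
have -> : e / (1 + `|k|) * (`|k| * `|s|) = (e * `|s|) * (`|k| / (1 + `|k|)) by ring.
rewrite ler_piMr ?mulr_ge0 // ?(ltW e0) // ler_pdivrMr; lra.
Qed.

End Deriv1.

(** * Mean value inequality and generic differentiability in one variable *)

Section MeanValue.
Variables (R : rcfType) (S : ominimal_expansion R).
Local Notation Def := (Def S).
Local Notation Dfun := (Dfun S).
Implicit Types (f g : R -> R).

(** Proved by real induction along the interval instead of Rolle's theorem. *)
Lemma mean_value_ge f (a b c : R) : Dfun f -> a <= b ->
  (forall t, a <= t -> t <= b -> exists2 l, is_d f t l & c <= l) ->
  c * (b - a) <= f b - f a.
Proof.
move=> hf; rewrite le_eqVlt => /orP [/eqP -> _|hab hd]; first by rewrite !subrr mulr0.
(* A slope strictly below [c] leaves room [c - c'] for the error in the definition of the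
   derivative. If the inequality with [c] failed, the midpoint between [c] and the average slope
   would contradict this. *)
have weak c' : c' < c -> c' * (b - a) <= f b - f a.
  move=> hc.
  apply: (@real_induction R S (fun t => c' * (t - a) <= f t - f a) a b) => //; try exact: ltW.
  - by definable.
  - by rewrite !subrr mulr0.
  - move=> x hx1 hx2 /(_ x hx1 (lexx x)) hx; have [l hl hcl] := hd x hx1 (ltW hx2).
    have [|d d0 k] := hl (c - c'); first lra.
    exists d => // y hy1 hy2; have := k (y - x).
    have -> : `|y - x| = y - x by rewrite ger0_norm; lra.
    have -> : x + (y - x) = y by ring.
    move=> /(_ _)/(ler_normlP _ _) [|k1 _]; first lra.
    have : (y - x) * c <= (y - x) * l by rewrite ler_wpM2l //; lra.
    by clear -k1 hx; lra.
  - move=> x hx1 hx2 hx; have [l hl hcl] := hd x (ltW hx1) hx2.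
    have [|d d0 k] := hl (c - c'); first lra.
    pose y := Num.max a (x - d / 2).
    have y1 : a <= y by exact: maxL.
    have y2 : x - d / 2 <= y by exact: maxR.
    have y3 : y < x by rewrite gt_max hx1 /=; lra.
    have hy := hx y y1 y3; have := k (y - x).
    have -> : `|y - x| = x - y by rewrite distrC ger0_norm; lra.
    have -> : x + (y - x) = y by ring.
    move=> /(_ _)/(ler_normlP _ _) [|_ k1]; first lra.
    have : (x - y) * c <= (x - y) * l by rewrite ler_wpM2l //; lra.
    by clear -k1 hy; lra.
rewrite leNgt; apply/negP => h.
pose q := (f b - f a) / (b - a).
have ba : 0 < b - a by lra.
have qe : q * (b - a) = f b - f a by rewrite /q divfK //; lra.
have qc : q < c by rewrite ltr_pdivrMr // in h *.
have := weak ((q + c) / 2).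
have -> : (q + c) / 2 * (b - a) = (q * (b - a) + c * (b - a)) / 2 by ring.
by rewrite qe; have : (q + c) / 2 < c; [lra | move=> hqc /(_ hqc); lra].
Qed.

Lemma mean_value_abs f (a b M : R) : Dfun f -> a <= b ->
  (forall t, a <= t -> t <= b -> exists2 l, is_d f t l & `|l| <= M) ->
  `|f b - f a| <= M * (b - a).
Proof.
move=> hf hab hd; rewrite ler_norml; apply/andP; split.
  rewrite -mulNr; apply: mean_value_ge => // t h1 h2; have [l hl] := hd t h1 h2.
  by rewrite ler_norml => /andP [h3 _]; exists l.
have hN : Dfun (fun t => - f t) by definable.
have := @mean_value_ge _ a b (- M) hN hab _.
rewrite mulNr => h; suff : - (M * (b - a)) <= - f b - - f a by lra.
apply: h => t h1 h2; have [l hl] := hd t h1 h2.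
by rewrite ler_norml => /andP [_ h3]; exists (- l); [exact: is_dN | lra].
Qed.

Lemma right_increasing f (a b : R) : Dfun f -> all_oo (ccont f) a b ->
  (forall x, a < x -> x < b -> exists2 e : R, 0 < e & all_oo (fun y => f x <= f y) x (x + e)) ->
  forall x y, a < x -> x <= y -> y < b -> f x <= f y.
Proof.
move=> hf hc hr x y hx hxy hy.
apply: (@real_induction R S (fun t => f x <= f t) x y) => //; first by definable.
- move=> t ht1 ht2 /(_ t ht1 (lexx t)) ht; have [||e e0 he] := hr t; try lra.
  by exists e => // z z1 z2; apply: le_trans ht _; apply: he.
- move=> t ht1 ht2 hb; rewrite leNgt; apply/negP => hlt.
  have [|||d d0 hd] := hc t _ _ (f x - f t); try lra.
  pose z := Num.max x (t - d / 2).
  have z1 : x <= z by exact: maxL.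
  have z2 : t - d / 2 <= z by exact: maxR.
  have z3 : z < t by rewrite gt_max ht1 /=; lra.
  have h1 := hb z z1 z3; have := hd z.
  rewrite distrC ger0_norm; last lra.
  have tz : t - z < d by lra.
  by move=> /(_ tz) /(le_lt_trans (ler_norm _)); lra.
Qed.

Lemma ccont_sub_linear f (c x : R) : ccont f x -> ccont (fun t => f t - c * t) x.
Proof.
move=> h e e0; have [|d d0 hd] := h (e / 2); first lra.
have c0 := normr_ge0 c.
exists (Num.min d (e / (2 * (1 + `|c|)))); first by apply: min_gt0 => //; rewrite divr_gt0 //; lra.
move=> z; rewrite lt_min => /andP [z1 z2].
have := hd z z1; move: z2; rewrite ltr_pdivlMr; last lra.
have -> : f z - c * z - (f x - c * x) = (f z - f x) - c * (z - x) by ring.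
have := ler_normB (f z - f x) (c * (z - x)); rewrite normrM.
by have := normr_ge0 (z - x); clear -c0; nra.
Qed.

(** [c] bounds the right difference quotients from below near [x]; the supremum of such [c] is the
    right derivative. *)
Definition rslope f x (c : R) := exists2 e : R, 0 < e & all_oo (fun y => c * (y - x) <= f y - f x) x (x + e).

Lemma rslope_dichotomy f x (c : R) : Dfun f -> rslope f x c \/
  exists2 e : R, 0 < e & all_oo (fun y => f y - f x < c * (y - x)) x (x + e).
Proof.
move=> hf; have h : Def (fun y => c * (y - x) <= f y - f x) by definable.
have [e e0 [he|he]] := germ_right x h; [left | right]; exists e => // y h1 h2.
by rewrite ltNge; apply/negP; apply: he.
Qed.

Lemma rslope_mono f x (c c' : R) : c' <= c -> rslope f x c -> rslope f x c'.
Proof.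
move=> hc [e e0 he]; exists e => // y h1 h2; apply: le_trans (he y h1 h2).
by rewrite ler_wpM2r //; lra.
Qed.

(** If these slopes were unbounded on an interval, [f t - c * t] would be increasing there for every
    [c], which fails once [c] exceeds an average slope of [f]. *)
Lemma rslope_bounded_somewhere f (a b : R) : Dfun f -> a < b -> all_oo (ccont f) a b ->
  exists a' b', [/\ a <= a', a' < b', b' <= b &
    forall x, a' < x -> x < b' -> exists M, forall c, rslope f x c -> c <= M].
Proof.
move=> hf hab hc.
have hU : Def (fun x => exists M, forall c, rslope f x c -> c <= M) by rewrite /rslope /all_oo; definable.
have [a' [b' [h1 h2 h3 [h|h]]]] := interval_dichotomy hU hab; first by exists a', b'; split.
exfalso; pose x := (2 * a' + b') / 3; pose y := (a' + 2 * b') / 3.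
have [x1 x2 x3] : [/\ a' < x, x < y & y < b'] by rewrite /x /y; split; lra.
pose c := (f y - f x) / (y - x) + 1.
have hg : Dfun (fun t => f t - c * t) by definable.
have := @right_increasing _ a' b' hg _ _ x y x1 (ltW x2) x3.
have -> : (f x - c * x <= f y - c * y) = false.
  apply/negbTE; rewrite -ltNge; have : c * (y - x) = f y - f x + (y - x).
    by rewrite /c; field; lra.
  by lra.
move=> hh; suff : false by [].
apply: hh.
- by move=> t t1 t2; apply: ccont_sub_linear; apply: hc; lra.
- move=> t t1 t2; have := h t t1 t2.
  have [[e e0 he] _|[e e0 he] hno] := rslope_dichotomy t c hf.
    by exists e => // z z1 z2; have := he z z1 z2; lra.
  case: hno; exists c => c' hc'; rewrite leNgt; apply/negP => hcc.
  have [e' e'0 he'] := rslope_mono (ltW hcc) hc'.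
  have m0 := min_gt0 e0 e'0; pose z := t + Num.min e e' / 2.
  have := minL e e'; have := minR e e' => m1 m2.
  by have := he z; have := he' z; rewrite /z; lra.
Qed.

Lemma rderiv_somewhere f (a b : R) : Dfun f -> a < b -> all_oo (ccont f) a b ->
  exists a' b' (r : R -> R), [/\ a <= a', a' < b', b' <= b, all_oo (ccont r) a' b' &
    forall x, a' < x -> x < b' -> (forall c, c < r x -> rslope f x c) /\
      (forall c, r x < c -> exists2 e : R, 0 < e & all_oo (fun y => f y - f x < c * (y - x)) x (x + e))].
Proof.
move=> hf hab hc.
have [a1 [b1 [h1 h2 h3 up]]] := rslope_bounded_somewhere hf hab hc.
have hN : Dfun (fun t => - f t) by definable.
have hcN : all_oo (ccont (fun t => - f t)) a1 b1.
  by move=> x x1 x2; apply: ccont_opp; apply: hc; lra.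
have [a2 [b2 [k1 k2 k3 dn]]] := rslope_bounded_somewhere hN h2 hcN.
have [|r hr hrP] := @Dfun_lub R S R _ (rslope f); first by rewrite /rslope /all_oo; definable.
have [a3 [b3 [q1 q2 q3 cr _]]] := monotone_cont_somewhere hr k2.
exists a3, b3, r; split=> //; try by clear -h1 h3 k1 k3 q1 q3; lra.
move=> x x1 x2.
have [||s1 s2] := hrP x.
- have [||M hM] := dn x; try by clear -q1 q3 x1 x2; lra.
  exists (- M - 1); have [//|[e e0 he]] := rslope_dichotomy x (- M - 1) hf.
  have [] : ~ (M + 1 <= M) by lra.
  by apply: hM; exists e => // y y1 y2; have := he y y1 y2; lra.
- by apply: up; clear -q1 q3 k1 k3 x1 x2; lra.
split=> c hcx; first by have [c' hc' hcc] := s2 c hcx; apply: rslope_mono (ltW hcc) hc'.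
have [/s1|//] := rslope_dichotomy x c hf; lra.
Qed.

(** The right-hand condition makes [f] nondecreasing, whereas to the left of each point [f] takes
    strictly larger values. *)
Lemma no_local_min f (a b : R) : Dfun f -> a < b -> all_oo (ccont f) a b ->
  (forall x, a < x -> x < b -> exists2 e : R, 0 < e & all_oo (fun y => f x <= f y) x (x + e)) ->
  (forall x, a < x -> x < b -> exists2 e : R, 0 < e & all_oo (fun y => f x < f y) (x - e) x) -> False.
Proof.
move=> hf hab hc hr hl; pose x := (a + b) / 2.
have [||e e0 he] := hl x; rewrite ?/x; try lra.
pose y := Num.max (x - e / 2) ((a + x) / 2).
have y1 : (a + x) / 2 <= y by exact: maxR.
have y2 : x - e / 2 <= y by exact: maxL.
have y3 : y < x by rewrite gt_max; apply/andP; split; rewrite /x; lra.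
have ay : a < y by rewrite /x in y1; lra.
have k1 : f x < f y by apply: he => //; lra.
have k2 : f y <= f x by apply: (right_increasing hf hc hr) => //; [exact: ltW | rewrite /x; lra].
lra.
Qed.

(** One-sided derivatives exist and are continuous on a subinterval, the left one as the negative of
    the right derivative of the reflected function. If they differed at a point, some [c] would
    separate them nearby, and [f t - c * t] or its negative would contradict [no_local_min]. *)
Lemma differentiable_somewhere f (a b : R) : Dfun f -> a < b ->
  exists x l, [/\ a < x, x < b & is_d f x l].
Proof.
move=> hf hab.
have [a0 [b0 [u1 u2 u3 hc _]]] := monotone_cont_somewhere hf hab.
have [a1 [b1 [r [h1 h2 h3 cr hr]]]] := rderiv_somewhere hf u2 hc.
have hN : Dfun (fun t => f (- t)) by definable.
have hcN : all_oo (ccont (fun t => f (- t))) (- b1) (- a1).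
  move=> x x1 x2 e e0; have [|||d d0 hd] := hc (- x) _ _ e; try lra.
  by exists d => // y hy; apply: hd; rewrite -opprD normrN.
have [|a2 [b2 [q [k1 k2 k3 cq hq]]]] := rderiv_somewhere hN _ hcN; first lra.
pose x : R := - (a2 + b2) / 2.
have x1 : - b2 < x by rewrite /x; lra.
have x2 : x < - a2 by rewrite /x; lra.
have left_ge (y c : R) : - b2 < y -> y < - a2 -> c < q (- y) ->
    exists2 e : R, 0 < e & all_oo (fun z => c * (y - z) <= f z - f y) (y - e) y.
  move=> y1 y2 hcq; have [|||e e0 he] := (hq (- y) _ _).1 c; try lra.
  exists e => // z z1 z2.
  have t1 : - y < - z by clear -z2; lra.
  have t2 : - z < - y + e by clear -z1; lra.
  by have := he _ t1 t2; rewrite !opprK (addrC (- z)).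
have left_lt (y c : R) : - b2 < y -> y < - a2 -> q (- y) < c ->
    exists2 e : R, 0 < e & all_oo (fun z => f z - f y < c * (y - z)) (y - e) y.
  move=> y1 y2 hcq; have [|||e e0 he] := (hq (- y) _ _).2 c; try lra.
  exists e => // z z1 z2.
  have t1 : - y < - z by clear -z2; lra.
  have t2 : - z < - y + e by clear -z1; lra.
  by have := he _ t1 t2; rewrite !opprK (addrC (- z)).
(* If [c] differs from both one-sided derivatives at [x], these stay on their sides of [c] near [x].
   The last disjunct lets the degenerate values of [c] pass; the midpoint used below is not one of
   them. *)
have near (c : R) : exists2 e : R, 0 < e & forall y, `|y - x| < e ->
   [/\ - b2 < y, y < - a2, a1 < y, y < b1 & `|r y - r x| < `|r x - c| /\ `|q (- y) - q (- x)| < `|- q (- x) - c| \/ (r x = c \/ - q (- x) = c)].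
  have [->|c1] := eqVneq (r x) c.
    exists (Num.min (x - - b2) (- a2 - x)); first by apply: min_gt0; lra.
    have := minL (x - - b2) (- a2 - x); have := minR (x - - b2) (- a2 - x) => m1 m2.
    by move=> y; rewrite ltr_norml => /andP [y1 y2]; split; try lra; right; left.
  have [e|c2] := eqVneq (- q (- x)) c.
    exists (Num.min (x - - b2) (- a2 - x)); first by apply: min_gt0; lra.
    have := minL (x - - b2) (- a2 - x); have := minR (x - - b2) (- a2 - x) => m1 m2.
    by move=> y; rewrite ltr_norml => /andP [y1 y2]; split; try lra; right; right.
  have [||| d1 d10 hd1] := cr x _ _ `|r x - c|; try lra; first by rewrite normr_gt0 subr_eq0.
  have [||| d2 d20 hd2] := cq (- x) _ _ `|- q (- x) - c|; try lra; first by rewrite normr_gt0 subr_eq0.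
  exists (Num.min (Num.min d1 d2) (Num.min (x - - b2) (- a2 - x))).
    by apply: min_gt0; apply: min_gt0 => //; lra.
  have := minL (x - - b2) (- a2 - x); have := minR (x - - b2) (- a2 - x) => m1 m2.
  move=> y; rewrite 3!lt_min => /andP [/andP [y1 y2] /andP [y3 y4]].
  have [y5 y6] : - b2 < y /\ y < - a2.
    by move: y3 y4; rewrite !ltr_norml => /andP [o1 o2] /andP [o3 o4]; clear -o1 o2 o3 o4 m1 m2; split; lra.
  split; try by clear -y5 y6 k1 k3; lra.
  by left; split; [exact: hd1 | apply: hd2; rewrite -opprD normrN].
have eqrq : r x = - q (- x).
  have [hlt|hlt|//] := ltgtP (r x) (- q (- x)); exfalso; pose c := (r x - q (- x)) / 2.
  - have [e e0 he] := near c.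
    have hg : Dfun (fun t => - (f t - c * t)) by definable.
    have ine y : x - e < y -> y < x + e -> `|y - x| < e by move=> ? ?; rewrite ltr_norml; apply/andP; split; lra.
    have bnd y : x - e < y -> y < x + e -> [/\ - b2 < y, y < - a2, a1 < y, y < b1 & r y < c /\ q (- y) < - c].
      move=> y1 y2; have [v1 v2 v3 v4 [[w1 w2]|w]] := he y (ine y y1 y2); last by rewrite /c in w; clear -w hlt; lra.
      have n1 : `|r x - c| = c - r x by rewrite distrC ger0_norm // /c; clear -hlt; lra.
      have n2 : `|- q (- x) - c| = - q (- x) - c by rewrite ger0_norm // /c; clear -hlt; lra.
      by rewrite n1 in w1; rewrite n2 in w2; move: w1 w2; rewrite !ltr_norml => /andP [o1 o2] /andP [o3 o4]; split=> //; clear -o1 o2 o3 o4; split; lra.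
    apply: (@no_local_min _ (x - e) (x + e) hg) => [|y y1 y2|y y1 y2|y y1 y2]; first lra.
    + by have [v1 v2 v3 v4 _] := bnd y y1 y2; apply: ccont_opp; apply: ccont_sub_linear; apply: hc; clear -v3 v4 h1 h3; lra.
    + have [v1 v2 v3 v4 [w1 w2]] := bnd y y1 y2; have [d d0 hd] := (hr y v3 v4).2 c w1.
      by exists d => // z z1 z2; have := hd z z1 z2; clear; lra.
    + have [v1 v2 v3 v4 [w1 w2]] := bnd y y1 y2; have [d d0 hd] := left_lt y (- c) v1 v2 w2.
      by exists d => // z z1 z2; have := hd z z1 z2; clear; lra.
  - have [e e0 he] := near c.
    have hg : Dfun (fun t => f t - c * t) by definable.
    have ine y : x - e < y -> y < x + e -> `|y - x| < e by move=> ? ?; rewrite ltr_norml; apply/andP; split; lra.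
    have bnd y : x - e < y -> y < x + e -> [/\ - b2 < y, y < - a2, a1 < y, y < b1 & c < r y /\ - c < q (- y)].
      move=> y1 y2; have [v1 v2 v3 v4 [[w1 w2]|w]] := he y (ine y y1 y2); last by rewrite /c in w; clear -w hlt; lra.
      have n1 : `|r x - c| = r x - c by rewrite ger0_norm // /c; clear -hlt; lra.
      have n2 : `|- q (- x) - c| = q (- x) + c by rewrite ler0_norm // /c; clear -hlt; lra.
      by rewrite n1 in w1; rewrite n2 in w2; move: w1 w2; rewrite !ltr_norml => /andP [o1 o2] /andP [o3 o4]; split=> //; clear -o1 o2 o3 o4; split; lra.
    apply: (@no_local_min _ (x - e) (x + e) hg) => [|y y1 y2|y y1 y2|y y1 y2]; first lra.
    + by have [v1 v2 v3 v4 _] := bnd y y1 y2; apply: ccont_sub_linear; apply: hc; clear -v3 v4 h1 h3; lra.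
    + have [v1 v2 v3 v4 [w1 w2]] := bnd y y1 y2; have [d d0 hd] := (hr y v3 v4).1 c w1.
      by exists d => // z z1 z2; have := hd z z1 z2; clear; lra.
    + have [v1 v2 v3 v4 [w1 w2]] := bnd y y1 y2; have [|d d0 hd] := left_ge y ((- c + q (- y)) / 2) v1 v2; first by clear -w2; lra.
      exists d => // z z1 z2; have := hd z z1 z2.
      have : 0 < ((- c + q (- y)) / 2 + c) * (y - z) by apply: mulr_gt0; clear -w2 z2; lra.
      by clear; lra.
exists x, (r x); split; [lra|lra|].
move=> e e0.
have [||rx1 rx2] := hr x; try lra.
have [|e1 e10 he1] := rx1 (r x - e); first lra.
have [|e2 e20 he2] := rx2 (r x + e); first lra.
have [|e3 e30 he3] := left_ge x (q (- x) - e) x1 x2; first lra.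
have [|e4 e40 he4] := left_lt x (q (- x) + e) x1 x2; first lra.
exists (Num.min (Num.min e1 e2) (Num.min e3 e4)); first by apply: min_gt0; apply: min_gt0.
move=> h; rewrite !lt_min => /andP [/andP [a11 a12] /andP [a13 a14]].
clear near left_ge left_lt.
have [h0|h0|->] := ltgtP h 0; last by rewrite addr0 mul0r !subrr normr0 mulr0.
- have nh : `|h| = - h by rewrite ltr0_norm.
  rewrite nh in a13 a14 *.
  have t1 : x - e3 < x + h by clear -a13; lra.
  have t2 : x - e4 < x + h by clear -a14; lra.
  have t3 : x + h < x by clear -h0; lra.
  have := he3 _ t1 t3; have := he4 _ t2 t3.
  have -> : x - (x + h) = - h by ring.
  have -> : q (- x) = - r x by rewrite eqrq opprK.
  by rewrite ler_norml => b1' b2'; apply/andP; split; clear -b1' b2'; lra.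
- have nh : `|h| = h by rewrite gtr0_norm.
  rewrite nh in a11 a12 *.
  have t1 : x + h < x + e1 by clear -a11; lra.
  have t2 : x + h < x + e2 by clear -a12; lra.
  have t3 : x < x + h by clear -h0; lra.
  have := he1 _ t3 t1; have := he2 _ t3 t2.
  have -> : x + h - x = h by ring.
  by rewrite ler_norml => b1' b2'; apply/andP; split; clear -b1' b2'; lra.
Qed.

End MeanValue.

(** * Partial derivatives and weighted [C^q] bounds *)

Section Partial.
Variable R : rcfType.

Definition is_pd n (i : 'I_n) (f : 'rV[R]_n -> R) v l :=
  is_d (fun t => f (v + t *: delta_mx 0 i)) 0 l.
(** The default value 0 makes this a total function, so that iterated derivatives can be written and
    shown definable before their existence is discussed. *)
Definition pd n (i : 'I_n) (f : 'rV[R]_n -> R) v : R :=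
  if pselect (exists l, is_pd i f v l) is left h then projT1 (cid h) else 0.

Lemma pdE n (i : 'I_n) f v l : is_pd i f v l -> pd i f v = l.
Proof.
move=> h; rewrite /pd; case: pselect => [h'|]; last by case; exists l.
by case: cid => l' hl' /=; apply: is_d_uniq hl' h.
Qed.

Lemma ex_pdP n (i : 'I_n) f v : (exists l, is_pd i f v l) -> is_pd i f v (pd i f v).
Proof. by move=> [l h]; rewrite (pdE h). Qed.

Lemma mnorm_shift n (i : 'I_n) (v : 'rV[R]_n) t : mnorm (v + t *: delta_mx 0 i - v) <= `|t|.
Proof.
rewrite addrAC subrr add0r mnormZ -[leRHS]mulr1 ler_wpM2l // mnorm_le // => j.
by rewrite mxE eqxx /=; case: (j == i); rewrite ?normr1 ?normr0.
Qed.

Lemma shift0 n (i : 'I_n) (v : 'rV[R]_n) : v + 0 *: delta_mx 0 i = v.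
Proof. by rewrite scale0r addr0. Qed.

Lemma is_pd_ext n (i : 'I_n) f g v l :
  (exists2 d : R, 0 < d & forall y, mnorm (y - v) < d -> f y = g y) ->
  is_pd i f v l -> is_pd i g v l.
Proof.
move=> [d d0 hd]; apply: is_d_ext; exists d => // h hh; apply: hd; rewrite add0r.
exact: le_lt_trans (mnorm_shift _ _ _) hh.
Qed.

Lemma pd_ext n (i : 'I_n) f g v :
  (exists2 d : R, 0 < d & forall y, mnorm (y - v) < d -> f y = g y) -> pd i f v = pd i g v.
Proof.
move=> [d d0 hd]; have [[l hl]|h] := EM (exists l, is_pd i f v l).
  by rewrite (pdE hl); symmetry; apply: pdE; apply: is_pd_ext hl; exists d.
rewrite /pd; case: pselect => // _; case: pselect => // -[l hl]; case: h; exists l.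
by apply: is_pd_ext hl; exists d => // y /hd.
Qed.

Lemma is_pd_cst n (i : 'I_n) c v : is_pd i (fun _ => c) v 0.
Proof. exact: is_d_cst. Qed.

Lemma is_pd_coord n (i j : 'I_n) v : is_pd i (fun v => v 0 j) v (i == j)%:R.
Proof.
move=> e e0; exists 1 => // h _.
rewrite !mxE eqxx /= [i == j]eq_sym; set b := (j == i)%:R.
have -> : v 0 j + (0 + h) * b - (v 0 j + 0 * b) - h * b = 0 by ring.
rewrite normr0.
by rewrite mulr_ge0 // ltW.
Qed.

Lemma is_pdD n (i : 'I_n) f g v l l' : is_pd i f v l -> is_pd i g v l' ->
  is_pd i (fun v => f v + g v) v (l + l').
Proof. exact: is_dD. Qed.

Lemma is_pdN n (i : 'I_n) f v l : is_pd i f v l -> is_pd i (fun v => - f v) v (- l).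
Proof. exact: is_dN. Qed.

Lemma is_pdM n (i : 'I_n) f g v l l' : is_pd i f v l -> is_pd i g v l' ->
  is_pd i (fun v => f v * g v) v (l * g v + f v * l').
Proof. by move=> hf hg; have := is_dM hf hg; rewrite !shift0. Qed.

Lemma is_pdV n (i : 'I_n) f v l : is_pd i f v l -> f v != 0 ->
  is_pd i (fun v => (f v)^-1) v (- l / f v ^+ 2).
Proof. by move=> hf h0; have := is_dV hf; rewrite !shift0; apply. Qed.

Lemma is_pd_shift n (i : 'I_n) f v t l : is_pd i f (v + t *: delta_mx 0 i) l <->
  is_d (fun t => f (v + t *: delta_mx 0 i)) t l.
Proof.
rewrite is_d_shift /is_pd.
have -> // : (fun h => f (v + (t + h) *: delta_mx 0 i)) = (fun s => f (v + t *: delta_mx 0 i + s *: delta_mx 0 i)).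
by apply: funext => s; rewrite scalerDl addrA.
Qed.

Lemma cont_ext n (f g : 'rV[R]_n -> R) v :
  (exists2 d : R, 0 < d & forall y, mnorm (y - v) < d -> f y = g y) -> cont f v -> cont g v.
Proof.
move=> [d d0 hd] h e /h [d' d'0 hd']; exists (Num.min d d'); first exact: min_gt0.
move=> y; rewrite lt_min => /andP [y1 y2]; rewrite -hd // -(hd v) ?ball_center //.
exact: hd'.
Qed.

Lemma cont_cst n c (v : 'rV[R]_n) : cont (fun _ => c) v.
Proof. by move=> e e0; exists 1 => // y _; rewrite subrr normr0. Qed.

Lemma cont_coord n (j : 'I_n) (v : 'rV[R]_n) : cont (fun v => v 0 j) v.
Proof.
move=> e e0; exists e => // y hy; apply: le_lt_trans hy.
by have := mnorm_coord (y - v) j; rewrite !mxE.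
Qed.

Lemma cont_add n (f g : 'rV[R]_n -> R) v : cont f v -> cont g v -> cont (fun v => f v + g v) v.
Proof.
move=> hf hg e e0; have [|d d0 hd] := hf (e / 2); first lra.
have [|d' d'0 hd'] := hg (e / 2); first lra.
exists (Num.min d d'); first exact: min_gt0.
move=> y; rewrite lt_min => /andP [/hd y1 /hd' y2].
have -> : f y + g y - (f v + g v) = (f y - f v) + (g y - g v) by ring.
by apply: le_lt_trans (ler_normD _ _) _; lra.
Qed.

Lemma cont_mul n (f g : 'rV[R]_n -> R) v : cont f v -> cont g v -> cont (fun v => f v * g v) v.
Proof.
move=> hf hg e e0; have f0 := normr_ge0 (f v); have g0 := normr_ge0 (g v).
pose K : R := `|f v| + `|g v| + 1.
have K0 : 0 < K by rewrite /K; lra.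
have e10 : 0 < e / (2 * K) by rewrite divr_gt0 //; lra.
have [d d0 hd] := hf _ (min_gt0 e10 (ltr01 : 0 < 1 :> R)).
have [d' d'0 hd'] := hg _ e10.
exists (Num.min d d'); first exact: min_gt0.
move=> y; rewrite lt_min => /andP [/hd y1 /hd' y2]; move: y1; rewrite lt_min => /andP [y1 y1'].
have -> : f y * g y - f v * g v = f y * (g y - g v) + (f y - f v) * g v by ring.
apply: le_lt_trans (ler_normD _ _) _; rewrite !normrM.
have fy : `|f y| <= `|f v| + 1 by have := ler_normD (f y - f v) (f v); rewrite subrK; lra.
move: y1 y2; rewrite !ltr_pdivlMr; [|lra|lra] => y1 y2.
have p1 := normr_ge0 (f y - f v); have p2 := normr_ge0 (g y - g v); have p3 := normr_ge0 (f y).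
rewrite /K in y1 y2; clear -y1 y2 fy p1 p2 p3 f0 g0.
have q1 : `|f y| * `|g y - g v| <= (`|f v| + 1) * `|g y - g v| by rewrite ler_wpM2r.
nra.
Qed.

Lemma cont_inv n (f : 'rV[R]_n -> R) v : cont f v -> f v != 0 -> cont (fun v => (f v)^-1) v.
Proof.
move=> hf h0 e e0; pose a := `|f v|; have a0 : 0 < a by rewrite normr_gt0.
have h1 : 0 < a / 2 by lra.
have h2 : 0 < e * a ^+ 2 / 2 by rewrite divr_gt0 // mulr_gt0 // exprn_gt0.
have [d d0 hd] := hf _ (min_gt0 h1 h2); exists d => // y /hd; rewrite lt_min => /andP [y1 y2].
have fy : a / 2 <= `|f y|.
  by have := ler_normD (f v - f y) (f y); rewrite subrK distrC -/a; lra.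
have fy0 : f y != 0 by rewrite -normr_gt0; lra.
have -> : (f y)^-1 - (f v)^-1 = - (f y - f v) / (f y * f v) by field; rewrite ?fy0 ?h0.
rewrite normrM normrN normfV normrM -/a ltr_pdivrMr ?mulr_gt0 //; last lra.
apply: lt_le_trans y2 _; have -> : e * a ^+ 2 / 2 = e * (a / 2 * a) by ring.
by rewrite ler_wpM2l ?(ltW e0) // ler_wpM2r // ltW.
Qed.

Lemma open_near n (V : 'rV[R]_n -> Prop) v (f g : 'rV[R]_n -> R) : open_set V -> V v ->
  (forall y, V y -> f y = g y) -> exists2 d : R, 0 < d & forall y, mnorm (y - v) < d -> f y = g y.
Proof. by move=> oV /oV [d d0 hd] h; exists d => // y /hd /h. Qed.

(** The working notion of smoothness, by iterated continuous partial derivatives of scalar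
    functions. [Cq_Ck] and [Ck_Cq] relate it to [Cq] on open sets. *)
Fixpoint Ck (q : nat) n (V : 'rV[R]_n -> Prop) (f : 'rV[R]_n -> R) : Prop :=
  (forall v, V v -> cont f v) /\
  match q with
  | 0 => True
  | q'.+1 => forall i, (forall v, V v -> exists l, is_pd i f v l) /\ Ck q' V (pd i f)
  end.

(* All partial derivatives of order [k <= q] exist, are continuous and bounded by [w / s ^ k]. *)
Fixpoint WC (q : nat) n (V : 'rV[R]_n -> Prop) (w s f : 'rV[R]_n -> R) : Prop :=
  (forall v, V v -> cont f v /\ `|f v| <= w v) /\
  match q with
  | 0 => True
  | q'.+1 => forall i, (forall v, V v -> exists l, is_pd i f v l) /\
                       WC q' V (fun v => w v / s v) s (pd i f)
  end.

(** [Kinv] and [Kpos] are the constants that the inductions in [WC_inv] and [WC_pos] produce: the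
    first summand pays for the function, the second for its derivative, with a factor [2 ^+ q'] for
    each use of the product rule. *)
Fixpoint Kinv q (c : R) : R :=
  if q is q'.+1 then c^-1 + 2 ^+ q' * (2 ^+ q' * Kinv q' c ^+ 2) else c^-1.
Fixpoint Kpos q N : R :=
  if q is q'.+1 then 1 + 2 ^+ q' * (2 ^+ q' * (N%:R * Kpos q' N.-1)) else 1.

Lemma Kinv_gt0 q c : 0 < c -> 0 < Kinv q c.
Proof.
move=> c0; have ci : 0 < c^-1 by rewrite invr_gt0.
by elim: q => [//|q IH] /=; rewrite addr_gt0 // !mulr_gt0 ?exprn_gt0.
Qed.

Lemma Kpos_gt0 q N : 0 < Kpos q N.
Proof. by elim: q N => [//|q IH] N /=; rewrite ltr_pwDl // !mulr_ge0 ?exprn_ge0 // ltW. Qed.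

Section WCtheory.
Variables (n : nat) (V : 'rV[R]_n -> Prop) (s : 'rV[R]_n -> R).
Hypotheses (oV : open_set V) (s0 : forall v, V v -> 0 < s v).
Implicit Types f g w : 'rV[R]_n -> R.

Lemma WC_ext q f g w : (forall v, V v -> f v = g v) -> WC q V w s f -> WC q V w s g.
Proof.
elim: q f g w => [|q IH] f g w h /= [h1 h2].
  by split=> // v hv; have [h3 h4] := h1 v hv; split; [apply: cont_ext h3; apply: open_near h | rewrite -h].
split=> [v hv|i].
  by have [h3 h4] := h1 v hv; split; [apply: cont_ext h3; apply: open_near h | rewrite -h].
have [h3 h4] := h2 i; split.
  by move=> v hv; have [l hl] := h3 v hv; exists l; apply: is_pd_ext hl; apply: open_near h.
by apply: IH h4 => v hv; apply: pd_ext; apply: open_near h.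
Qed.

Lemma WC_bound q f w v : WC q V w s f -> V v -> `|f v| <= w v.
Proof. by case: q => [|q] [h _] /h []. Qed.

Lemma WC_cont q f w v : WC q V w s f -> V v -> cont f v.
Proof. by case: q => [|q] [h _] /h []. Qed.

Lemma WC_w0 q f w v : WC q V w s f -> V v -> 0 <= w v.
Proof. by move=> h hv; apply: le_trans (WC_bound h hv). Qed.

Lemma WC_mono q f w w' : (forall v, V v -> w v <= w' v) -> WC q V w s f -> WC q V w' s f.
Proof.
elim: q f w w' => [|q IH] f w w' h /= [h1 h2]; split=> //.
- by move=> v hv; have [h3 h4] := h1 v hv; split=> //; apply: le_trans h4 (h v hv).
- by move=> v hv; have [h3 h4] := h1 v hv; split=> //; apply: le_trans h4 (h v hv).
move=> i; have [h3 h4] := h2 i; split=> //; apply: IH h4 => v hv.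
by rewrite ler_wpM2r ?h // invr_ge0 ltW ?s0.
Qed.

Lemma WC_eq q f w w' : (forall v, V v -> w v = w' v) -> WC q V w s f -> WC q V w' s f.
Proof. by move=> h; apply: WC_mono => v hv; rewrite h. Qed.

Lemma WC_pred q f w : WC q.+1 V w s f -> WC q V w s f.
Proof.
elim: q f w => [|q IH] f w [h1 h2]; split=> // i.
by have [h3 h4] := h2 i; split=> //; apply: IH.
Qed.

Lemma WC_leq q q' f w : (q' <= q)%N -> WC q V w s f -> WC q' V w s f.
Proof.
elim: q => [|q IH]; first by rewrite leqn0 => /eqP ->.
by rewrite leq_eqVlt => /orP [/eqP -> //|/IH h /WC_pred /h].
Qed.

Lemma WC_cst q c : WC q V (fun _ => `|c|) s (fun _ => c).
Proof.
suff gen w : (forall v, V v -> `|c| <= w v) -> WC q V w s (fun _ => c) by apply: gen.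
elim: q c w => [|q IH] c w h /=; split=> //; try by move=> v hv; split; [apply: cont_cst | apply: h].
move=> i; split=> [v hv|]; first by exists 0; apply: is_pd_cst.
apply: (@WC_ext _ (fun _ => 0)) => [v hv|]; first by rewrite (pdE (is_pd_cst i c v)).
apply: IH => v hv; rewrite normr0; apply: divr_ge0; last exact/ltW/s0.
exact: le_trans (normr_ge0 _) (h v hv).
Qed.

Lemma WC_zero q w : (forall v, V v -> 0 <= w v) -> WC q V w s (fun _ => 0).
Proof. by move=> h; apply: WC_mono (WC_cst q 0) => v hv; rewrite normr0 h. Qed.

Lemma WC_add q f g w w' : WC q V w s f -> WC q V w' s g ->
  WC q V (fun v => w v + w' v) s (fun v => f v + g v).
Proof.
elim: q f g w w' => [|q IH] f g w w' [h1 h2] [k1 k2].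
  split=> // v hv; have [a1 a2] := h1 v hv; have [b1 b2] := k1 v hv.
  by split; [apply: cont_add | apply: le_trans (ler_normD _ _) (lerD a2 b2)].
split=> [v hv|i].
  have [a1 a2] := h1 v hv; have [b1 b2] := k1 v hv.
  by split; [apply: cont_add | apply: le_trans (ler_normD _ _) (lerD a2 b2)].
have [h3 h4] := h2 i; have [k3 k4] := k2 i.
have ex v : V v -> is_pd i (fun v => f v + g v) v (pd i f v + pd i g v).
  by move=> hv; apply: is_pdD; apply: ex_pdP; [apply: h3 | apply: k3].
split=> [v hv|]; first by exists (pd i f v + pd i g v); apply: ex.
apply: (@WC_ext _ (fun v => pd i f v + pd i g v)) => [v hv|]; first by rewrite (pdE (ex v hv)).
by apply: WC_eq (IH _ _ _ _ h4 k4) => v hv; rewrite mulrDl.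
Qed.

(** Each derivative of a product has two terms with the same weight divided by [s], whence one
    factor 2 per order. *)
Lemma WC_mul q f g w w' : WC q V w s f -> WC q V w' s g ->
  WC q V (fun v => 2 ^+ q * (w v * w' v)) s (fun v => f v * g v).
Proof.
elim: q f g w w' => [|q IH] f g w w' hf hg.
  have [h1 _] := hf; have [k1 _] := hg; split=> // v hv.
  have [a1 a2] := h1 v hv; have [b1 b2] := k1 v hv.
  by rewrite expr0 mul1r; split; [apply: cont_mul | rewrite normrM ler_pM].
split=> [v hv|i].
  have a1 := WC_cont hf hv; have b1 := WC_cont hg hv.
  split; first exact: cont_mul.
  have p := ler_pM (normr_ge0 _) (normr_ge0 _) (WC_bound hf hv) (WC_bound hg hv).
  rewrite normrM; apply: le_trans p _.
  rewrite ler_peMl ?mulr_ge0 ?(WC_w0 hf hv) ?(WC_w0 hg hv) //.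
  by rewrite exprn_ege1 // ler1n.
have [_ h2] := hf; have [_ k2] := hg.
have [h3 h4] := h2 i; have [k3 k4] := k2 i.
have ex v : V v -> is_pd i (fun v => f v * g v) v (pd i f v * g v + f v * pd i g v).
  by move=> hv; apply: is_pdM; apply: ex_pdP; [apply: h3 | apply: k3].
split=> [v hv|]; first by exists (pd i f v * g v + f v * pd i g v); apply: ex.
apply: (@WC_ext _ (fun v => pd i f v * g v + f v * pd i g v)) => [v hv|]; first by rewrite (pdE (ex v hv)).
apply: WC_eq (WC_add (IH _ _ _ _ h4 (WC_pred hg)) (IH _ _ _ _ (WC_pred hf) k4)) => v hv.
by rewrite exprS; field; apply/eqP; have := s0 hv; lra.
Qed.

Lemma WC_scal q c f w : WC q V w s f -> WC q V (fun v => 2 ^+ q * (`|c| * w v)) s (fun v => c * f v).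
Proof. by move=> hf; apply: WC_mul hf; apply: WC_cst. Qed.

Lemma WC_opp q f w : WC q V w s f -> WC q V w s (fun v => - f v).
Proof.
elim: q f w => [|q IH] f w /= [h1 h2]; split=> //.
- by move=> v /h1 [a1 a2]; split; [exact: cont_opp | rewrite normrN].
- by move=> v /h1 [a1 a2]; split; [exact: cont_opp | rewrite normrN].
move=> i; have [h3 h4] := h2 i.
have ex v : V v -> is_pd i (fun v => - f v) v (- pd i f v).
  by move=> hv; apply: is_pdN; apply: ex_pdP; apply: h3.
split=> [v hv|]; first by exists (- pd i f v); apply: ex.
apply: (@WC_ext _ (fun v => - pd i f v)) => [v hv|]; first by rewrite (pdE (ex v hv)).
exact: IH.
Qed.

Lemma WC_sum q (I : Type) (r : seq I) (P : pred I) (F W : I -> 'rV[R]_n -> R) :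
  (forall i, P i -> WC q V (W i) s (F i)) ->
  WC q V (fun v => \sum_(i <- r | P i) W i v) s (fun v => \sum_(i <- r | P i) F i v).
Proof.
move=> h; elim: r => [|i r IH].
  apply: (@WC_ext _ (fun _ => 0)) => [v _|]; first by rewrite big_nil.
  by apply: WC_zero => v _; rewrite big_nil.
have [hi|hi] := boolP (P i); last first.
  apply: (@WC_ext _ (fun v => \sum_(i <- r | P i) F i v)) => [v _|]; first by rewrite big_cons (negbTE hi).
  by apply: WC_eq IH => v _; rewrite big_cons (negbTE hi).
apply: (@WC_ext _ (fun v => F i v + \sum_(i <- r | P i) F i v)) => [v _|]; first by rewrite big_cons hi.
by apply: WC_eq (WC_add (h i hi) IH) => v _; rewrite big_cons hi.
Qed.

(** When [f] is comparable to its weight from below, [f' / f ^+ 2] has size [(w / s) / w ^+ 2], so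
    that the inverse has weight [1 / w] on the same scale [s]. *)
Lemma WC_inv q c f w : 0 < c -> WC q V w s f ->
  (forall v, V v -> 0 < w v) -> (forall v, V v -> c * w v <= `|f v|) ->
  WC q V (fun v => Kinv q c / w v) s (fun v => (f v)^-1).
Proof.
move=> c0; move: f w.
have bnd f w v : V v -> 0 < w v -> c * w v <= `|f v| -> f v != 0 /\ `|(f v)^-1| <= c^-1 / w v.
  move=> hv w0 h; have p : 0 < c * w v by exact: mulr_gt0.
  have q0 : f v != 0 by rewrite -normr_gt0; apply: lt_le_trans h.
  by split=> //; rewrite normfV -invfM lef_pV2 ?posrE // normr_gt0.
elim: q => [|q IH].
  move=> f w hf w0 hc; split=> // v hv.
  have [q0 q1] := bnd f w v hv (w0 v hv) (hc v hv).
  by split=> //; apply: cont_inv => //; apply: WC_cont hf hv.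
pose K := Kinv q c; have K0 : 0 < K := Kinv_gt0 q c0; pose K' := c^-1 + 2 ^+ q * (2 ^+ q * K ^+ 2).
have pp : 0 < 2 ^+ q * (2 ^+ q * K ^+ 2) :> R by rewrite !mulr_gt0 ?exprn_gt0.
have ci : 0 < c^-1 by rewrite invr_gt0.
have K'0 : 0 < K' by rewrite /K'; lra.
move=> f w hf w0 hc; rewrite /= -/K -/K'.
have le1 v : V v -> c^-1 / w v <= K' / w v.
  by move=> hv; rewrite ler_wpM2r ?invr_ge0 ?ltW ?w0 // /K'; lra.
split=> [v hv|i].
  have [q0 q1] := bnd f w v hv (w0 v hv) (hc v hv).
  split; first by apply: cont_inv => //; apply: WC_cont hf hv.
  exact: le_trans q1 (le1 v hv).
have [_ h2] := hf; have [h3 h4] := h2 i.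
have ex v : V v -> is_pd i (fun v => (f v)^-1) v (- pd i f v / f v ^+ 2).
  move=> hv; have [q0 q1] := bnd f w v hv (w0 v hv) (hc v hv).
  by apply: is_pdV => //; apply: ex_pdP; apply: h3.
split=> [v hv|]; first by exists (- pd i f v / f v ^+ 2); apply: ex.
apply: (@WC_ext _ (fun v => - pd i f v * ((f v)^-1 * (f v)^-1))) => [v hv|].
  by rewrite (pdE (ex v hv)) expr2 invfM.
have hI := IH f w (WC_pred hf) w0 hc.
apply: WC_mono (WC_mul (WC_opp h4) (WC_mul hI hI)) => v hv.
have sv := s0 hv; have wv := w0 v hv.
have -> : 2 ^+ q * (w v / s v * (2 ^+ q * (K / w v * (K / w v)))) = (2 ^+ q * (2 ^+ q * K ^+ 2)) / w v / s v.
  by field; apply/andP; split; apply/eqP; lra.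
by rewrite !ler_wpM2r ?invr_ge0 ?(ltW sv) ?(ltW wv) // /K'; lra.
Qed.

Lemma cont_pos (f : 'rV[R]_n -> R) v : cont f v -> cont (fun v => Num.max (f v) 0) v.
Proof.
move=> h e /h [d d0 hd]; exists d => // y /hd; apply: le_lt_trans.
have a1 := ler_norm (f y - f v); have a2 := ler_norm (f v - f y); rewrite distrC in a2.
by clear -a1 a2; case: (leP (f y) 0) => h1; case: (leP (f v) 0) => h2; rewrite ler_norml; apply/andP; split; lra.
Qed.

(** Only the zeros of [f] need care: there the positive part is bounded by a multiple of the step,
    and the exponent is at least 2. *)
Lemma is_pd_pos (i : 'I_n) f v l N : is_pd i f v l -> cont f v ->
  is_pd i (fun v => Num.max (f v) 0 ^+ N.+2) v (N.+2%:R * Num.max (f v) 0 ^+ N.+1 * l).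
Proof.
move=> hl hc.
have pw k : is_pd i (fun v => f v ^+ k) v (k%:R * f v ^+ k.-1 * l).
  elim: k => [|k IH]; first by rewrite !mul0r; apply: is_pd_cst.
  have := is_pdM hl IH.
  have -> : (fun v => f v * f v ^+ k) = (fun v => f v ^+ k.+1) by apply: funext => y; rewrite exprS.
  congr is_pd; case: k {IH} => [|k]; first by rewrite /= !expr0; ring.
  by rewrite /= [f v ^+ k.+1]exprS -[k.+2%:R]natr1; ring.
have [h|h|h] := ltgtP (f v) 0.
- have [|d d0 hd] := hc (- f v); first lra.
  rewrite expr0n /= mulr0 mul0r; apply: is_pd_ext (is_pd_cst i 0 v); exists d => // y /hd.
  rewrite ltr_norml => /andP [_ h2]; rewrite (max_idPr _) ?expr0n //; lra.
- have [d d0 hd] := hc (f v) h.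
  apply: is_pd_ext (pw N.+2); exists d => // y /hd.
  by rewrite ltr_norml => /andP [h2 _]; rewrite (max_idPl _) //; lra.
rewrite h expr0n /= mulr0 mul0r => e e0.
have [d d0 hd] := is_d_ccont hl ltr01.
have [d1 d10 hd1] := hl 1 ltr01.
pose K : R := 1 + `|l|; have l0 := normr_ge0 l.
have K0 : 0 < K by rewrite /K; lra.
have [d2 d20 hd2] : exists2 d2 : R, 0 < d2 & d2 * K ^+ 2 <= e.
  by exists (e / K ^+ 2); [rewrite divr_gt0 // exprn_gt0 | rewrite divfK // expf_neq0 //; lra].
exists (Num.min (Num.min d d1) d2); first by rewrite !lt_min d0 d10.
move=> t; rewrite !lt_min => /andP [/andP [t1 t2] t3].
have := hd (0 + t); rewrite addrAC subrr add0r => /(_ t1); have := hd1 t t2.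
rewrite !add0r shift0 h !subr0 maxxx expr0n /= subr0 mulr0 subr0 mul1r.
set F := f _ => b1 b2; have t0 := normr_ge0 t.
have b3 : `|F| <= K * `|t|.
  have := ler_normD (F - t * l) (t * l); rewrite subrK normrM /K => b; clear -b b1; lra.
pose m := Num.max F 0; have m0 : 0 <= m by exact: maxR.
have m1 : m <= `|F| by rewrite ge_max ler_norm normr_ge0.
have m2 : m <= 1 by clear -m1 b2; lra.
rewrite -/m ger0_norm ?exprn_ge0 //.
have -> : N.+2 = (N + 2)%N by rewrite addn2.
rewrite exprD; apply: le_trans (_ : m ^+ 2 <= _).
  by rewrite ler_piMl ?exprn_ge0 // exprn_ile1.
have m3 : m <= K * `|t| by exact: le_trans m1 b3.
apply: le_trans (_ : (K * `|t|) ^+ 2 <= _); first by rewrite lerXn2r // nnegrE mulr_ge0 // ltW.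
have -> : (K * `|t|) ^+ 2 = `|t| * (`|t| * K ^+ 2) by ring.
rewrite mulrC ler_wpM2r //; apply: le_trans hd2; rewrite ler_wpM2r ?exprn_ge0 // ltW //.
Qed.

(** Truncated powers supply cut-offs of finite smoothness; since the exponent exceeds [q], a
    positive power survives [q] differentiations. *)
Lemma WC_pos q N f w : (q < N)%N -> WC q V w s f ->
  WC q V (fun v => Kpos q N * w v ^+ N) s (fun v => Num.max (f v) 0 ^+ N).
Proof.
move: f w.
have pwb (f w : 'rV[R]_n -> R) v k : `|f v| <= w v -> `|Num.max (f v) 0 ^+ k| <= w v ^+ k.
  move=> h; have m0 : 0 <= Num.max (f v) 0 by exact: maxR.
  rewrite ger0_norm ?exprn_ge0 // lerXn2r ?nnegrE //; first exact: le_trans h.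
  by apply: le_trans h; rewrite ge_max ler_norm normr_ge0.
have pwc (f : 'rV[R]_n -> R) v k : cont f v -> cont (fun v => Num.max (f v) 0 ^+ k) v.
  move=> /cont_pos h; elim: k => [|k IH]; first exact: cont_cst.
  have -> : (fun v => Num.max (f v) 0 ^+ k.+1) = (fun v => Num.max (f v) 0 * Num.max (f v) 0 ^+ k).
    by apply: funext => y; rewrite exprS.
  exact: cont_mul.
elim: q N => [|q IH] N f w hN.
  move=> [h _]; split=> // v /h [h1 h2].
  by split; [exact: pwc | rewrite mul1r; exact: pwb].
case: N hN => [//|[//|N]] hN; pose K := Kpos q N.+1; have K0 : 0 < K := Kpos_gt0 q N.+1.
pose K' : R := 1 + 2 ^+ q * (2 ^+ q * (N.+2%:R * K)).
have pp : 0 < 2 ^+ q * (2 ^+ q * (N.+2%:R * K)) by rewrite !mulr_gt0 ?exprn_gt0.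
move=> hf; have K'E : Kpos q.+1 N.+2 = K' by [].
rewrite K'E; split=> [v hv|i].
  have b := WC_bound hf hv; split; first by apply: pwc; apply: WC_cont hf hv.
  apply: le_trans (pwb _ _ _ _ b) _; rewrite ler_peMl //; first by rewrite exprn_ge0 // (WC_w0 hf hv).
  by rewrite /K'; lra.
have [_ h2] := hf; have [h3 h4] := h2 i.
have ex v : V v -> is_pd i (fun v => Num.max (f v) 0 ^+ N.+2) v (N.+2%:R * Num.max (f v) 0 ^+ N.+1 * pd i f v).
  by move=> hv; apply: is_pd_pos; [apply: ex_pdP; apply: h3 | apply: WC_cont hf hv].
split=> [v hv|]; first by eexists; apply: ex.
apply: (@WC_ext _ (fun v => N.+2%:R * Num.max (f v) 0 ^+ N.+1 * pd i f v)) => [v hv|]; first by rewrite (pdE (ex v hv)).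
apply: WC_mono (WC_mul (WC_scal N.+2%:R (IH N.+1 f w hN (WC_pred hf))) h4) => v hv.
have sv := s0 hv; have wv := WC_w0 hf hv.
rewrite normr_nat; have -> : 2 ^+ q * (2 ^+ q * (N.+2%:R * (K * w v ^+ N.+1)) * (w v / s v)) =
  (2 ^+ q * (2 ^+ q * (N.+2%:R * K))) * w v ^+ N.+2 / s v by rewrite (exprS _ N.+1); field; lra.
by rewrite !ler_wpM2r ?invr_ge0 ?exprn_ge0 ?(ltW sv) // /K'; lra.
Qed.

End WCtheory.
End Partial.

Section MoreCk.
Variable R : rcfType.
Implicit Types n q : nat.

Lemma WC_sub q n (V V' : 'rV[R]_n -> Prop) w s f : (forall v, V' v -> V v) ->
  WC q V w s f -> WC q V' w s f.
Proof.
move=> h; elim: q w f => [|q IH] w f /= [h1 h2]; split=> //; try by move=> v /h /h1.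
by move=> i; have [h3 h4] := h2 i; split; [move=> v /h /h3 | exact: IH].
Qed.

Lemma WC_scale q n (V : 'rV[R]_n -> Prop) w s s' f :
  (forall v, V v -> 0 < s' v) -> (forall v, V v -> s' v <= s v) -> WC q V w s f -> WC q V w s' f.
Proof.
move=> s0 hs; elim: q w f => [|q IH] w f // h; have [h1 h2] := h; split=> // i.
have [h3 h4] := h2 i; split=> //; apply: WC_mono (IH _ _ h4) => // v hv.
apply: ler_wpM2l; first exact: WC_w0 h hv.
by rewrite lef_pV2 ?posrE ?s0 ?hs //; apply: lt_le_trans (hs v hv); apply: s0.
Qed.

Lemma WC_coord q n (V : 'rV[R]_n -> Prop) (w s : 'rV[R]_n -> R) j : open_set V ->
  (forall v, V v -> 0 < s v) -> (forall v, V v -> `|v 0 j| <= w v) -> (forall v, V v -> s v <= w v) ->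
  WC q V w s (fun v => v 0 j).
Proof.
move=> oV s0 h1 h2; case: q => [|q]; split=> //; try by move=> v hv; split; [exact: cont_coord | exact: h1].
move=> i; split=> [v hv|]; first by exists (i == j)%:R; apply: is_pd_coord.
apply: (@WC_ext _ _ _ _ oV _ (fun _ => (i == j)%:R)) => [v hv|]; first by rewrite (pdE (is_pd_coord i j v)).
apply: WC_mono (WC_cst oV s0 q _) => // v hv.
rewrite ler_pdivlMr ?s0 //; case: (i == j); rewrite ?normr1 ?normr0 ?mul1r ?mul0r ?h2 //.
exact: le_trans (normr_ge0 _) (h1 v hv).
Qed.

(** Plain smoothness is the weighted notion with scale 1 and some weight, so its closure properties
    are read off from those of [WC]. *)
Lemma Ck_WC q n (V : 'rV[R]_n -> Prop) f : Ck q V f <-> exists w, WC q V w (fun _ => 1) f.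
Proof.
elim: q f => [|q IH] f; split.
- by move=> [h _]; exists (fun v => `|f v|); split=> // v /h.
- by move=> [w [h _]]; split=> // v /h [].
- move=> [h1 h2].
  have [W hW] := choice (fun i => (IH (pd i f)).1 (h2 i).2).
  exists (fun v => `|f v| + \sum_i `|W i v|); split.
    move=> v hv; split; first exact: h1.
    by rewrite lerDl sumr_ge0.
  move=> i; split; first exact: (h2 i).1.
  apply: WC_mono (hW i) => // v hv; rewrite divr1 (bigD1 i) //=.
  have := ler_norm (W i v); have := normr_ge0 (f v).
  have : 0 <= \sum_(j | j != i) `|W j v| by apply: sumr_ge0.
  lra.
- move=> [w [h1 h2]]; split=> [v /h1 [] //|i]; have [h3 h4] := h2 i; split=> //.
  by apply/IH; exists (fun v => w v / 1).
Qed.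

Section CkClosure.
Variables (n : nat) (V : 'rV[R]_n -> Prop).
Hypothesis oV : open_set V.
Implicit Types f g : 'rV[R]_n -> R.
Let one : 'rV[R]_n -> R := fun _ => 1.
Let one0 v : V v -> 0 < one v. Proof. by rewrite /one. Qed.

Lemma Ck_ext q f g : (forall v, V v -> f v = g v) -> Ck q V f -> Ck q V g.
Proof. by move=> h /Ck_WC [w hw]; apply/Ck_WC; exists w; apply: WC_ext h hw. Qed.
Lemma Ck_cst q c : Ck q V (fun _ => c).
Proof. by apply/Ck_WC; exists (fun _ => `|c|); apply: WC_cst. Qed.
Lemma Ck_coord q j : Ck q V (fun v => v 0 j).
Proof.
apply/Ck_WC; exists (fun v => 1 + `|v 0 j|); apply: WC_coord => // v _; first by rewrite lerDr.
by rewrite lerDl.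
Qed.
Lemma Ck_add q f g : Ck q V f -> Ck q V g -> Ck q V (fun v => f v + g v).
Proof. by move=> /Ck_WC [w hw] /Ck_WC [w' hw']; apply/Ck_WC; eexists; apply: (WC_add oV one0 hw hw'). Qed.
Lemma Ck_opp q f : Ck q V f -> Ck q V (fun v => - f v).
Proof. by move=> /Ck_WC [w hw]; apply/Ck_WC; eexists; apply: WC_opp; eassumption. Qed.
Lemma Ck_mul q f g : Ck q V f -> Ck q V g -> Ck q V (fun v => f v * g v).
Proof. by move=> /Ck_WC [w hw] /Ck_WC [w' hw']; apply/Ck_WC; eexists; apply: WC_mul hw hw'. Qed.
Lemma Ck_sum q (I : Type) (r : seq I) (P : pred I) (F : I -> 'rV[R]_n -> R) :
  (forall i, P i -> Ck q V (F i)) -> Ck q V (fun v => \sum_(i <- r | P i) F i v).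
Proof.
move=> h; elim: r => [|i r IH].
  by apply: (Ck_ext _ (Ck_cst q 0)) => v _; rewrite big_nil.
have [hi|hi] := boolP (P i); last by apply: Ck_ext IH => v _; rewrite big_cons (negbTE hi).
by apply: Ck_ext (Ck_add (h i hi) IH) => v _; rewrite big_cons hi.
Qed.
Lemma Ck_exp q f k : Ck q V f -> Ck q V (fun v => f v ^+ k).
Proof.
move=> hf; elim: k => [|k IH]; first exact: Ck_cst.
by apply: Ck_ext (Ck_mul hf IH) => v _; rewrite exprS.
Qed.
Lemma Ck_leq q q' f : (q' <= q)%N -> Ck q V f -> Ck q' V f.
Proof. by move=> h /Ck_WC [w hw]; apply/Ck_WC; exists w; apply: WC_leq hw. Qed.
Lemma Ck_sub q (V' : 'rV[R]_n -> Prop) f : (forall v, V' v -> V v) -> Ck q V f -> Ck q V' f.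
Proof. by move=> h /Ck_WC [w hw]; apply/Ck_WC; exists w; apply: WC_sub hw. Qed.
Lemma Ck_cont q f v : Ck q V f -> V v -> cont f v.
Proof. by case: q => [|q] [h _]; apply: h. Qed.
Lemma Ck_pd q f i : Ck q.+1 V f -> Ck q V (pd i f).
Proof. by move=> [_ /(_ i) []]. Qed.
Lemma Ck_ispd q f i v : Ck q.+1 V f -> V v -> is_pd i f v (pd i f v).
Proof. by move=> [_ /(_ i) [h _]] hv; apply: ex_pdP; apply: h. Qed.
Lemma Ck_inv q f : (forall v, V v -> f v != 0) -> Ck q V f -> Ck q V (fun v => (f v)^-1).
Proof.
move=> f0; elim: q f f0 => [|q IH] f f0 hf.
  by split=> // v hv; apply: cont_inv; [apply: Ck_cont hf hv | exact: f0].
split=> [v hv|i]; first by apply: cont_inv; [apply: Ck_cont hf hv | exact: f0].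
have ex v : V v -> is_pd i (fun v => (f v)^-1) v (- pd i f v / f v ^+ 2).
  by move=> hv; apply: is_pdV; [apply: Ck_ispd hf hv | exact: f0].
split=> [v hv|]; first by eexists; apply: ex.
have hI := IH f f0 (Ck_leq (leqnSn q) hf).
apply: Ck_ext (Ck_mul (Ck_opp (Ck_pd i hf)) (Ck_mul hI hI)) => v hv.
by rewrite (pdE (ex v hv)) expr2 invfM.
Qed.
End CkClosure.

Definition CkAt q n (f : 'rV[R]_n -> R) v := exists2 r : R, 0 < r & Ck q (fun y => mnorm (y - v) < r) f.

Lemma open_ball n (a : 'rV[R]_n) r : open_set (fun y => mnorm (y - a) < r).
Proof.
move=> x hx; exists (r - mnorm (x - a)); first lra.
by have [] := subball_inner hx.
Qed.

Lemma Ck_at q n (V : 'rV[R]_n -> Prop) f v : open_set V -> Ck q V f -> V v -> CkAt q f v.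
Proof. by move=> oV hf /oV [d d0 hd]; exists d => //; apply: Ck_sub hf. Qed.

Lemma Ck_local q n (V : 'rV[R]_n -> Prop) f : (forall v, V v -> CkAt q f v) -> Ck q V f.
Proof.
elim: q f => [|q IH] f h.
  by split=> // v /h [r r0 [hr _]]; apply: hr; apply: ball_center.
split=> [v /h [r r0 [hr _]]|i]; first by apply: hr; apply: ball_center.
split=> [v /h [r r0 [_ /(_ i) [hr _]]]|]; first by apply: hr; apply: ball_center.
by apply: IH => v /h [r r0 [_ /(_ i) [_ hr]]]; exists r.
Qed.

Lemma CkAt_open q n (f : 'rV[R]_n -> R) : open_set (CkAt q f).
Proof.
move=> v [r r0 hr]; exists r => // y hy; apply: (Ck_at (@open_ball _ v r) hr hy).
Qed.

Lemma CkAt_ext q n (f g : 'rV[R]_n -> R) v :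
  (exists2 d : R, 0 < d & forall y, mnorm (y - v) < d -> f y = g y) -> CkAt q f v -> CkAt q g v.
Proof.
move=> [d d0 hd] [r r0 hr]; exists (Num.min d r); first exact: min_gt0.
apply: (@Ck_ext _ _ (@open_ball _ _ _) _ f) => [y|]; first by rewrite lt_min => /andP [/hd].
by apply: Ck_sub hr => y; rewrite lt_min => /andP [].
Qed.

(** Projection to the coordinates selected by [sg]; it is used for injective [sg], in any order. *)
Definition prj d m (sg : 'I_d -> 'I_m) (v : 'rV[R]_m) : 'rV[R]_d := \row_k v 0 (sg k).

Lemma prjB d m (sg : 'I_d -> 'I_m) v w : prj sg v - prj sg w = prj sg (v - w).
Proof. by apply/rowP => k; rewrite !mxE. Qed.
Lemma mnorm_prj d m (sg : 'I_d -> 'I_m) v : mnorm (prj sg v) <= mnorm v.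
Proof. by apply: mnorm_le (mnorm_ge0 _) _ => k; rewrite mxE mnorm_coord. Qed.
Lemma open_prj d m (sg : 'I_d -> 'I_m) B : open_set B -> open_set (fun v => B (prj sg v)).
Proof.
move=> oB v /oB [e e0 he]; exists e => // y hy; apply: he; rewrite prjB.
exact: le_lt_trans (mnorm_prj _ _) hy.
Qed.
Lemma prj_shift d m (sg : 'I_d -> 'I_m) v i t : injective sg -> prj sg (v + t *: delta_mx 0 i) =
  prj sg v + (if [pick k | sg k == i] is Some k then t *: delta_mx 0 k else 0).
Proof.
move=> inj; apply/rowP => k; rewrite !mxE; case: pickP => [j /eqP <-|h].
  by rewrite !mxE (inj_eq inj).
by rewrite mxE h andbF mulr0.
Qed.

Lemma is_pd_prj d m (sg : 'I_d -> 'I_m) (f : 'rV[R]_d -> R) v k l : injective sg ->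
  is_pd k f (prj sg v) l -> is_pd (sg k) (fun v => f (prj sg v)) v l.
Proof.
move=> inj; apply: is_d_ext; exists 1 => // h _; rewrite prj_shift //.
case: pickP => [j /eqP /inj -> //|/(_ k)]; by rewrite eqxx.
Qed.

Lemma is_pd_prj0 d m (sg : 'I_d -> 'I_m) (f : 'rV[R]_d -> R) v i : injective sg ->
  (forall k, sg k != i) -> is_pd i (fun v => f (prj sg v)) v 0.
Proof.
move=> inj hi; apply: (is_d_ext _ (is_d_cst (f (prj sg v)) 0)); exists 1 => // h _.
rewrite prj_shift //; case: pickP => [j hj|_]; first by have := hi j; rewrite hj.
by rewrite addr0.
Qed.

Lemma cont_prj d m (sg : 'I_d -> 'I_m) f v : cont f (prj sg v) -> cont (fun v => f (prj sg v)) v.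
Proof.
move=> h e /h [r r0 hr]; exists r => // y hy; apply: hr; rewrite prjB.
exact: le_lt_trans (mnorm_prj _ _) hy.
Qed.

Lemma WC_prj q d m (sg : 'I_d -> 'I_m) (B : 'rV[R]_d -> Prop) w s f : injective sg -> open_set B ->
  (forall x, B x -> 0 < s x) -> WC q B w s f ->
  WC q (fun v => B (prj sg v)) (fun v => w (prj sg v)) (fun v => s (prj sg v)) (fun v => f (prj sg v)).
Proof.
move=> inj oB s0; have oV := open_prj (sg := sg) oB.
elim: q w f => [|q IH] w f h; have [h1 h2] := h.
  by split=> // v /h1 [c b]; split=> //; exact: cont_prj.
split=> [v /h1 [c b]|i]; first by split=> //; exact: cont_prj.
have [/existsP [k /eqP <-]|/existsPn hno] := boolP [exists k, sg k == i].
  have [h3 h4] := h2 k; split=> [v /h3 [l hl]|]; first by exists l; apply: is_pd_prj.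
  apply: (@WC_ext _ _ _ _ oV _ (fun v => pd k f (prj sg v))) (IH _ _ h4) => v hv.
  by symmetry; apply: pdE; apply: is_pd_prj => //; apply: ex_pdP; apply: h3.
split=> [v _|]; first by exists 0; apply: is_pd_prj0.
apply: (@WC_ext _ _ _ _ oV _ (fun _ => 0)) => [v hv|].
  by symmetry; apply: pdE; apply: is_pd_prj0.
apply: WC_zero => // v hv; first exact: s0.
by apply: divr_ge0; [exact: WC_w0 h hv | exact/ltW/s0].
Qed.

Lemma Ck_prj q d m (sg : 'I_d -> 'I_m) (B : 'rV[R]_d -> Prop) f : injective sg -> open_set B ->
  Ck q B f -> Ck q (fun v => B (prj sg v)) (fun v => f (prj sg v)).
Proof. by move=> inj oB /Ck_WC [w hw]; apply/Ck_WC; eexists; apply: WC_prj hw. Qed.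

(* A function decaying quadratically at the boundary of [U], together with its derivatives,
   extends by zero. *)
Lemma WC_glue q n (Om U : 'rV[R]_n -> Prop) w u : open_set Om -> open_set U ->
  (forall x, Om x -> ~ U x -> u x = 0) -> WC q U w (fun _ => 1) u ->
  (forall x a, U x -> Om a -> ~ U a -> w x <= mnorm (x - a) ^+ 2) ->
  WC q Om (fun x => if `[< U x >] then w x else 0) (fun _ => 1) u.
Proof.
move=> oO oU.
have zero (u1 : 'rV[R]_n -> R) w1 a : (forall x, Om x -> ~ U x -> u1 x = 0) ->
   (forall x, U x -> `|u1 x| <= w1 x) -> (forall x a, U x -> Om a -> ~ U a -> w1 x <= mnorm (x - a) ^+ 2) ->
   Om a -> ~ U a -> cont u1 a /\ forall i, is_pd i u1 a 0.
  move=> u0 uw wa Oa nUa; have [r r0 hr] := oO a Oa.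
  have bd x : mnorm (x - a) < r -> `|u1 x| <= mnorm (x - a) ^+ 2.
    move=> hx; have [Ux|nUx] := EM (U x); first exact: le_trans (uw x Ux) (wa x a Ux Oa nUa).
    by rewrite u0 ?normr0 ?exprn_ge0 ?mnorm_ge0 //; apply: hr.
  have ua : u1 a = 0 by exact: u0.
  split=> [e e0|i e e0].
    exists (Num.min r (Num.min 1 e)); first by rewrite !lt_min r0 e0 ltr01.
    move=> x; rewrite !lt_min ua subr0 => /andP [x1 /andP [x2 x3]].
    apply: le_lt_trans (bd x x1) _; apply: le_lt_trans x3.
    by rewrite expr2 ler_piMl ?mnorm_ge0 // ltW.
  exists (Num.min r e); first exact: min_gt0.
  move=> h; rewrite lt_min => /andP [h1 h2]; rewrite add0r shift0 ua mulr0 !subr0.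
  have ms := mnorm_shift i a h; have m0 := mnorm_ge0 (a + h *: delta_mx 0 i - a).
  apply: le_trans (bd _ (le_lt_trans ms h1)) _; rewrite expr2.
  apply: ler_pM => //; exact: le_trans ms (ltW h2).
elim: q w u => [|q IH] w u u0 h wa; have [h1 h2] := h.
  split=> // x Ox; case: asboolP => [Ux|nUx]; first exact: h1.
  have [c _] := zero u w x u0 (fun y hy => (h1 y hy).2) wa Ox nUx.
  by split=> //; rewrite u0 ?normr0.
split=> [x Ox|i].
  case: asboolP => [Ux|nUx]; first exact: h1.
  have [c _] := zero u w x u0 (fun y hy => (h1 y hy).2) wa Ox nUx.
  by split=> //; rewrite u0 ?normr0.
have pdz x : Om x -> ~ U x -> is_pd i u x 0.
  by move=> Ox nUx; have [_] := zero u w x u0 (fun y hy => (h1 y hy).2) wa Ox nUx.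
have [h3 h4] := h2 i; split.
  by move=> x Ox; have [/h3 //|nUx] := EM (U x); exists 0; apply: pdz.
have h5 : WC q U w (fun _ => 1) (pd i u) by apply: WC_mono h4 => // v _; rewrite divr1.
have := IH w (pd i u) _ h5 wa.
move=> h6; apply: WC_mono (h6 _) => // [v _|x Ox nUx].
  by case: asboolP => _; rewrite divr1.
exact: pdE (pdz x Ox nUx).
Qed.

End MoreCk.

Section DefCk.
Variables (R : rcfType) (S : ominimal_expansion R).
Local Notation Def := (Def S).
Local Notation Dfun := (Dfun S).

Lemma Def_is_pd n (i : 'I_n) (f : 'rV[R]_n -> R) : Dfun f ->
  Def (fun p : 'rV[R]_n * R => is_pd i f p.1 p.2).
Proof. by move=> hf; rewrite /is_pd /is_d; definable. Qed.

Lemma Dfun_pd n (i : 'I_n) (f : 'rV[R]_n -> R) : Dfun f -> Dfun (pd i f).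
Proof.
move=> hf; have hP := Def_is_pd i hf.
apply: (Dfun_graph (A := fun v r => is_pd i f v r \/ (~ (exists l, is_pd i f v l) /\ r = 0))).
  by definable.
move=> v r; split=> [[/pdE //|[h ->]]|<-]; first by rewrite /pd; case: pselect.
have [h|h] := EM (exists l, is_pd i f v l); first by left; apply: ex_pdP.
by right; split=> //; rewrite /pd; case: pselect.
Qed.

Lemma Def_cont n (f : 'rV[R]_n -> R) : Dfun f -> Def (cont f).
Proof. by move=> hf; rewrite /cont; definable. Qed.

Lemma Def_Ck q n (f : 'rV[R]_n -> R) : Dfun f ->
  Def (fun p : 'rV[R]_n * R => Ck q (fun y => mnorm (y - p.1) < p.2) f).
Proof.
elim: q f => [|q IH] f hf /=; have hc := Def_cont hf; apply: Def_and; try by definable.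
apply: Def_all_fin => i; have hp := Def_is_pd i hf; apply: Def_and; first by definable.
exact: IH (Dfun_pd i hf).
Qed.

Lemma Def_CkAt q n (f : 'rV[R]_n -> R) : Dfun f -> Def (CkAt q f).
Proof. by move=> hf; have h := @Def_Ck q n f hf; rewrite /CkAt; apply: Def_ex2; definable. Qed.

Lemma Dfun_prj d m (sg : 'I_d -> 'I_m) : Dfun (@prj R d m sg).
Proof. by rewrite /prj; definable. Qed.

(** By dichotomy a partial derivative exists either everywhere or nowhere on some ball, and the
    second case contradicts one-variable differentiability on a line through the centre. Then the
    induction on [q] applies to the partial derivatives. *)
Lemma generic_Ck q n (f : 'rV[R]_n -> R) a (r : R) : Dfun f -> 0 < r ->
  exists a' r', subball a r a' r' /\ forall x, mnorm (x - a') < r' -> CkAt q f x.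
Proof.
move=> hf; elim: q f hf a r => [|q IH] f hf a r r0.
  have [a' [r' [h1 h2]]] := @generic_continuity R S n f a r hf r0; exists a', r'; split=> // x hx.
  by have [e e0 he] := @open_ball R n a' r' x hx; exists e => //; split=> // y /he /h2.
have [a1 [r1 [h1 c1]]] := @IH f hf a r r0.
have [|a2 [r2 [h2 c2]]] := @refine_fin R n n (fun i x => exists l, is_pd i f x l) _ a1 r1 h1.1.
  move=> i b s s0 {a1 r1 h1 c1}.
  have hp := Def_is_pd i hf.
  have hD : Def (fun x => exists l, is_pd i f x l) by definable.
  have [b' [s' [k1 [k2|k2]]]] := @dichotomy R S n _ b s hD s0; first by exists b', s'.
  exfalso; have hg : Dfun (fun t => f (b' + t *: delta_mx 0 i)) by definable.
  have [|t [l [t1 t2 hl]]] := @differentiable_somewhere R S _ (- s') s' hg; first by have := k1.1; lra.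
  case: (k2 (b' + t *: delta_mx 0 i)).
    by apply: le_lt_trans (mnorm_shift _ _ _) _; rewrite ltr_norml t1.
  by exists l; apply/is_pd_shift.
have [|a3 [r3 [h3 c3]]] := @refine_fin R n n (fun i => CkAt q (pd i f)) _ a2 r2 h2.1.
  by move=> i b s s0; apply: IH => //; apply: Dfun_pd.
exists a3, r3; split; first by apply: subball_trans h3; apply: subball_trans h2.
move=> x hx; exists (r3 - mnorm (x - a3)); first by lra.
have inn y : mnorm (y - x) < r3 - mnorm (x - a3) -> mnorm (y - a3) < r3.
  by have [_] := subball_inner hx; apply.
split=> [y /inn hy|i].
  have [e e0 he] := c1 y (h2.2 _ (h3.2 _ hy)).
  by apply: Ck_cont he _; apply: ball_center.
split=> [y /inn hy|]; first by apply: c2; apply: h3.2.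
by apply: Ck_local => y /inn hy; apply: c3.
Qed.

End DefCk.

(** * Total derivatives, composition and symmetry of second derivatives *)

Section Frechet.
Variable R : rcfType.

Definition frechet n (f : 'rV[R]_n -> R) a (L : 'I_n -> R) := forall e : R, 0 < e ->
  exists2 d : R, 0 < d & forall x, mnorm (x - a) < d ->
    `|f x - f a - \sum_j (x 0 j - a 0 j) * L j| <= e * mnorm (x - a).

Lemma is_d_chain n (f : 'rV[R]_n -> R) (G : R -> 'rV[R]_n) t L (l : 'I_n -> R) :
  frechet f (G t) L -> (forall j, is_d (fun t => G t 0 j) t (l j)) ->
  is_d (fun t => f (G t)) t (\sum_j l j * L j).
Proof.
move=> hf hG e e0.
pose K : R := 1 + \sum_j `|l j|; pose M : R := 1 + \sum_j `|L j|.
have sl : 0 <= \sum_j `|l j| by apply: sumr_ge0.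
have sL : 0 <= \sum_j `|L j| by apply: sumr_ge0.
have K0 : 0 < K by rewrite /K; lra.
have M0 : 0 < M by rewrite /M; lra.
have e10 : 0 < e / (2 * K) by rewrite divr_gt0 //; lra.
have e20 : 0 < e / (2 * M) by rewrite divr_gt0 //; lra.
have [d d0 hd] := hf _ e10.
have e30 := min_gt0 e20 (ltr01 : 0 < 1 :> R).
have [D hD] := choice (fun j => let: ex_intro2 x p q := hG j _ e30 in
  ex_intro (fun x => 0 < x /\ forall h, `|h| < x -> `|G (t + h) 0 j - G t 0 j - h * l j| <= Num.min (e / (2 * M)) 1 * `|h|) x (conj p q)).
have [dl dl0 hdl] := finite_min (fun j => (hD j).1).
exists (Num.min dl (d / K)); first by apply: min_gt0 => //; exact: divr_gt0.
move=> h; rewrite lt_min ltr_pdivlMr // => /andP [h1 h2]; have h0 := normr_ge0 h.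
have near j : `|G (t + h) 0 j - G t 0 j - h * l j| <= Num.min (e / (2 * M)) 1 * `|h|.
  by apply: (hD j).2; apply: lt_le_trans h1 (hdl j).
have near1 j : `|G (t + h) 0 j - G t 0 j - h * l j| <= e / (2 * M) * `|h|.
  by apply: le_trans (near j) _; rewrite ler_wpM2r // minL.
have H : mnorm (G (t + h) - G t) <= K * `|h|.
  apply: mnorm_le => [|j]; first by rewrite mulr_ge0 // ltW.
  have n1 : `|G (t + h) 0 j - G t 0 j - h * l j| <= 1 * `|h|.
    by apply: le_trans (near j) _; rewrite ler_wpM2r // minR.
  have n2 := ler_normD (G (t + h) 0 j - G t 0 j - h * l j) (h * l j).
  rewrite subrK normrM in n2; rewrite !mxE.
  have n3 : `|l j| <= \sum_j `|l j| by rewrite (bigD1 j) //= lerDl sumr_ge0.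
  have n4 := ler_wpM2l h0 n3; rewrite /K; clear -n1 n2 n4; lra.
have b1 := hd (G (t + h)) (le_lt_trans H _).
have {}b1 : `|f (G (t + h)) - f (G t) - \sum_j (G (t + h) 0 j - G t 0 j) * L j| <= e / 2 * `|h|.
  apply: le_trans (b1 _) _; first by rewrite mulrC.
  have -> : e / 2 * `|h| = e / (2 * K) * (K * `|h|) by field; lra.
  by rewrite ler_wpM2l // ltW.
have b2 : `|\sum_j (G (t + h) 0 j - G t 0 j - h * l j) * L j| <= e / 2 * `|h|.
  apply: le_trans (ler_norm_sum _ _ _) _.
  apply: le_trans (_ : \sum_j (e / (2 * M) * `|h|) * `|L j| <= _).
    by apply: ler_sum => j _; rewrite normrM ler_wpM2r.
  rewrite -mulr_sumr; have -> : e / 2 * `|h| = e / (2 * M) * `|h| * M by field; lra.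
  apply: ler_wpM2l; first by apply: mulr_ge0 => //; exact: ltW.
  by rewrite /M; clear; lra.
have -> : f (G (t + h)) - f (G t) - h * (\sum_j l j * L j) =
  (f (G (t + h)) - f (G t) - \sum_j (G (t + h) 0 j - G t 0 j) * L j) +
  \sum_j (G (t + h) 0 j - G t 0 j - h * l j) * L j.
  have -> : \sum_j (G (t + h) 0 j - G t 0 j - h * l j) * L j =
    \sum_j (G (t + h) 0 j - G t 0 j) * L j - h * (\sum_j l j * L j).
    by rewrite mulr_sumr -sumrB; apply: eq_bigr => j _; ring.
  ring.
by apply: le_trans (ler_normD _ _) _; clear -b1 b2; lra.
Qed.

Lemma cont_comp n k (f : 'rV[R]_k -> R) (G : 'rV[R]_n -> 'rV[R]_k) v :
  cont f (G v) -> (forall j, cont (fun v => G v 0 j) v) -> cont (fun v => f (G v)) v.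
Proof.
move=> hf hG e /hf [d d0 hd].
have [D hD] := choice (fun j => let: ex_intro2 x p q := hG j _ d0 in
  ex_intro (fun x => 0 < x /\ forall y, mnorm (y - v) < x -> `|G y 0 j - G v 0 j| < d) x (conj p q)).
have [dl dl0 hdl] := finite_min (fun j => (hD j).1).
exists dl => // y hy; apply: hd; apply: mnorm_lt => // j; rewrite !mxE.
by apply: (hD j).2; apply: lt_le_trans hy (hdl j).
Qed.

(** Bounds for the derivatives of the outer function [F], evaluated along [G], by a weight that
    lives on the source. In this form the weight may vary with the point of the source, as the
    estimate for compositions requires. *)
Fixpoint PB q n k (V : 'rV[R]_n -> Prop) (G : 'rV[R]_n -> 'rV[R]_k) (w : 'rV[R]_n -> R)
    (F : 'rV[R]_k -> R) : Prop :=
  (forall v, V v -> `|F (G v)| <= w v) /\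
  match q with 0 => True | q'.+1 => forall j, PB q' V G w (pd j F) end.

Lemma PB_mono q n k (V : 'rV[R]_n -> Prop) (G : 'rV[R]_n -> 'rV[R]_k) w w' F :
  (forall v, V v -> w v <= w' v) -> PB q V G w F -> PB q V G w' F.
Proof.
move=> h; elim: q F => [|q IH] F /= [h1 h2]; split=> //; try by move=> v hv; apply: le_trans (h1 v hv) (h v hv).
by move=> j; apply: IH.
Qed.

Lemma PB_exists q n k (V : 'rV[R]_n -> Prop) (G : 'rV[R]_n -> 'rV[R]_k) F : exists w, PB q V G w F.
Proof.
elim: q F => [|q IH] F; first by exists (fun v => `|F (G v)|).
have [W hW] := choice (fun j => IH (pd j F)).
exists (fun v => `|F (G v)| + \sum_j `|W j v|); split; first by move=> v _; rewrite lerDl sumr_ge0.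
move=> j; apply: PB_mono (hW j) => v _; rewrite (bigD1 j) //=.
have := ler_norm (W j v); have := normr_ge0 (F (G v)).
have : 0 <= \sum_(i | i != j) `|W i v| by apply: sumr_ge0.
lra.
Qed.

End Frechet.

Section FrechetDef.
Variables (R : rcfType) (S : ominimal_expansion R).
Local Notation Def := (Def S).
Local Notation Dfun := (Dfun S).

Lemma mean_value_dir n (f : 'rV[R]_n -> R) (i : 'I_n) z (h L M : R) : Dfun f ->
  (forall t, 0 <= t -> t <= 1 -> exists2 l, is_pd i f (z + (t * h) *: delta_mx 0 i) l & `|l - L| <= M) ->
  `|f (z + h *: delta_mx 0 i) - f z - h * L| <= M * `|h|.
Proof.
move=> hf hd.
have hg : Dfun (fun t => f (z + (0 + h * t) *: delta_mx 0 i) - t * (h * L)) by definable.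
have := @mean_value_abs R S _ 0 1 (M * `|h|) hg ler01.
rewrite !mulr0 !mulr1 !add0r mul0r mul1r shift0 !subr0 mulr1.
have -> : f (z + h *: delta_mx 0 i) - h * L - f z = f (z + h *: delta_mx 0 i) - f z - h * L by ring.
apply=> t t0 t1; have [l hl hlM] := hd t t0 t1.
exists (h * l - h * L); last by rewrite -mulrBr normrM mulrC ler_wpM2r.
apply: is_dD; last first.
  have := is_dN (is_dM (is_d_id t) (is_d_cst (h * L) t)).
  by rewrite mul1r mulr0 addr0.
apply: (@is_d_affine _ (fun s => f (z + s *: delta_mx 0 i)) 0 h).
by apply/is_pd_shift; rewrite add0r mulrC.
Qed.

Lemma frechet_C1 n (f : 'rV[R]_n -> R) (V : 'rV[R]_n -> Prop) a : Dfun f -> open_set V ->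
  Ck 1 V f -> V a -> frechet f a (fun j => pd j f a).
Proof.
move=> hf oV hC Va e e0.
have n1 : 0 < n%:R + 1 :> R by have := ler0n R n; lra.
have e10 : 0 < e / (n%:R + 1) by exact: divr_gt0.
have [r r0 hr] := oV a Va.
have hc j : cont (pd j f) a by apply: (Ck_cont (Ck_pd j hC)).
have [D hD] := choice (fun j => let: ex_intro2 x p q := hc j _ e10 in
  ex_intro (fun x => 0 < x /\ forall y, mnorm (y - a) < x -> `|pd j f y - pd j f a| < e / (n%:R + 1)) x (conj p q)).
have [dl dl0 hdl] := finite_min (fun j => (hD j).1).
exists (Num.min r dl); first exact: min_gt0.
move=> x hx.
(* The path from [a] to [x] changes one coordinate at a time, so each step is a one-variable mean
   value estimate. *)
pose z (k : nat) : 'rV[R]_n := \row_i (if (i < k)%N then x 0 i else a 0 i).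
have z0 : z 0%N = a by apply/rowP => i; rewrite mxE.
have zn : z n = x by apply/rowP => i; rewrite mxE ltn_ord.
have zS (k : 'I_n) : z k.+1 = z k + (x 0 k - a 0 k) *: delta_mx 0 k.
  apply/rowP => i; rewrite !mxE eqxx /= ltnS leq_eqVlt -val_eqE /=.
  by case: (ltngtP i k) => [h|h|/val_inj ->] /=; rewrite ?mulr0 ?addr0 ?mulr1 //; ring.
have step (k : 'I_n) : `|f (z k.+1) - f (z k) - (x 0 k - a 0 k) * pd k f a| <= e / (n%:R + 1) * mnorm (x - a).
  rewrite zS; apply: le_trans (_ : e / (n%:R + 1) * `|x 0 k - a 0 k| <= _); last first.
    by rewrite ler_wpM2l ?(ltW e10) //; have := mnorm_coord (x - a) k; rewrite !mxE.
  apply: mean_value_dir => // t t0 t1.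
  have inb : mnorm (z k + (t * (x 0 k - a 0 k)) *: delta_mx 0 k - a) < Num.min r dl.
    apply: le_lt_trans hx; apply: mnorm_le (mnorm_ge0 _) _ => i; rewrite !mxE eqxx /=.
    have hi := mnorm_coord (x - a) i; rewrite !mxE in hi.
    case: (eqVneq i k) => [->|hik]; last first.
      by rewrite mulr0 addr0; case: ifP => _ //; rewrite subrr normr0 mnorm_ge0.
    rewrite ltnn mulr1 addrAC subrr add0r normrM (ger0_norm t0).
    have hk := mnorm_coord (x - a) k; rewrite !mxE in hk.
    by apply: le_trans hk; rewrite ler_piMl.
  exists (pd k f (z k + (t * (x 0 k - a 0 k)) *: delta_mx 0 k)).
    by apply: (Ck_ispd k hC); apply: hr; apply: lt_le_trans inb (minL _ _).
  apply/ltW; apply: (hD k).2; apply: lt_le_trans inb _.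
  exact: le_trans (minR _ _) (hdl k).
have -> : f x - f a - \sum_j (x 0 j - a 0 j) * pd j f a =
   \sum_(k < n) (f (z k.+1) - f (z k) - (x 0 k - a 0 k) * pd k f a).
  rewrite big_split /= sumrN; congr (_ - _).
  rewrite -(big_mkord xpredT (fun k => f (z k.+1) - f (z k))) telescope_sumr //.
  by rewrite z0 zn.
apply: le_trans (ler_norm_sum _ _ _) _.
apply: le_trans (_ : \sum_(k < n) e / (n%:R + 1) * mnorm (x - a) <= _).
  by apply: ler_sum => k _; apply: step.
rewrite sumr_const card_ord -[X in X <= _]mulr_natl.
have -> : n%:R * (e / (n%:R + 1) * mnorm (x - a)) = (n%:R / (n%:R + 1)) * (e * mnorm (x - a)) by ring.
rewrite ler_piMl ?mulr_ge0 ?mnorm_ge0 ?(ltW e0) // ler_pdivrMr //; lra.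
Qed.

(** The constant depends only on the order and on the dimension of the middle space. It is therefore
    available before the functions are constructed, which the choice of the weight [tgt] relies
    on. *)
Lemma WC_comp q k : exists2 K : R, 0 < K & forall n (V : 'rV[R]_n -> Prop) (V' : 'rV[R]_k -> Prop)
    (G : 'rV[R]_n -> 'rV[R]_k) (F : 'rV[R]_k -> R) (ka w : 'rV[R]_n -> R),
  open_set V -> open_set V' -> Dfun F -> Ck q V' F -> (forall v, V v -> V' (G v)) ->
  (forall v, V v -> 1 <= ka v) -> (forall j, WC q V ka (fun _ => 1) (fun v => G v 0 j)) ->
  PB q V G w F -> WC q V (fun v => K * ka v ^+ q * w v) (fun _ => 1) (fun v => F (G v)).
Proof.
elim: q => [|q [K K0 IH]].
  exists 1 => // n V V' G F ka w oV oV' hF hC hG ka1 hGj [hPB _]; split=> // v hv.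
  split; last by rewrite expr0 !mul1r; apply: hPB.
  by apply: cont_comp => [|j]; [apply: Ck_cont hC (hG v hv) | apply: WC_cont (hGj j) hv].
pose K' : R := 1 + k%:R * (2 ^+ q * K).
have p0 : 0 <= k%:R * (2 ^+ q * K) by rewrite mulr_ge0 ?ler0n // mulr_ge0 ?exprn_ge0 // ltW.
exists K'; first by rewrite /K'; lra.
move=> n V V' G F ka w oV oV' hF hC hG ka1 hGj hPB; have [hP0 hP1] := hPB.
have one0 (v : 'rV[R]_n) : V v -> 0 < (1 : R) by [].
have wv v : V v -> 0 <= w v by move=> hv; apply: le_trans (hP0 v hv).
split=> [v hv|i].
  split; first by apply: cont_comp => [|j]; [apply: Ck_cont hC (hG v hv) | apply: WC_cont (hGj j) hv].
  apply: le_trans (hP0 v hv) _; rewrite ler_peMl ?wv //.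
  have k1 : 1 <= ka v ^+ q.+1 by apply: exprn_ege1; apply: ka1.
  have K1 : 1 <= K' by rewrite /K'; lra.
  by clear -k1 K1; nra.
have ex v : V v -> is_pd i (fun v => F (G v)) v (\sum_j pd i (fun v => G v 0 j) v * pd j F (G v)).
  move=> hv; apply: (@is_d_chain R k F (fun t => G (v + t *: delta_mx 0 i))).
    by rewrite shift0; apply: (frechet_C1 hF oV' (Ck_leq _ hC)) => //; apply: hG.
  by move=> j; have [_ /(_ i) [h3 _]] := hGj j; apply: ex_pdP; apply: h3.
split=> [v hv|]; first by eexists; apply: ex.
apply: (@WC_ext _ _ _ _ oV _ (fun v => \sum_j pd i (fun v => G v 0 j) v * pd j F (G v))).
  by move=> v hv; rewrite (pdE (ex v hv)).
have hj j : WC q V (fun v => 2 ^+ q * (ka v / 1 * (K * ka v ^+ q * w v))) (fun _ => 1)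
     (fun v => pd i (fun v => G v 0 j) v * pd j F (G v)).
  apply: WC_mul => //; first by have [_ /(_ i) []] := hGj j.
  apply: (IH n V V') => //; [exact: Dfun_pd | exact: Ck_pd | by move=> l; apply: WC_pred | exact: hP1].
apply: WC_mono (WC_sum oV one0 (index_enum _) (fun j _ => hj j)) => // v hv.
rewrite sumr_const card_ord -[X in X <= _]mulr_natl !divr1.
have -> : k%:R * (2 ^+ q * (ka v * (K * ka v ^+ q * w v))) = k%:R * (2 ^+ q * K) * ka v ^+ q.+1 * w v.
  by rewrite exprS; ring.
rewrite ler_wpM2r ?wv // ler_wpM2r ?exprn_ge0 //; first by apply: le_trans (ka1 v hv).
by rewrite /K'; lra.
Qed.

Lemma Ck_comp q n k (V : 'rV[R]_n -> Prop) (V' : 'rV[R]_k -> Prop)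
    (G : 'rV[R]_n -> 'rV[R]_k) (F : 'rV[R]_k -> R) :
  open_set V -> open_set V' -> Dfun F -> Ck q V' F -> (forall v, V v -> V' (G v)) ->
  (forall j, Ck q V (fun v => G v 0 j)) -> Ck q V (fun v => F (G v)).
Proof.
move=> oV oV' hF hC hG hGj.
have [K K0 hK] := WC_comp q k.
have [W hW] := choice (fun j => (Ck_WC q V _).1 (hGj j)).
have [w hw] := PB_exists q V G F.
apply/Ck_WC; eexists; apply: (hK n V V' G F (fun v => 1 + \sum_j `|W j v|) w) => //.
  by move=> v _; rewrite lerDl sumr_ge0.
move=> j; apply: WC_mono (hW j) => // v _; rewrite (bigD1 j) //=.
have := ler_norm (W j v); have : 0 <= \sum_(i | i != j) `|W i v| by apply: sumr_ge0.
lra.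
Qed.

Lemma second_difference n (f : 'rV[R]_n -> R) (V : 'rV[R]_n -> Prop) i j v : Dfun f -> open_set V ->
  Ck 2 V f -> V v -> forall e : R, 0 < e -> exists2 d : R, 0 < d & forall h, 0 < h -> h < d ->
  `|f (v + h *: delta_mx 0 j + h *: delta_mx 0 i) - f (v + h *: delta_mx 0 j)
    - f (v + h *: delta_mx 0 i) + f v - h * h * pd i (pd j f) v| <= e * h * h.
Proof.
move=> hf oV hC Vv e e0; have [r r0 hr] := oV v Vv.
have hCj := Ck_pd j hC; have hCi := Ck_pd i hCj.
have [d d0 hd] := Ck_cont hCi Vv e0.
exists (Num.min r d / 2); first by rewrite divr_gt0 //; exact: min_gt0.
move=> h h0 hh; set A := pd i (pd j f) v.
have inb s t : `|s| <= h -> `|t| <= h -> mnorm (v + s *: delta_mx 0 j + t *: delta_mx 0 i - v) < Num.min r d.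
  move=> hs ht; have := mnormB_tri (v + s *: delta_mx 0 j + t *: delta_mx 0 i) (v + s *: delta_mx 0 j) v.
  have := mnorm_shift j v s; have := mnorm_shift i (v + s *: delta_mx 0 j) t; clear -hs ht hh; lra.
have inr s t : `|s| <= h -> `|t| <= h -> V (v + s *: delta_mx 0 j + t *: delta_mx 0 i).
  by move=> hs ht; apply: hr; apply: lt_le_trans (inb s t hs ht) (minL _ _).
have inner s : `|s| <= h -> `|pd j f (v + s *: delta_mx 0 j + h *: delta_mx 0 i) - pd j f (v + s *: delta_mx 0 j) - h * A| <= e * h.
  move=> hs; rewrite -{3}(ger0_norm (ltW h0)).
  apply: mean_value_dir; first exact: Dfun_pd.
  move=> t t0 t1; have th : `|t * h| <= h by rewrite normrM (ger0_norm t0) (gtr0_norm h0) ler_piMl // ltW.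
  exists (pd i (pd j f) (v + s *: delta_mx 0 j + (t * h) *: delta_mx 0 i)).
    by apply: (Ck_ispd i hCj); apply: inr.
  by apply/ltW; apply: hd; apply: lt_le_trans (inb s _ hs th) (minR _ _).
have hg : Dfun (fun y => f (y + h *: delta_mx 0 i) - f y) by definable.
have := @mean_value_dir n (fun y => f (y + h *: delta_mx 0 i) - f y) j v h (h * A) (e * h) hg.
rewrite (gtr0_norm h0) => key.
have -> : f (v + h *: delta_mx 0 j + h *: delta_mx 0 i) - f (v + h *: delta_mx 0 j) -
   f (v + h *: delta_mx 0 i) + f v - h * h * A =
   f (v + h *: delta_mx 0 j + h *: delta_mx 0 i) - f (v + h *: delta_mx 0 j) -
   (f (v + h *: delta_mx 0 i) - f v) - h * (h * A) by ring.
apply: key => t t0 t1.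
have th : `|t * h| <= h by rewrite normrM (ger0_norm t0) (gtr0_norm h0) ler_piMl // ltW.
exists (pd j f (v + (t * h) *: delta_mx 0 j + h *: delta_mx 0 i) - pd j f (v + (t * h) *: delta_mx 0 j)).
  apply: is_pdD; last apply: is_pdN.
    rewrite /is_pd.
    have -> : (fun s => f (v + (t * h) *: delta_mx 0 j + s *: delta_mx 0 j + h *: delta_mx 0 i)) =
      (fun s => f (v + (t * h) *: delta_mx 0 j + h *: delta_mx 0 i + s *: delta_mx 0 j)).
      by apply: funext => s; rewrite addrAC.
    by apply: (Ck_ispd j hC); apply: inr => //; rewrite gtr0_norm.
  by apply: (Ck_ispd j hC); have := inr (t * h) 0 th; rewrite shift0; apply; rewrite normr0 ltW.
by apply: inner.
Qed.

(** Both mixed derivatives are approximated, up to [e * h * h], by one second difference that is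
    symmetric in the two directions. *)
Lemma pdC n (f : 'rV[R]_n -> R) (V : 'rV[R]_n -> Prop) i j v : Dfun f -> open_set V ->
  Ck 2 V f -> V v -> pd i (pd j f) v = pd j (pd i f) v.
Proof.
move=> hf oV hC Vv; apply/eqP; rewrite -subr_eq0 -normr_le0 leNgt; apply/negP => p.
set A := pd i _ _ in p; set B := pd j _ _ in p.
have e0 : 0 < `|A - B| / 4 by lra.
have [d d0 hd] := second_difference i j hf oV hC Vv e0.
have [d' d'0 hd'] := second_difference j i hf oV hC Vv e0.
have m0 := min_gt0 d0 d'0; pose h := Num.min d d' / 2.
have h0 : 0 < h by rewrite /h; lra.
have [h1 h2] : h < d /\ h < d' by have := minL d d'; have := minR d d'; rewrite /h; split; lra.
have b1 := hd h h0 h1; have b2 := hd' h h0 h2.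
rewrite (addrAC v (h *: delta_mx 0 i) (h *: delta_mx 0 j)) in b2.
move: b1 b2; rewrite -/A -/B.
set X := f (_ + _ + _); set Y := f (v + h *: delta_mx 0 j); set Z := f (v + h *: delta_mx 0 i) => b1 b2.
have b3 : h * h * `|A - B| <= `|X - Y - Z + f v - h * h * A| + `|X - Z - Y + f v - h * h * B|.
  have -> : h * h * `|A - B| = `|(X - Z - Y + f v - h * h * B) - (X - Y - Z + f v - h * h * A)|.
    have -> : (X - Z - Y + f v - h * h * B) - (X - Y - Z + f v - h * h * A) = h * h * (A - B) by ring.
    by rewrite normrM (ger0_norm (mulr_ge0 (ltW h0) (ltW h0))).
  by rewrite (addrC `|_|) ler_normB.
have : 0 < h * h * `|A - B| by apply: mulr_gt0 => //; apply: mulr_gt0.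
by clear -b1 b2 b3; lra.
Qed.

Lemma continuous_on_cont n k (U : 'rV[R]_n -> Prop) (f : 'rV[R]_n -> 'rV[R]_k) v j : open_set U ->
  continuous_on U f -> U v -> cont (fun v => f v 0 j) v.
Proof.
move=> oU hf Uv e e0; have [r r0 hr] := oU v Uv; have [d d0 hd] := hf v Uv e e0.
exists (Num.min r d); first exact: min_gt0.
move=> y; rewrite lt_min => /andP [/hr y1 y2]; have := hd y y1 y2.
by apply: le_lt_trans; have := mnorm_coord (f y - f v) j; rewrite !mxE.
Qed.

(** Testing the derivative matrix on multiples of a basis vector identifies its entries with partial
    derivatives. *)
Lemma Cq_Ck q n k (U : 'rV[R]_n -> Prop) (f : 'rV[R]_n -> 'rV[R]_k) : open_set U ->
  Cq q U f -> forall j, Ck q U (fun v => f v 0 j).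
Proof.
move=> oU; elim: q k f => [|q IH] k f.
  by move=> hf j; split=> // v Uv; apply: continuous_on_cont hf Uv.
move=> [D [hD hDq]] j.
have ex i v : U v -> is_pd i (fun v => f v 0 j) v (D v i j).
  move=> Uv e e0; have [r r0 hr] := oU v Uv; have [d d0 hd] := hD v Uv e e0.
  exists (Num.min r d); first exact: min_gt0.
  move=> h; rewrite lt_min add0r shift0 => /andP [h1 h2].
  have sh := mnorm_shift i v h.
  have := hd (v + h *: delta_mx 0 i) (hr _ (le_lt_trans sh h1)) (le_lt_trans sh h2).
  move=> /(le_trans (mnorm_coord _ j)) b.
  have {}b := le_trans b (ler_wpM2l (ltW e0) sh); apply: le_trans b.
  rewrite (_ : v + h *: delta_mx 0 i - v = h *: delta_mx 0 i); last by rewrite addrAC subrr add0r.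
  rewrite -scalemxAl -rowE !mxE.
  by rewrite le_eqVlt eqxx.
split=> [v Uv|i].
  move=> e e0; have [r r0 hr] := oU v Uv; have [d d0 hd] := hD v Uv 1 ltr01.
  pose M : R := 1 + \sum_i `|D v i j|; have sM : 0 <= \sum_i `|D v i j| by apply: sumr_ge0.
  have M0 : 0 < M by rewrite /M; lra.
  exists (Num.min (Num.min r d) (e / M)); first by rewrite !lt_min r0 d0 divr_gt0.
  move=> y; rewrite !lt_min ltr_pdivlMr // => /andP [/andP [y1 y2] y3].
  have := hd y (hr y y1) y2; rewrite mul1r => /(le_trans (mnorm_coord _ j)).
  rewrite !mxE => b; apply: le_lt_trans y3.
  have y0 := mnorm_ge0 (y - v).
  have b2 : `|\sum_i (y - v) 0 i * D v i j| <= mnorm (y - v) * \sum_i `|D v i j|.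
    apply: le_trans (ler_norm_sum _ _ _) _; rewrite mulr_sumr; apply: ler_sum => i _.
    by rewrite normrM ler_wpM2r // mnorm_coord.
  have b3 := ler_normD (f y 0 j - f v 0 j - \sum_i (y - v) 0 i * D v i j) (\sum_i (y - v) 0 i * D v i j).
  rewrite subrK in b3; rewrite /M mulrDr mulr1; clear -b b2 b3; lra.
split=> [v Uv|]; first by exists (D v i j); apply: ex.
apply: (@Ck_ext _ _ _ oU _ (fun v => mxvec (D v) 0 (mxvec_index i j))); last exact: IH.
by move=> v Uv; rewrite mxvecE (pdE (ex i v Uv)).
Qed.

Lemma Ck_Cq q n k (U : 'rV[R]_n -> Prop) (f : 'rV[R]_n -> 'rV[R]_k) : open_set U ->
  Dfun f -> (forall j, Ck q U (fun v => f v 0 j)) -> Cq q U f.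
Proof.
move=> oU; elim: q k f => [|q IH] k f hf hC.
  move=> v Uv e e0.
  have [D hD] := choice (fun j => let: ex_intro2 x p q := (Ck_cont (hC j) Uv) e e0 in
    ex_intro (fun x => 0 < x /\ forall y, mnorm (y - v) < x -> `|f y 0 j - f v 0 j| < e) x (conj p q)).
  have [dl dl0 hdl] := finite_min (fun j => (hD j).1).
  exists dl => // y _ hy; apply: mnorm_lt => // j; rewrite !mxE.
  by apply: (hD j).2; apply: lt_le_trans hy (hdl j).
have hfj j : Dfun (fun v => f v 0 j) by definable.
exists (fun v => \matrix_(i, j) pd i (fun v => f v 0 j) v); split.
  move=> v Uv e e0.
  have fr j := frechet_C1 (hfj j) oU (Ck_leq (isT : (1 <= q.+1)%N) (hC j)) Uv.
  have [D hD] := choice (fun j => let: ex_intro2 x p q := fr j e e0 in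
    ex_intro (fun x => 0 < x /\ forall y, mnorm (y - v) < x -> `|f y 0 j - f v 0 j - \sum_i (y 0 i - v 0 i) * pd i (fun v => f v 0 j) v| <= e * mnorm (y - v)) x (conj p q)).
  have [dl dl0 hdl] := finite_min (fun j => (hD j).1).
  exists dl => // y _ hy; apply: mnorm_le; first by rewrite mulr_ge0 ?mnorm_ge0 // ltW.
  move=> j; have := (hD j).2 y (lt_le_trans hy (hdl j)).
  rewrite !mxE; congr (_ <= _); congr (Num.norm (_ - _)).
  by apply: eq_bigr => i _; rewrite !mxE.
apply: IH.
  apply: Dfun_row => l; case/mxvec_indexP: l => i j.
  have -> : (fun v => mxvec (\matrix_(i, j) pd i (fun v => f v 0 j) v) 0 (mxvec_index i j)) = pd i (fun v => f v 0 j).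
    by apply: funext => v; rewrite mxvecE mxE.
  exact: Dfun_pd.
move=> l; case/mxvec_indexP: l => i j.
apply: (@Ck_ext _ _ _ oU _ (pd i (fun v => f v 0 j))) => [v _|]; first by rewrite mxvecE mxE.
exact: Ck_pd.
Qed.

Lemma Cq_ext q n k (U : 'rV[R]_n -> Prop) (f g : 'rV[R]_n -> 'rV[R]_k) :
  (forall v, U v -> f v = g v) -> Cq q U f -> Cq q U g.
Proof.
case: q => [|q] h.
  move=> hf v Uv e e0; have [d d0 hd] := hf v Uv e e0; exists d => // x Ux hx.
  by rewrite -!h //; apply: hd.
move=> [D [hD hDq]]; exists D; split=> // v Uv e e0; have [d d0 hd] := hD v Uv e e0.
by exists d => // x Ux hx; rewrite -!h //; apply: hd.
Qed.

End FrechetDef.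

(** * Slowly varying minorants *)

Section Slow.
Variables (R : rcfType) (S : ominimal_expansion R).
Local Notation Def := (Def S).
Local Notation Dfun := (Dfun S).

Definition oint (e : R) (v : 'rV[R]_1) := 0 < v 0 0 /\ v 0 0 < e.

Lemma open_oint e : open_set (oint e).
Proof.
move=> v [v1 v2]; exists (Num.min (v 0 0) (e - v 0 0)); first by apply: min_gt0; lra.
move=> y; rewrite lt_min => /andP [h1 h2].
have := mnorm_coord (y - v) 0; rewrite !mxE => h3.
have := le_lt_trans h3 h1; have := le_lt_trans h3 h2; rewrite !ltr_norml => /andP [? ?] /andP [? ?].
by split; lra.
Qed.

Lemma mnorm1 (v : 'rV[R]_1) (r : R) : 0 < r -> (mnorm v < r) = (`|v 0 0| < r).
Proof.
move=> r0; apply/idP/idP => h; first exact: le_lt_trans (mnorm_coord _ _) h.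
by apply: mnorm_lt => // i; rewrite (ord1 i).
Qed.

(** By the germ dichotomy the property holds or fails on a whole interval to the right of 0, and
    genericity excludes failure. *)
Lemma near_zero (P : 'rV[R]_1 -> Prop) : Def P ->
  (forall a r, 0 < r -> exists a' r', subball a r a' r' /\ forall x, mnorm (x - a') < r' -> P x) ->
  exists2 e : R, 0 < e & forall v, oint e v -> P v.
Proof.
move=> hP gen; have hP1 : Def (fun t => P (const_mx t)).
  have hc : Dfun (fun t : R => const_mx t : 'rV[R]_1).
    apply: Dfun_row => i; have -> : (fun t : R => (const_mx t : 'rV[R]_1) 0 i) = id by apply: funext => t; rewrite mxE.
    exact: Dfun_id.
  exact: Def_comp hP hc.
have cst (v : 'rV[R]_1) : v = const_mx (v 0 0) by apply/rowP => i; rewrite mxE (ord1 i).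
have [e e0 [h|h]] := germ_right 0 hP1; rewrite add0r in h.
  by exists e => // v [v1 v2]; rewrite (cst v); apply: h.
exfalso; have [|a [r [h1 h2]]] := gen (const_mx (e / 2)) (e / 2); first lra.
have := subball_center h1; rewrite mnorm1; last lra.
rewrite !mxE ltr_norml => /andP [a1 a2].
by apply: (h (a 0 0)); [lra | lra | rewrite -cst; apply: h2; apply: ball_center; exact: h1.1].
Qed.

Lemma sign_near_zero (f : 'rV[R]_1 -> R) : Dfun f ->
  exists2 e : R, 0 < e & (forall v, oint e v -> 0 <= f v) \/ (forall v, oint e v -> f v <= 0).
Proof.
move=> hf.
have hP : Def (fun v => CkAt 0 (fun y => if 0 <= f y then 1 else 0) v).
  by apply: Def_CkAt; apply: Dfun_iteb; definable.
have hc : Dfun (fun t : R => const_mx t : 'rV[R]_1).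
  apply: Dfun_row => i; have -> : (fun t : R => (const_mx t : 'rV[R]_1) 0 i) = id by apply: funext => t; rewrite mxE.
  exact: Dfun_id.
have hA : Def (fun t => 0 <= f (const_mx t)) by definable.
have cst (v : 'rV[R]_1) : v = const_mx (v 0 0) by apply/rowP => i; rewrite mxE (ord1 i).
have [e e0 [h|h]] := germ_right 0 hA; rewrite add0r in h; exists e => //; [left | right] => v [v1 v2].
  by rewrite (cst v); apply: h.
by rewrite leNgt; apply/negP => h1; apply: (h (v 0 0)) => //; rewrite -cst; apply: ltW.
Qed.

(* With [f'] monotone, the variation of [f] on the half interval next to [t] on which [|f'|] is
   largest bounds [|f' t|]. *)
Lemma deriv_bound_mono (f g h : R -> R) (e : R) : Dfun f -> Dfun g ->
  (forall t, 0 < t -> t < e -> is_d f t (g t)) -> (forall t, 0 < t -> t < e -> is_d g t (h t)) ->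
  (forall t, 0 < t -> t < e -> 0 <= h t) \/ (forall t, 0 < t -> t < e -> h t <= 0) ->
  forall t (B : R), 0 < t -> t < e / 2 -> (forall s, t / 2 <= s -> s <= 3 * t / 2 -> `|f s| <= B) ->
  `|g t| * t <= 4 * B.
Proof.
move=> hf hg df dg sg t B t0 te fB.
have mono (s s' : R) : 0 < s -> s <= s' -> s' < e ->
   ((forall t, 0 < t -> t < e -> 0 <= h t) -> g s <= g s') /\ ((forall t, 0 < t -> t < e -> h t <= 0) -> g s' <= g s).
  move=> s0 ss se; split=> hs.
    have := @mean_value_ge R S g s s' 0 hg ss; rewrite mul0r subr_ge0; apply=> u u1 u2.
    by exists (h u); [apply: dg; lra | apply: hs; lra].
  have hN : Dfun (fun t => - g t) by definable.
  have := @mean_value_ge R S _ s s' 0 hN ss; rewrite mul0r subr_ge0 lerN2; apply=> u u1 u2.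
  by exists (- h u); [apply: is_dN; apply: dg; lra | rewrite oppr_ge0; apply: hs; lra].
have lower (a b c : R) : 0 < a -> a <= b -> b < e -> (forall u, a <= u -> u <= b -> c <= g u) -> c * (b - a) <= f b - f a.
  move=> a0 ab be hc; apply: (@mean_value_ge R S f a b c hf ab) => u u1 u2.
  by exists (g u); [apply: df; lra | apply: hc].
have upper (a b c : R) : 0 < a -> a <= b -> b < e -> (forall u, a <= u -> u <= b -> g u <= c) -> f b - f a <= c * (b - a).
  move=> a0 ab be hc; have hN : Dfun (fun t => - f t) by definable.
  have := @mean_value_ge R S _ a b (- c) hN ab; rewrite mulNr => k.
  suff : - (c * (b - a)) <= - f b - - f a by lra.
  by apply: k => u u1 u2; exists (- g u); [apply: is_dN; apply: df; lra | rewrite lerN2; apply: hc].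
have f1 : `|f t| <= B by apply: fB; lra.
have f2 : `|f (t / 2)| <= B by apply: fB; lra.
have f3 : `|f (3 * t / 2)| <= B by apply: fB; lra.
move: f1 f2 f3; rewrite !ler_norml => /andP [f1 f1'] /andP [f2 f2'] /andP [f3 f3'].
have right_side c := lower t (3 * t / 2) c; have left_side c := lower (t / 2) t c.
have right_up c := upper t (3 * t / 2) c; have left_up c := upper (t / 2) t c.
case: sg => sg; case: (leP 0 (g t)) => gt.
- have := right_side (g t) t0; rewrite ger0_norm // => k; have : g t * (3 * t / 2 - t) <= f (3 * t / 2) - f t.
    by apply: k; try lra; move=> u u1 u2; apply: (mono t u _ _ _).1 => //; lra.
  by clear -f1 f1' f3 f3'; lra.
- have := left_up (g t); rewrite ltr0_norm // => k; have : f t - f (t / 2) <= g t * (t - t / 2).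
    by apply: k; try lra; move=> u u1 u2; apply: (mono u t _ _ _).1 => //; lra.
  by clear -f1 f1' f2 f2'; lra.
- have := left_side (g t); rewrite ger0_norm // => k; have : g t * (t - t / 2) <= f t - f (t / 2).
    by apply: k; try lra; move=> u u1 u2; apply: (mono u t _ _ _).2 => //; lra.
  by clear -f1 f1' f2 f2'; lra.
- have := right_up (g t) t0; rewrite ltr0_norm // => k; have : f (3 * t / 2) - f t <= g t * (3 * t / 2 - t).
    by apply: k; try lra; move=> u u1 u2; apply: (mono t u _ _ _).2 => //; lra.
  by clear -f1 f1' f3 f3'; lra.
Qed.

(** Near 0 a definable function of one variable loses at most one power of the variable per
    derivative. Close to 0 it is [C^2] and its second derivative has constant sign, so
    [deriv_bound_mono] bounds the first derivative and the induction continues with it. *)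
Lemma WC_near_zero q j (f : 'rV[R]_1 -> R) (e M : R) : Dfun f -> 0 < e -> 0 <= M ->
  (forall v, oint e v -> `|f v| <= M / v 0 0 ^+ j) ->
  exists2 e' : R, 0 < e' /\ e' <= e & exists2 K : R, 0 <= K &
    WC q (oint e') (fun v => K / v 0 0 ^+ j) (fun v => v 0 0) f.
Proof.
elim: q j f e M => [|q IH] j f e M hf e0 M0 hM.
  have [e1 e10 h1] := near_zero (Def_CkAt 0 hf) (fun a r => @generic_Ck R S 0 1 f a r hf).
  exists (Num.min e e1); first by split; [exact: min_gt0 | exact: minL].
  exists M => //; split=> // v [v1]; rewrite lt_min => /andP [v2 v3]; split; last exact: hM.
  by have [r r0 hr] := h1 v (conj v1 v3); apply: Ck_cont hr _; apply: ball_center.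
pose g := pd ord0 f; have hg : Dfun g by exact: Dfun_pd.
pose h := pd ord0 g; have hh : Dfun h by exact: Dfun_pd.
have [e1 e10 h1] := near_zero (Def_CkAt 2 hf) (fun a r => @generic_Ck R S 2 1 f a r hf).
have [e2 e20 h2] := sign_near_zero hh.
pose e3 := Num.min e (Num.min e1 e2).
have e30 : 0 < e3 by rewrite !lt_min e0 e10.
have in3 v : oint e3 v -> [/\ oint e v, oint e1 v & oint e2 v].
  by move=> [v1]; rewrite !lt_min => /andP [v2 /andP [v3 v4]].
have C2 : Ck 2 (oint e3) f by apply: Ck_local => v /in3 [_ /h1].
have line (F : 'rV[R]_1 -> R) l t : is_pd ord0 F (const_mx t) l -> is_d (fun t => F (const_mx t)) t l.
  move=> hl; apply/is_d_shift; apply: is_d_ext hl; exists 1 => // k _; congr F.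
  by apply/rowP => i; rewrite !mxE !(ord1 i) eqxx mulr1 add0r.
have hc : Dfun (fun t : R => const_mx t : 'rV[R]_1).
  apply: Dfun_row => i; have -> : (fun t : R => (const_mx t : 'rV[R]_1) 0 i) = id by apply: funext => t; rewrite mxE.
  exact: Dfun_id.
have inc (e' t : R) : 0 < t -> t < e' -> oint e' (const_mx t) by rewrite /oint mxE.
(* The factor [2 ^+ j] compares the bound at points [s >= t / 2] with the one at [t], and 4 comes
   from [deriv_bound_mono]; halving [e3] keeps [3 * t / 2] in the domain. *)
have hbound : forall v, oint (e3 / 2) v -> `|g v| <= (4 * (2 ^+ j * M)) / v 0 0 ^+ j.+1.
  move=> v [v1 v2]; have cst : v = const_mx (v 0 0) by apply/rowP => i; rewrite mxE (ord1 i).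
  set t := v 0 0 in v1 v2 *; have tj : 0 < t ^+ j by exact: exprn_gt0.
  have := @deriv_bound_mono (fun t => f (const_mx t)) (fun t => g (const_mx t)) (fun t => h (const_mx t)) e3 _ _ _ _ _ t (2 ^+ j * M / t ^+ j) v1 v2.
  rewrite -cst => k; rewrite exprS invfM mulrCA mulrC ler_pdivlMr //.
  have -> : 4 * (2 ^+ j * M) * (t ^+ j)^-1 = 4 * (2 ^+ j * M / t ^+ j) by ring.
  apply: k; try by definable.
  - by move=> s s0 se; apply: line; apply: (Ck_ispd ord0 C2); apply: inc.
  - by move=> s s0 se; apply: line; apply: (Ck_ispd ord0 (Ck_pd ord0 C2)); apply: inc.
  - by case: h2 => h2; [left | right] => s s0 se; apply: h2; have [] := in3 _ (inc _ _ s0 se).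
  move=> s s1 s2; have s0 : 0 < s by lra.
  have se : s < e3 by lra.
  have [o1 _ _] := in3 _ (inc _ _ s0 se); apply: le_trans (hM _ o1) _; rewrite mxE.
  rewrite (mulrC _ M) -mulrA ler_wpM2l // -[X in _ <= X]invrK invfM invrK lef_pV2 ?posrE ?exprn_gt0 //; last first.
    by rewrite mulr_gt0 ?invr_gt0 ?exprn_gt0.
  by rewrite -exprVn -exprMn lerXn2r ?nnegrE //; lra.
have [||e4 [e40 e43] [K K0 hK]] := IH j.+1 g (e3 / 2) (4 * (2 ^+ j * M)) hg _ _ hbound; first lra.
  by rewrite !mulr_ge0 // exprn_ge0.
have sub v : oint e4 v -> oint e3 v by move=> [v1 v2]; split=> //; lra.
have pos v : oint e4 v -> 0 < v 0 0 by case.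
exists e4; first by split=> //; have := minL e (Num.min e1 e2); rewrite -/e3; lra.
exists (M + K); first lra.
split=> [v hv|i].
  have [o1 _ _] := in3 v (sub v hv); split; first by apply: Ck_cont C2 (sub v hv).
  by apply: le_trans (hM v o1) _; rewrite ler_wpM2r ?invr_ge0 ?exprn_ge0 ?(ltW (pos v hv)) // lerDl.
rewrite (ord1 i); split=> [v hv|]; first by exists (g v); apply: (Ck_ispd ord0 C2); apply: sub.
apply: WC_mono hK => // v hv; rewrite exprSr invfM mulrA.
rewrite !ler_wpM2r ?invr_ge0 ?exprn_ge0 ?(ltW (pos v hv)) //; lra.
Qed.

(** A factor [s ^+ q] in the weight absorbs the up to [q] divisions by [s]. *)
Lemma WC_unscale q n (V : 'rV[R]_n -> Prop) (s f K : 'rV[R]_n -> R) : (forall v, V v -> 0 <= K v) ->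
  (forall v, V v -> 0 < s v) -> (forall v, V v -> s v <= 1) ->
  WC q V (fun v => K v * s v ^+ q) s f -> WC q V K (fun _ => 1) f.
Proof.
move=> K0 s0 s1; elim: q f => [|q IH] f h; have [h1 h2] := h.
  by split=> // v hv; have [c b] := h1 v hv; split=> //; move: b; rewrite mulr1.
split=> [v hv|i].
  have [c b] := h1 v hv; split=> //; apply: le_trans b _.
  by rewrite ler_piMr ?K0 // exprn_ile1 ?s1 // ltW ?s0.
have [h3 h4] := h2 i; split=> //.
apply: WC_mono (IH (pd i f) _) => // [v _|]; first by rewrite divr1.
apply: WC_mono h4 => // v hv; rewrite exprSr mulrA mulfK //.
by have := s0 v hv; lra.
Qed.

(** The prescribed function times a high power of the variable: the power compensates the blow-up of
    derivatives at 0, and a small constant brings all bounds below 1. *)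
Lemma slow1 q (ps : R -> R) : Dfun ps -> (forall t, 0 < t -> 0 < ps t) -> (forall t, ps t <= 1) ->
  (forall t, 0 <= ps t) ->
  exists2 e : R, 0 < e /\ e <= 1 & exists2 f : 'rV[R]_1 -> R, Dfun f &
    WC q (oint e) (fun _ => 1) (fun _ => 1) f /\
    forall v, oint e v -> [/\ 0 < f v, f v <= ps (v 0 0) & f v <= v 0 0].
Proof.
move=> hps ps0 ps1 psn; have hf : Dfun (fun v : 'rV[R]_1 => ps (v 0 0)) by definable.
have [|e [e0 e1] [K K0 hK]] := @WC_near_zero q 0 _ 1 1 hf ltr01 ler01.
  by move=> v [v0 _]; rewrite expr0 divr1 ger0_norm ?ps1.
have pos v : oint e v -> 0 < v 0 0 by case.
have le1 v : oint e v -> v 0 0 <= 1 by case=> _; lra.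
have oe := @open_oint e.
have hX k : WC q (oint e) (fun v => 2 ^+ (q * k) * v 0 0 ^+ k) (fun v => v 0 0) (fun v => v 0 0 ^+ k).
  elim: k => [|k IH].
    by apply: WC_mono (WC_cst oe pos q 1) => // v hv; rewrite normr1 muln0 !expr0 mulr1.
  have hid : WC q (oint e) (fun v => v 0 0) (fun v => v 0 0) (fun v => v 0 0).
    by apply: WC_coord => // v hv; rewrite ger0_norm // ltW // pos.
  apply: (@WC_ext _ _ _ _ oe _ (fun v => v 0 0 * v 0 0 ^+ k)) => [v _|]; first by rewrite exprS.
  apply: WC_mono (WC_mul oe pos hid IH) => // v hv.
  by rewrite mulnS exprD exprS le_eqVlt; apply/orP; left; apply/eqP; ring.
(* The exponent [q] would suffice against the derivatives; the additional power gives the bound by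
   [v 0 0]. [C] bounds the derivatives of the product and [c] below normalises them. *)
pose N := q.+1; pose C : R := 2 ^+ q * (2 ^+ (q * N) * K).
have C0 : 0 <= C by rewrite /C !mulr_ge0 ?exprn_ge0.
have C1 : 0 < 1 + C by lra.
pose c : R := (2 ^+ q * (1 + C))^-1.
have p0 : 0 < 2 ^+ q * (1 + C) by rewrite mulr_gt0 ?exprn_gt0.
have c0 : 0 < c by rewrite invr_gt0.
have c1 : c <= 1.
  rewrite invf_le1 //; have : 1 <= 2 ^+ q :> R by rewrite exprn_ege1 // ler1n.
  by clear -C0; nra.
exists e => //; exists (fun v => c * (v 0 0 ^+ N * ps (v 0 0))); first by definable.
split.
  have w1 : WC q (oint e) (fun _ => C) (fun _ => 1) (fun v => v 0 0 ^+ N * ps (v 0 0)).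
    apply: (WC_unscale (K := fun _ => C) (fun _ _ => C0) pos le1); apply: WC_mono (WC_mul oe pos (hX N) hK) => // v hv.
    have v0 := pos v hv; rewrite expr0 divr1 /N (exprS _ q) /C.
    have -> : 2 ^+ q * (2 ^+ (q * q.+1) * (v 0 0 * v 0 0 ^+ q) * K) = (2 ^+ q * (2 ^+ (q * q.+1) * K) * v 0 0 ^+ q) * v 0 0 by ring.
    by rewrite ler_piMr ?le1 // !mulr_ge0 ?exprn_ge0 // ltW.
  have one0 (v : 'rV[R]_1) : oint e v -> 0 < (1 : R) by [].
  apply: WC_mono (WC_scal oe one0 c w1) => // v hv; rewrite (gtr0_norm c0).
  have -> : 2 ^+ q * (c * C) = C / (1 + C).
    by rewrite /c; field; rewrite ?expf_neq0 // ?andbT; lra.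
  by rewrite ler_pdivrMr //; lra.
move=> v hv; have v0 := pos v hv; have v1 := le1 v hv; have p := ps0 _ v0.
have x0 : 0 < v 0 0 ^+ N by exact: exprn_gt0.
have x1 : v 0 0 ^+ N <= 1 by apply: exprn_ile1 => //; apply: ltW.
have x2 : v 0 0 ^+ N <= v 0 0 by rewrite /N exprS ler_piMr ?(ltW v0) // exprn_ile1 // ltW.
split; first by rewrite !mulr_gt0.
  apply: le_trans (_ : 1 * (1 * ps (v 0 0)) <= _); last by rewrite !mul1r.
  by rewrite ler_pM ?mulr_ge0 ?(ltW c0) ?(ltW x0) ?(ltW p) // ler_wpM2r // ltW.
apply: le_trans (_ : 1 * (v 0 0 * 1) <= _); last by rewrite mulr1 mul1r.
by rewrite ler_pM ?mulr_ge0 ?(ltW c0) ?(ltW x0) ?(ltW p) // ler_pM ?(ltW x0) ?(ltW p).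
Qed.

Lemma WC_PB q n k (V : 'rV[R]_n -> Prop) (V' : 'rV[R]_k -> Prop) (G : 'rV[R]_n -> 'rV[R]_k) w F :
  (forall v, V v -> V' (G v)) -> WC q V' w (fun _ => 1) F -> PB q V G (fun v => w (G v)) F.
Proof.
move=> hG; elim: q w F => [|q IH] w F [h1 h2]; split=> //; try by move=> v /hG /h1 [].
move=> j; have [_ h4] := h2 j; apply: PB_mono (IH _ _ h4) => v _; by rewrite divr1.
Qed.

Lemma WC_Ck q n (V : 'rV[R]_n -> Prop) w f : WC q V w (fun _ => 1) f -> Ck q V f.
Proof. by move=> h; apply/Ck_WC; exists w. Qed.

(** A definable exhaustion of [O] with bounded derivatives. Its superlevel sets are closed and
    bounded, so compactness applies to them, and the decay towards the complement allows extension
    by zero. *)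
Record slowfn q d (O : 'rV[R]_d -> Prop) (g : 'rV[R]_d -> R) : Prop := SlowFn {
  slow_def : Dfun g;
  slow_dom : forall x, O x <-> 0 < g x;
  slow_ge0 : forall x, 0 <= g x;
  slow_le1 : forall x, g x <= 1;
  slow_WC : WC q O (fun _ => 1) (fun _ => 1) g;
  slow_decay : forall x a, ~ O a -> g x <= mnorm (x - a);
  slow_bounded : forall t : R, 0 < t -> exists M : R, forall x, t <= g x -> mnorm x <= M }.

Lemma slow_cont q d O (g : 'rV[R]_d -> R) x : slowfn q O g -> cont g x.
Proof.
move=> sg; have [Ox|nOx] := EM (O x); first exact: WC_cont (slow_WC sg) Ox.
move=> e e0; exists e => // y hy.
have -> : g x = 0.
  by apply/eqP; rewrite eq_le (slow_ge0 sg) andbT leNgt; apply/negP => /(slow_dom sg).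
by rewrite subr0 ger0_norm ?(slow_ge0 sg) //; apply: le_lt_trans (slow_decay sg y nOx) hy.
Qed.

Lemma slow_open q d O (g : 'rV[R]_d -> R) : slowfn q O g -> open_set O.
Proof.
move=> sg x /(slow_dom sg) gx; have [e e0 he] := slow_cont x sg gx.
exists e => // y /he; rewrite ltr_norml => /andP [h _]; apply/(slow_dom sg); lra.
Qed.

(** On each superlevel set of [g] compactness gives a uniform admissible radius, which reduces the
    constraint to a positive function [ps] of the level alone. The solution is the one-variable
    function of [slow1] for [ps], composed with [g]. *)
Lemma slow_minorant q d O (g : 'rV[R]_d -> R) (C : 'rV[R]_d -> R -> Prop) : slowfn q O g ->
  Def (fun p : 'rV[R]_d * R => C p.1 p.2) ->
  (forall x (r r' : R), C x r -> 0 < r' -> r' <= r -> C x r') ->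
  (forall x, O x -> exists2 r : R, 0 < r & forall y, mnorm (y - x) < r -> O y -> C y r) ->
  exists2 de : 'rV[R]_d -> R, Dfun de &
    [/\ forall x, O x -> 0 < de x, forall x, ~ O x -> de x = 0, forall x, de x <= g x,
        forall x, O x -> C x (de x) & WC q O (fun _ => 1) (fun _ => 1) de].
Proof.
move=> sg hC mC loc; have hg := slow_def sg; have oO := slow_open sg.
have [||ps hps hpsP] := @Dfun_radius R S R _ (fun t r => forall x, t <= g x -> C x r).
- by definable.
- by move=> t r r' h r0 hr x hx; apply: mC (h x hx) r0 hr.
have pspos t : 0 < t -> 0 < ps t.
  move=> t0; have [M hM] := slow_bounded sg t0.
  have [||||||r r0 hr] := @closed_compact R S d (fun x => t <= g x) C M.
  - by definable.
  - exact: hC.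
  - exact: hM.
  - move=> x /negP; rewrite -ltNge => hx; have [|e e0 he] := slow_cont x sg (e := t - g x); first lra.
    by exists e => // y /he; rewrite ltr_norml => /andP [_ h]; apply/negP; rewrite -ltNge; lra.
  - exact: mC.
  - move=> x hx; have Ox : O x by apply/(slow_dom sg); lra.
    have [r r0 hr] := loc x Ox; exists r => // y hy ty; apply: hr => //.
    by apply/(slow_dom sg); lra.
  have [_ _ _ h] := hpsP t; have m0 := min_gt0 r0 (ltr01 : 0 < 1 :> R).
  suff : Num.min r 1 <= 2 * ps t by lra.
  apply: h => // [|x hx]; first exact: minR.
  by apply: mC (hr x hx) m0 (minL _ _).
have [e [e0 e1] [f hf [fW fP]]] := @slow1 q ps hps pspos (fun t => let: And4 _ h _ _ := hpsP t in h) (fun t => let: And4 h _ _ _ := hpsP t in h).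
(* As [g] is at most 1, the factor [e / 2] places the level inside the interval on which [f] is
   controlled. *)
pose G (x : 'rV[R]_d) : 'rV[R]_1 := const_mx (e / 2 * g x).
have hG : Dfun G.
  apply: Dfun_row => i; have -> : (fun x => G x 0 i) = (fun x => e / 2 * g x) by apply: funext => x; rewrite mxE.
  by definable.
have Gin x : O x -> oint e (G x).
  move=> /(slow_dom sg) gx; have g1 := slow_le1 sg x; rewrite /oint !mxE; split; first by rewrite mulr_gt0 //; lra.
  by clear -e0 g1 gx; nra.
have one0 (v : 'rV[R]_d) : O v -> 0 < (1 : R) by [].
have [K K0 hK] := WC_comp S q 1.
pose ka : R := 1 + 2 ^+ q * (e / 2).
have kq : 0 <= 2 ^+ q * (e / 2) by rewrite mulr_ge0 ?exprn_ge0 //; lra.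
have hW : WC q O (fun _ => K * ka ^+ q * 1) (fun _ => 1) (fun x => f (G x)).
  apply: (hK d O (oint e) G f (fun _ => ka) (fun _ => 1)) => //.
  - exact: open_oint.
  - exact: WC_Ck fW.
  - by move=> v _; rewrite /ka; lra.
  - move=> j; apply: (@WC_ext _ _ _ _ oO _ (fun x => e / 2 * g x)) => [x _|]; first by rewrite mxE.
    apply: WC_mono (WC_scal oO one0 (e / 2) (slow_WC sg)) => // x _.
    by rewrite mulr1 ger0_norm /ka; lra.
  - exact: WC_PB Gin fW.
(* Normalises the composition so that its derivatives are again bounded by 1. *)
pose c : R := (1 + 2 ^+ q * (K * ka ^+ q))^-1.
have pp : 0 <= 2 ^+ q * (K * ka ^+ q).
  by rewrite !mulr_ge0 ?exprn_ge0 ?(ltW K0) // /ka; lra.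
have c0 : 0 < c by rewrite invr_gt0; lra.
have c1 : c <= 1 by rewrite invf_le1; lra.
have hO : Def O by apply: Def_ext (_ : Def (fun x => 0 < g x)) => [x|]; [rewrite (slow_dom sg) | definable].
have fb x : O x -> 0 < f (G x) /\ f (G x) <= g x /\ f (G x) <= ps (e / 2 * g x).
  move=> Ox; have [f1 f2 f3] := fP _ (Gin x Ox); rewrite !mxE in f2 f3; split=> //; split=> //.
  by apply: le_trans f3 _; have := slow_ge0 sg x; clear -e1; nra.
exists (fun x => if `[< O x >] then c * f (G x) else 0); first by definable.
split=> [x Ox|x nOx|x|x Ox|].
- by rewrite asboolT //; apply: mulr_gt0 => //; have [] := fb x Ox.
- by rewrite asboolF.
- case: asboolP => [Ox|_]; last exact: (slow_ge0 sg x).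
  by have [f1 [f2 _]] := fb x Ox; apply: le_trans f2; rewrite ler_piMl // ltW.
- rewrite asboolT //; have [f1 [f2 f3]] := fb x Ox.
  have [p0 _ p1 _] := hpsP (e / 2 * g x).
  have gx : 0 < e / 2 * g x by rewrite mulr_gt0 //; [lra | exact/(slow_dom sg)].
  apply: mC (p1 (pspos _ gx) x _) _ _; first by have := slow_ge0 sg x; clear -e1; nra.
    exact: mulr_gt0.
  by apply: le_trans f3; rewrite ler_piMl // ltW.
apply: (@WC_ext _ _ _ _ oO _ (fun x => c * f (G x))) => [x Ox|]; first by rewrite asboolT.
apply: WC_mono (WC_scal oO one0 c hW) => // x _; rewrite (gtr0_norm c0) mulr1.
have -> : 2 ^+ q * (c * (K * ka ^+ q)) = (2 ^+ q * (K * ka ^+ q)) * c by ring.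
by rewrite /c ler_pdivrMr; lra.
Qed.

End Slow.

(** * Generic local sections of sets with finite fibres *)

Section Branches.
Variables (R : rcfType) (S : ominimal_expansion R).
Local Notation Def := (Def S).
Local Notation Dfun := (Dfun S).

Definition nowhere_dense n (A : 'rV[R]_n -> Prop) := forall a (r : R), 0 < r ->
  exists a' r', subball a r a' r' /\ forall x, mnorm (x - a') < r' -> ~ A x.

Lemma nowhere_dense_sub n (A B : 'rV[R]_n -> Prop) : (forall x, B x -> A x) ->
  nowhere_dense A -> nowhere_dense B.
Proof.
by move=> h hA a r /(hA a r) [a' [r' [h1 h2]]]; exists a', r'; split=> // x /h2 hx /h.
Qed.

Lemma refine_finT n (T : finType) (P : T -> 'rV[R]_n -> Prop) :
  (forall i a (r : R), 0 < r -> exists a' r', subball a r a' r' /\ forall x, mnorm (x - a') < r' -> P i x) ->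
  forall a (r : R), 0 < r -> exists a' r', subball a r a' r' /\ forall i x, mnorm (x - a') < r' -> P i x.
Proof.
move=> h a r r0.
have [|a' [r' [h1 h2]]] := @refine_fin R n #|T| (fun i => P (enum_val i)) _ a r r0; first by move=> i; apply: h.
by exists a', r'; split=> // i x hx; rewrite -(enum_rankK i); apply: h2.
Qed.

Lemma finite_minT (T : finType) (P : T -> R -> Prop) :
  (forall i (r r' : R), P i r -> 0 < r' -> r' <= r -> P i r') ->
  (forall i, exists2 r : R, 0 < r & P i r) -> exists2 r : R, 0 < r & forall i, P i r.
Proof.
move=> mP h; have [|r r0 hr] := @seq_uniform R T (enum T) P mP; first by move=> i _; apply: h.
by exists r => // i; apply: hr; rewrite mem_enum.
Qed.

(** A definable choice of intervals: fix a definable radius [rh x], then take the supremum of the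
    admissible centres. Requiring centres to be nonpositive makes that supremum exist; it need not
    be admissible, but half the radius around it works. Generic continuity of centre and radius then
    gives a box. *)
Lemma interval_selection_le0 n (A : 'rV[R]_n -> R -> Prop) a (r : R) :
  Def (fun p : 'rV[R]_n * R => A p.1 p.2) -> 0 < r ->
  (forall x, mnorm (x - a) < r -> exists t e : R, [/\ t <= 0, 0 < e & forall s, `|s - t| < e -> A x s]) ->
  exists v (e : R), [/\ 0 < e, mnorm (tlr v - a) < r & forall y, mnorm (y - v) < e -> A (tlr y) (y 0 ord0)].
Proof.
move=> hA r0 hint.
have [||rh hrh rhP] := @Dfun_radius R S _ _ (fun x e => exists t, t <= 0 /\ forall s, `|s - t| < e -> A x s).
- by definable.
- by move=> x e e' [t [t0 h]] e0 he; exists t; split=> // s hs; apply: h; lra.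
have rh0 x : mnorm (x - a) < r -> 0 < rh x.
  move=> hx; have [t [e [t0 e0 h]]] := hint x hx; have [_ _ _ k] := rhP x.
  have m0 := min_gt0 e0 (ltr01 : 0 < 1 :> R); suff : Num.min e 1 <= 2 * rh x by lra.
  apply: k => //; first exact: minR.
  by exists t; split=> // s hs; apply: h; apply: lt_le_trans hs (minL _ _).
have [|ta hta taP] := @Dfun_lub R S _ _ (fun x t => t <= 0 /\ forall s, `|s - t| < rh x -> A x s); first by definable.
have sel x : mnorm (x - a) < r -> forall s, `|s - ta x| < rh x / 2 -> A x s.
  move=> hx s hs; have p := rh0 x hx; have [_ _ k _] := rhP x.
  have [||k1 k2] := taP x; first by have [t ht] := k p; exists t.
    by exists 0 => t [].
  have [|t [t0 ht] htt] := k2 (ta x - rh x / 2); first lra.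
  have tle := k1 t (conj t0 ht); apply: ht.
  by move: hs; rewrite !ltr_norml => /andP [u1 u2]; clear -u1 u2 htt tle; apply/andP; split; lra.
have [a1 [r1 [h1 c1]]] := @generic_continuity R S n ta a r hta r0.
have [a2 [r2 [h2 c2]]] := @generic_continuity R S n rh a1 r1 hrh h1.1.
have ca := ball_center a2 h2.1.
have ina : mnorm (a2 - a) < r by apply: h1.2; apply: h2.2.
have p := rh0 a2 ina.
have [|d1 d10 hd1] := c1 a2 (h2.2 _ ca) (rh a2 / 8); first lra.
have [|d2 d20 hd2] := c2 a2 ca (rh a2 / 2); first lra.
pose e := Num.min (Num.min d1 d2) (Num.min (rh a2 / 8) (r - mnorm (a2 - a))).
have e0 : 0 < e by rewrite /e; apply: min_gt0; apply: min_gt0 => //; lra.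
have [m1 m2 m3 m4] : [/\ e <= d1, e <= d2, e <= rh a2 / 8 & e <= r - mnorm (a2 - a)].
  have := minL (Num.min d1 d2) (Num.min (rh a2 / 8) (r - mnorm (a2 - a))).
  have := minR (Num.min d1 d2) (Num.min (rh a2 / 8) (r - mnorm (a2 - a))).
  have := minL d1 d2; have := minR d1 d2.
  have := minL (rh a2 / 8) (r - mnorm (a2 - a)); have := minR (rh a2 / 8) (r - mnorm (a2 - a)).
  by clear; rewrite /e => *; split; lra.
exists (consr (ta a2) a2), e; split=> //; first by rewrite tlr_cons.
move=> y; rewrite -{1}(consr_eta y) mnorm_consrB => /andP [y1 y2].
have b1 := hd1 (tlr y) (lt_le_trans y2 m1); have b2 := hd2 (tlr y) (lt_le_trans y2 m2).
apply: sel.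
  by have := mnormB_tri (tlr y) a2 a; clear -y2 m4; lra.
move: b1 b2 y1; rewrite !ltr_norml => /andP [u1 u2] /andP [u3 u4] /andP [u5 u6].
by clear -u1 u2 u3 u4 u5 u6 m3 p; apply/andP; split; lra.
Qed.

(** By dichotomy nonpositive centres are available over a whole ball or nowhere on it; in the second
    case the reflected set has them. *)
Lemma interval_selection n (A : 'rV[R]_n -> R -> Prop) a (r : R) :
  Def (fun p : 'rV[R]_n * R => A p.1 p.2) -> 0 < r ->
  (forall x, mnorm (x - a) < r -> exists p q : R, p < q /\ all_oo (A x) p q) ->
  exists v (e : R), 0 < e /\ forall y, mnorm (y - v) < e -> A (tlr y) (y 0 ord0).
Proof.
move=> hA r0 hint.
pose L x := exists t e : R, [/\ t <= 0, 0 < e & forall s, `|s - t| < e -> A x s].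
have hL : Def L.
  apply: Def_ext (_ : Def (fun x => exists t e : R, t <= 0 /\ 0 < e /\ forall s, `|s - t| < e -> A x s)).
    by move=> x; split=> -[t [e]]; [move=> [? [? ?]]|move=> [? ? ?]]; exists t, e.
  by definable.
have [a1 [r1 [h1 [h2|h2]]]] := @dichotomy R S n L a r hL r0.
  by have [v [e [e0 _ h]]] := interval_selection_le0 hA h1.1 h2; exists v, e.
have hA' : Def (fun p : 'rV[R]_n * R => A p.1 (- p.2)) by definable.
have [|v [e [e0 _ h]]] := interval_selection_le0 hA' h1.1 (A := fun x t => A x (- t)) (a := a1).
  move=> x hx; have [p [q [pq hpq]]] := hint x (h1.2 x hx).
  exists (- ((p + q) / 2)), ((q - p) / 2); split; [|lra|].
    rewrite leNgt; apply/negP => hneg; apply: (h2 x hx); exists ((p + q) / 2), ((q - p) / 2).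
    split; [lra|lra|].
    by move=> s; rewrite ltr_norml => /andP [u1 u2]; apply: hpq; lra.
  by move=> s; rewrite ltr_norml => /andP [u1 u2]; apply: hpq; lra.
exists (consr (- v 0 ord0) (tlr v)), e; split=> // y.
rewrite -{1}(consr_eta y) mnorm_consrB => /andP [y1 y2].
have := h (consr (- y 0 ord0) (tlr y)); rewrite consr0 tlr_cons opprK; apply.
rewrite -[X in _ - X](consr_eta v) mnorm_consrB y2 andbT.
by move: y1; rewrite -opprD normrN opprK.
Qed.

Variables (m d : nat) (sg : 'I_d -> 'I_m) (Z : 'rV[R]_m -> Prop).
Hypotheses (inj : injective sg) (hZ : Def Z).

Definition fibre x z := Z z /\ prj sg z = x.
Definition tcoord i := forall k, sg k != i.
(** The projection of [Z] to the base together with the coordinate [i], which is placed first. *)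
Definition coord_set i (v : 'rV[R]_d.+1) := exists z, fibre (tlr v) z /\ z 0 i = v 0 ord0.
Hypothesis hnd : forall i, tcoord i -> nowhere_dense (coord_set i).

Lemma Def_fibre : Def (fun p : 'rV[R]_d * 'rV[R]_m => fibre p.1 p.2).
Proof. by have hp := Dfun_prj S sg; rewrite /fibre; definable. Qed.

Definition no_interval x := forall i, tcoord i ->
  ~ exists p q : R, p < q /\ all_oo (fun t => exists z, fibre x z /\ z 0 i = t) p q.

Lemma generic_no_interval i a (r : R) : tcoord i -> 0 < r ->
  exists a' r', subball a r a' r' /\ forall x, mnorm (x - a') < r' ->
   ~ exists p q : R, p < q /\ all_oo (fun t => exists z, fibre x z /\ z 0 i = t) p q.
Proof.
move=> hi r0; have hF := Def_fibre.
have hA : Def (fun p : 'rV[R]_d * R => exists z, fibre p.1 z /\ z 0 i = p.2) by definable.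
have hI : Def (fun x => exists p q : R, p < q /\ all_oo (fun t => exists z, fibre x z /\ z 0 i = t) p q).
  by rewrite /all_oo; definable.
have [a' [r' [h1 [h2|h2]]]] := @dichotomy R S d _ a r hI r0; last by exists a', r'.
exfalso; have [v [e [e0 he]]] := interval_selection hA h1.1 h2.
have [a2 [r2 [k1 k2]]] := hnd hi v e0.
apply: (k2 a2); first by apply: ball_center; exact: k1.1.
exact: he (subball_center k1).
Qed.

Lemma no_interval_fibre_finite x : no_interval x -> exists t : seq 'rV[R]_m, forall z, fibre x z -> z \in t.
Proof.
move=> hx.
have fin i : exists s : seq R, forall z, fibre x z -> z 0 i \in s.
  have [/existsP [k /eqP <-]|/existsPn hi] := boolP [exists k, sg k == i].
    exists [:: x 0 k] => z [_ <-]; by rewrite mxE inE.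
  have hF := Def_fibre; have hA : Def (fun t => exists z, fibre x z /\ z 0 i = t) by definable.
  have [|s hs] := no_interval_finite hA; first by move=> p q pq h; apply: (hx i hi); exists p, q.
  by exists s => z hz; apply: hs; exists z.
have [F hF] := choice fin.
suff gen k : (k <= m)%N -> exists t : seq 'rV[R]_m, forall z, fibre x z ->
   exists2 w, w \in t & forall i : 'I_m, (i < k)%N -> z 0 i = w 0 i.
  have [t ht] := gen m (leqnn m); exists t => z /ht [w hw e].
  by have -> : z = w by apply/rowP => i; apply: e.
elim: k => [_|k IH hk]; first by exists [:: 0] => z _; exists 0; rewrite ?inE.
have [t ht] := IH (ltnW hk); pose j := Ordinal hk.
exists [seq (\row_i (if i == j then y else w 0 i) : 'rV[R]_m) | w : 'rV[R]_m <- t, y : R <- F j] => z hz.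
have [w hw e] := ht z hz.
exists (\row_i (if i == j then z 0 j else w 0 i)).
  by apply/allpairsP; exists (w, z 0 j); split=> //=; apply: hF.
move=> i; rewrite ltnS leq_eqVlt mxE => /orP [/eqP h|h].
  by have -> : i = j by [apply: val_inj]; rewrite eqxx.
by rewrite ifN ?e // -val_eqE /= neq_ltn h.
Qed.

Definition covered n a' (r' : R) := exists (T : finType) (ze : T -> 'rV[R]_d -> 'rV[R]_m),
  (forall k, Dfun (ze k)) /\ forall x z, mnorm (x - a') < r' -> fibre x z ->
    exists k, forall i : 'I_m, (i < n)%N -> z 0 i = ze k x 0 i.

(** The covering functions are built one coordinate at a time: base coordinates are known, and each
    transverse coordinate takes finitely many values, generically given by finitely many definable
    branches. *)
Lemma generic_cover a (r : R) : 0 < r -> exists a' r', subball a r a' r' /\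
  exists (T : finType) (ze : T -> 'rV[R]_d -> 'rV[R]_m), (forall k, Dfun (ze k)) /\
   forall x z, mnorm (x - a') < r' -> fibre x z -> exists k, z = ze k x.
Proof.
move=> r0.
suff gen : forall n, (n <= m)%N -> exists a' r', subball a r a' r' /\ covered n a' r'.
  have [a' [r' [h1 [T [ze [h2 h3]]]]]] := gen m (leqnn m).
  exists a', r'; split=> //; exists T, ze; split=> // x z hx hz.
  by have [k hk] := h3 x z hx hz; exists k; apply/rowP => i; apply: hk.
elim=> [_|n IH hn].
  exists a, r; split=> //; exists unit, (fun _ _ => 0); split=> [k|x z _ _]; first by definable.
  by exists tt.
have [a1 [r1 [h1 [T [ze [h2 h3]]]]]] := IH (ltnW hn); pose j := Ordinal hn.
pose upd (f : 'rV[R]_d -> R) (g : 'rV[R]_d -> 'rV[R]_m) x : 'rV[R]_m := \row_i (if i == j then f x else g x 0 i).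
have hupd f g : Dfun f -> Dfun g -> Dfun (upd f g).
  move=> hf hg; apply: Dfun_rowmk => i; case: (i == j) => //.
  by definable.
have updE (f : 'rV[R]_d -> R) (g : 'rV[R]_d -> 'rV[R]_m) x (z : 'rV[R]_m) : z 0 j = f x -> (forall i : 'I_m, (i < n)%N -> z 0 i = g x 0 i) ->
   forall i : 'I_m, (i < n.+1)%N -> z 0 i = upd f g x 0 i.
  move=> e1 e2 i; rewrite ltnS leq_eqVlt mxE => /orP [/eqP h|h].
    by have -> : i = j by [apply: val_inj]; rewrite eqxx.
  by rewrite ifN ?e2 // -val_eqE /= neq_ltn h.
have [/existsP [k /eqP ek]|/existsPn hi] := boolP [exists k, sg k == j].
  exists a1, r1; split=> //; exists T, (fun t => upd (fun x => x 0 k) (ze t)); split.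
    by move=> t; apply: hupd => //; definable.
  move=> x z hx hz; have [t ht] := h3 x z hx hz; exists t; apply: updE => //.
  by case: hz => _ <-; rewrite mxE ek.
have [a2 [r2 [k1 k2]]] := generic_no_interval a1 hi h1.1.
have hF := Def_fibre.
have hA : Def (fun p : 'rV[R]_d * R => exists z, fibre p.1 z /\ z 0 j = p.2) by definable.
have [|a3 [r3 [k3 [N [F [k4 k5]]]]]] := @finite_branches R S d (fun x t => exists z, fibre x z /\ z 0 j = t) a2 r2 hA k1.1.
  move=> x hx; apply: (@no_interval_finite R S); first by definable.
  by move=> p q pq h; apply: (k2 x hx); exists p, q.
exists a3, r3; split; first by apply: subball_trans k3; apply: subball_trans k1.
exists (T * 'I_N)%type, (fun t => upd (F t.2) (ze t.1)); split; first by move=> t; apply: hupd.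
move=> x z hx hz; have [t ht] := h3 x z (k1.2 _ (k3.2 _ hx)) hz.
have [|i hi2] := k5 x (z 0 j) hx; first by exists z.
by exists (t, i); apply: updE.
Qed.

(** Near a point of a local section the nearest point of the fibre is the value of that section. One
    global function [Sn] thus stands for all sections at once, without numbering them. *)
Definition nearest v z := fibre (prj sg v) z /\
  forall z', fibre (prj sg v) z' -> z' <> z -> mnorm (v - z) < mnorm (v - z').

Lemma nearest_uniq v z z' : nearest v z -> nearest v z' -> z = z'.
Proof.
move=> [h1 h2] [h3 h4]; apply: contrapT => hne.
have := h2 z' h3 (fun e => hne (esym e)); have := h4 z h1 hne; lra.
Qed.

Lemma nearest_fun : exists2 Sn : 'rV[R]_m -> 'rV[R]_m, Dfun Sn & forall v z, nearest v z -> Sn v = z.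
Proof.
have hF := Def_fibre; have hp := Dfun_prj S sg.
have hN : Def (fun p : 'rV[R]_m * 'rV[R]_m => nearest p.1 p.2) by rewrite /nearest; definable.
have hi i : exists f : 'rV[R]_m -> R, Dfun f /\ forall v z, nearest v z -> f v = z 0 i.
  have [||f hf h] := @Dfun_partial R S 'rV[R]_m _ (fun v t => exists z, nearest v z /\ z 0 i = t).
  - by definable.
  - by move=> v t t' [z [hz <-]] [z' [hz' <-]]; rewrite (nearest_uniq hz hz').
  by exists f; split=> // v z hz; apply: h; exists z.
have [F hF2] := choice hi.
exists (fun v => \row_i F i v); first by apply: Dfun_rowmk => i; have [] := hF2 i.
by move=> v z hz; apply/rowP => i; rewrite mxE; have [_ h] := hF2 i; apply: h.
Qed.

Section Good.
Variables (q : nat) (J : finType) (c : J -> 'rV[R]_m -> R) (Sn : 'rV[R]_m -> 'rV[R]_m).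
Hypotheses (hc : forall j, Dfun (c j)) (hSn : Dfun Sn) (SnP : forall v z, nearest v z -> Sn v = z).

(** The functions [c j] will be the Taylor coefficients; what is needed is that they become smooth
    along the section, after composition with [Sn]. *)
Definition good_point z := (exists2 r : R, 0 < r & forall v, mnorm (v - z) < r -> nearest v (Sn v) /\
    forall v', mnorm (v' - z) < r -> prj sg v' = prj sg v -> Sn v' = Sn v) /\
  (forall i, CkAt q (fun v => Sn v 0 i) z) /\ (forall j, CkAt q (fun v => c j (Sn v)) z).

(** The middle condition says that nearby fibres stay close to the fibre over [x]: no branch arrives
    from infinity or appears out of nothing. *)
Definition good_base x := (forall z, fibre x z -> good_point z) /\
  (forall e : R, 0 < e -> exists2 r : R, 0 < r & forall z', Z z' -> mnorm (prj sg z' - x) < r ->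
     exists z, fibre x z /\ mnorm (z' - z) < e) /\ no_interval x.

Lemma Def_good_point : Def good_point.
Proof.
have hF := Def_fibre; have hp := Dfun_prj S sg.
have hN : Def (fun p : 'rV[R]_m * 'rV[R]_m => nearest p.1 p.2) by rewrite /nearest; definable.
have h1 i : Def (CkAt q (fun v => Sn v 0 i)) by apply: Def_CkAt; definable.
have h2 j : Def (CkAt q (fun v => c j (Sn v))) by apply: Def_CkAt; apply: (Dfun_comp (hc j)).
rewrite /good_point; apply: Def_and; first by definable.
by apply: Def_and; apply: Def_all_fin.
Qed.

Lemma Def_good_base : Def good_base.
Proof.
have hF := Def_fibre; have hp := Dfun_prj S sg; have hg := Def_good_point.
rewrite /good_base /no_interval /all_oo; apply: Def_and; first by definable.
apply: Def_and; first by definable.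
by apply: Def_all_fin => i; apply: Def_imp; definable.
Qed.

Lemma local_decide (P : 'rV[R]_d -> Prop) a (r : R) : Def P -> 0 < r -> exists a' r', subball a r a' r' /\
  forall x, mnorm (x - a') < r' -> exists2 e : R, 0 < e &
    (forall y, mnorm (y - x) < e -> P y) \/ (forall y, mnorm (y - x) < e -> ~ P y).
Proof.
move=> hP r0; have [a' [r' [h1 h2]]] := @dichotomy R S d P a r hP r0.
exists a', r'; split=> // x hx; have [e e0 he] := open_ball hx; exists e => //.
by case: h2 => h2; [left | right] => y /he /h2.
Qed.

(** At the chosen base point every covering branch is locally in [Z] or locally outside, any two
    branches agree locally or differ locally, and all branches and coefficients are smooth. The
    conditions of [good_base] follow from this finite list. *)
Lemma generic_good_base a (r : R) : 0 < r -> exists x, mnorm (x - a) < r /\ good_base x.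
Proof.
move=> r0; have [a1 [r1 [h1 [T [ze [hze cov]]]]]] := generic_cover a r0.
have hF := Def_fibre.
have hzei k i : Dfun (fun x => ze k x 0 i) by definable.
have hcz k j : Dfun (fun x => c j (ze k x)) by apply: (Dfun_comp (hc j)).
have [|a2 [r2 [h2 mem]]] := @refine_finT d T (fun k x => exists2 e : R, 0 < e &
    (forall y, mnorm (y - x) < e -> fibre y (ze k y)) \/ (forall y, mnorm (y - x) < e -> ~ fibre y (ze k y))) _ a1 r1 h1.1.
  by move=> k b s s0; apply: local_decide => //; definable.
have [|a3 [r3 [h3 eqs]]] := @refine_finT d (T * T)%type (fun k x => exists2 e : R, 0 < e &
    (forall y, mnorm (y - x) < e -> ze k.1 y = ze k.2 y) \/ (forall y, mnorm (y - x) < e -> ~ ze k.1 y = ze k.2 y)) _ a2 r2 h2.1.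
  by move=> k b s s0; apply: local_decide => //; definable.
have [|a4 [r4 [h4 smo]]] := @refine_finT d (T * 'I_m)%type (fun k => CkAt q (fun x => ze k.1 x 0 k.2)) _ a3 r3 h3.1.
  by move=> k b s s0; apply: generic_Ck.
have [|a5 [r5 [h5 smc]]] := @refine_finT d (T * J)%type (fun k => CkAt q (fun x => c k.2 (ze k.1 x))) _ a4 r4 h4.1.
  by move=> k b s s0; apply: generic_Ck.
pose x := a5; have x5 := ball_center x h5.1; have x4 := h5.2 _ x5; have x3 := h4.2 _ x4.
have x2 := h3.2 _ x3; have x1 := h2.2 _ x2.
exists x; split; first exact: h1.2.
have contz k (e : R) : 0 < e -> exists2 r : R, 0 < r & forall y, mnorm (y - x) < r -> mnorm (ze k y - ze k x) < e.
  move=> e0; have [||s s0 hs] := @finite_minT 'I_m (fun i r => forall y, mnorm (y - x) < r -> `|ze k y 0 i - ze k x 0 i| < e).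
  - by move=> i s s' h _ hs y hy; apply: h; lra.
  - move=> i; have [s s0 hs] := smo (k, i) x x4.
    have := Ck_cont hs (ball_center x s0); apply; exact: e0.
  - by exists s => // y hy; apply: mnorm_lt => // i; rewrite !mxE; apply: hs.
have [rc rc0 hrc] : exists2 s : R, 0 < s & forall y, mnorm (y - x) < s -> mnorm (y - a1) < r1.
  by have [e e0 he] := open_ball x1; exists e.
split.
  move=> z hz; have [k ek] := cov x z x1 hz.
  have [e1 e10 [inZ|]] := mem k x x2; last first.
    by move=> /(_ x (ball_center x e10)); rewrite -ek.
  (* [s] separates the branch [k] from all branches differing from it. A point within [s / 8] of [z]
     has distance below [s / 4] to the value of branch [k] and more than [s / 2] to the other
     values, so branch [k] is nearest. *)
  have sepT : exists2 s : R, 0 < s & forall l y, mnorm (y - x) < s -> ze l y <> ze k y -> s <= mnorm (ze l y - ze k x).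
    apply: (@finite_minT T (fun l s => forall y, mnorm (y - x) < s -> ze l y <> ze k y -> s <= mnorm (ze l y - ze k x))).
      by move=> l s s' h s0 hs y hy hne; have := h y (lt_le_trans hy hs) hne; apply: le_trans.
    move=> l; have [e2 e20 [he|hne]] := eqs (l, k) x x3; first by exists e2 => // y /he /= ->.
    have D0 : 0 < mnorm (ze l x - ze k x).
      rewrite lt_neqAle mnorm_ge0 andbT eq_sym; apply/eqP => h0.
      apply: (hne x (ball_center x e20)) => /=; apply/eqP; rewrite -subr_eq0; apply/eqP.
      by apply: mnorm_eq0; rewrite h0.
    set D := mnorm (ze l x - ze k x) in D0.
    have [|s s0 hs] := contz l (D / 2); first lra.
    exists (Num.min s (D / 2)); first by apply: min_gt0 => //; lra.
    move=> y; rewrite lt_min => /andP [y1 y2] _; have := hs y y1.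
    have := mnormB_tri (ze l x) (ze l y) (ze k x); rewrite (mnormBC (ze l x) (ze l y)) -/D.
    by have := minR s (D / 2); lra.
  have [s s0 sep] := sepT.
  have [|s1 s10 cz] := contz k (s / 8); first lra.
  pose rr := Num.min (Num.min rc e1) (Num.min (s / 8) s1).
  have rr0 : 0 < rr by rewrite /rr; apply: min_gt0; apply: min_gt0 => //; lra.
  have [m1 m2 m3 m4] : [/\ rr <= rc, rr <= e1, rr <= s / 8 & rr <= s1].
    have := minL (Num.min rc e1) (Num.min (s / 8) s1); have := minR (Num.min rc e1) (Num.min (s / 8) s1).
    have := minL rc e1; have := minR rc e1; have := minL (s / 8) s1; have := minR (s / 8) s1.
    by rewrite /rr => *; split; lra.
  have px : prj sg z = x by case: hz.
  have nrst v : mnorm (v - z) < rr -> nearest v (ze k (prj sg v)).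
    move=> hv; have hpv : mnorm (prj sg v - x) < rr.
      by rewrite -px prjB; apply: le_lt_trans (mnorm_prj _ _) hv.
    split; first by apply: inZ; apply: lt_le_trans hpv m2.
    move=> z' hz' hne; have [l el] := cov (prj sg v) z' (hrc _ (lt_le_trans hpv m1)) hz'.
    have q1 : s <= mnorm (z' - ze k x).
      by rewrite el; apply: sep; [apply: lt_le_trans hpv _; lra | rewrite -el].
    have q2 := cz (prj sg v) (lt_le_trans hpv m4).
    have q3 : mnorm (v - ze k x) < rr by rewrite -ek.
    have q4 := mnormB_tri v (ze k x) (ze k (prj sg v)); rewrite (mnormBC (ze k x)) in q4.
    have q5 := mnormB_tri z' v (ze k x); rewrite (mnormBC z' v) in q5.
    by clear -q1 q2 q3 q4 q5 m3 s0; lra.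
  have SE v : mnorm (v - z) < rr -> Sn v = ze k (prj sg v) by move=> hv; apply: SnP; apply: nrst.
  split.
    exists rr => // v hv; split=> [|v' hv' e]; first by rewrite SE //; apply: nrst.
    by rewrite !SE // e.
  split=> [i|j].
    have [t t0 ht] := smo (k, i) x x4.
    apply: (@CkAt_ext _ _ _ (fun v => ze k (prj sg v) 0 i)); first by exists rr => // v hv; rewrite SE.
    have := @Ck_prj R q d m sg _ _ inj (@open_ball _ _ x t) ht => hk.
    by apply: Ck_at (open_prj (@open_ball _ _ x t)) hk _; rewrite px; apply: ball_center.
  have [t t0 ht] := smc (k, j) x x5.
  apply: (@CkAt_ext _ _ _ (fun v => c j (ze k (prj sg v)))); first by exists rr => // v hv; rewrite SE.
  have := @Ck_prj R q d m sg _ _ inj (@open_ball _ _ x t) ht => hk.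
  by apply: Ck_at (open_prj (@open_ball _ _ x t)) hk _; rewrite px; apply: ball_center.
split.
  move=> e e0.
  have [||s s0 hs] := @finite_minT T (fun l s => forall y, mnorm (y - x) < s -> fibre y (ze l y) -> fibre x (ze l x) /\ mnorm (ze l y - ze l x) < e).
  - by move=> l s s' h _ hs y hy; apply: h; lra.
  - move=> l; have [e1 e10 [inZ|outZ]] := mem l x x2; last by exists e1 => // y /outZ.
    have [s s0 hs] := contz l e e0; exists s => // y hy _; split; last exact: hs.
    by apply: inZ; apply: ball_center.
  exists (Num.min rc s); first exact: min_gt0.
  move=> z' Zz'; rewrite lt_min => /andP [y1 y2].
  have hz' : fibre (prj sg z') z' by [].
  have [l el] := cov _ _ (hrc _ y1) hz'; exists (ze l x).
  by rewrite {1}el; apply: hs => //; rewrite -el.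
move=> i hi [p [q' [pq hall]]].
have [t /andP [t1 t2] /negP t3] := @finite_avoid R [seq ze k x 0 i | k <- enum T] p q' pq.
apply: t3; have [z [hz <-]] := hall t t1 t2.
have [k ->] := cov x z x1 hz; apply/mapP; exists k => //; by rewrite mem_enum.
Qed.

Lemma good_base_complement_nd : nowhere_dense (fun x => ~ good_base x).
Proof.
move=> a r r0; have hN := Def_not Def_good_base.
have [a' [r' [h1 [h2|h2]]]] := @dichotomy R S d _ a r hN r0; last by exists a', r'.
have [x [hx gx]] := generic_good_base a' h1.1.
by case: (h2 x hx).
Qed.

End Good.
End Branches.

(** * Iterated derivatives *)

Section Words.
Variables (R : rcfType) (S : ominimal_expansion R).
Local Notation Def := (Def S).
Local Notation Dfun := (Dfun S).

Fixpoint pdw n (w : seq 'I_n) (f : 'rV[R]_n -> R) := if w is i :: w' then pdw w' (pd i f) else f.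

Lemma Dfun_pdw n (w : seq 'I_n) f : Dfun f -> Dfun (pdw w f).
Proof. by elim: w f => [//|i w IH] f hf /=; apply: IH; apply: Dfun_pd. Qed.

Lemma pdw_ext n (w : seq 'I_n) (f g : 'rV[R]_n -> R) (V : 'rV[R]_n -> Prop) : open_set V ->
  (forall v, V v -> f v = g v) -> forall v, V v -> pdw w f v = pdw w g v.
Proof.
move=> oV; elim: w f g => [//|i w IH] f g h /=; apply: IH => v hv; apply: pd_ext.
exact: open_near h.
Qed.

Lemma Ck_pdw q n (w : seq 'I_n) (V : 'rV[R]_n -> Prop) f : Ck (size w + q) V f -> Ck q V (pdw w f).
Proof. by elim: w f => [//|i w IH] f h /=; apply: IH; apply: Ck_pd h. Qed.

Lemma WC_words q n (V : 'rV[R]_n -> Prop) f (W : 'rV[R]_n -> R) : Ck q V f ->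
  (forall w, (size w <= q)%N -> forall v, V v -> `|pdw w f v| <= W v) -> WC q V W (fun _ => 1) f.
Proof.
elim: q f => [|q IH] f hf hw.
  by split=> // v hv; split; [apply: Ck_cont hf hv | exact: (hw [::])].
split=> [v hv|i]; first by split; [apply: Ck_cont hf hv | exact: (hw [::])].
split=> [v hv|]; first by exists (pd i f v); apply: Ck_ispd hf hv.
suff h : WC q V W (fun _ => 1) (pd i f) by apply: WC_mono h => // v _; rewrite divr1.
by apply: IH => [|w ws v hv]; [apply: Ck_pd | apply: (hw (i :: w))].
Qed.

(** Ordinary derivative bounds become bounds on a scale [s <= 1]: only the function and its first
    division by [s] need comparing, since further divisions enlarge the weight. *)
Lemma WC_rescale q n (V : 'rV[R]_n -> Prop) (f w W s : 'rV[R]_n -> R) :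
  (forall v, V v -> 0 < s v) -> (forall v, V v -> s v <= 1) -> (forall v, V v -> `|f v| <= w v) ->
  (forall v, V v -> W v <= w v / s v) -> WC q V W (fun _ => 1) f -> WC q V w s f.
Proof.
move=> s0 s1 hf hW; case: q => [|q] [h1 h2]; split=> //; try by move=> v hv; have [c _] := h1 v hv; split=> //; apply: hf.
move=> i; have [h3 h4] := h2 i; split=> //.
apply: (WC_scale (s := fun _ => 1) s0 s1); apply: WC_mono h4 => // v hv.
by rewrite divr1; apply: hW.
Qed.

Lemma Ck_of_WC q n (V : 'rV[R]_n -> Prop) w s f : WC q V w s f -> Ck q V f.
Proof.
elim: q w f => [|q IH] w f [h1 h2]; split=> //; try by move=> v /h1 [].
by move=> i; have [h3 h4] := h2 i; split=> //; apply: IH h4.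
Qed.

Lemma WC_exp q n (V : 'rV[R]_n -> Prop) (w s f : 'rV[R]_n -> R) k : open_set V ->
  (forall v, V v -> 0 < s v) -> WC q V w s f ->
  WC q V (fun v => 2 ^+ (q * k) * w v ^+ k) s (fun v => f v ^+ k).
Proof.
move=> oV s0 hf; elim: k => [|k IH].
  by apply: WC_mono (WC_cst oV s0 q 1) => // v hv; rewrite normr1 muln0 !expr0 mulr1.
apply: (@WC_ext _ _ _ _ oV _ (fun v => f v * f v ^+ k)) => [v _|]; first by rewrite exprS.
apply: WC_mono (WC_mul oV s0 hf IH) => // v hv.
by rewrite mulnS exprD exprS le_eqVlt; apply/orP; left; apply/eqP; ring.
Qed.

Lemma WC_union q n (V1 V2 : 'rV[R]_n -> Prop) w s f : WC q V1 w s f -> WC q V2 w s f ->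
  WC q (fun v => V1 v \/ V2 v) w s f.
Proof.
elim: q w f => [|q IH] w f [h1 h2] [k1 k2]; split=> //; try by move=> v [/h1|/k1].
move=> i; have [h3 h4] := h2 i; have [k3 k4] := k2 i.
by split; [move=> v [/h3|/k3] | exact: IH].
Qed.

(* Moves from [a] to [b] along the coordinate directions in which they differ. *)
Lemma lipschitz_path n (f : 'rV[R]_n -> R) (a b : 'rV[R]_n) (M : R) : Dfun f -> 0 <= M ->
  (forall v, mnorm (v - a) <= mnorm (b - a) -> (forall i, a 0 i = b 0 i -> v 0 i = a 0 i) ->
     forall i, a 0 i != b 0 i -> exists2 l, is_pd i f v l & `|l| <= M) ->
  `|f b - f a| <= n%:R * M * mnorm (b - a).
Proof.
move=> hf M0 hd; set D := mnorm (b - a); have D0 : 0 <= D by exact: mnorm_ge0.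
pose w k : 'rV[R]_n := \row_i (if (i < k)%N then b 0 i else a 0 i).
have wn : w n = b by apply/rowP => i; rewrite mxE ltn_ord.
have w0 : w 0 = a by apply/rowP => i; rewrite mxE.
suff gen k : (k <= n)%N -> `|f (w k) - f a| <= k%:R * M * D by rewrite -{1}wn; apply: gen.
elim: k => [_|k IH kn]; first by rewrite w0 subrr normr0 !mul0r.
pose j := Ordinal kn; pose h := b 0 j - a 0 j.
have wS : w k.+1 = w k + h *: delta_mx 0 j.
  apply/rowP => i; rewrite !mxE eqxx /= ltnS leq_eqVlt.
  have [->|ne] := eqVneq i j; first by rewrite eqxx /= ltnn mulr1 /h addrC subrK.
  have -> : (val i == k) = false by apply/negbTE; move: ne; rewrite -val_eqE.
  by rewrite mulr0 addr0.
have hD : `|h| <= D by have := mnorm_coord (b - a) j; rewrite !mxE.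
have [hj|hj] := eqVneq (a 0 j) (b 0 j).
  have -> : w k.+1 = w k by rewrite wS /h -hj subrr scale0r addr0.
  apply: le_trans (IH (ltnW kn)) _; rewrite -mulrA -[leRHS]mulrA ler_wpM2r ?mulr_ge0 //.
  by rewrite ler_nat.
have step : `|f (w k.+1) - f (w k)| <= M * D.
  rewrite wS; have := @mean_value_dir R S n f j (w k) h 0 M hf; rewrite mulr0 subr0.
  move=> H; apply: le_trans (H _) _; last by rewrite ler_wpM2l.
  move=> t t0 t1; have [|||l l1 l2] := hd (w k + (t * h) *: delta_mx 0 j) _ _ j => //.
  - apply: mnorm_le => // i; rewrite !mxE eqxx /=.
    have [->|ne] := eqVneq i j; last first.
      rewrite mulr0 addr0; case: ifP => _; last by rewrite subrr normr0.
      by have := mnorm_coord (b - a) i; rewrite !mxE.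
    rewrite ltnn mulr1 addrAC subrr add0r normrM ger0_norm //.
    by apply: le_trans hD; rewrite ler_piMl.
  - move=> i hi; rewrite !mxE eqxx /=; case: eqVneq hi => [->|_] hi.
      by move: hj; rewrite hi eqxx.
    by rewrite mulr0 addr0; case: ifP.
  - by exists l => //; rewrite subr0.
have -> : f (w k.+1) - f a = (f (w k.+1) - f (w k)) + (f (w k) - f a) by ring.
apply: le_trans (ler_normD _ _) _; have := IH (ltnW kn); rewrite -natr1.
by clear -step; lra.
Qed.

Lemma slowfn_minorant q d O (g : 'rV[R]_d -> R) (C : 'rV[R]_d -> R -> Prop) : slowfn S q O g ->
  Def (fun p : 'rV[R]_d * R => C p.1 p.2) ->
  (forall x (r r' : R), C x r -> 0 < r' -> r' <= r -> C x r') ->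
  (forall x, O x -> exists2 r : R, 0 < r & forall y, mnorm (y - x) < r -> O y -> C y r) ->
  exists2 de, slowfn S q O de & (forall x, de x <= g x) /\ forall x, O x -> C x (de x).
Proof.
move=> sg hC mC lC; have [de hde [d1 d2 d3 d4 d5]] := slow_minorant sg hC mC lC.
exists de => //; split=> // [x|x|x|x a na|t t0].
- by split=> [/d1 //|]; have [//|/d2 ->] := EM (O x); rewrite ltxx.
- by have [/d1 /ltW //|/d2 ->] := EM (O x).
- exact: le_trans (d3 x) (slow_le1 sg x).
- exact: le_trans (d3 x) (slow_decay sg x na).
- by have [M hM] := slow_bounded sg t0; exists M => x hx; apply: hM; apply: le_trans hx (d3 x).
Qed.

End Words.

(** * Tubular cut-off functions *)

Section Tube.
Variables (R : rcfType) (S : ominimal_expansion R).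
Local Notation Def := (Def S).
Local Notation Dfun := (Dfun S).
Variables (m d : nat) (sg : 'I_d -> 'I_m) (Z : 'rV[R]_m -> Prop).
Hypotheses (inj : injective sg) (hZ : Def Z).
Variables (q : nat) (J : finType) (c : J -> 'rV[R]_m -> R) (Sn : 'rV[R]_m -> 'rV[R]_m).
Hypotheses (hc : forall j, Dfun (c j)) (hSn : Dfun Sn).
Local Notation pr := (prj sg).
Local Notation fib := (fibre sg Z).

(** What remains of [good_point] at a point of the tube that need not lie on the section. *)
Definition regular v := (exists2 e : R, 0 < e & forall v', mnorm (v' - v) < e -> fib (pr v') (Sn v') /\
    forall v'', mnorm (v'' - v) < e -> pr v'' = pr v' -> Sn v'' = Sn v') /\
  (forall i, CkAt q (fun v => Sn v 0 i) v) /\ (forall j, CkAt q (fun v => c j (Sn v)) v).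

Lemma Def_regular : Def regular.
Proof.
have hF := Def_fibre sg hZ; have hp := Dfun_prj S sg.
have h1 i : Def (CkAt q (fun v => Sn v 0 i)) by apply: Def_CkAt; definable.
have h2 j : Def (CkAt q (fun v => c j (Sn v))) by apply: Def_CkAt; apply: (Dfun_comp (hc j)).
rewrite /regular; apply: Def_and; first by definable.
by apply: Def_and; apply: Def_all_fin.
Qed.

Lemma good_point_near z : good_point sg Z q c Sn z -> exists2 r : R, 0 < r & forall v, mnorm (v - z) < r ->
  regular v /\ forall z', Z z' -> mnorm (z' - z) < r -> pr z' = pr v -> Sn v = z'.
Proof.
move=> [[r0 r00 h0] [h1 h2]].
have [||r1 r10 hr1] := @finite_minT R 'I_m (fun i r => Ck q (fun y => mnorm (y - z) < r) (fun v => Sn v 0 i)).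
- by move=> i r r' h _ hr; apply: Ck_sub h => v hv; apply: lt_le_trans hv hr.
- by move=> i; apply: h1.
have [||r2 r20 hr2] := @finite_minT R J (fun j r => Ck q (fun y => mnorm (y - z) < r) (fun v => c j (Sn v))).
- by move=> i r r' h _ hr; apply: Ck_sub h => v hv; apply: lt_le_trans hv hr.
- by move=> j; apply: h2.
exists (Num.min r0 (Num.min r1 r2)); first by rewrite !lt_min r00 r10.
move=> v; rewrite !lt_min => /andP [v0 /andP [v1 v2]]; split.
  split; last by split=> i; [exact: Ck_at (@open_ball _ _ _ _) (hr1 i) v1 | exact: Ck_at (@open_ball _ _ _ _) (hr2 i) v2].
  have [e e0 he] := open_ball v0; exists e => // v' hv'; have [[hn _] hk] := h0 v' (he _ hv').
  by split=> // v'' /he; apply: hk.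
move=> z' Zz'; rewrite !lt_min => /andP [z0 _] ez; have [_ hk] := h0 _ z0.
have [[_ hn] _] := h0 _ z0; rewrite (hk v v0 (esym ez)).
apply: contrapT => ne; have := hn z' (conj Zz' erefl) (fun e => ne (esym e)).
by rewrite subrr mnorm0 ltNge mnorm_ge0.
Qed.

(** The finitely many points of the fibre over [x] have a common good radius, and every point of a
    nearby fibre is close to one of them. *)
Lemma tube_local (Q : 'rV[R]_m -> R -> Prop) x : good_base sg Z q c Sn x ->
  (forall v (r r' : R), Q v r -> 0 < r' -> r' <= r -> Q v r') ->
  (forall z, fib x z -> exists2 r : R, 0 < r & forall v, mnorm (v - z) < r -> Q v r) ->
  exists2 r : R, 0 < r & forall y, mnorm (y - x) < r -> forall v z, fib y z -> pr v = y ->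
    mnorm (v - z) < r -> [/\ Q v r, regular v & Sn v = z].
Proof.
move=> [gx [near nint]] mQ lQ; have [t ht] := no_interval_fibre_finite hZ nint.
have [||r r0 hr] := @seq_uniform R _ t (fun z r => fib x z -> forall v, mnorm (v - z) < r ->
   Q v r /\ regular v /\ forall z', Z z' -> mnorm (z' - z) < r -> pr z' = pr v -> Sn v = z').
- move=> z r r' h r0 hr hz v hv; have [h1 [h2 h3]] := h hz v (lt_le_trans hv hr).
  split; [exact: mQ h1 r0 hr | split=> // z' Zz' hz'; apply: h3 => //; exact: lt_le_trans hz' hr].
- move=> z _; have [hz|nz] := EM (fib x z); last by exists 1.
  have [r1 r10 h1] := lQ z hz; have [r2 r20 h2] := good_point_near (gx z hz).
  have m0 := min_gt0 r10 r20; exists (Num.min r1 r2) => // _ v; rewrite lt_min => /andP [v1 v2].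
  have [h3 h4] := h2 v v2; split; first by apply: mQ (h1 v v1) m0 (minL _ _).
  by split=> // z' Zz'; rewrite lt_min => /andP [_ z2]; apply: h4.
have [|r2 r20 h2] := near (r / 2); first lra.
exists (Num.min r2 (r / 2)); first by apply: min_gt0 => //; lra.
move=> y; rewrite lt_min => /andP [y1 _] v z [Zz pz] pv; rewrite lt_min => /andP [v1 v2].
have [|z0 [fz0 hz0]] := h2 z Zz; first by rewrite pz.
have vz : mnorm (v - z0) < r by have := mnormB_tri v z z0; lra.
have [k1 [k2 k3]] := hr z0 (ht z0 fz0) fz0 v vz; split=> //.
  apply: mQ k1 _ _; first by apply: min_gt0 => //; lra.
  by have := minR r2 (r / 2); lra.
by apply: k3 => //; [lra | rewrite pz pv].
Qed.

Variable O : 'rV[R]_d -> Prop.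
Hypothesis hO : forall x, O x -> good_base sg Z q c Sn x.

Definition tube_ok (de : 'rV[R]_d -> R) (Q : 'rV[R]_m -> R -> Prop) := forall v z, O (pr v) ->
  fib (pr v) z -> mnorm (v - z) < de (pr v) -> [/\ Q v (de (pr v)), regular v & Sn v = z].

Lemma tube_minorant g Q : slowfn S q O g -> Def (fun p : 'rV[R]_m * R => Q p.1 p.2) ->
  (forall v (r r' : R), Q v r -> 0 < r' -> r' <= r -> Q v r') ->
  (forall z, Z z -> O (pr z) -> exists2 r : R, 0 < r & forall v, mnorm (v - z) < r -> Q v r) ->
  exists2 de, slowfn S q O de & (forall x, de x <= g x) /\ tube_ok de Q.
Proof.
move=> sg0 hQ mQ lQ; have hF := Def_fibre sg hZ; have hp := Dfun_prj S sg; have hr := Def_regular.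
have [|||de sde [h1 h2]] := @slowfn_minorant R S q d O g (fun x r => forall v z, fib x z -> pr v = x ->
    mnorm (v - z) < r -> Q v r /\ regular v /\ Sn v = z) sg0.
- by definable.
- move=> x r r' h r0 hrr v z fz pv hv; have [k1 k2] := h v z fz pv (lt_le_trans hv hrr).
  by split=> //; apply: mQ k1 r0 hrr.
- move=> x Ox; have [|r r0 k] := @tube_local Q x (hO Ox) mQ; first by move=> z [Zz pz]; apply: lQ => //; rewrite pz.
  by exists r => // y hy _ v z fz pv hv; have [] := k y hy v z fz pv hv.
exists de => //; split=> // v z Ov fz hv; have [k1 [k2 k3]] := h2 _ Ov v z fz erefl hv; split=> //.
Qed.

(** Derivatives of the section up to order [q] are bounded by [1 / r]. Words of bounded length form
    a finite type, which permits taking finitely many minima. *)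
Definition tame v (r : R) := forall i (w : q.-bseq 'I_m), `|pdw w (fun v => Sn v 0 i) v| * r <= 1.

Lemma tame_minorant g : slowfn S q O g ->
  exists2 th, slowfn S q O th & (forall x, th x <= g x) /\ tube_ok th tame.
Proof.
move=> sg0; apply: tube_minorant => //.
- apply: Def_all_fin => i; apply: Def_all_fin => w.
  have hf : Dfun (pdw w (fun v => Sn v 0 i)) by apply: Dfun_pdw; definable.
  by definable.
- move=> v r r' h r0 hr i w; apply: le_trans (h i w); exact: ler_wpM2l.
move=> z Zz Oz; have [gz _] := hO Oz; have [_ [smo _]] := gz z (conj Zz erefl).
have [||r r0 hr] := @finite_minT R ('I_m * q.-bseq 'I_m)%type (fun k r => forall v, mnorm (v - z) < r ->
    `|pdw k.2 (fun v => Sn v 0 k.1) v| * r <= 1).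
- move=> k r r' h r0 hr v hv; apply: le_trans (h v (lt_le_trans hv hr)); exact: ler_wpM2l.
- move=> [i w] /=; have [r r0 hr] := smo i.
  have hC : Ck 0 (fun y => mnorm (y - z) < r) (pdw w (fun v => Sn v 0 i)).
    by apply: Ck_pdw; rewrite addn0; apply: Ck_leq (size_bseq w) hr.
  have [e e0 he] := Ck_cont hC (ball_center z r0) ltr01.
  set f := pdw _ _ in he *; pose M : R := `|f z| + 1; have M0 : 0 < M by rewrite /M; have := normr_ge0 (f z); lra.
  exists (Num.min e M^-1); first by apply: min_gt0 => //; rewrite invr_gt0.
  move=> v; rewrite lt_min => /andP [v1 _].
  have fM : `|f v| <= M by have := he v v1; have := ler_normD (f v - f z) (f z); rewrite subrK /M; lra.
  apply: le_trans (_ : M * M^-1 <= _); last by rewrite mulfV //; lra.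
  by apply: ler_pM => //; [apply: ltW; apply: min_gt0 => //; rewrite invr_gt0 | exact: minR].
by exists r => // v hv i w; apply: (hr (i, w)).
Qed.

(** * Cut-off function of a tube and its derivative bounds *)

Section Cut.
Variables th de : 'rV[R]_d -> R.
Hypotheses (sth : slowfn S q O th) (sde : slowfn S q O de) (dth : forall x, de x <= th x) (tok : tube_ok th tame).

Definition tube v := O (pr v) /\ exists z, fib (pr v) z /\ mnorm (v - z) < de (pr v).
(** The length scale of the tube: displacements have size [de] and their derivatives size [1 / th],
    so one derivative costs [1 / (de * th)]. *)
Definition tscale v := de (pr v) * th (pr v).
Local Notation sc := tscale.

Lemma tubeP v : tube v -> [/\ O (pr v), fib (pr v) (Sn v), mnorm (v - Sn v) < de (pr v), regular v & tame v (th (pr v))].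
Proof.
move=> [Ov [z [fz hz]]]; have [k1 k2 k3] := tok Ov fz (lt_le_trans hz (dth _)).
by rewrite k3; split.
Qed.

Lemma de_gt0 v : O (pr v) -> 0 < de (pr v). Proof. by move/(slow_dom sde). Qed.
Lemma th_gt0 v : O (pr v) -> 0 < th (pr v). Proof. by move/(slow_dom sth). Qed.

Lemma tscale_gt0 v : O (pr v) -> 0 < sc v.
Proof. by move=> Ov; rewrite mulr_gt0 ?de_gt0 ?th_gt0. Qed.

Lemma tscale_le1 v : sc v <= 1.
Proof. by rewrite mulr_ile1 ?(slow_ge0 sde) ?(slow_ge0 sth) ?(slow_le1 sde) ?(slow_le1 sth). Qed.

Lemma tube_gt0 v : tube v -> 0 < sc v.
Proof. by case=> Ov _; apply: tscale_gt0. Qed.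

Lemma open_over : open_set (fun v => O (pr v)).
Proof. exact: open_prj (slow_open sde). Qed.

Lemma Sn_cont v i : regular v -> cont (fun v => Sn v 0 i) v.
Proof. by move=> [_ [h _]]; have [r r0 hr] := h i; apply: Ck_cont hr _; apply: ball_center. Qed.

Lemma cont_mnorm n k (f : 'rV[R]_n -> 'rV[R]_k) v : (forall i, cont (fun v => f v 0 i) v) ->
  forall e : R, 0 < e -> exists2 r : R, 0 < r & forall y, mnorm (y - v) < r -> mnorm (f y - f v) < e.
Proof.
move=> h e e0.
have [||r r0 hr] := @finite_minT R 'I_k (fun i r => forall y, mnorm (y - v) < r -> `|f y 0 i - f v 0 i| < e).
- by move=> i r r' hr _ rr y hy; apply: hr; apply: lt_le_trans hy rr.
- by move=> i; apply: h.
by exists r => // y hy; apply: mnorm_lt => // i; rewrite !mxE; apply: hr.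
Qed.

Lemma open_tube : open_set tube.
Proof.
move=> v tv; have [Ov fv hv rv _] := tubeP tv.
have [r1 r10 h1] := open_over Ov; have [[e2 e20 h2] _] := rv.
pose g : R := (de (pr v) - mnorm (v - Sn v)) / 3; have g0 : 0 < g by rewrite /g; lra.
have [r3 r30 h3] := cont_mnorm (fun i => Sn_cont i rv) g0.
have [r4 r40 h4] := cont_prj (slow_cont (pr v) sde) g0.
exists (Num.min (Num.min r1 e2) (Num.min g (Num.min r3 r4))); first by rewrite !lt_min r10 e20 g0 r30.
move=> y; rewrite !lt_min => /andP [/andP [y1 y2] /andP [y5 /andP [y3 y4]]].
split; first exact: h1.
exists (Sn y); split; first by have [] := h2 y y2.
have := h3 y y3; have := h4 y y4; rewrite ltr_norml => /andP [k1 _] k2.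
have k3 := mnormB_tri y v (Sn y); have k4 := mnormB_tri v (Sn v) (Sn y); rewrite (mnormBC (Sn v)) in k4.
by move: y5 k1 k2; rewrite /g => y5 k1 k2; lra.
Qed.

Lemma Ck_tube_Sn i : Ck q tube (fun v => Sn v 0 i).
Proof. by apply: Ck_local => v /tubeP [_ _ _ [_ [h _]] _]. Qed.

Lemma Ck_tube_c j : Ck q tube (fun v => c j (Sn v)).
Proof. by apply: Ck_local => v /tubeP [_ _ _ [_ [_ h]] _]. Qed.

Local Notation over := (fun v => O (pr v)).

Lemma WC_slow_pr s : slowfn S q O s -> WC q over (fun _ => 1) (fun _ => 1) (fun v => s (pr v)).
Proof.
move=> ss; exact: (WC_prj (s := fun _ => 1) inj (slow_open ss) (fun _ _ => ltr01) (slow_WC ss)).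
Qed.

Lemma WC_de_over : WC q over (fun v => de (pr v)) sc (fun v => de (pr v)).
Proof.
apply: (WC_rescale (W := fun _ => 1) tscale_gt0 (fun v _ => tscale_le1 v)) => [v _|v Ov|].
- by rewrite ger0_norm // (slow_ge0 sde).
- have h1 := de_gt0 Ov; have h2 := th_gt0 Ov.
  have -> : de (pr v) / sc v = (th (pr v))^-1 by rewrite /tscale; field; apply/andP; split; apply/eqP; lra.
  by rewrite -invr1 lef_pV2 ?posrE // (slow_le1 sth).
exact: WC_slow_pr sde.
Qed.

Lemma WC_de : WC q tube (fun v => de (pr v)) sc (fun v => de (pr v)).
Proof. by apply: WC_sub WC_de_over => v []. Qed.

Lemma WC_Sn i : WC q tube (fun v => (th (pr v))^-1) (fun _ => 1) (fun v => Sn v 0 i).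
Proof.
apply: WC_words (Ck_tube_Sn i) _ => w ws v tv; have [Ov _ _ _ tm] := tubeP tv.
by have := tm i (Bseq ws); rewrite -ler_pdivlMr ?th_gt0 // mul1r.
Qed.

Definition ycoord i (v : 'rV[R]_m) := v 0 i - Sn v 0 i.

(** The displacement is at most [de]. The factor 3 comes from its derivatives: [v 0 i] is bounded by
    [2 / th], because [de <= 1 <= 1 / th], and [Sn v 0 i] by [1 / th]. *)
Lemma WC_ycoord i : WC q tube (fun v => 3 * de (pr v)) sc (ycoord i).
Proof.
have yb v : tube v -> `|ycoord i v| <= de (pr v).
  move=> /tubeP [_ _ h _ _]; have := mnorm_coord (v - Sn v) i; rewrite !mxE /ycoord; lra.
have one0 v : tube v -> 0 < (1 : R) by [].
have oT := open_tube.
apply: (WC_rescale (W := fun v => 2 * (th (pr v))^-1 + (th (pr v))^-1) tube_gt0 (fun v _ => tscale_le1 v)) => [v tv|v tv|].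
- by have := yb v tv; have := slow_ge0 sde (pr v); lra.
- have [Ov _] := tv; have h1 := de_gt0 Ov; have h2 := th_gt0 Ov.
  rewrite le_eqVlt; apply/orP; left; apply/eqP; rewrite /tscale; field; apply/andP; split; apply/eqP; lra.
apply: WC_add => //; last by apply: WC_opp => //; apply: WC_Sn.
have ti v : tube v -> 1 <= (th (pr v))^-1.
  by case=> Ov _; rewrite -invr1 lef_pV2 ?posrE ?th_gt0 // (slow_le1 sth).
apply: WC_coord => // v tv; last by have := ti v tv; lra.
have := WC_bound (WC_Sn i) tv; have := yb v tv; have := ti v tv; have := slow_le1 sde (pr v).
have := ler_normD (ycoord i v) (Sn v 0 i); rewrite /ycoord subrK; lra.
Qed.

Definition rho v := \sum_i ycoord i v ^+ 2.
Definition cutN := q.+1.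
Definition cutP v := de (pr v) ^+ 2 / 4 - rho v.
Definition cutQ v := rho v - de (pr v) ^+ 2 / 16.
(** The usual quotient of truncated powers: it is 1 where [rho <= de ^ 2 / 16] and 0 where
    [rho >= de ^ 2 / 4]. The exponent [cutN] is the least one covered by [WC_pos] for smoothness
    [q]. *)
Definition cut v : R := if `[< tube v >] then
  Num.max (cutP v) 0 ^+ cutN / (Num.max (cutP v) 0 ^+ cutN + Num.max (cutQ v) 0 ^+ cutN) else 0.
Definition cutA : R := 2 ^+ q * 2 ^+ q + m%:R * (2 ^+ q * 9).
Definition cutc : R := (3 / 32 / cutA) ^+ cutN / (2 * Kpos R q cutN).
Definition Kcut : R := 2 ^+ q * (Kinv q cutc / 2).

Lemma cutA_gt0 : 0 < cutA.
Proof. by rewrite /cutA ltr_pwDl ?mulr_gt0 ?exprn_gt0 // !mulr_ge0 ?exprn_ge0. Qed.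

Lemma cutc_gt0 : 0 < cutc.
Proof. by rewrite divr_gt0 ?exprn_gt0 ?mulr_gt0 ?Kpos_gt0 ?invr_gt0 ?cutA_gt0. Qed.

Lemma Kcut_gt0 : 0 < Kcut.
Proof. by rewrite mulr_gt0 ?exprn_gt0 // divr_gt0 // Kinv_gt0 ?cutc_gt0. Qed.

Lemma WC_rho : WC q tube (fun v => m%:R * (2 ^+ q * 9) * de (pr v) ^+ 2) sc rho.
Proof.
have oT := open_tube.
have h i : WC q tube (fun v => 2 ^+ q * (3 * de (pr v) * (3 * de (pr v)))) sc (fun v => ycoord i v ^+ 2).
  apply: (WC_ext oT _ (WC_mul oT tube_gt0 (WC_ycoord i) (WC_ycoord i))) => v _; by rewrite expr2.
apply: WC_mono (WC_sum oT tube_gt0 (index_enum _) (fun i _ => h i)); first exact: tube_gt0.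
move=> v _; rewrite sumr_const card_ord -mulr_natl le_eqVlt; apply/orP; left; apply/eqP; ring.
Qed.

Lemma WC_de2 (k : R) : 0 <= k -> k <= 1 ->
  WC q tube (fun v => 2 ^+ q * 2 ^+ q * de (pr v) ^+ 2) sc (fun v => de (pr v) ^+ 2 * k).
Proof.
move=> k0 k1; have oT := open_tube.
apply: (WC_ext oT (f := fun v => k * (de (pr v) * de (pr v)))) => [v _|]; first by rewrite expr2 mulrC.
apply: WC_mono (WC_scal oT tube_gt0 k (WC_mul oT tube_gt0 WC_de WC_de)); first exact: tube_gt0.
move=> v _; rewrite ger0_norm // -mulrA ler_wpM2l ?exprn_ge0 // expr2.
by rewrite ler_piMl // !mulr_ge0 ?exprn_ge0 ?(slow_ge0 sde).
Qed.

Lemma WC_cutP : WC q tube (fun v => cutA * de (pr v) ^+ 2) sc cutP.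
Proof.
have oT := open_tube; have h0 : 0 <= 4^-1 :> R by lra.
have h1 : 4^-1 <= 1 :> R by lra.
rewrite /cutP; apply: WC_mono (WC_add oT tube_gt0 (WC_de2 h0 h1) (WC_opp oT WC_rho)); first exact: tube_gt0.
by move=> v _; rewrite /cutA -mulrDl.
Qed.

Lemma WC_cutQ : WC q tube (fun v => cutA * de (pr v) ^+ 2) sc cutQ.
Proof.
have oT := open_tube; have h0 : 0 <= 16^-1 :> R by lra.
have h1 : 16^-1 <= 1 :> R by lra.
rewrite /cutQ; apply: WC_mono (WC_add oT tube_gt0 WC_rho (WC_opp oT (WC_de2 h0 h1))); first exact: tube_gt0.
by move=> v _; rewrite /cutA -mulrDl addrC.
Qed.

(** [cutP] and [cutQ] add up to [3 / 16 * de ^ 2], so one of them is at least half of that. *)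
Lemma cut_denom v : tube v -> (3 / 32 * de (pr v) ^+ 2) ^+ cutN <=
  Num.max (cutP v) 0 ^+ cutN + Num.max (cutQ v) 0 ^+ cutN.
Proof.
move=> [Ov _]; have d0 := de_gt0 Ov; have d2 : 0 < de (pr v) ^+ 2 by exact: exprn_gt0.
have hs : cutP v + cutQ v = 3 / 16 * de (pr v) ^+ 2 by rewrite /cutP /cutQ; field.
have p0 := maxR (cutP v) 0; have q0 := maxR (cutQ v) 0; have p1 := maxL (cutP v) 0; have q1 := maxL (cutQ v) 0.
have [h|h] := leP (3 / 32 * de (pr v) ^+ 2) (cutP v).
  apply: le_trans (_ : Num.max (cutP v) 0 ^+ cutN <= _); last by rewrite lerDl exprn_ge0.
  by rewrite lerXn2r ?nnegrE //; lra.
apply: le_trans (_ : Num.max (cutQ v) 0 ^+ cutN <= _); last by rewrite lerDr exprn_ge0.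
by rewrite lerXn2r ?nnegrE //; lra.
Qed.

Lemma cut_denom_gt0 v : tube v -> 0 < Num.max (cutP v) 0 ^+ cutN + Num.max (cutQ v) 0 ^+ cutN.
Proof.
move=> tv; apply: lt_le_trans (cut_denom tv); have [Ov _] := tv.
by apply: exprn_gt0; apply: mulr_gt0; [lra | apply: exprn_gt0; exact: de_gt0].
Qed.

(** The bound [Kcut] depends only on the dimension and the order, not on the widths; hence the width
    may be fixed afterwards in terms of it. *)
Lemma WC_cut : WC q tube (fun _ => Kcut) sc cut.
Proof.
have oT := open_tube; have A0 := cutA_gt0; have K0 := Kpos_gt0 R q cutN.
have hN : (q < cutN)%N by [].
have hP := WC_pos oT tube_gt0 hN WC_cutP; have hQ := WC_pos oT tube_gt0 hN WC_cutQ.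
have hD := WC_add oT tube_gt0 hP hQ.
have w0 v : tube v -> 0 < Kpos R q cutN * (cutA * de (pr v) ^+ 2) ^+ cutN.
  by case=> Ov _; rewrite mulr_gt0 // exprn_gt0 // mulr_gt0 // exprn_gt0 // de_gt0.
have hI := WC_inv oT tube_gt0 cutc_gt0 hD.
apply: (WC_ext oT (f := fun v => Num.max (cutP v) 0 ^+ cutN * (Num.max (cutP v) 0 ^+ cutN + Num.max (cutQ v) 0 ^+ cutN)^-1)).
  by move=> v tv; rewrite /cut asboolT.
apply: WC_mono (WC_mul oT tube_gt0 hP (hI _ _)); first exact: tube_gt0.
- move=> v tv; have := w0 v tv; set W := Kpos R q cutN * _ => W0.
  rewrite /Kcut ler_wpM2l ?exprn_ge0 // le_eqVlt; apply/orP; left; apply/eqP; field; lra.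
- by move=> v tv; have := w0 v tv; lra.
move=> v tv; rewrite ger0_norm; last exact: ltW (cut_denom_gt0 tv).
apply: le_trans (cut_denom tv); rewrite le_eqVlt; apply/orP; left; apply/eqP.
have [Ov _] := tv; have d0 := de_gt0 Ov.
have -> : 3 / 32 * de (pr v) ^+ 2 = (3 / 32 / cutA) * (cutA * de (pr v) ^+ 2) by field; lra.
by rewrite [RHS]exprMn /cutc; field; lra.
Qed.

Lemma rho_ge v i : ycoord i v ^+ 2 <= rho v.
Proof. by rewrite /rho (bigD1 i) //= lerDl sumr_ge0 // => j _; rewrite sqr_ge0. Qed.

Lemma rho_ge0 v : 0 <= rho v.
Proof. by rewrite sumr_ge0 // => j _; rewrite sqr_ge0. Qed.

Lemma cut_support v : cut v != 0 -> tube v /\ mnorm (v - Sn v) < de (pr v) / 2.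
Proof.
rewrite /cut; case: asboolP => [tv h|_]; last by rewrite eqxx.
split=> //; have [Ov _] := tv; have d0 := de_gt0 Ov; apply: mnorm_lt => [|i]; first lra.
have P0 : 0 < cutP v.
  rewrite ltNge; apply/negP => hle; move: h.
  by rewrite (max_idPr hle) expr0n /= mul0r eqxx.
have := rho_ge v i; move: P0; rewrite /cutP /ycoord !mxE => P0 hr.
rewrite -(ltr_pXn2r (n := 2)) ?nnegrE ?normr_ge0 //; last lra.
by rewrite real_normK ?num_real // expr_div_n; lra.
Qed.

Lemma cut_eq1 v : tube v -> rho v <= de (pr v) ^+ 2 / 16 -> cut v = 1.
Proof.
move=> tv h; have := cut_denom_gt0 tv; rewrite /cut asboolT // {1 2}/cutQ.
have hle : rho v - de (pr v) ^+ 2 / 16 <= 0 by lra.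
rewrite (max_idPr hle) expr0n /= addr0 => D0.
by rewrite divff // lt0r_neq0.
Qed.

Lemma cut_ge0 v : 0 <= cut v.
Proof.
rewrite /cut; case: asboolP => // tv; apply: divr_ge0; first by rewrite exprn_ge0 // maxR.
exact: ltW (cut_denom_gt0 tv).
Qed.

Lemma cut_le1 v : cut v <= 1.
Proof.
rewrite /cut; case: asboolP => // tv; rewrite ler_pdivrMr ?cut_denom_gt0 // mul1r lerDl.
by rewrite exprn_ge0 // maxR.
Qed.

(** If the cut-off were nonzero at points arbitrarily close to [v], these would lie within [de / 2]
    of [Z], and by the middle condition of [good_base] some point of the fibre of [v] would be
    within [de] of [v]. *)
Lemma cut_outside v : O (pr v) -> ~ tube v -> exists2 e : R, 0 < e & forall y, mnorm (y - v) < e -> cut y = 0.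
Proof.
move=> Ov nt; have d0 := de_gt0 Ov; have [_ [near _]] := hO Ov.
have e0 : 0 < de (pr v) / 8 by lra.
have [r1 r10 h1] := near _ e0; have [r2 r20 h2] := cont_prj (slow_cont (pr v) sde) e0.
exists (Num.min (de (pr v) / 8) (Num.min r1 r2)); first by rewrite !lt_min e0 r10.
move=> y; rewrite !lt_min => /andP [y0 /andP [y1 y2]]; apply/eqP; apply: contrapT => /negP /cut_support [ty hy].
have [Oy [Zy py] _ _ _] := tubeP ty.
have [|z [fz hz]] := h1 _ Zy; first by rewrite py prjB; apply: le_lt_trans (mnorm_prj _ _) y1.
apply: nt; split=> //; exists z; split=> //.
have := h2 y y2; rewrite ltr_norml => /andP [_ k1].
have k2 := mnormB_tri v y z; have k3 := mnormB_tri y (Sn y) z; rewrite (mnormBC v y) in k2.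
by lra.
Qed.

Definition off_cut v := O (pr v) /\ exists2 e : R, 0 < e & forall y, mnorm (y - v) < e -> cut y = 0.

Lemma tube_or_off v : O (pr v) -> tube v \/ off_cut v.
Proof. by move=> Ov; have [|nt] := EM (tube v); [left | right; split=> //; apply: cut_outside]. Qed.

Lemma open_off_cut : open_set off_cut.
Proof.
move=> v [Ov [e e0 he]]; have [r r0 hr] := open_over Ov.
exists (Num.min r (e / 2)); first by rewrite lt_min r0; lra.
move=> y; rewrite lt_min => /andP [y1 y2]; split; first exact: hr.
by exists (e / 2); [lra | move=> x hx; apply: he; have := mnormB_tri x y v; lra].
Qed.

Lemma off_cut0 v : off_cut v -> cut v = 0.
Proof. by case=> _ [e e0]; apply; apply: ball_center. Qed.

(** Over [O] every point lies in the tube or has a neighbourhood on which the cut-off vanishes, so a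
    product with the cut-off keeps its bounds after extension by zero. *)
Lemma WC_cut_mul q' f (w : 'rV[R]_m -> R) : (q' <= q)%N -> (forall v, O (pr v) -> 0 <= w v) -> WC q' tube w sc f ->
  WC q' (fun v => O (pr v)) (fun v => 2 ^+ q' * (Kcut * w v)) sc (fun v => cut v * f v).
Proof.
move=> hq w0 hf; apply: WC_sub tube_or_off _; apply: WC_union.
  exact: (WC_mul open_tube tube_gt0 (WC_leq hq WC_cut) hf).
have s0 v : off_cut v -> 0 < sc v by case=> Ov _; apply: tscale_gt0.
apply: (WC_ext open_off_cut (f := fun _ => 0)) => [v ov|]; first by rewrite off_cut0 // mul0r.
apply: WC_zero => //; first exact: open_off_cut.
by move=> v [Ov _]; rewrite mulr_ge0 ?exprn_ge0 // mulr_ge0 ?w0 // (ltW Kcut_gt0).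
Qed.

Lemma Def_over : Def (fun v => O (pr v)).
Proof.
have hp := Dfun_prj S sg; have hd := slow_def sde.
by apply: Def_ext (_ : Def (fun v => 0 < de (pr v))) => [v|]; [rewrite (slow_dom sde) | definable].
Qed.

Lemma Def_tube : Def tube.
Proof.
have hF := Def_fibre sg hZ; have hp := Dfun_prj S sg; have hd := slow_def sde; have ho := Def_over.
by rewrite /tube; definable.
Qed.

Lemma Dfun_rho : Dfun rho.
Proof. by rewrite /rho /ycoord; definable. Qed.

Lemma Dfun_cut : Dfun cut.
Proof.
have hT := Def_tube; have hp := Dfun_prj S sg; have hd := slow_def sde; have hr := Dfun_rho.
by rewrite /cut /cutP /cutQ; definable.
Qed.

Lemma tube_near_Z z : Z z -> O (pr z) -> exists2 e : R, 0 < e & forall y, mnorm (y - z) < e -> tube y /\ cut y = 1.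
Proof.
move=> Zz Oz; have d0 := de_gt0 Oz.
have tz : tube z by split=> //; exists z; split=> //; apply: ball_center.
have Sz : Sn z = z by have [_ _] := tok Oz (conj Zz erefl : fib (pr z) z) (ball_center z (th_gt0 Oz)).
have [r r0 hr] := open_tube tz.
have crho : cont rho z by apply: WC_cont WC_rho tz.
have rz : rho z = 0 by rewrite /rho big1 // => i _; rewrite /ycoord Sz subrr expr0n.
have e0 : 0 < de (pr z) ^+ 2 / 64 by rewrite divr_gt0 ?exprn_gt0.
have d20 : 0 < de (pr z) / 2 by lra.
have [r1 r10 h1] := crho _ e0; have [r2 r20 h2] := cont_prj (slow_cont (pr z) sde) d20.
exists (Num.min r (Num.min r1 r2)); first by rewrite !lt_min r0 r10.
move=> y; rewrite !lt_min => /andP [y0 /andP [y1 y2]]; have ty := hr y y0; split=> //; apply: cut_eq1 => //.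
have := h1 y y1; rewrite rz subr0 => /(le_lt_trans (ler_norm _)) k1.
have := h2 y y2; rewrite ltr_norml => /andP [k2 _].
have k3 : de (pr z) / 2 <= de (pr y) by lra.
have : (de (pr z) / 2) ^+ 2 <= de (pr y) ^+ 2 by rewrite lerXn2r ?nnegrE //; lra.
rewrite expr_div_n; lra.
Qed.

End Cut.
End Tube.

(** * Existence of slowly varying functions *)

Section SlowExistence.
Variables (R : rcfType) (S : ominimal_expansion R).
Local Notation Def := (Def S).
Local Notation Dfun := (Dfun S).

Definition closure_of n (C : 'rV[R]_n -> Prop) v := forall e : R, 0 < e -> exists y, C y /\ mnorm (y - v) < e.

Lemma Def_closure n (C : 'rV[R]_n -> Prop) : Def C -> Def (closure_of C).
Proof. by move=> hC; rewrite /closure_of; definable. Qed.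

Lemma closure_sub n (C : 'rV[R]_n -> Prop) v : C v -> closure_of C v.
Proof. by move=> Cv e e0; exists v; split=> //; apply: ball_center. Qed.

Lemma nowhere_dense_closure n (C : 'rV[R]_n -> Prop) : nowhere_dense C -> nowhere_dense (closure_of C).
Proof.
move=> hC a r r0; have [a' [r' [h1 h2]]] := hC a r r0; have r'0 := h1.1.
exists a', (r' / 2); split; first by apply: subball_trans h1 (subball_shrink _ _ _); lra.
move=> x hx /(_ (r' / 2)) [|y [Cy hy]]; first lra.
by apply: (h2 y) Cy; have := mnormB_tri y x a'; lra.
Qed.

Lemma prj_lift n (v : 'rV[R]_n.+1) : prj (lift ord0) v = tlr v.
Proof. by apply/rowP => k; rewrite !mxE. Qed.

(** This factor makes superlevel sets bounded in the new coordinate, while its derivatives remain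
    bounded. *)
Lemma WC_bump q n (V : 'rV[R]_n -> Prop) i : open_set V -> exists2 K : R, 0 < K &
  WC q V (fun _ => K) (fun _ => 1) (fun v => (1 + v 0 i ^+ 2)^-1).
Proof.
move=> oV; have one0 v : V v -> 0 < (1 : R) by [].
have h1 : WC q V (fun v => 1 + `|v 0 i|) (fun _ => 1) (fun v => v 0 i).
  by apply: WC_coord => // v _; [rewrite lerDr | rewrite lerDl].
pose B : R := 1 + 2 ^+ q * 2; have p0 : 0 < 2 ^+ q * 2 :> R by rewrite mulr_gt0 ?exprn_gt0.
have B0 : 0 < B by rewrite /B; lra.
have h2 : WC q V (fun v => B * (1 + v 0 i ^+ 2)) (fun _ => 1) (fun v => 1 + v 0 i ^+ 2).
  apply: (WC_ext oV (f := fun v => 1 + v 0 i * v 0 i)) => [v _|]; first by rewrite expr2.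
  apply: WC_mono (WC_add oV one0 (WC_cst oV one0 q 1) (WC_mul oV one0 h1 h1)) => // v _.
  rewrite normr1 /B mulrDl mul1r; have a0 := sqr_ge0 (v 0 i).
  have a1 : (1 + `|v 0 i|) * (1 + `|v 0 i|) <= 2 * (1 + v 0 i ^+ 2).
    have -> : v 0 i ^+ 2 = `|v 0 i| ^+ 2 by rewrite real_normK ?num_real.
    by have := sqr_ge0 (1 - `|v 0 i|); rewrite !expr2; clear; lra.
  have a2 : 2 ^+ q * ((1 + `|v 0 i|) * (1 + `|v 0 i|)) <= 2 ^+ q * 2 * (1 + v 0 i ^+ 2).
    by rewrite -mulrA ler_wpM2l ?exprn_ge0.
  by lra.
have B1 : 0 < B^-1 by rewrite invr_gt0.
exists (Kinv q B^-1 / B); first by rewrite divr_gt0 // Kinv_gt0.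
have hI := WC_inv oV one0 B1 h2.
apply: WC_mono (hI _ _) => // [v _|v _|v _].
- have a0 := sqr_ge0 (v 0 i); rewrite ler_wpM2l ?(ltW (Kinv_gt0 _ _)) // lef_pV2 ?posrE //.
    by rewrite ler_peMr ?(ltW B0) //; lra.
  by rewrite mulr_gt0 //; lra.
- by have a0 := sqr_ge0 (v 0 i); rewrite mulr_gt0 //; lra.
have a0 := sqr_ge0 (v 0 i); rewrite mulrA mulVf ?mul1r; last lra.
by rewrite ger0_norm //; lra.
Qed.

Lemma le_sqr_bound (x y : R) : 1 + x ^+ 2 <= y -> x <= 1 + y.
Proof. nra. Qed.

(** * Raising the dimension of slowly varying functions by one *)

Section Step.
Variables (q d : nat) (Z : 'rV[R]_d.+1 -> Prop) (O : 'rV[R]_d -> Prop) (de : 'rV[R]_d -> R).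
Variable Sn : 'rV[R]_d.+1 -> 'rV[R]_d.+1.
Let c0 (j : 'I_0) (v : 'rV[R]_d.+1) : R := 0.
Let sg : 'I_d -> 'I_d.+1 := lift ord0.
Hypotheses (hZ : Def Z) (hSn : Dfun Sn) (ndO : nowhere_dense (fun x => ~ O x)) (ndZ : nowhere_dense Z).
Hypotheses (hO : forall x, O x -> good_base sg Z q.+1 c0 Sn x) (sde : slowfn S q.+1 O de).
Hypothesis tok : tube_ok sg Z q.+1 c0 Sn O de (tame q.+1 Sn).
Let dth x : de x <= de x := lexx _.
Let inj : injective sg := @lift_inj _ _.
Let chi := cut sg Z q.+1 Sn O de.
Let D v := de (prj sg v).
(** A smooth substitute for the squared distance to [Z], capped by the width: a convex combination
    of [rho] near [Z] and [D ^ 2] away from it. Multiplication by a power of the scale, in [g3],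
    then makes its derivatives bounded. *)
Let g1 v := D v ^+ 2 + chi v * (rho Sn v - D v ^+ 2).
Let sc := tscale sg de de.
Let g3 v := sc v ^+ q.+1 * g1 v.
Let over v := O (prj sg v).

Let over0 v : over v -> 0 < sc v. Proof. exact: tscale_gt0 sde sde v. Qed.
Let sc1 v : sc v <= 1. Proof. exact: tscale_le1 sde sde v. Qed.
Let oO : open_set over. Proof. exact: open_over sde. Qed.
Let D0 v : 0 <= D v. Proof. exact: slow_ge0 sde _. Qed.
Let D1 v : D v <= 1. Proof. exact: slow_le1 sde _. Qed.
Let sc0 v : 0 <= sc v. Proof. by rewrite mulr_ge0 ?D0. Qed.

Lemma slow_step_g1 : exists2 K : R, 0 < K & WC q.+1 over (fun v => K * D v ^+ 2) sc g1.
Proof.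
have oT : open_set (tube sg Z O de) := open_tube sde dth tok.
have t0 := @tube_gt0 R S _ _ sg Z q.+1 O de de sde sde.
have w1 : WC q.+1 (tube sg Z O de) (fun v => cutA R d.+1 q.+1 * D v ^+ 2) sc (fun v => rho Sn v - D v ^+ 2 * 1).
  have h2 := WC_de2 inj sde sde dth tok ler01 (lexx 1).
  apply: WC_mono (WC_add oT t0 (WC_rho sde sde dth tok) (WC_opp oT h2)) => // v tv.
  by rewrite -mulrDl addrC.
have w2 := WC_cut_mul inj hO sde sde dth tok (leqnn _) _ w1.
have h3 := WC_de_over inj sde sde; have w3 := WC_mul oO over0 h3 h3.
exists (2 ^+ q.+1 + 2 ^+ q.+1 * (Kcut R d.+1 q.+1 * cutA R d.+1 q.+1)).
  by rewrite addr_gt0 ?exprn_gt0 // mulr_gt0 ?exprn_gt0 // mulr_gt0 ?Kcut_gt0 ?cutA_gt0.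
apply: (WC_ext oO (f := fun v => D v * D v + chi v * (rho Sn v - D v ^+ 2 * 1))) => [v _|].
  by rewrite /g1 mulr1 expr2.
apply: WC_mono (WC_add oO over0 w3 (w2 _)) => // v _; last first.
  by rewrite mulr_ge0 ?(ltW (cutA_gt0 _ _ _)) // exprn_ge0.
by rewrite -/(D v) le_eqVlt; apply/orP; left; apply/eqP; ring.
Qed.

Lemma slow_step_g3 : exists2 K : R, 0 < K & WC q.+1 over (fun v => K * sc v ^+ q.+1) sc g3.
Proof.
have [K K0 h1] := slow_step_g1; have h3 := WC_de_over inj sde sde; have w3 := WC_mul oO over0 h3 h3.
have h4 := WC_mul oO over0 (WC_exp q.+1 oO over0 w3) h1.
exists (2 ^+ q.+1 * (2 ^+ (q.+1 * q.+1) * (2 ^+ q.+1) ^+ q.+1 * K)); first by rewrite !mulr_gt0 ?exprn_gt0.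
apply: WC_mono h4 => // v ov; rewrite -/(D v) exprMn -/(sc v).
have -> : de (prj sg v) * de (prj sg v) = sc v by [].
have -> : 2 ^+ q.+1 * (2 ^+ (q.+1 * q.+1) * ((2 ^+ q.+1) ^+ q.+1 * sc v ^+ q.+1) * (K * D v ^+ 2)) =
  2 ^+ q.+1 * (2 ^+ (q.+1 * q.+1) * (2 ^+ q.+1) ^+ q.+1 * K) * sc v ^+ q.+1 * D v ^+ 2 by ring.
apply: ler_piMr; last by rewrite exprn_ile1.
apply: mulr_ge0; last by rewrite exprn_ge0.
by rewrite !mulr_ge0 ?exprn_ge0 // ltW.
Qed.

Let chi0 v : 0 <= chi v. Proof. exact: cut_ge0 sde v. Qed.
Let chi1 v : chi v <= 1. Proof. exact: cut_le1 sde v. Qed.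

Let g1E v : g1 v = (1 - chi v) * D v ^+ 2 + chi v * rho Sn v.
Proof. by rewrite /g1; ring. Qed.

Let g1_ge0 v : 0 <= g1 v.
Proof. by rewrite g1E addr_ge0 // mulr_ge0 ?exprn_ge0 ?rho_ge0 // subr_ge0. Qed.

Lemma slow_step_pos v : over v -> ~ Z v -> 0 < g1 v.
Proof.
move=> ov nz; have d0 : 0 < D v ^+ 2 by rewrite exprn_gt0 //; apply/(slow_dom sde).
have [c1|] := ltP (chi v) 1.
  by rewrite g1E ltr_pwDl ?mulr_ge0 ?rho_ge0 // mulr_gt0 // subr_gt0.
move=> hc; have c1 : chi v = 1 by apply/eqP; rewrite eq_le chi1.
rewrite g1E c1 subrr mul0r add0r mul1r lt_neqAle rho_ge0 andbT eq_sym.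
have cn : chi v != 0 by rewrite c1 oner_neq0.
have [tv _] := cut_support sde cn.
have [_ [ZS _] _ _ _] := tubeP dth tok tv; apply/eqP => r0; apply: nz.
have <- // : Sn v = v; apply/rowP => i; apply/eqP; rewrite eq_sym -subr_eq0 -sqrf_eq0.
by rewrite eq_le sqr_ge0 andbT -r0; exact: rho_ge.
Qed.

Lemma slow_step_zero v : ~ (over v /\ ~ Z v) -> g3 v = 0.
Proof.
move=> h; have [ov|nv] := EM (over v); last first.
  have -> : g3 v = sc v * (sc v ^+ q * g1 v) by rewrite /g3 exprS mulrA.
  have -> : sc v = 0 by rewrite /sc /tscale (_ : de _ = 0) ?mul0r //; apply/eqP; rewrite eq_le (slow_ge0 sde) andbT leNgt; apply/negP => /(slow_dom sde).
  by rewrite mul0r.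
have Zv : Z v by apply: contrapT => nz; apply: h.
have [e e0 he] := tube_near_Z sde sde dth tok Zv ov.
have [_ c1] := he v (ball_center v e0).
have dp : 0 < de (prj sg v) by apply/(slow_dom sde).
have [_ _ Sv] := tok ov (conj Zv erefl) (ball_center v dp).
rewrite /g3 g1E /chi c1 subrr mul0r add0r mul1r.
suff -> : rho Sn v = 0 by rewrite mulr0.
rewrite /rho big1 // => i _; by rewrite /ycoord Sv subrr expr0n.
Qed.

Lemma slow_step : exists g, slowfn S q.+1 (fun v => over v /\ ~ Z v) g.
Proof.
have [K3 K30 w3] := slow_step_g3; have [Kt Kt0 wt] := WC_bump q.+1 ord0 oO.
have one0 v : over v -> 0 < (1 : R) by [].
have u3 := WC_unscale (K := fun _ => K3) (fun _ _ => ltW K30) over0 (fun v _ => sc1 v) w3.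
have u2 := WC_mul oO one0 u3 wt.
pose K : R := 2 ^+ q.+1 * (K3 * Kt); have K0 : 0 < K by rewrite !mulr_gt0 ?exprn_gt0.
(* The divisor bounds the derivatives and keeps [g] below [D]; the factor [d.+2] makes the Lipschitz
   constant times the dimension [d.+1] at most 1, as the decay condition demands. *)
pose B : R := d.+2%:R * (1 + 2 ^+ q.+1 * K + K3).
have p0 : 0 < 2 ^+ q.+1 * K by rewrite mulr_gt0 ?exprn_gt0.
have B0 : 0 < B by rewrite mulr_gt0 //; lra.
pose c := B^-1; have cpos : 0 < c by rewrite invr_gt0.
pose g v := c * (g3 v * (1 + v 0 ord0 ^+ 2)^-1).
have M0 : 0 < d.+2%:R^-1 :> R by rewrite invr_gt0.
have M1 : d.+2%:R^-1 <= 1 :> R by rewrite invf_le1 // ler1n.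
have cM (x : R) : 0 <= x -> x <= 1 + 2 ^+ q.+1 * K + K3 -> c * x <= d.+2%:R^-1.
  by move=> x0 hx; rewrite /c mulrC ler_pdivrMr // /B mulKf ?pnatr_eq0.
have wg : WC q.+1 over (fun _ => d.+2%:R^-1) (fun _ => 1) g.
  apply: WC_mono (WC_scal oO one0 c u2) => // v _; rewrite (gtr0_norm cpos) -/K mulrCA; apply: cM; first lra.
  by lra.
have tau (v : 'rV[R]_d.+1) : 0 < (1 + v 0 ord0 ^+ 2)^-1 :> R by rewrite invr_gt0; have := sqr_ge0 (v 0 ord0 : R); lra.
have tau1 (v : 'rV[R]_d.+1) : (1 + v 0 ord0 ^+ 2)^-1 <= 1 :> R by rewrite invf_le1 ?lerDl ?sqr_ge0 //; have := sqr_ge0 (v 0 ord0 : R); lra.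
have g3_ge0 v : 0 <= g3 v by rewrite mulr_ge0 ?exprn_ge0.
have g_ge0 v : 0 <= g v by apply: mulr_ge0; [exact: ltW | apply: mulr_ge0 => //; exact: ltW].
have zero v : ~ (over v /\ ~ Z v) -> g v = 0 by move=> h; rewrite /g slow_step_zero // mul0r mulr0.
have gD v : g v <= D v.
  have [ov|nv] := EM (over v); last by rewrite zero ?D0 // => -[].
  have b3 := WC_bound w3 ov; rewrite ger0_norm // in b3.
  have s1 : sc v ^+ q.+1 <= D v.
    apply: le_trans (_ : sc v <= _); first by rewrite exprS ler_piMr // exprn_ile1.
    by rewrite /sc /tscale ler_piMr ?(slow_ge0 sde) ?(slow_le1 sde).
  apply: le_trans (_ : c * g3 v <= _); first by rewrite ler_wpM2l ?(ltW cpos) // ler_piMr.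
  apply: le_trans (_ : c * (K3 * D v) <= _).
    rewrite ler_wpM2l ?(ltW cpos) //; apply: le_trans b3 _; by rewrite ler_wpM2l // ltW.
  rewrite mulrA; apply: ler_piMl => //; apply: le_trans M1; apply: cM; first exact: ltW.
  by lra.
have g3K v : g3 v <= K3.
  have [ov|nv] := EM (over v); last by rewrite slow_step_zero ?(ltW K30) // => -[].
  by have := WC_bound u3 ov; rewrite ger0_norm.
have hg : Dfun g.
  have h1 := Dfun_cut sg hZ hSn sde; have h2 := Dfun_rho hSn; have h4 := slow_def sde; have h5 := Dfun_prj S sg.
  by rewrite /g /g3 /g1 /sc /tscale /D /chi; definable.
exists g; split=> // [v|v||v a na|t t0].
- split=> [[ov nz]|gp]; last by apply: contrapT => h; move: gp; rewrite zero // ltxx.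
  apply: mulr_gt0 => //; apply: mulr_gt0 => //; apply: mulr_gt0; last exact: slow_step_pos.
  by apply: exprn_gt0; apply: over0.
- by apply: le_trans (gD v) (D1 v).
- by apply: WC_mono (WC_sub _ wg) => // v [].
- have [oa|noa] := EM (over a); last first.
    apply: le_trans (gD v) _; apply: le_trans (slow_decay sde _ noa) _.
    by rewrite prjB; apply: mnorm_prj.
  (* If [D v] is at most the distance to [a], then [g v <= D v] suffices. Otherwise every point no
     farther from [v] than [a] projects into [O], since [D] decays towards the complement, and the
     path estimate applies. *)
  have [h|h] := leP (D v) (mnorm (v - a)); first exact: le_trans (gD v) h.
  have := @lipschitz_path R S _ g v a d.+2%:R^-1 hg (ltW M0).
  rewrite (zero a na) sub0r normrN ger0_norm // (mnormBC a v) => L.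
  apply: le_trans (L _) _.
    move=> y hy _ i _; have oy : over y.
      apply: contrapT => ny; have := slow_decay sde (prj sg v) ny; rewrite prjB -/(D v).
      by have := mnorm_prj sg (v - y); rewrite (mnormBC v y); lra.
    have [_ k] := wg; have [k1 k2] := k i; exists (pd i g y); first exact: ex_pdP (k1 y oy).
    by have := WC_bound k2 oy; rewrite divr1.
  rewrite ler_piMl ?mnorm_ge0 // ler_pdivrMr // mul1r ler_nat //.
have [M hM] := slow_bounded sde t0.
exists (Num.max M (1 + c * K3 / t)) => v hv.
have p1 : 0 <= c * K3 / t by rewrite !mulr_ge0 ?invr_ge0 // ltW.
have DM := hM _ (le_trans hv (gD v)).
apply: mnorm_le => [|i]; first by apply: le_trans (maxR _ _); lra.
case: (unliftP ord0 i) => [k ->|->].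
  apply: le_trans (maxL _ _); apply: le_trans DM; have := mnorm_coord (prj sg v) k; by rewrite mxE.
apply: le_trans (maxR _ _).
have q1 : t * (1 + v 0 ord0 ^+ 2) <= c * K3.
  have := sqr_ge0 (v 0 ord0 : R) => s0.
  rewrite -ler_pdivlMr; last lra.
  apply: le_trans hv _; rewrite /g mulrA; apply: ler_wpM2r; first exact: ltW (tau v).
  by apply: ler_wpM2l; [exact: ltW | exact: g3K].
have q2 : 1 + v 0 ord0 ^+ 2 <= c * K3 / t by rewrite ler_pdivlMr // mulrC.
have q3 : v 0 ord0 ^+ 2 = `|v 0 ord0| ^+ 2 by rewrite real_normK ?num_real.
by rewrite q3 in q2; apply: le_sqr_bound q2.
Qed.

Lemma slow_step_nd : nowhere_dense (fun v => ~ (over v /\ ~ Z v)).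
Proof.
move=> a r r0; have [b [s [h1 h2]]] := ndO (tlr a) r0; have s0 := h1.1.
have m0 := min_gt0 s0 r0.
have sub : subball a r (consr (a 0 ord0) b) (Num.min s r).
  split=> // x; rewrite -[x]consr_eta mnorm_consrB !lt_min => /andP [/andP [_ x1] /andP [x2 _]].
  by rewrite -[a]consr_eta mnorm_consrB x1 /=; apply: h1.2.
have [a' [r' [k1 k2]]] := ndZ (consr (a 0 ord0) b) m0.
exists a', r'; split; first exact: subball_trans sub k1.
move=> x hx h; apply: h; split; last exact: k2.
have := k1.2 x hx; rewrite -[x in x - _]consr_eta mnorm_consrB !lt_min => /andP [_ /andP [x2 _]].
by apply: contrapT; rewrite /over /sg prj_lift; apply: h2.
Qed.

End Step.

(** Induction on the dimension: the base points that are not good for the closure of [C] are nowhere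
    dense one dimension lower, so a slowly varying function exists off them. The closure is used
    since a slowly varying function is continuous and its zero set closed. *)
Lemma slow_exists q d (C : 'rV[R]_d -> Prop) : Def C -> nowhere_dense C ->
  exists O g, [/\ slowfn S q.+1 O g, forall x, O x -> ~ C x & nowhere_dense (fun x => ~ O x)].
Proof.
elim: d C => [|d IH] C hC ndC.
  have e0 (x y : 'rV[R]_0) : x = y by apply/rowP => -[].
  have nC x : ~ C x.
    by have [a [r [h1 h2]]] := ndC 0 1 ltr01; rewrite (e0 x a); apply: h2; apply: ball_center; exact: h1.1.
  exists (fun _ => True), (fun _ => 1); split=> //.
  - split=> //; first by definable.
    + by apply: WC_mono (WC_cst _ _ _ _) => // [v _|v _]; [rewrite normr1 | exists 1].
    + by move=> t _; exists 0 => x _; rewrite (e0 x 0) mnorm0.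
  - by move=> a r r0; exists a, r; split; [exact: subball_refl | move=> x _ h; apply: h].
pose Z := closure_of C; have hZ : Def Z by exact: Def_closure.
have ndZ : nowhere_dense Z by exact: nowhere_dense_closure.
pose sg : 'I_d -> 'I_d.+1 := lift ord0; have inj : injective sg by exact: lift_inj.
(* The only transverse coordinate is the first one, so [coord_set] is contained in [Z] itself. *)
have hnd i : tcoord sg i -> nowhere_dense (coord_set sg Z i).
  move=> hi; case: (unliftP ord0 i) => [k ek|->]; first by have := hi k; rewrite /sg ek eqxx.
  apply: nowhere_dense_sub ndZ => v [z [[Zz pz] ez]].
  by rewrite -(consr_eta v) -ez -pz prj_lift consr_eta.
have [Sn hSn SnP] := nearest_fun sg hZ.
pose c0 (j : 'I_0) (v : 'rV[R]_d.+1) : R := 0; have hc j : Dfun (c0 j) by case: j.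
have hG := Def_good_base sg hZ q.+1 hc hSn.
have ndG := good_base_complement_nd inj hZ hnd q.+1 hc hSn SnP.
have [O [g [sO OG ndO]]] := IH _ (Def_not hG) ndG.
have hO x : O x -> good_base sg Z q.+1 c0 Sn x by move=> /OG; apply: contrapT.
have [th sth [_ tok]] := tame_minorant hZ hc hSn hO sO.
have [g' sg'] := slow_step hZ hSn hO sth tok.
exists (fun v => O (prj sg v) /\ ~ Z v), g'; split=> //.
  by move=> v [_ nz] Cv; apply: nz; apply: closure_sub.
exact: slow_step_nd.
Qed.

End SlowExistence.

(** * Fibrewise Taylor polynomials *)

Section Taylor.
Variables (R : rcfType) (S : ominimal_expansion R).
Local Notation Def := (Def S).
Local Notation Dfun := (Dfun S).

Lemma is_pd_sum n (j : 'I_n) (I : Type) (r : seq I) (P : pred I) (F : I -> 'rV[R]_n -> R) v (L : I -> R) :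
  (forall i, P i -> is_pd j (F i) v (L i)) ->
  is_pd j (fun v => \sum_(i <- r | P i) F i v) v (\sum_(i <- r | P i) L i).
Proof.
move=> h; elim: r => [|i r IH].
  rewrite big_nil; apply: (is_pd_ext _ (is_pd_cst j 0 v)); exists 1 => // y _; by rewrite big_nil.
have [hi|hi] := boolP (P i).
  rewrite big_cons hi; apply: (is_pd_ext _ (is_pdD (h i hi) IH)); exists 1 => // y _; by rewrite big_cons hi.
rewrite big_cons (negbTE hi); apply: (is_pd_ext _ IH); exists 1 => // y _; by rewrite big_cons (negbTE hi).
Qed.

Lemma pdw_pd n (w : seq 'I_n) i (h : 'rV[R]_n -> R) (V : 'rV[R]_n -> Prop) : Dfun h -> open_set V ->
  Ck (size w).+1 V h -> forall v, V v -> pdw w (pd i h) v = pd i (pdw w h) v.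
Proof.
move=> hh oV; elim: w h hh => [//|j w IH] h hh hC v Vv /=.
rewrite -IH //; [|exact: Dfun_pd|exact: Ck_pd hC].
apply: (@pdw_ext R n w _ _ V oV) => // y Vy; apply: (pdC _ _ hh oV) => //.
exact: Ck_leq hC.
Qed.

Variables (m d : nat) (sg : 'I_d -> 'I_m) (Sn : 'rV[R]_m -> 'rV[R]_m) (V G : 'rV[R]_m -> Prop).
Local Notation pr := (prj sg).
Local Notation yc := (ycoord Sn).
Definition tr (i : 'I_m) := [forall k, sg k != i].

(** The sum runs over ordered sequences of transverse directions; dividing by [k!] in [taylor] gives
    the usual homogeneous part of degree [k] of the expansion along the fibre at [Sn v]. *)
Fixpoint tay k (u : 'rV[R]_m -> R) v : R :=
  if k is k'.+1 then \sum_(i | tr i) yc i v * tay k' (pd i u) v else u (Sn v).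
Definition taylor n u v : R := \sum_(k < n.+1) tay k u v / (k`!)%:R.
Definition rem n u v : R := u v - taylor n u v.

Hypotheses (oV : open_set V) (oG : open_set G) (VG : forall v, V v -> G v) (hSn : Dfun Sn).
Hypothesis Snp : forall v, V v -> pr (Sn v) = pr v.
Hypothesis SnV : forall v, V v -> V (Sn v) /\ Sn (Sn v) = Sn v.
Hypothesis Snc : forall v y, V v -> mnorm (y - Sn v) <= mnorm (v - Sn v) -> pr y = pr v -> V y /\ Sn y = Sn v.
Hypothesis SnL : forall v, V v -> exists2 e : R, 0 < e & forall y, mnorm (y - v) < e -> pr y = pr v -> Sn y = Sn v.
Hypothesis SnC : forall i, Ck 1 V (fun v => Sn v 0 i).

Lemma Dfun_tay k u : Dfun u -> Dfun (tay k u).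
Proof.
elim: k u => [|k IH] u hu /=; first exact: Dfun_comp hu hSn.
have h i : Dfun (tay k (pd i u)) by apply: IH; apply: Dfun_pd.
by rewrite /ycoord; definable.
Qed.

Lemma Dfun_taylor n u : Dfun u -> Dfun (taylor n u).
Proof. by move=> hu; have h k := Dfun_tay k hu; rewrite /taylor; definable. Qed.

Lemma tay_ext k u u' v : (forall y, G y -> u y = u' y) -> G (Sn v) -> tay k u v = tay k u' v.
Proof.
move=> h Gv; elim: k u u' h => [|k IH] u u' h /=; first exact: h.
apply: eq_bigr => i _; congr (_ * _); apply: IH => y Gy; apply: pd_ext; exact: open_near h.
Qed.

Lemma is_pd_fibre (u : 'rV[R]_m -> R) j v : tr j -> V v -> is_pd j (fun v => u (Sn v)) v 0.
Proof.
move=> /forallP hj Vv; have [e e0 he] := SnL Vv.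
apply: (is_d_ext _ (is_d_cst (u (Sn v)) 0)); exists e => // h hh; congr u; symmetry; rewrite add0r.
apply: he; first exact: le_lt_trans (mnorm_shift _ _ _) hh.
by apply/rowP => k; rewrite !mxE eqxx /= (negbTE (hj k)) mulr0 addr0.
Qed.

Lemma is_pd_yc i j v : tr j -> V v -> is_pd j (yc i) v (j == i)%:R.
Proof.
move=> hj Vv; have := is_pdD (is_pd_coord j i v) (is_pdN (is_pd_fibre (fun y => y 0 i) hj Vv)).
by rewrite oppr0 addr0.
Qed.

Lemma sum_delta (F : 'I_m -> R) j : tr j -> \sum_(i | tr i) (j == i)%:R * F i = F j.
Proof.
move=> hj; rewrite (bigD1 j) //= eqxx mul1r big1 ?addr0 // => i /andP [_ ne].
by rewrite eq_sym (negbTE ne) mul0r.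
Qed.

(** The coefficients are constant along fibres, so only the displacements are differentiated;
    symmetry of second derivatives gathers the resulting [k.+1] equal terms. *)
Lemma is_pd_tay k u j v : tr j -> V v -> Dfun u -> Ck k.+1 G u ->
  is_pd j (tay k.+1 u) v (k.+1%:R * tay k (pd j u) v).
Proof.
move=> hj Vv; elim: k u => [|k IH] u hu hC.
  have h i : tr i -> is_pd j (fun v => yc i v * tay 0 (pd i u) v) v ((j == i)%:R * tay 0 (pd i u) v + yc i v * 0).
    by move=> _; apply: is_pdM; [exact: is_pd_yc | exact: is_pd_fibre].
  have := is_pd_sum (index_enum _) h; rewrite (bigD1 j) //= eqxx mul1r mulr0 addr0 big1 ?addr0 //.
  by move=> i /andP [_ ne]; rewrite eq_sym (negbTE ne) mul0r mulr0 addr0.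
have h i : tr i -> is_pd j (fun v => yc i v * tay k.+1 (pd i u) v) v
   ((j == i)%:R * tay k.+1 (pd i u) v + yc i v * (k.+1%:R * tay k (pd j (pd i u)) v)).
  move=> _; apply: is_pdM; first exact: is_pd_yc.
  by apply: IH; [exact: Dfun_pd | exact: Ck_pd hC].
have H := is_pd_sum (index_enum _) h; rewrite big_split in H; rewrite sum_delta // in H.
have e : \sum_(i | tr i) yc i v * (k.+1%:R * tay k (pd j (pd i u)) v) = k.+1%:R * tay k.+1 (pd j u) v.
  rewrite [tay k.+1 _ _]/= mulr_sumr; apply: eq_bigr => i _; rewrite mulrCA; congr (_ * (_ * _)).
  apply: tay_ext => [y Gy|]; last by apply: VG; have [] := SnV Vv.
  by apply: (pdC _ _ hu oG) => //; apply: Ck_leq hC.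
have -> : k.+2%:R * tay k.+1 (pd j u) v = tay k.+1 (pd j u) v + k.+1%:R * tay k.+1 (pd j u) v.
  by rewrite -[k.+2%:R]natr1 mulrDl mul1r addrC.
by rewrite -e; exact: H.
Qed.

(** Transverse differentiation turns a remainder into the remainder of the derivative, one order
    lower. As remainders vanish on the section, all their transverse derivatives up to the order
    do. *)
Lemma is_pd_rem n u j v : tr j -> V v -> Dfun u -> Ck n.+1 G u -> is_pd j (rem n.+1 u) v (rem n (pd j u) v).
Proof.
move=> hj Vv hu hC; apply: is_pdD; first exact: Ck_ispd hC (VG Vv).
apply: is_pdN.
have h (k : 'I_n.+1) : is_pd j (fun v => tay k.+1 u v / (k.+1`!)%:R) v (tay k (pd j u) v / (k`!)%:R).
  have kn : (k.+1 <= n.+1)%N by [].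
  have := is_pdM (is_pd_tay hj Vv hu (Ck_leq kn hC)) (is_pd_cst j ((k.+1`!)%:R^-1) v).
  rewrite mulr0 addr0 factS natrM invfM mulrACA divff ?mul1r // pnatr_eq0 //.
have h0 : is_pd j (fun v => tay 0 u v / (0`!)%:R) v 0.
  have := is_pdM (is_pd_fibre u hj Vv) (is_pd_cst j ((0`!)%:R^-1) v).
  by rewrite mul0r mulr0 addr0.
rewrite -[taylor n (pd j u) v]add0r.
apply: is_pd_ext (is_pdD h0 (is_pd_sum (index_enum _) (fun k _ => h k))); exists 1 => // y _; by rewrite /taylor [RHS]big_ord_recl.
Qed.

Lemma pd_rem n u j v : tr j -> V v -> Dfun u -> Ck n.+1 G u -> pd j (rem n.+1 u) v = rem n (pd j u) v.
Proof. by move=> hj Vv hu hC; apply: pdE; apply: is_pd_rem. Qed.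

Lemma pdw_rem n w u v : all tr w -> (size w <= n)%N -> V v -> Dfun u -> Ck n G u ->
  pdw w (rem n u) v = rem (n - size w) (pdw w u) v.
Proof.
elim: w n u => [|j w IH] n u; first by rewrite subn0.
case: n => [//|n] /= /andP [hj hw] ws Vv hu hC; rewrite subSS.
rewrite (@pdw_ext _ _ _ _ (rem n (pd j u)) V oV) //; last by move=> y Vy; apply: pd_rem.
by apply: IH => //; [exact: Dfun_pd | exact: Ck_pd hC].
Qed.

Lemma rem_fixed n u z : Sn z = z -> rem n u z = 0.
Proof.
move=> hz; rewrite /rem /taylor big_ord_recl /= hz divr1 big1 ?addr0 ?subrr // => k _.
by rewrite /= big1 ?mul0r // => i _; rewrite /ycoord hz subrr mul0r.
Qed.

Lemma rem_words n u w z : all tr w -> (size w <= n)%N -> V z -> Sn z = z -> Dfun u -> Ck n G u ->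
  pdw w (rem n u) z = 0.
Proof. by move=> *; rewrite pdw_rem // rem_fixed. Qed.

(** Differentiate the identity [g (Sn (z + t e_i)) = 0] at [t = 0]. The transverse terms vanish by
    assumption, the section moves in the base direction [i] with speed 1, and no other base
    direction contributes. *)
Lemma frechet_uniq0 (g : 'rV[R]_m -> R) z i : Dfun g -> Ck 1 V g -> V z -> Sn z = z -> ~~ tr i ->
  (forall y, V y -> Sn y = y -> g y = 0) -> (forall j, tr j -> pd j g z = 0) -> pd i g z = 0.
Proof.
move=> hg hC Vz Sz hi g0 gt.
have hfr : frechet g (Sn (z + 0 *: delta_mx 0 i)) (fun j => pd j g z).
  by rewrite shift0 Sz; exact: (frechet_C1 hg oV hC Vz).
have hl j : is_d (fun t => Sn (z + t *: delta_mx 0 i) 0 j) 0 (pd i (fun v => Sn v 0 j) z).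
  exact: (Ck_ispd i (SnC j) Vz).
have h1 := is_d_chain hfr hl.
have h2 : is_d (fun t => g (Sn (z + t *: delta_mx 0 i))) 0 0.
  have [r r0 hr] := oV Vz; apply: (is_d_ext _ (is_d_cst 0 0)); exists r => // h hh; rewrite add0r.
  have Vy : V (z + h *: delta_mx 0 i) by apply: hr; apply: le_lt_trans (mnorm_shift _ _ _) hh.
  by have [k1 k2] := SnV Vy; rewrite g0.
have := is_d_uniq h1 h2; rewrite (bigD1 i) //= big1 ?addr0.
  suff -> : pd i (fun v => Sn v 0 i) z = 1 by rewrite mul1r.
  apply: pdE; move: hi; rewrite negb_forall => /existsP [k /negPn /eqP ek].
  have := is_pd_coord i i z; rewrite eqxx; apply: is_pd_ext.
  have [r r0 hr] := oV Vz; exists r => // y /hr Vy.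
  by have := Snp Vy => /rowP /(_ k); rewrite !mxE ek.
move=> j ne; have [tj|ntj] := boolP (tr j); first by rewrite gt ?mulr0.
suff -> : pd i (fun v => Sn v 0 j) z = 0 by rewrite mul0r.
apply: pdE; move: ntj; rewrite negb_forall => /existsP [k /negPn /eqP ek].
have := is_pd_coord i j z; rewrite eq_sym (negbTE ne); apply: is_pd_ext.
have [r r0 hr] := oV Vz; exists r => // y /hr Vy.
by have := Snp Vy => /rowP /(_ k); rewrite !mxE ek.
Qed.

(* Derivatives along the section are controlled by the transverse ones, because the section is
   contained in the zero set. *)
Lemma flat_words p h : Dfun h -> Ck p V h ->
  (forall w, all tr w -> (size w <= p)%N -> forall z, V z -> Sn z = z -> pdw w h z = 0) ->
  forall w, (size w <= p)%N -> forall z, V z -> Sn z = z -> pdw w h z = 0.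
Proof.
elim: p h => [|p IH] h hh hC A w; first by case: w => // _; apply: (A [::]).
case: w => [|i w] ws; first by apply: (A [::]).
apply: (IH (pd i h)) => //=; [exact: Dfun_pd | exact: Ck_pd hC |].
move=> w' tw' ws' z Vz Sz; have [ti|nti] := boolP (tr i).
  by apply: (A (i :: w')) => //=; rewrite ti.
have hC' : Ck (size w').+1 V h by apply: Ck_leq hC.
rewrite (pdw_pd i hh oV hC') //; apply: frechet_uniq0 => //.
- exact: Dfun_pdw.
- by apply: Ck_pdw; rewrite addn1.
- by move=> y Vy Sy; apply: A => //; apply: leqW.
move=> j tj; rewrite -(pdw_pd j hh oV hC') //.
by apply: (A (j :: w')) => //=; rewrite tj.
Qed.

Variable D : 'rV[R]_m -> R.
Hypothesis DS : forall v, V v -> mnorm (v - Sn v) <= D v.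
Hypothesis Dc : forall v y, V v -> V y -> Sn y = Sn v -> D y = D v.
Hypothesis D0 : forall v, V v -> 0 < D v.

(** The derivative bound is integrated [p] times, each time along a coordinate path from the section
    inside one fibre; each integration gains a factor [m * D]. *)
Lemma flat_bound p h (E : R) v : 0 <= E -> Dfun h -> Ck p V h ->
  (forall w, (size w <= p)%N -> forall z, V z -> Sn z = z -> pdw w h z = 0) -> V v ->
  (forall w y, size w = p -> V y -> Sn y = Sn v -> `|pdw w h y| <= E) ->
  forall y, V y -> Sn y = Sn v -> `|h y| <= (m%:R * D v) ^+ p * E.
Proof.
move=> E0 hh hC A Vv; elim: p h hh hC A => [|p IH] h hh hC A hE y Vy Sy.
  by rewrite mul1r; apply: (hE [::]).
have [Vz Sz] := SnV Vv; set z := Sn v in Vz Sz Sy hE IH *.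
have z0 : h z = 0 by apply: (A [::]).
have mD0 : 0 <= m%:R * D v by rewrite mulr_ge0 // ltW ?D0.
pose M : R := (m%:R * D v) ^+ p * E; have M0 : 0 <= M by rewrite mulr_ge0 ?exprn_ge0.
have := @lipschitz_path R S _ h z y M hh M0; rewrite z0 subr0 => L.
apply: le_trans (L _) _.
  move=> x hx hxi i _.
  have px : pr x = pr y.
    have py : pr z = pr y by rewrite -Sy Snp.
    apply/rowP => k; rewrite !mxE; have := py => /rowP /(_ k); rewrite !mxE => e.
    by rewrite hxi.
  have [|Vx Sx] := Snc Vy _ px; first by rewrite Sy.
  exists (pd i h x); first exact: Ck_ispd hC Vx.
  apply: (IH (pd i h)) => //; first exact: Dfun_pd.
  - exact: Ck_pd hC.
  - by move=> w ws; apply: (A (i :: w)).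
  - by move=> w x' ws; apply: (hE (i :: w)); rewrite /= ws.
  - by rewrite Sx Sy.
have yz : mnorm (y - z) <= D v by rewrite -(Dc Vv Vy Sy) -Sy; apply: DS.
rewrite exprS /M; apply: le_trans (_ : m%:R * ((m%:R * D v) ^+ p * E) * D v <= _).
  by apply: ler_wpM2l => //; rewrite mulr_ge0.
by rewrite le_eqVlt; apply/orP; left; apply/eqP; ring.
Qed.

(** A derivative of order [k] still vanishes to order [p - k] on the section, which is what the
    scale [D] expresses. The factor [m.+1] instead of [m] keeps the scale positive when [m] is 0. *)
Lemma flat_WC p h (eta : 'rV[R]_m -> R) : Dfun h -> Ck p V h -> (forall v, V v -> 0 <= eta v) ->
  (forall w, (size w <= p)%N -> forall z, V z -> Sn z = z -> pdw w h z = 0) ->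
  (forall w v y, size w = p -> V v -> V y -> Sn y = Sn v -> `|pdw w h y| <= eta v) ->
  WC p V (fun v => (m.+1%:R * D v) ^+ p * eta v) (fun v => m.+1%:R * D v) h.
Proof.
move=> hh hC e0 A hE; elim: p h hh hC A hE => [|p IH] h hh hC A hE.
  split=> // v Vv; split; first exact: Ck_cont hC Vv.
  by rewrite mul1r; apply: (hE [::]).
split=> [v Vv|i].
  split; first exact: Ck_cont hC Vv.
  apply: le_trans (@flat_bound p.+1 h (eta v) v _ _ _ _ _ _ v _ _) _ => //; first exact: e0.
    by move=> w y ws Vy Sy; apply: hE.
  have d0 := ltW (D0 Vv); apply: ler_wpM2r; first exact: e0.
  by rewrite lerXn2r ?nnegrE ?mulr_ge0 // ler_wpM2r // ler_nat.
split=> [v Vv|]; first by exists (pd i h v); apply: Ck_ispd hC Vv.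
have s0 v : V v -> 0 < m.+1%:R * D v by move=> Vv; rewrite mulr_gt0 ?D0.
apply: WC_mono (IH (pd i h) _ _ _ _) => //.
- move=> v Vv; have p0 := s0 v Vv; set X := m.+1%:R * D v in p0 *; rewrite le_eqVlt; apply/orP; left; apply/eqP.
  by rewrite exprS; field; exact: lt0r_neq0.
- exact: Dfun_pd.
- exact: Ck_pd hC.
- by move=> w ws; apply: (A (i :: w)).
- by move=> w v y ws; apply: (hE (i :: w)); rewrite /= ws.
Qed.

(** The function [u] enters only through its derivatives along the section, so the polynomial can be
    smoother than [u]; this gain is the point of the construction. *)
Lemma Ck_tay q k u : (forall i, Ck q V (fun v => Sn v 0 i)) ->
  (forall w, (size w <= k)%N -> Ck q V (fun v => pdw w u (Sn v))) -> Ck q V (tay k u).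
Proof.
move=> hS; elim: k u => [|k IH] u hw; first exact: (hw [::]).
apply: Ck_sum => // i _; apply: Ck_mul => //; last by apply: IH => w ws; apply: (hw (i :: w)).
by apply: Ck_add => //; [exact: Ck_coord | apply: Ck_opp].
Qed.

Lemma Ck_taylor q n u : (forall i, Ck q V (fun v => Sn v 0 i)) ->
  (forall w, (size w <= n)%N -> Ck q V (fun v => pdw w u (Sn v))) -> Ck q V (taylor n u).
Proof.
move=> hS hw; apply: Ck_sum => // k _; apply: Ck_mul => //; last exact: Ck_cst.
by apply: Ck_tay => // w ws; apply: hw; apply: leq_trans ws _; rewrite -ltnS.
Qed.

End Taylor.

(** * Smoothing over a generic base *)

Section Smoothing.
Variables (R : rcfType) (S : ominimal_expansion R).
Local Notation Def := (Def S).
Local Notation Dfun := (Dfun S).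

Lemma CkAt_add q n (f g : 'rV[R]_n -> R) v : CkAt q f v -> CkAt q g v -> CkAt q (fun v => f v + g v) v.
Proof.
move=> [r r0 hr] [s s0 hs]; exists (Num.min r s); first exact: min_gt0.
by apply: Ck_add; [exact: open_ball | apply: Ck_sub hr | apply: Ck_sub hs] => y; rewrite lt_min => /andP [].
Qed.

Lemma CkAt_mul q n (f g : 'rV[R]_n -> R) v : CkAt q f v -> CkAt q g v -> CkAt q (fun v => f v * g v) v.
Proof.
move=> [r r0 hr] [s s0 hs]; exists (Num.min r s); first exact: min_gt0.
by apply: Ck_mul; [exact: open_ball | apply: Ck_sub hr | apply: Ck_sub hs] => y; rewrite lt_min => /andP [].
Qed.

Lemma CkAt_opp q n (f : 'rV[R]_n -> R) v : CkAt q f v -> CkAt q (fun v => - f v) v.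
Proof. by move=> [r r0 hr]; exists r => //; apply: Ck_opp hr; exact: open_ball. Qed.

Variables (p m d n : nat) (sg : 'I_d -> 'I_m) (G Z : 'rV[R]_m -> Prop) (F : 'I_n -> 'rV[R]_m -> R).
Hypotheses (inj : injective sg) (hG : Def G) (oG : open_set G) (hZ : Def Z) (ZG : forall v, Z v -> G v).
Hypotheses (hF : forall i, Dfun (F i)) (FC : forall i, Ck p G (F i)).
Hypothesis FZ : forall v, G v -> ~ Z v -> forall i, CkAt p.+1 (F i) v.
Local Notation pr := (prj sg).
(** All possible Taylor coefficients up to order [p]; they form the finite family whose smoothness
    along the sections is required of a good point. *)
Let c (j : 'I_n * p.-bseq 'I_m) := pdw j.2 (F j.1).
Let hc j : Dfun (c j). Proof. exact: Dfun_pdw. Qed.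

Section Given.
Variables (Sn : 'rV[R]_m -> 'rV[R]_m) (O : 'rV[R]_d -> Prop) (th : 'rV[R]_d -> R).
Hypotheses (hSn : Dfun Sn) (hO : forall x, O x -> good_base sg Z p.+1 c Sn x).
Hypotheses (sth : slowfn S p.+1 O th) (tok : tube_ok sg Z p.+1 c Sn O th (tame p.+1 Sn)).
Hypothesis tokG : tube_ok sg Z p.+1 c Sn O th (fun v _ => G v).
Let h i := rem sg Sn p (F i).

Let hh i : Dfun (h i).
Proof. have hT := Dfun_taylor sg hSn p (hF i); rewrite /h /rem; have := hF i => hFi; by definable. Qed.

Section AnyTube.
Variable de : 'rV[R]_d -> R.
Hypotheses (sde : slowfn S p.+1 O de) (dth : forall x, de x <= th x).
Local Notation V := (tube sg Z O de).

Lemma tube_G v : V v -> G v.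
Proof. by move=> [Ov [z [fz hz]]]; have [] := tokG Ov fz (lt_le_trans hz (dth _)). Qed.

Lemma tube_Snp v : V v -> pr (Sn v) = pr v.
Proof. by move=> /(tubeP dth tok) [_ [_ e] _ _ _]. Qed.

Lemma tube_in v z : O (pr v) -> Z z -> pr z = pr v -> mnorm (v - z) < de (pr v) -> V v /\ Sn v = z.
Proof.
move=> Ov Zz pz hv; split; first by split=> //; exists z.
by have [] := tok Ov (conj Zz pz) (lt_le_trans hv (dth _)).
Qed.

Lemma tube_SnV v : V v -> V (Sn v) /\ Sn (Sn v) = Sn v.
Proof.
move=> Vv; have [Ov [ZS pS] _ _ _] := tubeP dth tok Vv.
by apply: tube_in => //; rewrite pS //; apply: ball_center; apply/(slow_dom sde).
Qed.

Lemma tube_Snc v y : V v -> mnorm (y - Sn v) <= mnorm (v - Sn v) -> pr y = pr v -> V y /\ Sn y = Sn v.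
Proof.
move=> Vv hy py; have [Ov [ZS pS] hv _ _] := tubeP dth tok Vv.
by apply: tube_in; rewrite ?py //; apply: le_lt_trans hy hv.
Qed.

Lemma tube_SnL v : V v -> exists2 e : R, 0 < e & forall y, mnorm (y - v) < e -> pr y = pr v -> Sn y = Sn v.
Proof.
move=> Vv; have [_ _ _ [[e e0 he] _] _] := tubeP dth tok Vv; exists e => // y hy py.
by have [_ k] := he v (ball_center v e0); apply: k.
Qed.

Lemma tube_SnC i : Ck 1 V (fun v => Sn v 0 i).
Proof. by apply: Ck_leq (Ck_tube_Sn dth tok i). Qed.

Lemma tube_taylor i : Ck p.+1 V (taylor sg Sn p (F i)).
Proof.
apply: Ck_taylor; first exact: open_tube sde dth tok.
- by move=> k; apply: Ck_tube_Sn dth tok k.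
- by move=> w ws; apply: (Ck_tube_c dth tok (i, Bseq ws)).
Qed.

Lemma tube_rem i : Ck p V (h i).
Proof.
have oV := open_tube sde dth tok; apply: Ck_add => //; first exact: Ck_sub tube_G (FC i).
by apply: Ck_opp => //; apply: Ck_leq (tube_taylor i).
Qed.

Lemma tube_flat i w z : (size w <= p)%N -> V z -> Sn z = z -> pdw w (h i) z = 0.
Proof.
move=> ws Vz Sz; have oV := open_tube sde dth tok.
apply: (flat_words oV tube_Snp tube_SnV tube_SnC (hh i) (tube_rem i)) => // w' tw' ws' y Vy Sy.
exact: (rem_words oV oG tube_G tube_SnV tube_SnL tw' ws' Vy Sy (hF i) (FC i)).
Qed.

End AnyTube.

Variables (tg : 'rV[R]_m -> R) (N : 'rV[R]_m -> 'rV[R]_m -> Prop).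
Hypotheses (htg : Dfun tg) (hN : Def (fun p : 'rV[R]_m * 'rV[R]_m => N p.1 p.2)) (tg0 : forall v, 0 <= tg v).
Hypothesis tgZ : forall z, Z z -> O (pr z) -> exists2 t : R, 0 < t & exists2 r : R, 0 < r &
  forall v, mnorm (v - z) < r -> t <= tg v.
Hypothesis NZ : forall z, Z z -> O (pr z) -> exists2 r : R, 0 < r &
  forall v z', mnorm (v - z) < r -> mnorm (z' - z) < r -> N v z'.
(** The total loss when the remainder, controlled on the scale [m.+1 * de], is multiplied by the
    cut-off. *)
Let KM : R := 2 ^+ p * Kcut R m p.+1 * m.+1%:R ^+ p.
Let KM0 : 0 < KM. Proof. by apply: mulr_gt0; [apply: mulr_gt0; [exact: exprn_gt0 | exact: Kcut_gt0] | exact: exprn_gt0]. Qed.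
Let Q v (r : R) := N v (Sn v) /\ forall i (w : p.-tuple 'I_m) v', mnorm (v' - Sn v) < r -> pr v' = pr v ->
  `|pdw w (h i) v'| * KM <= tg v * th (pr v) ^+ p.

(** The derivatives of order [p] of the remainder are continuous and vanish on the section, whereas
    [tg] and [th] are bounded below near [z]. *)
Lemma smoothing_local z : Z z -> O (pr z) -> exists2 r : R, 0 < r & forall v, mnorm (v - z) < r -> Q v r.
Proof.
move=> Zz Oz; have dth x : th x <= th x by [].
have t0 : 0 < th (pr z) by apply/(slow_dom sth).
have [Vz Sz] := tube_in dth Oz Zz erefl (ball_center z t0).
have [tau tau0 [r1 r10 h1]] := tgZ Zz Oz; have [r2 r20 h2] := NZ Zz Oz.
have th20 : 0 < th (pr z) / 2 by lra.
have [r3 r30 h3] := cont_prj (slow_cont (pr z) sth) th20.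
pose ep := tau * (th (pr z) / 2) ^+ p; have ep0 : 0 < ep by rewrite mulr_gt0 ?exprn_gt0.
have [||r4 r40 h4] := @finite_minT R ('I_n * p.-tuple 'I_m)%type (fun k r => forall y, mnorm (y - z) < r ->
    `|pdw k.2 (h k.1) y| * KM <= ep).
- by move=> k r r' hr _ rr y hy; apply: hr; apply: lt_le_trans hy rr.
- move=> [i w] /=; have hC : Ck 0 (tube sg Z O th) (pdw w (h i)).
    by apply: Ck_pdw; rewrite size_tuple addn0; apply: tube_rem sth dth i.
  have e0 : 0 < ep / KM := divr_gt0 ep0 KM0.
  have [r r0 hr] := Ck_cont hC Vz e0; exists r => // y /hr.
  have -> : pdw w (h i) z = 0 by apply: (tube_flat sth dth) => //; rewrite size_tuple.
  by rewrite subr0 => k; rewrite -ler_pdivlMr // ltW.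
have [_ _ _ rz _] := tubeP dth tok Vz.
have r5 : 0 < Num.min (r4 / 2) r2 by apply: min_gt0 => //; lra.
have [r6 r60 h6] := cont_mnorm (fun i => Sn_cont i rz) r5; rewrite Sz in h6.
exists (Num.min (Num.min r1 r2) (Num.min r3 (Num.min (r4 / 2) r6))).
  by rewrite !lt_min r10 r20 r30 r60 andbT /=; lra.
move=> v; rewrite !lt_min => /andP [/andP [v1 v2] /andP [v3 /andP [v4 v6]]].
have := h6 v v6; rewrite lt_min => /andP [s4 s2].
split; first exact: h2.
move=> i w v'; rewrite !lt_min => /andP [_ /andP [_ /andP [v'4 _]]] _.
have vz : mnorm (v' - z) < r4 by have := mnormB_tri v' (Sn v) z; lra.
apply: le_trans (h4 (i, w) v' vz) _; apply: ler_pM.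
- exact: ltW.
- by rewrite exprn_ge0 // ltW.
- exact: h1.
have := h3 v v3; rewrite ltr_norml => /andP [k _].
by rewrite lerXn2r ?nnegrE ?(slow_ge0 sth) //; lra.
Qed.

(** The correction is [E i = - chi * h i], so that [F i + E i] is the Taylor polynomial wherever the
    cut-off is 1. *)
Lemma smoothing_correction : exists E : 'I_n -> 'rV[R]_m -> R, [/\ forall i, Dfun (E i),
  forall i, WC p (fun v => G v /\ O (pr v)) tg (fun _ => 1) (E i),
  forall i v, E i v != 0 -> [/\ G v, O (pr v) & exists z, [/\ Z z, O (pr z) & N v z]] &
  forall i v, G v -> O (pr v) -> CkAt p.+1 (fun v => F i v + E i v) v].
Proof.
have hprj := Dfun_prj S sg; have hth := slow_def sth.
have hpd i (w : p.-tuple 'I_m) : Dfun (pdw w (h i)) by apply: Dfun_pdw.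
have [||de sde [dth tokQ]] := tube_minorant hZ hc hSn hO sth (Q := Q) _ _ smoothing_local.
- rewrite /Q; apply: Def_and; first by definable.
  by apply: Def_all_fin => i; apply: Def_all_fin => w; have hiw := hpd i w; definable.
- by move=> v r r' [k1 k2] _ hr; split=> // i w v' hv'; apply: k2; apply: lt_le_trans hv' hr.
set V := tube sg Z O de; have oV : open_set V := open_tube sde dth tok.
pose chi := cut sg Z p.+1 Sn O de; pose D v := de (pr v); pose sc := tscale sg th de.
have VQ v : V v -> Q v (D v) by move=> [Ov [z [fz hz]]]; have [] := tokQ v z Ov fz hz.
pose eta v := tg v * th (pr v) ^+ p / KM.
have eta0 v : 0 <= eta v.
  apply: divr_ge0; last exact: ltW KM0.
  by apply: mulr_ge0 => //; apply: exprn_ge0; exact: slow_ge0 sth _.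
have wh i : WC p V (fun v => (m.+1%:R * D v) ^+ p * eta v) (fun v => m.+1%:R * D v) (h i).
  apply: (flat_WC (tube_Snp dth) (tube_SnV sde dth) (tube_Snc dth)) => //.
  - by move=> v /(tubeP dth tok) [_ _ /ltW].
  - by move=> v y Vv Vy e; rewrite /D -(tube_Snp dth Vv) -(tube_Snp dth Vy) e.
  - by move=> v [Ov _]; apply/(slow_dom sde).
  - exact: tube_rem sde dth i.
  - by move=> w ws z Vz Sz; apply: tube_flat sde dth i w z ws Vz Sz.
  move=> w v y ws Vv Vy e; rewrite /eta ler_pdivlMr //.
  have ws' : size w == p by apply/eqP.
  have [_ k] := VQ v Vv; apply: (k i (Tuple ws')).
  - have [_ _ hy _ _] := tubeP dth tok Vy; rewrite -e; apply: lt_le_trans hy _.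
    by rewrite /D -(tube_Snp dth Vv) -(tube_Snp dth Vy) e.
  - by rewrite -(tube_Snp dth Vv) -(tube_Snp dth Vy) e.
have sc0 v : O (pr v) -> 0 < sc v by exact: tscale_gt0 sth sde v.
(* Multiplying by the cut-off costs [2 ^+ p * Kcut], and [eta] was divided by [KM] precisely so that
   the outcome is [tg * sc ^+ p]; [WC_unscale] then removes the powers of the scale. *)
have wE i : WC p (fun v => O (pr v)) (fun v => tg v * sc v ^+ p) sc (fun v => chi v * - h i v).
  have w1 : WC p V (fun v => (m.+1%:R * D v) ^+ p * eta v) sc (fun v => - h i v).
    apply: WC_opp => //; apply: WC_scale (wh i) => [v [Ov _]|v [Ov _]]; first exact: sc0.
    rewrite /sc /tscale mulrC; apply: ler_wpM2r; first exact: slow_ge0 sde _.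
    by apply: le_trans (slow_le1 sth _) _; rewrite ler1n.
  have w2 := WC_cut_mul inj hO sth sde dth tok (leqnSn p) _ w1.
  apply: WC_mono (w2 _) => // v Ov; last by rewrite mulr_ge0 ?exprn_ge0 // mulr_ge0 // (slow_ge0 sde).
  rewrite le_eqVlt; apply/orP; left; apply/eqP; rewrite /eta /KM /sc /tscale /D !exprMn.
  have := Kcut_gt0 R m p.+1 => K0; field.
  by apply/and3P; split; rewrite ?expf_neq0 ?lt0r_neq0.
pose E i v := chi v * - h i v.
have hE i : Dfun (E i).
  have h1 := Dfun_cut sg hZ hSn sde; have h2 := hh i; by rewrite /E; definable.
exists E; split=> // [i|i v Ev|i v Gv Ov].
- apply: WC_sub (_ : WC p (fun v => O (pr v)) tg (fun _ => 1) (E i)); first by move=> v [].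
  apply: (WC_unscale _ sc0 _ (wE i)) => // v _; exact: tscale_le1 sth sde v.
- have cv : chi v != 0 by apply: contraNneq Ev => e; rewrite /E e mul0r.
  have [Vv _] := cut_support sde cv; have [Ov [ZS pS] _ _ _] := tubeP dth tok Vv.
  have [k _] := VQ v Vv.
  split=> //; [exact: tube_G dth v Vv | exists (Sn v); rewrite pS; split=> //].
(* Three situations: on [Z] the sum is locally the Taylor polynomial; in the tube off [Z] all
   ingredients are smooth; elsewhere the correction vanishes locally. *)
have [Zv|nZ] := EM (Z v).
  have [e e0 he] := tube_near_Z sth sde dth tok Zv Ov.
  have [Vv _] := he v (ball_center v e0).
  apply: CkAt_ext (Ck_at oV (tube_taylor sde dth i) Vv); exists e => // y /he [_ c1].
  by rewrite /E /chi c1 /h /rem; ring.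
have [Vv|[_ [e e0 he]]] := tube_or_off hO sde dth tok Ov; last first.
  apply: CkAt_ext (FZ Gv nZ i); exists e => // y /he c1.
  by rewrite /E /chi c1 mul0r addr0.
apply: CkAt_add; first exact: FZ.
apply: CkAt_mul; first by apply: Ck_at oV _ Vv; exact: Ck_of_WC (WC_cut inj sth sde dth tok).
apply: CkAt_opp; apply: CkAt_add; first exact: FZ.
apply: CkAt_opp; exact: Ck_at oV (tube_taylor sde dth i) Vv.
Qed.

End Given.

Hypothesis hnd : forall i, tcoord sg i -> nowhere_dense (coord_set sg Z i).

(** The set [O] is fixed before the weight [tg] and the relation [N], because these will be built
    from the distance to the boundary of the region over [O]. *)
Lemma smoothing_step : exists O : 'rV[R]_d -> Prop, [/\ Def O, open_set O, nowhere_dense (fun x => ~ O x) &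
  forall (tg : 'rV[R]_m -> R) (N : 'rV[R]_m -> 'rV[R]_m -> Prop),
  Dfun tg -> Def (fun p : 'rV[R]_m * 'rV[R]_m => N p.1 p.2) -> (forall v, 0 <= tg v) ->
  (forall z, Z z -> O (pr z) -> exists2 t : R, 0 < t & exists2 r : R, 0 < r &
     forall v, mnorm (v - z) < r -> t <= tg v) ->
  (forall z, Z z -> O (pr z) -> exists2 r : R, 0 < r &
     forall v z', mnorm (v - z) < r -> mnorm (z' - z) < r -> N v z') ->
  exists E : 'I_n -> 'rV[R]_m -> R, [/\ forall i, Dfun (E i),
    forall i, WC p (fun v => G v /\ O (pr v)) tg (fun _ => 1) (E i),
    forall i v, E i v != 0 -> [/\ G v, O (pr v) & exists z, [/\ Z z, O (pr z) & N v z]] &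
    forall i v, G v -> O (pr v) -> CkAt p.+1 (fun v => F i v + E i v) v]].
Proof.
have [Sn hSn SnP] := nearest_fun sg hZ.
have hB := Def_good_base sg hZ p.+1 hc hSn.
have ndB := good_base_complement_nd inj hZ hnd p.+1 hc hSn SnP.
have [O [g [sO OB ndO]]] := slow_exists p (Def_not hB) ndB.
have hO x : O x -> good_base sg Z p.+1 c Sn x by move=> /OB; apply: contrapT.
have hg := slow_def sO; exists O; split=> //.
- by apply: Def_ext (_ : Def (fun x => 0 < g x)) => [x|]; [rewrite (slow_dom sO) | definable].
- exact: slow_open sO.
move=> tg N htg hN tg0 tgZ NZ.
have [th0 sth0 [_ tok0]] := tame_minorant hZ hc hSn hO sO.
have [|||th sth [dth tokG]] := tube_minorant hZ hc hSn hO sth0 (Q := fun v _ => G v).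
- by definable.
- by [].
- by move=> z /ZG /oG.
apply: (@smoothing_correction Sn O th) => // v z Ov fz hv.
have [k1 k2 k3] := tok0 v z Ov fz (lt_le_trans hv (dth _)); split=> // i w.
by apply: le_trans (k1 i w); apply: ler_wpM2l.
Qed.

End Smoothing.

(** * Inverse maps *)

Section Inverse.
Variables (R : rcfType) (S : ominimal_expansion R).
Local Notation Def := (Def S).
Local Notation Dfun := (Dfun S).

Lemma Dfun_prod X (dX : dtype R X) (I : Type) (s : seq I) (P : pred I) (F : I -> X -> R) :
  (forall i, P i -> Dfun (F i)) -> Dfun (fun x => \prod_(i <- s | P i) F i x).
Proof.
move=> h; elim: s => [|i s IH].
  have -> : (fun x => \prod_(i <- [::] | P i) F i x) = (fun _ => 1) by apply: funext => x; rewrite big_nil.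
  exact: Dfun_cst.
have [hi|hi] := boolP (P i).
  have -> : (fun x => \prod_(i <- i :: s | P i) F i x) = (fun x => F i x * \prod_(i <- s | P i) F i x).
    by apply: funext => x; rewrite big_cons hi.
  by apply: Dfun_mul => //; apply: h.
have -> // : (fun x => \prod_(i <- i :: s | P i) F i x) = (fun x => \prod_(i <- s | P i) F i x).
by apply: funext => x; rewrite big_cons (negbTE hi).
Qed.

Lemma Dfun_det X (dX : dtype R X) n (A : X -> 'M[R]_n) :
  (forall i j, Dfun (fun x => A x i j)) -> Dfun (fun x => \det (A x)).
Proof.
move=> h; rewrite /determinant; apply: Dfun_sum => s _; apply: Dfun_mul; first exact: Dfun_cst.
by apply: Dfun_prod.
Qed.

Lemma Dfun_adj X (dX : dtype R X) n (A : X -> 'M[R]_n) i j :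
  (forall i j, Dfun (fun x => A x i j)) -> Dfun (fun x => (\adj (A x)) i j).
Proof.
move=> h; have -> : (fun x => (\adj (A x)) i j) = (fun x => (-1) ^+ (j + i) * \det (row' j (col' i (A x)))).
  by apply: funext => x; rewrite mxE.
apply: Dfun_mul; first exact: Dfun_cst.
apply: Dfun_det => k l.
have -> : (fun x => (row' j (col' i (A x))) k l) = (fun x => A x (lift j k) (lift i l)); last exact: h.
by apply: funext => x; rewrite !mxE.
Qed.

Section CkMatrix.
Variables (q n : nat) (V : 'rV[R]_n -> Prop).
Hypothesis oV : open_set V.

Lemma Ck_prod (I : Type) (s : seq I) (F : I -> 'rV[R]_n -> R) :
  (forall i, Ck q V (F i)) -> Ck q V (fun x => \prod_(i <- s) F i x).
Proof.
move=> h; elim: s => [|i s IH]; first by apply: (Ck_ext oV _ (Ck_cst oV q 1)) => v _; rewrite big_nil.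
by apply: (Ck_ext oV _ (Ck_mul oV (h i) IH)) => v _; rewrite big_cons.
Qed.

Lemma Ck_det k (A : 'rV[R]_n -> 'M[R]_k) :
  (forall i j, Ck q V (fun x => A x i j)) -> Ck q V (fun x => \det (A x)).
Proof.
move=> h; rewrite /determinant; apply: Ck_sum => // s _; apply: Ck_mul => //; first exact: Ck_cst.
by apply: Ck_prod.
Qed.

Lemma Ck_adj k (A : 'rV[R]_n -> 'M[R]_k) i j :
  (forall i j, Ck q V (fun x => A x i j)) -> Ck q V (fun x => (\adj (A x)) i j).
Proof.
move=> h; apply: (Ck_ext oV (f := fun x => (-1) ^+ (j + i) * \det (row' j (col' i (A x))))) => [x _|].
  by rewrite mxE.
apply: Ck_mul => //; first exact: Ck_cst.
apply: Ck_det => a b; apply: (Ck_ext oV _ (h (lift j a) (lift i b))) => x _; by rewrite !mxE.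
Qed.

End CkMatrix.

Variable m : nat.
Implicit Types (F H e : 'rV[R]_m -> 'rV[R]_m).

Definition jac F v : 'M[R]_m := \matrix_(l, k) pd l (fun v => F v 0 k) v.

(** A bootstrap: the derivatives of [H] are entries of the inverse Jacobian of [F], by Cramer's
    formula smooth functions composed with [H], so each order of smoothness of [H] yields the
    next. *)
Lemma inverse_Ck q F H (V W : 'rV[R]_m -> Prop) : open_set V -> open_set W -> Dfun F ->
  (forall k, Ck q.+1 V (fun v => F v 0 k)) -> (forall y, W y -> V (H y)) ->
  (forall y, W y -> jac F (H y) \in unitmx) -> (forall l y, W y -> cont (fun y => H y 0 l) y) ->
  (forall i l y, W y -> is_pd i (fun y => H y 0 l) y (invmx (jac F (H y)) i l)) ->
  forall l, Ck q.+1 W (fun y => H y 0 l).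
Proof.
move=> oV oW hF FC HV uJ cH dH.
pose dt (v : 'rV[R]_m) := \det (jac F v).
have hj a b : Dfun (fun v => jac F v a b).
  have -> : (fun v => jac F v a b) = pd a (fun v => F v 0 b) by apply: funext => v; rewrite mxE.
  by apply: Dfun_pd; definable.
have jC a b : Ck q V (fun v => jac F v a b).
  by apply: (Ck_ext oV _ (Ck_pd a (FC b))) => v _; rewrite mxE.
have dtC : Ck q V dt by exact: Ck_det.
pose V' v := V v /\ dt v != 0.
have oV' : open_set V'.
  move=> v [Vv dv]; have [r r0 hr] := oV v Vv; have d0 : 0 < `|dt v| by rewrite normr_gt0.
  have [s s0 hs] := Ck_cont dtC Vv d0; exists (Num.min r s); first exact: min_gt0.
  move=> y; rewrite lt_min => /andP [/hr Vy /hs hy]; split=> //.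
  by apply: contraTneq hy => ->; rewrite sub0r normrN ltxx.
suff gen k : (k <= q.+1)%N -> forall l, Ck k W (fun y => H y 0 l) by apply: gen.
elim: k => [|k IH] hk l; first by split=> // y; apply: cH.
split=> [y|i]; first exact: cH.
split=> [y Wy|]; first by eexists; apply: dH.
pose Ph (v : 'rV[R]_m) := (dt v)^-1 * (\adj (jac F v)) i l.
have hk' : (k <= q)%N by [].
have PC : Ck k V' Ph.
  apply: Ck_mul => //.
    by apply: Ck_inv; [exact: oV' | move=> v [] | apply: Ck_sub (Ck_leq hk' dtC) => v []].
  by apply: Ck_adj => // a b; apply: Ck_sub (Ck_leq hk' (jC a b)) => v [].
apply: (Ck_ext oW (f := fun y => Ph (H y))) => [y Wy|].
  by rewrite (pdE (dH i l y Wy)) /invmx uJ // mxE.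
apply: (Ck_comp oW oV' _ PC); first by apply: Dfun_mul; [apply: Dfun_inv; apply: Dfun_det | apply: Dfun_adj].
- by move=> y Wy; split; [exact: HV | have := uJ y Wy; rewrite unitmxE unitfE].
- by move=> j; apply: IH; apply: ltnW.
Qed.

(** The chain rule for [F (H y) = y] exhibits the Jacobian of [H] as the inverse matrix. *)
Lemma inverse_jac F H (V W : 'rV[R]_m -> Prop) : open_set V -> open_set W -> Dfun F ->
  (forall k, Ck 1 V (fun v => F v 0 k)) -> (forall l, Ck 1 W (fun y => H y 0 l)) ->
  (forall y, W y -> V (H y)) -> (forall y, W y -> F (H y) = y) ->
  forall y, W y -> jac F (H y) \in unitmx /\
    forall i l, is_pd i (fun y => H y 0 l) y (invmx (jac F (H y)) i l).
Proof.
move=> oV oW hF FC HC HV FH y Wy.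
have e1 : jac H y *m jac F (H y) = 1%:M.
  apply/matrixP => i k; rewrite !mxE.
  have hfr : frechet (fun v => F v 0 k) (H (y + 0 *: delta_mx 0 i)) (fun j => pd j (fun v => F v 0 k) (H y)).
    rewrite shift0; apply: (frechet_C1 _ oV (FC k)); last exact: HV.
    by definable.
  have hl j : is_d (fun t => H (y + t *: delta_mx 0 i) 0 j) 0 (pd i (fun y => H y 0 j) y).
    exact: (Ck_ispd i (HC j) Wy).
  have h1 := is_d_chain hfr hl.
  have h2 : is_d (fun t => F (H (y + t *: delta_mx 0 i)) 0 k) 0 (i == k)%:R.
    have [r r0 hr] := oW y Wy; have := is_pd_coord i k y; apply: is_d_ext; exists r => // t ht.
    by rewrite add0r FH //; apply: hr; apply: le_lt_trans (mnorm_shift _ _ _) ht.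
  rewrite -(is_d_uniq h1 h2); apply: eq_bigr => j _; by rewrite !mxE.
have [_ uJ] := mulmx1_unit e1; split=> // i l.
have <- : jac H y = invmx (jac F (H y)) by rewrite -[LHS]mulmx1 -(mulmxV uJ) mulmxA e1 mul1mx.
by rewrite mxE; apply: Ck_ispd (HC l) Wy.
Qed.

(** The threshold makes [e] a Lipschitz map with constant 1/2. The strict inequality leaves slack
    for the next correction to be added. *)
Definition small e := exists2 L : R, L < (2 * m.+1%:R)^-1 &
  forall i k x, `|pd i (fun v => e v 0 k) x| <= L.

Let all_pts (_ : 'rV[R]_m) := True.
Let open_all : open_set all_pts. Proof. by move=> a _; exists 1. Qed.

(** * Perturbations of the identity with small derivatives *)

Section Small.
Variable e : 'rV[R]_m -> 'rV[R]_m.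
Hypotheses (he : Dfun e) (eC : forall k, Ck 1 all_pts (fun v => e v 0 k)) (sm : small e).
Let f x := x + e x.

Lemma small_lip x y : mnorm (e x - e y) <= mnorm (x - y) / 2.
Proof.
have [L hL hb] := sm; have c0 : 0 < 2 * m.+1%:R :> R by rewrite mulr_gt0.
pose L' := Num.max L 0; have L'0 : 0 <= L' by exact: maxR.
have L'1 : L' <= (2 * m.+1%:R)^-1 by rewrite ge_max (ltW hL) invr_ge0 ltW.
have n0 := mnorm_ge0 (x - y).
have mL : m%:R * L' <= 2^-1.
  apply: le_trans (_ : m.+1%:R * (2 * m.+1%:R)^-1 <= _); first by apply: ler_pM => //; rewrite ler_nat.
  by rewrite invfM mulrCA divff ?mulr1 // pnatr_eq0.
apply: mnorm_le => [|k]; first lra.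
rewrite !mxE; have hk : Dfun (fun v => e v 0 k) by definable.
have := @lipschitz_path R S m (fun v => e v 0 k) y x L' hk L'0 => lp.
apply: le_trans (lp _) _.
  move=> v _ _ i _; exists (pd i (fun v => e v 0 k) v); first exact: (Ck_ispd i (eC k) (I : all_pts v)).
  by apply: le_trans (hb i k v) (maxL _ _).
by rewrite [leRHS]mulrC ler_wpM2r.
Qed.

Lemma small_expand x y : mnorm (x - y) <= 2 * mnorm (f x - f y).
Proof.
have h := small_lip x y.
have -> : f x - f y = (x - y) + (e x - e y) by rewrite /f opprD addrACA.
have := mnormD ((x - y) + (e x - e y)) (- (e x - e y)); rewrite addrK mnormN; lra.
Qed.

Lemma small_inj x y : f x = f y -> x = y.
Proof.
move=> exy; have := small_expand x y; rewrite exy subrr mnorm0 mulr0 => h.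
by apply/eqP; rewrite -subr_eq0; apply/eqP; apply: mnorm_eq0.
Qed.

Lemma small_cont k x : cont (fun v => f v 0 k) x.
Proof.
have := cont_add (cont_coord k x) (Ck_cont (eC k) (I : all_pts x)); apply: cont_ext.
by exists 1 => // y _; rewrite mxE.
Qed.

(** The contraction principle would need completeness. Instead the definable set of values of
    [mnorm (f x - b)] has an infimum, positive by compactness if [b] is not attained, and one step
    of the fixed point iteration goes below it. *)
Lemma small_surj b : exists x, f x = b.
Proof.
apply: contrapT => no.
have pos x : 0 < mnorm (f x - b).
  rewrite lt_neqAle mnorm_ge0 andbT eq_sym; apply/eqP => h; apply: no; exists x.
  by apply/eqP; rewrite -subr_eq0; apply/eqP; apply: mnorm_eq0; rewrite h.
have hf : Dfun f by rewrite /f; definable.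
pose M : R := mnorm (f 0 - b) + 1.
have cph x (s : R) : 0 < s -> exists2 r : R, 0 < r & forall y, mnorm (y - x) < r -> mnorm (f y - f x) < s.
  by move=> s0; apply: cont_mnorm => // k; apply: small_cont.
have [||||||r r0 hr] := @closed_compact R S m (fun x => mnorm (f x - b) <= M) (fun x r => r <= mnorm (f x - b)) (2 * (M + M)).
- by definable.
- by definable.
- move=> x hx; have := small_expand x 0; rewrite subr0 => h.
  have := mnormB_tri (f x) b (f 0); rewrite (mnormBC b); rewrite /M in hx *; lra.
- move=> x /negP; rewrite -ltNge => hx; have [|s s0 hs] := cph x (mnorm (f x - b) - M); first lra.
  exists s => // y /hs hy; apply/negP; rewrite -ltNge.
  have := mnormB_tri (f x) (f y) b; rewrite (mnormBC (f x) (f y)); lra.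
- by move=> y s s' h1 _ h2; apply: le_trans h2 h1.
- move=> y _; have p := pos y; have [|s s0 hs] := cph y (mnorm (f y - b) / 2); first lra.
  exists (Num.min s (mnorm (f y - b) / 2)); first by apply: min_gt0 => //; lra.
  move=> y' ; rewrite lt_min => /andP [/hs y1 _] _.
  have := mnormB_tri (f y) (f y') b; rewrite (mnormBC (f y) (f y')); have := minR s (mnorm (f y - b) / 2); lra.
have hA : Def (fun t => exists x, mnorm (f x - b) = t) by definable.
have [||s [s1 s2]] := def_glb hA.
- by exists (mnorm (f 0 - b)), 0.
- by exists 0 => t [x <-]; apply: mnorm_ge0.
have m0 := min_gt0 r0 (pos 0).
have sp : 0 < s.
  apply: lt_le_trans m0 _; rewrite leNgt; apply/negP => /s2 [t [x <-]]; rewrite lt_min => /andP [k1 k2].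
  have : mnorm (f x - b) <= M by rewrite /M; lra.
  by move=> /hr; lra.
(* One iteration step halves the distance to [b], so a value below [3 / 2 * s] leads to one below
   [s]. *)
have [|t [x <-] hx] := s2 (3 / 2 * s); first lra.
pose x' := x - (f x - b).
have := s1 _ (ex_intro _ x' erefl).
have -> : f x' - b = e x' - e x by rewrite /f /x' /f; apply/rowP => i; rewrite !mxE; ring.
have := small_lip x' x; rewrite {2}/x' addrAC subrr add0r mnormN; lra.
Qed.

Lemma small_inverse : exists2 H, Dfun H & forall y, f (H y) = y.
Proof.
have hf : Dfun f by rewrite /f; definable.
have hi i : exists g : 'rV[R]_m -> R, Dfun g /\ forall x, g (f x) = x 0 i.
  have [||g hg hgP] := @Dfun_partial R S 'rV[R]_m _ (fun y t => exists x, f x = y /\ x 0 i = t).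
  - by definable.
  - by move=> y t t' [x [<- <-]] [x' [/small_inj -> <-]].
  by exists g; split=> // x; apply: hgP; exists x.
have [g hg] := choice hi.
exists (fun y => \row_i g i y); first by apply: Dfun_rowmk => i; have [] := hg i.
move=> y; have [x <-] := small_surj y; congr f.
by apply/rowP => i; rewrite mxE; have [_ ->] := hg i.
Qed.

Lemma small_jac x : jac f x = 1%:M + jac e x.
Proof.
apply/matrixP => l k; rewrite !mxE eq_sym; apply: pdE.
have h1 := is_pdD (is_pd_coord l k x) (Ck_ispd l (eC k) (I : all_pts x)).
rewrite eq_sym in h1; apply: is_pd_ext h1.
by exists 1 => // y _; rewrite mxE.
Qed.

(** A vector [u] in the left kernel satisfies [u = - u *m jac e x], whose norm is at most half that
    of [u]. *)
Lemma small_unit x : jac f x \in unitmx.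
Proof.
rewrite -row_free_unit -kermx_eq0; apply/eqP/row_matrixP => a; rewrite row0.
set u := row a _; have hu : u *m jac f x = 0 by rewrite -row_mul mulmx_ker row0.
have [L hL hb] := sm; have c0 : 0 < 2 * m.+1%:R :> R by rewrite mulr_gt0.
have u0 := mnorm_ge0 u.
apply: mnorm_eq0; suff : mnorm u <= mnorm u / 2 by lra.
apply: mnorm_le => [|k]; first lra.
have : (u *m jac f x) 0 k = 0 by rewrite hu mxE.
rewrite small_jac mulmxDr mulmx1 !mxE => /eqP; rewrite addr_eq0 => /eqP ->; rewrite normrN.
apply: le_trans (ler_norm_sum _ _ _) _.
apply: le_trans (_ : \sum_(l < m) mnorm u * (2 * m.+1%:R)^-1 <= _).
  apply: ler_sum => l _; rewrite normrM; apply: ler_pM => //; first exact: mnorm_coord.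
  rewrite mxE.
  by apply: le_trans (hb l k x) (ltW hL).
rewrite sumr_const card_ord -[leLHS]mulr_natl mulrCA; apply: ler_wpM2l => //.
apply: le_trans (_ : m.+1%:R * (2 * m.+1%:R)^-1 <= _); first by rewrite ler_wpM2r ?invr_ge0 ?(ltW c0) // ler_nat.
by rewrite invfM mulrCA divff ?mulr1 // pnatr_eq0.
Qed.

(** The expansion estimate bounds the increment of [H] by twice that of its argument, so the error
    in differentiating [f] at [H y] stays small after multiplication by the inverse Jacobian. *)
Lemma small_inverse_pd H : (forall y, f (H y) = y) ->
  forall i l y, is_pd i (fun y => H y 0 l) y (invmx (jac f (H y)) i l).
Proof.
move=> fH i l y ep ep0; set x := H y; set A := jac f x; set B := invmx A.
have hf : Dfun f by rewrite /f; definable.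
have s0 : 0 <= \sum_k `|B k l| by apply: sumr_ge0.
pose c : R := 2 * (1 + \sum_k `|B k l|); have c0 : 0 < c by rewrite /c; lra.
have e0 : 0 < ep / c by rewrite divr_gt0.
have fC k : Ck 1 all_pts (fun v => f v 0 k).
  apply: (Ck_ext open_all _ (Ck_add open_all (Ck_coord open_all 1 k) (eC k))) => v _; by rewrite mxE.
have [||r r0 hr] := @finite_minT R 'I_m (fun k r => forall v, mnorm (v - x) < r ->
    `|f v 0 k - f x 0 k - \sum_j (v 0 j - x 0 j) * A j k| <= ep / c * mnorm (v - x)).
- by move=> k r r' hr _ rr v hv; apply: hr; apply: lt_le_trans hv rr.
- move=> k; have hk : Dfun (fun v => f v 0 k) by definable.
  have [r r0 hr] := frechet_C1 hk open_all (fC k) (I : all_pts x) e0; exists r => // v /hr.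
  by congr (`|_ - _| <= _); apply: eq_bigr => j _; rewrite mxE.
exists (r / 2); first lra.
move=> t ht; rewrite add0r shift0 -/x; set v := H _.
have fv : f v = y + t *: delta_mx 0 i by exact: fH.
have fx : f x = y by exact: fH.
have kt : mnorm (v - x) <= 2 * `|t|.
  have := small_expand v x; rewrite fv fx.
  by have := mnorm_shift i y t; lra.
pose rr := t *: delta_mx 0 i - (v - x) *m A.
have hrr k : `|rr 0 k| <= ep / c * (2 * `|t|).
  have vr : mnorm (v - x) < r by lra.
  apply: le_trans (_ : ep / c * mnorm (v - x) <= _); last by rewrite ler_wpM2l // ltW.
  have := hr k v vr; rewrite fv fx.
  suff -> : (y + t *: delta_mx 0 i) 0 k - y 0 k - \sum_j (v 0 j - x 0 j) * A j k = rr 0 k by [].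
  rewrite /rr !mxE [y 0 k + _]addrC addrK; congr (_ - _); apply: eq_bigr => j _; by rewrite !mxE.
have uA : A \in unitmx by exact: small_unit.
have key : v 0 l - x 0 l - t * B i l = - (rr *m B) 0 l.
  rewrite /rr mulmxBl -mulmxA mulmxV // mulmx1 -scalemxAl -rowE !mxE; ring.
rewrite key normrN mxE; apply: le_trans (ler_norm_sum _ _ _) _.
apply: le_trans (_ : \sum_k (ep / c * (2 * `|t|)) * `|B k l| <= _).
  by apply: ler_sum => k _; rewrite normrM ler_wpM2r.
rewrite -mulr_sumr.
have -> : ep * `|t| = ep / c * (2 * `|t|) * (c / 2) by field; lra.
apply: ler_wpM2l; first by rewrite mulr_ge0 ?(ltW e0) // mulr_ge0.
by rewrite /c mulrC mulKf ?lerDr //; lra.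
Qed.

End Small.

Lemma small_diffeo p e : Dfun e -> (forall k, Ck p.+1 all_pts (fun v => e v 0 k)) -> small e ->
  exists2 H, Dfun H & [/\ forall x, H (x + e x) = x, forall y, H y + e (H y) = y &
    forall k, Ck p.+1 all_pts (fun v => H v 0 k)].
Proof.
move=> he eC sm; have eC1 k : Ck 1 all_pts (fun v => e v 0 k) by exact: Ck_leq (eC k).
have [H hH fH] := small_inverse he eC1 sm; exists H => //; split=> //.
  by move=> x; apply: (small_inj he eC1 sm); rewrite fH.
have hf : Dfun (fun x => x + e x) by definable.
apply: (inverse_Ck open_all open_all hf) => //.
- move=> k; apply: (Ck_ext open_all _ (Ck_add open_all (Ck_coord open_all _ k) (eC k))) => v _; by rewrite mxE.
- by move=> y _; apply: small_unit.
- move=> l y _ ep ep0; exists (ep / 2); first lra.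
  move=> y' hy; have := small_expand he eC1 sm (H y') (H y); rewrite !fH.
  have := mnorm_coord (H y' - H y) l; rewrite !mxE; lra.
- by move=> i l y _; apply: small_inverse_pd.
Qed.

End Inverse.

(** * Smoothing one chart against finitely many others *)

Section ChartSmoothing.
Variables (R : rcfType) (S : ominimal_expansion R).
Local Notation Def := (Def S).
Local Notation Dfun := (Dfun S).

Lemma Def_ex_fin X (dX : dtype R X) (T : finType) (P : T -> X -> Prop) : (forall j, Def (P j)) ->
  Def (fun x => exists j, P j x).
Proof.
move=> hP; apply: Def_ext (Def_not (Def_all_fin (fun j => Def_not (hP j)))) => x; split.
  by move=> h; apply: contrapT => n; apply: h => j hj; apply: n; exists j.
by move=> [j hj] h; apply: (h j).
Qed.

Lemma norm_le_sqr (a : R) : `|a| <= 1 + a ^+ 2.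
Proof. by rewrite -[a ^+ 2]real_normK ?num_real //; have := normr_ge0 a; nra. Qed.

Lemma open_preim n k (G : 'rV[R]_n -> Prop) (Om : 'rV[R]_k -> Prop) (h : 'rV[R]_n -> 'rV[R]_k) :
  open_set G -> open_set Om -> (forall i v, G v -> cont (fun v => h v 0 i) v) ->
  open_set (fun v => G v /\ Om (h v)).
Proof.
move=> oG oO ch v [Gv Ov]; have [r r0 hr] := oG v Gv; have [s s0 hs] := oO _ Ov.
have [t t0 ht] := cont_mnorm (fun i => ch i v Gv) s0.
exists (Num.min r t); first exact: min_gt0.
by move=> y; rewrite lt_min => /andP [/hr y1 /ht y2]; split=> //; apply: hs.
Qed.

Lemma CkAt_comp q n k (F : 'rV[R]_k -> R) (H : 'rV[R]_n -> 'rV[R]_k) v : Dfun F ->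
  CkAt q F (H v) -> (forall j, CkAt q (fun v => H v 0 j) v) -> CkAt q (fun v => F (H v)) v.
Proof.
move=> hF [r r0 hr] hH.
have [||s s0 hs] := @finite_minT R 'I_k (fun j r => Ck q (fun y => mnorm (y - v) < r) (fun v => H v 0 j)).
- by move=> i a b h _ hb; apply: Ck_sub h => y hy; apply: lt_le_trans hy hb.
- by move=> j; apply: hH.
have ch i y : mnorm (y - v) < s -> cont (fun v => H v 0 i) y by move=> hy; apply: Ck_cont (hs i) hy.
have oW := open_preim (@open_ball _ _ v s) (@open_ball _ _ (H v) r) ch.
apply: (Ck_at oW); last by split; apply: ball_center.
apply: (Ck_comp oW (@open_ball _ _ (H v) r) hF hr) => [y []//|j].
by apply: Ck_sub (hs j) => y [].
Qed.

Variables (T : finType) (p m : nat) (Om G : T -> 'rV[R]_m -> Prop) (g h : T -> 'rV[R]_m -> 'rV[R]_m).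
Hypothesis p0 : (0 < p)%N.
Hypotheses (oOm : forall j, open_set (Om j)) (oG : forall j, open_set (G j)).
Hypotheses (dOm : forall j, Def (Om j)) (dG : forall j, Def (G j)).
Hypotheses (hg : forall j, Dfun (g j)) (hh : forall j, Dfun (h j)).
Hypotheses (gG : forall j x, Om j x -> G j (g j x)) (hO : forall j v, G j v -> Om j (h j v)).
Hypotheses (ghK : forall j x, Om j x -> h j (g j x) = x) (hgK : forall j v, G j v -> g j (h j v) = v).
Hypothesis gC : forall j i, Ck p (Om j) (fun x => g j x 0 i).
Hypothesis hC : forall j i, Ck p (G j) (fun v => h j v 0 i).
Hypothesis ghC : forall j l i, Ck p.+1 (fun v => G j v /\ Om l (h j v)) (fun v => g l (h j v) 0 i).

Implicit Type e : 'rV[R]_m -> 'rV[R]_m.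
Let all_pts (_ : 'rV[R]_m) := True.
Let open_all : open_set all_pts. Proof. by move=> a _; exists 1. Qed.

(** Points [x] are coordinates in the chart under correction, [v] in an earlier chart [l]; this is
    the transition from [l] to the chart corrected by [e]. *)
Definition comp_chart e l i v := h l v 0 i + e (h l v) 0 i.
Definition good e l x := forall i, CkAt p.+1 (comp_chart e l i) (g l x).
Definition Bad e x := exists l, Om l x /\ ~ good e l x.
Definition state e := [/\ Dfun e, forall k, Ck p all_pts (fun v => e v 0 k) & small e].

Let g_cont j x i : Om j x -> cont (fun x => g j x 0 i) x. Proof. by move=> Ox; apply: Ck_cont (gC j i) Ox. Qed.
Let h_cont j v i : G j v -> cont (fun v => h j v 0 i) v. Proof. by move=> Gv; apply: Ck_cont (hC j i) Gv. Qed.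

Lemma Dfun_comp_chart e l i : Dfun e -> Dfun (comp_chart e l i).
Proof. by move=> he; have hl := hh l; rewrite /comp_chart; definable. Qed.

(** The two expressions of the corrected chart differ by the transition between the charts [j] and
    [l], which is already [C^(p+1)]. *)
Lemma good_transfer e j l x : Dfun e -> Om j x -> Om l x -> good e j x -> good e l x.
Proof.
move=> he Oj Ol gd i; pose v := g l x; have Gv : G l v by exact: gG.
have oW : open_set (fun v => G l v /\ Om j (h l v)) by apply: open_preim => // k y; apply: h_cont.
have Wv : G l v /\ Om j (h l v) by split=> //; rewrite /v ghK.
have hv : h l v = x by rewrite /v ghK.
have hF := Dfun_comp_chart j i he.
have := @CkAt_comp p.+1 m m (comp_chart e j i) (fun v => g j (h l v)) v hF.
rewrite hv => /(_ (gd i) (fun k => Ck_at oW (ghC l j k) Wv)); apply: CkAt_ext.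
have [r r0 hr] := oW v Wv; exists r => // y /hr [Gy Oy]; by rewrite /comp_chart ghK.
Qed.

Lemma Bad_closed e l x : Dfun e -> Om l x -> ~ Bad e x -> exists2 r : R, 0 < r & forall y, mnorm (y - x) < r -> ~ Bad e y.
Proof.
move=> he Ox nB; have [r r0 hr] := oOm Ox.
have gd : good e l x by apply: contrapT => n; apply: nB; exists l.
have [||s s0 hs] := @finite_minT R 'I_m (fun i r => forall v, mnorm (v - g l x) < r -> CkAt p.+1 (comp_chart e l i) v).
- by move=> i a b k _ ba v hv; apply: k; apply: lt_le_trans hv ba.
- by move=> i; apply: CkAt_open (gd i).
have [t t0 ht] := cont_mnorm (fun i => g_cont i Ox) s0.
exists (Num.min r t); first exact: min_gt0.
move=> y; rewrite lt_min => /andP [/hr Oy /ht hy] [l' [Oy' ng]]; apply: ng.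
by apply: (good_transfer he Oy Oy') => i; apply: hs.
Qed.

Lemma Def_Bad e : Dfun e -> Def (Bad e).
Proof.
move=> he; rewrite /Bad; apply: Def_ex_fin => l; apply: Def_and; first exact: dOm.
apply: Def_not; apply: Def_all_fin => i.
exact: Def_comp (Def_CkAt p.+1 (Dfun_comp_chart l i he)) (hg l).
Qed.

Definition Zset j e v := G j v /\ Bad e (h j v).
Definition img d (sg : 'I_d -> 'I_m) (Z : 'rV[R]_m -> Prop) x := exists v, Z v /\ prj sg v = x.

(** * One correction over a generic part of a coordinate projection *)

Section Step.
Variables (e : 'rV[R]_m -> 'rV[R]_m) (j : T) (d : nat) (sg : 'I_d -> 'I_m).
Hypotheses (inj : injective sg) (he : Dfun e) (eC : forall k, Ck p all_pts (fun v => e v 0 k)).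
Variable O : 'rV[R]_d -> Prop.
Hypotheses (dO : Def O) (oO : open_set O).
Local Notation pr := (prj sg).
Local Notation Z := (Zset j e).
Definition U x := Om j x /\ O (pr (g j x)).

Lemma open_U : open_set U.
Proof.
have oP : open_set (fun v => O (pr v)) by exact: open_prj.
exact: (open_preim (@oOm j) oP (fun i v => @g_cont j v i)).
Qed.

Lemma Def_U : Def U.
Proof. by have hj := hg j; have dj := dOm j; have hp := Dfun_prj S sg; rewrite /U; definable. Qed.

Variable dd : 'rV[R]_m -> R.
Hypothesis hdd : Dfun dd.
Hypothesis ddP : forall x, [/\ 0 <= dd x, dd x <= 1, 0 < dd x -> forall y, mnorm (y - x) < dd x -> U y &
  forall r : R, 0 < r -> r <= 1 -> (forall y, mnorm (y - x) < r -> U y) -> r <= 2 * dd x].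

Lemma dd_le x a : ~ U a -> dd x <= mnorm (x - a).
Proof.
move=> na; have [d0 _ d1 _] := ddP x; rewrite leNgt; apply/negP => hlt.
by apply: na; apply: d1; [apply: le_lt_trans (mnorm_ge0 _) hlt | rewrite mnormBC].
Qed.

Lemma dd_near z : Z z -> O (pr z) -> exists2 t : R, 0 < t & exists2 r : R, 0 < r &
  forall v, mnorm (v - z) < r -> [/\ G j v, t <= dd (h j v) & mnorm (h j v - h j z) < t / 4].
Proof.
move=> [Gz _] Oz; have Ux : U (h j z) by split; [exact: hO | rewrite hgK].
have [r0 r00 h0] := open_U Ux; pose t0 := Num.min (r0 / 2) 1.
have t00 : 0 < t0 by rewrite lt_min ltr01 andbT; lra.
have [t1 t2] : t0 <= r0 / 2 /\ t0 <= 1 by split; [exact: minL | exact: minR].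
exists (t0 / 2); first lra.
have e0 : 0 < t0 / 2 / 4 by lra.
have [r1 r10 h1] := cont_mnorm (fun i => h_cont i Gz) e0; have [r2 r20 h2] := oG Gz.
exists (Num.min r1 r2); first exact: min_gt0.
move=> v; rewrite lt_min => /andP [/h1 v1 /h2 v2]; split=> //.
have [_ _ _ k] := ddP (h j v); suff : t0 <= 2 * dd (h j v) by lra.
by apply: k => // y hy; apply: h0; have := mnormB_tri y (h j v) (h j z); lra.
Qed.

Variables (ep : R) (ka : 'rV[R]_m -> R) (K : R).
Hypotheses (ep0 : 0 < ep) (K0 : 0 < K) (ka1 : forall x, 1 <= ka x) (hka : Dfun ka).
Hypothesis kac : forall x, Om j x -> cont ka x.
Hypothesis kaW : forall i, WC p (Om j) ka (fun _ => 1) (fun x => g j x 0 i).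
Hypothesis KP : forall n (V : 'rV[R]_n -> Prop) (V' : 'rV[R]_m -> Prop)
    (G : 'rV[R]_n -> 'rV[R]_m) (F : 'rV[R]_m -> R) (ka w : 'rV[R]_n -> R),
  open_set V -> open_set V' -> Dfun F -> Ck p V' F -> (forall v, V v -> V' (G v)) ->
  (forall v, V v -> 1 <= ka v) -> (forall j, WC p V ka (fun _ => 1) (fun v => G v 0 j)) ->
  PB p V G w F -> WC p V (fun v => K * ka v ^+ p * w v) (fun _ => 1) (fun v => F (G v)).

Definition wgt x := Num.min (dd x ^+ 2) ep.
(** The divisor is the loss in composing with [g j]. The transported correction is then bounded by
    [wgt], which is small and decays quadratically at the boundary of [U]. *)
Definition tgt v : R := wgt (h j v) / (K * ka (h j v) ^+ p).
(** Keeps the support of the correction close to bad points relative to their distance from the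
    boundary of [U], so that it can accumulate outside [U] only at bad points; see [corr_off]. *)
Definition near v z : Prop := 2 * mnorm (h j v - h j z) <= dd (h j z).

Lemma ka_gt0 x : 0 < ka x ^+ p.
Proof. by apply: exprn_gt0; apply: lt_le_trans (ka1 x). Qed.

Lemma wgt_ge0 x : 0 <= wgt x.
Proof. by rewrite /wgt le_min sqr_ge0 ltW. Qed.

Lemma tgt_ge0 v : 0 <= tgt v.
Proof. by apply: divr_ge0; [exact: wgt_ge0 | rewrite mulr_ge0 // ltW // ka_gt0]. Qed.

Lemma tgt_near z : Z z -> O (pr z) -> exists2 t : R, 0 < t & exists2 r : R, 0 < r &
  forall v, mnorm (v - z) < r -> t <= tgt v.
Proof.
move=> Zz Oz; have [t t0 [r r0 hr]] := dd_near Zz Oz; have [Gz _] := Zz.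
have ck : cont (fun v => ka (h j v)) z.
  by apply: cont_comp => [|i]; [apply: kac; exact: hO | exact: h_cont].
have [s s0 hs] := ck _ ltr01.
pose M := ka (h j z) + 1; have M0 : 0 < M by rewrite /M; have := ka1 (h j z); lra.
exists (Num.min (t ^+ 2) ep / (K * M ^+ p)).
  by rewrite divr_gt0 ?lt_min ?exprn_gt0 // mulr_gt0 ?exprn_gt0.
exists (Num.min r s); first exact: min_gt0.
move=> v; rewrite lt_min => /andP [/hr [Gv tv _] /hs hv].
have kM : ka (h j v) <= M by move: hv; rewrite ltr_norml /M => /andP [_]; lra.
have k1 := ka1 (h j v).
apply: ler_pM.
- by rewrite le_min sqr_ge0 ltW.
- by rewrite invr_ge0 mulr_ge0 ?exprn_ge0 // ltW.
- rewrite /wgt le_min; apply/andP; split; last exact: minR.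
  apply: le_trans (minL _ _) _; rewrite lerXn2r ?nnegrE //; [exact: ltW | lra].
have a1 : 0 < K * M ^+ p by rewrite mulr_gt0 ?exprn_gt0.
have a2 : 0 < K * ka (h j v) ^+ p by rewrite mulr_gt0 ?ka_gt0.
rewrite lef_pV2 ?posrE //.
by apply: ler_wpM2l; [exact: ltW | rewrite lerXn2r ?nnegrE //; lra].
Qed.

Lemma near_near z : Z z -> O (pr z) -> exists2 r : R, 0 < r &
  forall v z', mnorm (v - z) < r -> mnorm (z' - z) < r -> near v z'.
Proof.
move=> Zz Oz; have [t t0 [r r0 hr]] := dd_near Zz Oz.
exists r => // v z' /hr [_ _ k1] /hr [_ k2 k3]; rewrite /near.
by have := mnormB_tri (h j v) (h j z) (h j z'); rewrite (mnormBC (h j z) (h j z')); lra.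
Qed.

Variable E : 'I_m -> 'rV[R]_m -> R.
Hypothesis hE : forall i, Dfun (E i).
Hypothesis EW : forall i, WC p (fun v => G j v /\ O (pr v)) tgt (fun _ => 1) (E i).
Hypothesis Esupp : forall i v, E i v != 0 -> [/\ G j v, O (pr v) & exists z, [/\ Z z, O (pr z) & near v z]].
Hypothesis Esmooth : forall i v, G j v -> O (pr v) -> CkAt p.+1 (fun v => comp_chart e j i v + E i v) v.

Definition corr x : 'rV[R]_m := \row_i (if `[< U x >] then E i (g j x) else 0).
Definition new x : 'rV[R]_m := e x + corr x.

Lemma Dfun_corr : Dfun corr.
Proof. by have hu := Def_U; have hj := hg j; rewrite /corr; definable. Qed.

Lemma Dfun_new : Dfun new.
Proof. by have := Dfun_corr => hc; rewrite /new; definable. Qed.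

Lemma WC_corr i : WC p all_pts (fun _ => ep) (fun _ => 1) (fun x => corr x 0 i).
Proof.
have oGO : open_set (fun v => G j v /\ O (pr v)).
  move=> v [Gv Ov]; have [r r0 hr] := oG Gv; have [s s0 hs] := open_prj oO Ov.
  by exists (Num.min r s); [exact: min_gt0 | move=> y; rewrite lt_min => /andP [/hr y1 /hs y2]].
have wU : WC p U wgt (fun _ => 1) (fun x => corr x 0 i).
  apply: (WC_ext open_U (f := fun x => E i (g j x))) => [x Ux|]; first by rewrite mxE asboolT.
  have UG x : U x -> G j (g j x) /\ O (pr (g j x)) by case=> Ox Op; split=> //; apply: gG.
  have := @KP m U _ (g j) (E i) ka (fun x => tgt (g j x)) open_U oGO (hE i) (Ck_of_WC (EW i)) UG (fun v _ => ka1 v) _ (WC_PB UG (EW i)).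
  move=> k; apply: WC_mono (k _) => // [x [Ox _]|l]; last by apply: WC_sub (kaW l) => x [].
  rewrite /tgt ghK // mulrC -mulrA mulVf ?mulr1 //; apply: lt0r_neq0; rewrite mulr_gt0 ?ka_gt0 //.
have := @WC_glue R p m all_pts U wgt (fun x => corr x 0 i) open_all open_U _ wU _ => k.
apply: WC_mono (k _ _) => //.
- by move=> x _; case: asboolP => _; [exact: minR | exact: ltW].
- by move=> x _ nU; rewrite mxE asboolF.
move=> x a Ux _ na; apply: le_trans (minL _ _) _.
have [d0 _ _ _] := ddP x; rewrite lerXn2r ?nnegrE ?mnorm_ge0 //; exact: dd_le.
Qed.

(** A point [y] of the support is within half of [dd] of some bad point, and [dd] there is at most
    the distance of that bad point to [x]. Hence the bad point is at most twice as far from [x] as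
    [y], impossible for [y] close to [x] because a neighbourhood of [x] has no bad points. *)
Lemma corr_off l x : Om l x -> ~ Bad e x -> ~ U x -> exists2 r : R, 0 < r & forall y, mnorm (y - x) < r -> corr y = 0.
Proof.
move=> Ox nB nU; have [r r0 hr] := Bad_closed he Ox nB.
exists (r / 2); first lra.
move=> y hy; apply/rowP => i; rewrite !mxE; case: asboolP => // Uy; apply/eqP.
apply: contrapT => /negP /Esupp [_ _ [z [[Gz Bz] Oz]]]; rewrite /near ghK; last by case: Uy.
move=> k; apply: (hr _ _ Bz); have := dd_le (h j z) nU; have := mnormB_tri (h j z) y x.
by rewrite (mnormBC (h j z) y); lra.
Qed.

Lemma good_on_U x : U x -> good new j x.
Proof.
move=> [Ox Ov] i; have Gv := gG Ox; apply: CkAt_ext (Esmooth i Gv Ov).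
have [r r0 hr] := oG Gv; have [s s0 hs] := open_prj oO Ov.
exists (Num.min r s); first exact: min_gt0.
move=> y; rewrite lt_min => /andP [/hr Gy /hs Oy].
rewrite /comp_chart /new !mxE asboolT ?hgK // ?addrA //; split; [exact: hO | by rewrite hgK].
Qed.

(** On [U] the correction makes the chart good; outside [U] a point that was good has a
    neighbourhood on which nothing changes. *)
Lemma Bad_new x : Bad new x -> Bad e x /\ ~ U x.
Proof.
move=> [l [Ol ng]]; have nU : ~ U x.
  by move=> Ux; apply: ng; apply: (good_transfer Dfun_new _ Ol (good_on_U Ux)); case: Ux.
split=> //; apply: contrapT => nB; apply: ng => i.
have gd : good e l x by apply: contrapT => n; apply: nB; exists l.
apply: CkAt_ext (gd i); have [r r0 hr] := corr_off Ol nB nU.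
have Gv := gG Ol; have [s s0 hs] := cont_mnorm (fun i => h_cont i Gv) r0; rewrite ghK // in hs.
by exists s => // y /hs /hr k; rewrite /comp_chart /new k addr0.
Qed.

End Step.

Lemma smooth_step e j d (sg : 'I_d -> 'I_m) : injective sg -> state e ->
  (forall sg' : 'I_d.+1 -> 'I_m, injective sg' -> nowhere_dense (img sg' (Zset j e))) ->
  exists e', [/\ state e', forall x, Bad e' x -> Bad e x & nowhere_dense (img sg (Zset j e'))].
Proof.
move=> inj [he eC [L hL Lb]] nd.
have hB := Def_Bad he; have hj := hh j; have gj := hg j; have dGj := dG j; have dOj := dOm j.
have hZ : Def (Zset j e) by rewrite /Zset; definable.
have hF i : Dfun (comp_chart e j i) by exact: Dfun_comp_chart.
have FC i : Ck p (G j) (comp_chart e j i).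
  have hei : Dfun (fun v => e v 0 i) by definable.
  have c2 := @Ck_comp R S p m m (G j) all_pts (h j) (fun v => e v 0 i) (@oG j) open_all hei (eC i) (fun _ _ => I) (hC j).
  exact: (Ck_add (@oG j) (hC j i) c2).
have FZ v : G j v -> ~ Zset j e v -> forall i, CkAt p.+1 (comp_chart e j i) v.
  move=> Gv nZ i; have gd : good e j (h j v).
    by apply: contrapT => n; apply: nZ; split=> //; exists j; split=> //; apply: hO.
  by have := gd i; rewrite hgK.
have [|O [dO oO ndO step]] := @smoothing_step R S p m d m sg (G j) (Zset j e) (comp_chart e j) inj dGj (@oG j) hZ (fun v z => proj1 z) hF FC FZ.
  (* Adjoining the transverse coordinate [i] in front gives an injection from [d.+1] coordinates, to
     which the hypothesis of the previous dimension applies. *)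
  move=> i hi; pose sg' (k : 'I_d.+1) := if unlift ord0 k is Some k' then sg k' else i.
  have inj' : injective sg'.
    move=> a b; rewrite /sg'; case: (unliftP ord0 a) => [a' ->|->]; case: (unliftP ord0 b) => [b' ->|->] //.
    + by move=> /inj ->.
    + by move=> ea; have := hi a'; rewrite ea eqxx.
    + by move=> ea; have := hi b'; rewrite -ea eqxx.
  apply: nowhere_dense_sub (nd sg' inj') => x [z [[Zz pz] ez]]; exists z; split=> //.
  apply/rowP => k; rewrite mxE /sg'; case: (unliftP ord0 k) => [k' ->|-> //].
  by have := pz => /rowP /(_ k'); rewrite !mxE.
have hU := @Def_U j d sg O dO.
have [||dd hdd ddP] := @Dfun_radius R S 'rV[R]_m _ (fun x r => forall y, mnorm (y - x) < r -> U j sg O y).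
- by definable.
- by move=> x r r' k _ rr y hy; apply: k; apply: lt_le_trans hy rr.
pose fw (k : 'I_m * p.-bseq 'I_m) := pdw k.2 (fun x => g j x 0 k.1).
have hfw k : Dfun (fw k) by apply: Dfun_pdw; definable.
(* A sum of squares is a definable, continuous majorant, at least 1, of all derivatives of [g j] up
   to order [p]. *)
pose ka x := 1 + \sum_k fw k x ^+ 2.
have hka : Dfun ka by rewrite /ka; definable.
have ka1 x : 1 <= ka x by rewrite /ka lerDl sumr_ge0 // => k _; rewrite sqr_ge0.
have kac x : Om j x -> cont ka x.
  move=> Ox; suff k0 : Ck 0 (Om j) ka by apply: Ck_cont k0 Ox.
  apply: Ck_add => //; first exact: Ck_cst.
  apply: Ck_sum => // k _; apply: Ck_exp => //; apply: Ck_pdw; rewrite addn0.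
  exact: Ck_leq (size_bseq k.2) (gC j k.1).
have kaW i : WC p (Om j) ka (fun _ => 1) (fun x => g j x 0 i).
  apply: WC_words (gC j i) _ => w ws x _; rewrite /ka (bigD1 (i, Bseq ws)) //= -/(fw (i, Bseq ws) x).
  have s0 : 0 <= \sum_(k | k != (i, Bseq ws)) fw k x ^+ 2 by apply: sumr_ge0 => k _; rewrite sqr_ge0.
  rewrite -[X in `|X|]/(fw (i, Bseq ws) x); set a := fw _ x in s0 *.
  have := norm_le_sqr a.
  lra.
have [K K0 KP] := WC_comp S p m.
(* Half of the slack left by [L], so that the corrected map is again [small]. *)
pose ep : R := ((2 * m.+1%:R)^-1 - L) / 2; have ep0 : 0 < ep by rewrite divr_gt0 // subr_gt0.
have [|||||E [hE EW Es Esm]] := step (tgt j dd ep ka K) (near j dd).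
- by rewrite /tgt /wgt; definable.
- by rewrite /near; definable.
- by move=> v; apply: tgt_ge0.
- by move=> z; apply: (tgt_near oO ddP ep0 K0 ka1 kac).
- by move=> z; apply: (near_near oO ddP).
have wc := WC_corr oO ddP ep0 K0 ka1 kaW KP hE EW.
have hn := Dfun_new j sg he dO hE.
have bn x := @Bad_new e j d sg he O dO oO dd ddP E hE Es Esm x.
exists (new e j sg O E); split.
- split=> // [k|].
    apply: (Ck_ext open_all _ (Ck_add open_all (eC k) (Ck_of_WC (wc k)))) => v _; by rewrite !mxE.
  exists (L + ep); first by rewrite /ep; set c0 := (2 * _)^-1 in hL *; lra.
  move=> i k x; have pp : p = p.-1.+1 by rewrite prednK.
  have e1 : is_pd i (fun v => e v 0 k) x (pd i (fun v => e v 0 k) x).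
    by have := eC k; rewrite pp => q1; apply: (Ck_ispd i q1 (I : all_pts x)).
  have [e2 e3] : is_pd i (fun x => corr j sg O E x 0 k) x (pd i (fun x => corr j sg O E x 0 k) x) /\
     `|pd i (fun x => corr j sg O E x 0 k) x| <= ep.
    have := wc k; rewrite pp => -[_ q1]; have [q2 q3] := q1 i; split; first exact: ex_pdP (q2 x I).
    by have := WC_bound q3 (I : all_pts x); rewrite divr1.
  have -> : pd i (fun v => new e j sg O E v 0 k) x = pd i (fun v => e v 0 k) x + pd i (fun x => corr j sg O E x 0 k) x.
    apply: pdE; apply: is_pd_ext (is_pdD e1 e2); exists 1 => // y _; by rewrite !mxE.
  by apply: le_trans (ler_normD _ _) _; have := Lb i k x; lra.
- by move=> x /bn [].
apply: nowhere_dense_sub ndO => x [v [[Gv Bv] <-]] Ov; have [_ nU] := bn _ Bv; apply: nU.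
by split; [exact: hO | rewrite hgK].
Qed.

Lemma nowhere_dense_img_sub j e e' d (sg : 'I_d -> 'I_m) : (forall x, Bad e' x -> Bad e x) ->
  nowhere_dense (img sg (Zset j e)) -> nowhere_dense (img sg (Zset j e')).
Proof.
by move=> sub; apply: nowhere_dense_sub => x [v [[Gv Bv] <-]]; exists v; split=> //; split=> //; apply: sub.
Qed.

Lemma smooth_dim e j d : state e ->
  (forall sg : 'I_d.+1 -> 'I_m, injective sg -> nowhere_dense (img sg (Zset j e))) ->
  exists e', [/\ state e', forall x, Bad e' x -> Bad e x &
    forall sg : 'I_d -> 'I_m, injective sg -> nowhere_dense (img sg (Zset j e'))].
Proof.
move=> st nd.
(* Projections are treated one after another along an enumeration, for which they are represented as
   finite functions; those already treated stay so because the bad set only shrinks. *)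
suff gen (s : seq {ffun 'I_d -> 'I_m}) : exists e', [/\ state e', forall x, Bad e' x -> Bad e x &
    forall sg : {ffun 'I_d -> 'I_m}, sg \in s -> injective sg -> nowhere_dense (img sg (Zset j e'))].
  have [e' [h1 h2 h3]] := gen (enum {ffun 'I_d -> 'I_m}); exists e'; split=> // sg inj.
  have -> : sg = [ffun k => sg k] by apply: funext => k; rewrite ffunE.
  by apply: h3; [rewrite mem_enum | move=> a b; rewrite !ffunE => /inj].
elim: s => [|sg s [e' [h1 h2 h3]]]; first by exists e; split.
have [inj|ninj] := EM (injective sg); last first.
  by exists e'; split=> // sg'; rewrite inE => /orP [/eqP -> //|]; apply: h3.
have [|e'' [k1 k2 k3]] := @smooth_step e' j d sg inj h1.
  by move=> sg' inj'; apply: nowhere_dense_img_sub h2 (nd sg' inj').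
exists e''; split=> // [x /k2 /h2 //|sg']; rewrite inE => /orP [/eqP -> //|hs inj'].
by apply: nowhere_dense_img_sub k2 (h3 sg' hs inj').
Qed.

Lemma smooth_chart e j : state e ->
  exists e', [/\ state e', forall x, Bad e' x -> Bad e x & forall x, Om j x -> ~ Bad e' x].
Proof.
move=> st.
have [e' [h1 h2 h3]] : exists e', [/\ state e', forall x, Bad e' x -> Bad e x &
    forall sg : 'I_0 -> 'I_m, injective sg -> nowhere_dense (img sg (Zset j e'))].
  suff gen k : (k <= m.+1)%N -> exists e', [/\ state e', forall x, Bad e' x -> Bad e x &
    forall sg : 'I_(m.+1 - k) -> 'I_m, injective sg -> nowhere_dense (img sg (Zset j e'))].
    by have := gen m.+1 (leqnn _); rewrite subnn.
  elim: k => [_|k IH hk].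
    (* The descent starts at [m.+1], where there is no injection into the [m] coordinates and the
       condition is vacuous. *)
    exists e; split=> // sg inj; exfalso.
    by have := leq_card sg inj; rewrite !card_ord subn0 ltnn.
  have [e' [h1 h2 h3]] := IH (ltnW hk).
  have ek : (m.+1 - k = (m.+1 - k.+1).+1)%N by rewrite subnS prednK // subn_gt0.
  rewrite ek in h3; have [e'' [k1 k2 k3]] := smooth_dim h1 h3.
  by exists e''; split=> // x /k2 /h2.
exists e'; split=> // x Ox Bx.
pose sg (k : 'I_0) : 'I_m := match k with Ordinal i hi => match notF hi with end end.
have inj : injective sg by case.
have [a [r [k1 k2]]] := h3 sg inj 0 1 ltr01.
have e0 (u v : 'rV[R]_0) : u = v by apply/rowP => -[].
apply: (k2 a); first by apply: ball_center; exact: k1.1.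
exists (g j x); split=> //; split; [exact: gG | by rewrite ghK].
Qed.

(** The indices are handled in turn starting from [e = 0]; shrinking of the bad set preserves what
    was achieved for earlier ones. *)
Lemma smooth_all : exists e, state e /\ forall j v i, G j v -> CkAt p.+1 (comp_chart e j i) v.
Proof.
have st0 : state (fun _ => 0).
  split=> [|k|]; first by definable.
    by apply: (Ck_ext open_all _ (Ck_cst open_all p 0)) => v _; rewrite mxE.
  have c0 : 0 < 2 * m.+1%:R :> R by rewrite mulr_gt0.
  exists 0; first by rewrite invr_gt0.
  move=> i k x; suff -> : pd i (fun v : 'rV[R]_m => (0 : 'rV[R]_m) 0 k) x = 0 by rewrite normr0.
  by apply: pdE; apply: is_pd_cst.
suff [e [st nb]] : exists e, state e /\ forall j x, Om j x -> ~ Bad e x.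
  exists e; split=> // j v i Gv; have gd : good e j (h j v).
    by apply: contrapT => n; apply: (nb j (h j v)); [exact: hO | exists j; split=> //; exact: hO].
  by have := gd i; rewrite hgK.
suff gen (s : seq T) : exists e, state e /\ forall j, j \in s -> forall x, Om j x -> ~ Bad e x.
  by have [e [h1 h2]] := gen (enum T); exists e; split=> // j; apply: h2; rewrite mem_enum.
elim: s => [|j s [e [h1 h2]]]; first by exists (fun _ => 0).
have [e' [k1 k2 k3]] := smooth_chart j h1; exists e'; split=> // j'; rewrite inE => /orP [/eqP -> //|hj x Ox].
by move=> /k2; apply: h2 Ox.
Qed.

End ChartSmoothing.

(** * Atlases *)

Section Atlases.
Variables (R : rcfType) (S : ominimal_expansion R).
Local Notation Def := (Def S).
Local Notation Dfun := (Dfun S).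

Lemma Dfun_of_map m n (A : 'rV[R]_m -> Prop) (g : 'rV[R]_m -> 'rV[R]_n) : definable_map_on S A g ->
  exists2 f : 'rV[R]_m -> 'rV[R]_n, Dfun f & forall v, A v -> f v = g v.
Proof.
move=> hg; have hB : Def (fun q : 'rV[R]_m * 'rV[R]_n => A q.1 /\ q.2 = g q.1) by exact: hg.
have hi i : exists f : 'rV[R]_m -> R, Dfun f /\ forall v, A v -> f v = g v 0 i.
  have [||f hf hP] := @Dfun_partial R S 'rV[R]_m _ (fun v t => exists w, (A v /\ w = g v) /\ w 0 i = t).
  - have hB' := hB; apply: Def_ex; apply: Def_and; last by definable.
    apply: (Def_comp2 (A := fun v w => A v /\ w = g v) hB'); by definable.
  - by move=> v t t' [w [[_ ->] <-]] [w' [[_ ->] <-]].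
  by exists f; split=> // v Av; apply: hP; exists (g v).
have [f hf] := choice hi; exists (fun v => \row_i f i v); first by apply: Dfun_rowmk => i; have [] := hf i.
by move=> v Av; apply/rowP => i; rewrite mxE; have [_ ->] := hf i.
Qed.

Lemma map_of_Dfun m n (A : 'rV[R]_m -> Prop) (f : 'rV[R]_m -> 'rV[R]_n) : Def A -> Dfun f -> definable_map_on S A f.
Proof.
move=> hA hf; have h : Def (fun q : 'rV[R]_m * 'rV[R]_n => A q.1 /\ q.2 = f q.1) by definable.
exact: h.
Qed.

Lemma open_preimT n k (B : 'rV[R]_k -> Prop) (h : 'rV[R]_n -> 'rV[R]_k) : open_set B ->
  (forall i v, cont (fun v => h v 0 i) v) -> open_set (fun v => B (h v)).
Proof.
move=> oB ch v Bv; have [s s0 hs] := oB _ Bv; have [t t0 ht] := cont_mnorm (fun i => ch i v) s0.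
by exists t => // y /ht; apply: hs.
Qed.

Variables (p : nat) (M : Type) (m : nat) (I : finType) (U : I -> M -> Prop) (phi : I -> M -> 'rV[R]_m).
Hypothesis at_ : is_atlas S p U phi.
Let A i j := chart_image U phi i j.
Let all_pts (_ : 'rV[R]_m) := True.
Let open_all : open_set all_pts. Proof. by move=> a _; exists 1. Qed.

(** Total definable representatives of the transition maps are fixed once; away from the overlaps
    their values carry no meaning. *)
Lemma transitions : exists t : I -> I -> 'rV[R]_m -> 'rV[R]_m, forall i j,
  [/\ Dfun (t i j), forall l, Ck p (A i j) (fun v => t i j v 0 l) &
      forall x, U i x -> U j x -> t i j (phi i x) = phi j x].
Proof.
have [_ _ _ hop htr] := at_.
have hij (ij : I * I) : exists t : 'rV[R]_m -> 'rV[R]_m, [/\ Dfun t, forall l, Ck p (A ij.1 ij.2) (fun v => t v 0 l) &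
      forall x, U ij.1 x -> U ij.2 x -> t (phi ij.1 x) = phi ij.2 x].
  have [g [gE [gd [gC _]]]] := htr ij.1 ij.2; have [f hf fg] := Dfun_of_map gd.
  exists f; split=> // [|x U1 U2]; last by rewrite fg; [exact: gE | exists x].
  apply: Cq_Ck; first exact: (hop ij.1 ij.2).2.
  by apply: Cq_ext gC => v /fg.
have [t ht] := choice hij; exists (fun i j => t (i, j)) => i j; exact: (ht (i, j)).
Qed.

Variable t : I -> I -> 'rV[R]_m -> 'rV[R]_m.
Hypotheses (tD : forall i j, Dfun (t i j)) (tC : forall i j l, Ck p (A i j) (fun v => t i j v 0 l)).
Hypothesis tE : forall i j x, U i x -> U j x -> t i j (phi i x) = phi j x.

Let phi_inj i x y : U i x -> U i y -> phi i x = phi i y -> x = y.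
Proof. by have [_ h _ _ _] := at_; apply: h. Qed.
Let dA i j : Def (A i j). Proof. by have [_ _ _ h _] := at_; have [] := h i j. Qed.
Let oA i j : open_set (A i j). Proof. by have [_ _ _ h _] := at_; have [] := h i j. Qed.

Lemma tA i j v : A i j v -> A j i (t i j v).
Proof. by move=> [x [Ui [Uj <-]]]; rewrite tE //; exists x. Qed.

Lemma tK i j v : A i j v -> t j i (t i j v) = v.
Proof. by move=> [x [Ui [Uj <-]]]; rewrite !tE. Qed.

Lemma t_id i v : A i i v -> t i i v = v.
Proof. by move=> [x [Ui [_ <-]]]; rewrite tE. Qed.

Lemma t_cocycle j k l w : A j k w -> A k l (t j k w) -> A j l w /\ t k l (t j k w) = t j l w.
Proof.
move=> [x [Uj [Uk <-]]]; rewrite tE // => -[y [Uk' [Ul e]]].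
have ey : y = x by apply: (phi_inj Uk').
by subst y; rewrite !tE //; split=> //; exists x.
Qed.

Section MkAtlas.
Variables (K : finType) (idx : K -> I) (r : nat) (f fi : K -> 'rV[R]_m -> 'rV[R]_m).
Hypotheses (fD : forall a, Dfun (f a)) (fiD : forall a, Dfun (fi a)).
Hypotheses (fK : forall a x, fi a (f a x) = x) (fiK : forall a y, f a (fi a y) = y).
Hypothesis fiC : forall a l y, cont (fun y => fi a y 0 l) y.
Hypothesis cov : forall x, exists a, U (idx a) x.
Hypothesis trC : forall a b l, Ck r (fun v => A (idx a) (idx b) (fi a v))
  (fun v => f b (t (idx a) (idx b) (fi a v)) 0 l).

(** Charts are changed only by global bijections of their target, so chart domains and overlaps are
    inherited. The map [idx] lets one original chart occur several times, so that both the new atlas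
    and its union with the given one are instances. *)
Lemma mk_atlas : is_atlas S r (fun a => U (idx a)) (fun a x => f a (phi (idx a) x)).
Proof.
have [_ _ him hch _] := at_.
have oi a (B : 'rV[R]_m -> Prop) : open_set B -> open_set (fun v => B (fi a v)).
  by move=> oB; apply: open_preimT => // i v; apply: fiC.
have cE a b : chart_image (fun a => U (idx a)) (fun a x => f a (phi (idx a) x)) a b = (fun v => A (idx a) (idx b) (fi a v)).
  apply: funext => v; apply: propext; split=> [[x [U1 [U2 <-]]]|[x [U1 [U2 e]]]]; first by rewrite fK; exists x.
  by exists x; rewrite e fiK.
have dC a b : Def (fun v => A (idx a) (idx b) (fi a v)).
  by have := fiD a; have := dA (idx a) (idx b) => h1 h2; definable.
split=> //.
- by move=> a x y U1 U2 e; apply: (phi_inj U1 U2); rewrite -[LHS](fK a) e fK.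
- move=> a; have -> : (fun v => exists x, U (idx a) x /\ f a (phi (idx a) x) = v) =
      (fun v => (fun w => exists x, U (idx a) x /\ phi (idx a) x = w) (fi a v)).
    apply: funext => v; apply: propext; split=> [[x [U1 <-]]|[x [U1 e]]]; first by exists x; rewrite fK.
    by exists x; rewrite e fiK.
  have [d1 o1] := him (idx a); split; last exact: oi o1.
  have d1' : Def (fun w => exists x, U (idx a) x /\ phi (idx a) x = w) by exact: d1.
  exact: (Def_comp d1' (fiD a)).
- by move=> a b; rewrite cE; split; [exact: (dC a b) | exact: oi].
move=> a b; rewrite !cE; pose g a b v := f b (t (idx a) (idx b) (fi a v)).
have gD a' b' : Dfun (g a' b').
  have h1 := fD b'; have h2 := fiD a'; have h3 := tD (idx a') (idx b').
  exact: Dfun_comp h1 (Dfun_comp h3 h2).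
have gC a' b' : Cq r (fun v => A (idx a') (idx b') (fi a' v)) (g a' b').
  apply: Ck_Cq (gD a' b') _; first exact: oi.
  by move=> l; apply: trC.
have gA a' b' v : A (idx a') (idx b') (fi a' v) -> A (idx b') (idx a') (fi b' (g a' b' v)).
  by move=> h; rewrite /g fK; apply: tA.
have gK a' b' v : A (idx a') (idx b') (fi a' v) -> g b' a' (g a' b' v) = v.
  by move=> h; rewrite /g fK tK // fiK.
exists (g a b); split; first by move=> x U1 U2; rewrite /g fK tE.
split; first exact: map_of_Dfun.
split=> //; split; first exact: gA.
exists (g b a); split; first exact: map_of_Dfun.
by split=> //; split; [exact: gA | split; exact: gK].
Qed.

End MkAtlas.

Hypothesis p0 : (0 < p)%N.

Definition diffeo_pair (f fi : 'rV[R]_m -> 'rV[R]_m) := [/\ Dfun f, Dfun fi, cancel f fi /\ cancel fi f,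
  forall l, Ck p all_pts (fun v => f v 0 l) & forall l, Ck p all_pts (fun v => fi v 0 l)].

(** * Adding one chart to a smooth family *)

Section Extend.
Variables (s : seq I) (k : I) (f fi : I -> 'rV[R]_m -> 'rV[R]_m).
Hypothesis dp : forall i, diffeo_pair (f i) (fi i).
Hypothesis trC : forall i j, i \in s -> j \in s -> forall l, Ck p.+1 (fun v => A i j (fi i v))
  (fun v => f j (t i j (fi i v)) 0 l).
(** The smoothing result is indexed by a whole finite type; charts not yet in the list are disabled
    by giving them empty domains. *)
Let Om j x := j \in s /\ A k j x.
Let G j v := j \in s /\ A j k (fi j v).
Let g j x := f j (t k j x).
Let h j v := t j k (fi j v).

Let fi_cont j l v : cont (fun v => fi j v 0 l) v.
Proof. by have [_ _ _ _ c] := dp j; apply: Ck_cont (c l) (Logic.I : all_pts v). Qed.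

Let open_Afi i j : open_set (fun v => A i j (fi i v)).
Proof. by apply: open_preimT => // l v; apply: fi_cont. Qed.

Let Ck_g j l : Ck p (A k j) (fun x => g j x 0 l).
Proof.
have [fD _ _ fC _] := dp j; have hf : Dfun (fun v => f j v 0 l) by definable.
exact: (@Ck_comp R S p m m (A k j) all_pts (t k j) (fun v => f j v 0 l) (@oA k j) open_all hf (fC l) (fun _ _ => Logic.I) (tC k j)).
Qed.

Let Ck_h j l : Ck p (fun v => A j k (fi j v)) (fun v => h j v 0 l).
Proof.
have [_ fD _ _ fC] := dp j; have hD := tD j k; have ht : Dfun (fun v => t j k v 0 l) by definable.
apply: (@Ck_comp R S p m m _ (A j k) (fi j) (fun v => t j k v 0 l) (@open_Afi j k) (@oA j k) ht (tC j k l)) => // i.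
by apply: Ck_sub (fC i).
Qed.

Lemma chart_correction : exists e : 'rV[R]_m -> 'rV[R]_m, [/\ Dfun e, forall l, Ck p all_pts (fun v => e v 0 l), small e &
  forall j l, j \in s -> Ck p.+1 (fun v => A j k (fi j v)) (fun v => h j v 0 l + e (h j v) 0 l)].
Proof.
have oOm j : open_set (Om j) by move=> x [js /oA [r r0 hr]]; exists r => // y /hr.
have oG j : open_set (G j) by move=> x [js /open_Afi [r r0 hr]]; exists r => // y /hr.
have oGO j l : open_set (fun v => G j v /\ Om l (h j v)).
  apply: open_preim => // i v [_ Av]; exact: Ck_cont (Ck_h j i) Av.
have := @smooth_all R S I p m Om G g h p0 oOm oG.
move=> /(_ _ _ _ _ _ _ _ _ _ _ _); case.
- by move=> j; have d1 := dA k j; rewrite /Om; definable.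
- by move=> j; have d1 := dA j k; have [_ d2 _ _ _] := dp j; rewrite /G; definable.
- by move=> j; have [d1 _ _ _ _] := dp j; have d2 := tD k j; exact: Dfun_comp d1 d2.
- by move=> j; have [_ d1 _ _ _] := dp j; have d2 := tD j k; exact: Dfun_comp d2 d1.
- by move=> j x [js Ax]; split=> //; have [_ _ [c1 _] _ _] := dp j; rewrite /g c1; apply: tA.
- by move=> j v [js Av]; split=> //; apply: tA.
- by move=> j x [js Ax]; have [_ _ [c1 _] _ _] := dp j; rewrite /g /h c1 tK.
- by move=> j v [js Av]; have [_ _ [_ c2] _ _] := dp j; rewrite /g /h tK.
- by move=> j l; apply: Ck_sub (Ck_g j l) => x [].
- by move=> j l; apply: Ck_sub (Ck_h j l) => x [].
- move=> j l i.
  have [js|njs] := boolP (j \in s); last first.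
    apply: (Ck_ext (@oGO j l) (f := fun _ => 0)) => [v [[js _] _]|]; first by rewrite js in njs.
    exact: Ck_cst.
  have [ls|nls] := boolP (l \in s); last first.
    apply: (Ck_ext (@oGO j l) (f := fun _ => 0)) => [v [_ [ls _]]|]; first by rewrite ls in nls.
    exact: Ck_cst.
  apply: (Ck_ext (@oGO j l) (f := fun v => f l (t j l (fi j v)) 0 i)) => [v [[_ A1] [_ A2]]|].
    by have [_ e] := t_cocycle A1 A2; rewrite /g /h e.
  by apply: Ck_sub (trC js ls i) => v [[_ A1] [_ A2]]; have [] := t_cocycle A1 A2.
move=> e [[e1 e2 e3] e4]; exists e; split=> // j l js; apply: Ck_local => v Av.
exact: e4.
Qed.

Lemma extend_family : k \notin s -> exists f' fi' : I -> 'rV[R]_m -> 'rV[R]_m,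
  (forall i, diffeo_pair (f' i) (fi' i)) /\
  forall i j, i \in k :: s -> j \in k :: s -> forall l, Ck p.+1 (fun v => A i j (fi' i v))
    (fun v => f' j (t i j (fi' i v)) 0 l).
Proof.
move=> nk; have [e [e1 e2 e3 e4]] := chart_correction.
have pp : p = p.-1.+1 by rewrite prednK.
have e2' l : Ck p.-1.+1 all_pts (fun v => e v 0 l) by rewrite -pp.
have [H hH [H1 H2 H3]] := small_diffeo e1 e2' e3; rewrite -pp in H3.
pose fk (x : 'rV[R]_m) : 'rV[R]_m := x + e x.
have fkD : Dfun fk by rewrite /fk; definable.
have fkC l : Ck p all_pts (fun v => fk v 0 l).
  apply: (Ck_ext open_all _ (Ck_add open_all (Ck_coord open_all p l) (e2 l))) => v _; by rewrite mxE.
pose f' i := if i == k then fk else f i; pose fi' i := if i == k then H else fi i.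
have dpk : diffeo_pair fk H by split.
have oH i : open_set (fun v => A k i (H v)).
  by apply: open_preimT => // l v; apply: Ck_cont (H3 l) (Logic.I : all_pts v).
have toK i l : i \in s -> Ck p.+1 (fun v => A i k (fi i v)) (fun v => fk (t i k (fi i v)) 0 l).
  by move=> si; apply: (Ck_ext (@open_Afi i k) _ (e4 i l si)) => v _; rewrite [RHS]mxE.
exists f', fi'; split=> [i|i j]; first by rewrite /f' /fi'; case: eqP.
rewrite !inE /f' /fi'; case: eqVneq => [->|nik]; case: eqVneq => [->|njk]; rewrite ?orTb ?orFb.
- move=> _ _ l; apply: (Ck_ext (@oH k) (f := fun v => v 0 l)) => [v Av|]; last exact: Ck_coord.
  by rewrite t_id // /fk H2.
- move=> _ js.
  (* [chart_correction] provides smoothness from [j] to [k] only. The reverse transition [H'] is a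
     composition of [C^p] maps, and as [p] is positive [inverse_jac] applies to it. *)
  pose F v := fk (t j k (fi j v)); pose H' y := f j (t k j (H y)).
  have [fjD fijD [c1 c2] fjC fijC] := dp j.
  have FD : Dfun F by have d1 := tD j k; exact: Dfun_comp fkD (Dfun_comp d1 fijD).
  have FC l : Ck p.+1 (fun v => A j k (fi j v)) (fun v => F v 0 l) by exact: toK.
  have H'C l : Ck p (fun v => A k j (H v)) (fun v => H' v 0 l).
    have hgD : Dfun (fun x => g j x 0 l) by have d1 := tD k j; apply: (Dfun_coord l); exact: Dfun_comp fjD d1.
    apply: (@Ck_comp R S p m m _ (A k j) H (fun x => g j x 0 l) (@oH j) (@oA k j) hgD (Ck_g j l)) => // i'.
    by apply: Ck_sub (H3 i').
  have HV y : A k j (H y) -> A j k (fi j (H' y)) by move=> Ay; rewrite /H' c1; apply: tA.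
  have FH y : A k j (H y) -> F (H' y) = y by move=> Ay; rewrite /F /H' c1 tK // /fk H2.
  have p1 : (1 <= p)%N by [].
  have J := inverse_jac (@open_Afi j k) (@oH j) FD (fun l => Ck_leq (ltn0Sn p) (FC l)) (fun l => Ck_leq p1 (H'C l)) HV FH.
  apply: (inverse_Ck (@open_Afi j k) (@oH j) FD FC HV).
  + by move=> y /J [].
  + by move=> l y Ay; apply: Ck_cont (H'C l) Ay.
  + by move=> i' l y /J [_]; apply.
- by move=> si _ l; apply: toK.
by move=> si js l; apply: trC.
Qed.

End Extend.

Lemma smooth_family (s : seq I) : exists f fi : I -> 'rV[R]_m -> 'rV[R]_m,
  (forall i, diffeo_pair (f i) (fi i)) /\
  forall i j, i \in s -> j \in s -> forall l, Ck p.+1 (fun v => A i j (fi i v))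
    (fun v => f j (t i j (fi i v)) 0 l).
Proof.
elim: s => [|k s [f [fi [h1 h2]]]].
  exists (fun _ => id), (fun _ => id); split=> // i; split=> //; try exact: Dfun_id.
  - by move=> l; exact: (Ck_coord open_all).
  - by move=> l; exact: (Ck_coord open_all).
have [ks|nks] := boolP (k \in s); last exact: extend_family h1 h2 nks.
exists f, fi; split=> // i j hi hj; apply: h2.
- by move: hi; rewrite inE => /orP [/eqP -> //|].
- by move: hj; rewrite inE => /orP [/eqP -> //|].
Qed.

End Atlases.

Theorem theorem4p6 (R : rcfType) (S : ominimal_expansion R) (p : nat) (hp : (1 <= p)%N)
  (M : Type) (m : nat) (I : finType) (U : I -> M -> Prop) (phi : I -> M -> 'rV[R]_m) :
  is_manifold S p U phi ->
  exists (J : finType) (V : J -> M -> Prop) (psi : J -> M -> 'rV[R]_m),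
    is_atlas S p.+1 V psi /\ compatible_atlases S p U phi V psi.
Proof.
move=> [at_ _]; have [t ht] := transitions at_.
have tD i j : Dfun S (t i j) by have [] := ht i j.
have tC i j l : Ck p (chart_image U phi i j) (fun v => t i j v 0 l) by have [_ h _] := ht i j; apply: h.
have tE i j x : U i x -> U j x -> t i j (phi i x) = phi j x by have [_ _ h] := ht i j; apply: h.
have [f [fi [dp trC]]] := smooth_family at_ tD tC tE hp (enum I).
have [cov _ _ hop _] := at_.
have oA i j : open_set (chart_image U phi i j) by have [] := hop i j.
have oall : open_set (fun _ : 'rV[R]_m => True) by move=> a _; exists 1.
exists I, U, (fun i x => f i (phi i x)); split.
  apply: (@mk_atlas R S p M m I U phi at_ t tD tE I id p.+1 f fi) => //.
  - by move=> i; have [] := dp i.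
  - by move=> i; have [] := dp i.
  - by move=> i; have [_ _ []] := dp i.
  - by move=> i; have [_ _ []] := dp i.
  - by move=> i l y; have [_ _ _ _ c] := dp i; apply: Ck_cont (c l) Logic.I.
  - by move=> i j l; apply: trC; rewrite mem_enum.
(* Compatibility is obtained by presenting the union as a family over [I + I]: each original chart
   occurs once with the identity and once with its correction. *)
pose idx : I + I -> I := sum_fam id id.
pose F := sum_fam (fun _ : I => (id : 'rV[R]_m -> 'rV[R]_m)) f.
pose Fi := sum_fam (fun _ : I => (id : 'rV[R]_m -> 'rV[R]_m)) fi.
have dpF a : diffeo_pair S p (F a) (Fi a).
  case: a => i /=; last exact: dp.
  split=> //; try exact: Dfun_id.
  - by move=> l; exact: (Ck_coord oall).
  - by move=> l; exact: (Ck_coord oall).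
have := @mk_atlas R S p M m I U phi at_ t tD tE (I + I)%type idx p F Fi.
rewrite /compatible_atlases.
have -> : sum_fam U U = (fun a => U (idx a)) by apply: funext => -[].
have -> : sum_fam phi (fun i x => f i (phi i x)) = (fun a x => F a (phi (idx a) x)) by apply: funext => -[].
apply=> //.
- by move=> i; have [] := dpF i.
- by move=> i; have [] := dpF i.
- by move=> i; have [_ _ []] := dpF i.
- by move=> i; have [_ _ []] := dpF i.
- by move=> i l y; have [_ _ _ _ c] := dpF i; apply: Ck_cont (c l) Logic.I.
- by move=> x; have [i Ui] := cov x; exists (inl i).
move=> a b l; have [_ FiD _ _ FiC] := dpF a; have [FD _ _ FC _] := dpF b.
have oW : open_set (fun v => chart_image U phi (idx a) (idx b) (Fi a v)).
  by apply: open_preimT => // i v; apply: Ck_cont (FiC i) Logic.I.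
have tabD := tD (idx a) (idx b).
have h1 : Dfun S (fun v => F b (t (idx a) (idx b) v) 0 l) by apply: (Dfun_coord l); exact: Dfun_comp FD tabD.
have h2 : Dfun S (fun v => F b v 0 l) by exact: Dfun_coord.
apply: (@Ck_comp R S p m m _ (chart_image U phi (idx a) (idx b)) (Fi a) (fun v => F b (t (idx a) (idx b) v) 0 l) oW (@oA _ _) h1) => //.
  exact: (@Ck_comp R S p m m _ (fun _ => True) (t (idx a) (idx b)) (fun v => F b v 0 l) (@oA _ _) oall h2 (FC l) (fun _ _ => Logic.I) (tC _ _)).
by move=> i; apply: Ck_sub (FiC i).
Qed.
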